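(* Let $E$ be an elliptic curve over a number field $K$ of degree $n=[K:\mathbf{Q}]$. Then there is an isomorphism of topological groups $$E(\mathbf{A}_K)\cong(\mathbf{R}/\mathbf{Z})^n\times\widehat{\mathbf{Z}}^n\times T_{E/K},$$ under which $(\mathbf{R}/\mathbf{Z})^n$ corresponds to the connected component $E_{\mathrm{cc}}(\mathbf{A}_K)$ of the zero element of $E(\mathbf{A}_K)$, and under which, in the totally disconnected profinite quotient group $E(\mathbf{A}_K)/E_{\mathrm{cc}}(\mathbf{A}_K)\cong\widehat{\mathbf{Z}}^n\times T_{E/K}$, the subgroup $T_{E/K}$ corresponds to the closure of the torsion subgroup.
   Context: Adelic point group: $E(\mathbf{A}_K)=\prod_{\mathfrak{p}\le\infty}E(K_\mathfrak{p})$, the product over all finite and infinite primes $\mathfrak{p}$ of $K$ of the point groups over the completions $K_\mathfrak{p}$, each with its natural topology, and the product carrying the product topology. $T_{E/K}=\prod_{\mathfrak{p}\le\infty}T_\mathfrak{p}$ is the profinite group obtained as the product of the following finite groups: for $\mathfrak{p}$ finite, $T_\mathfrak{p}=E(K_\mathfrak{p})^{\mathrm{tor}}$ is the torsion subgroup of $E(K_\mathfrak{p})$, which is finite; for $\mathfrak{p}$ real such that the discriminant $\Delta_E$ of $E$ is positive under the real embedding $\mathfrak{p}:K\to\mathbf{R}$, $T_\mathfrak{p}=\mathbf{Z}/2\mathbf{Z}$; for all other $\mathfrak{p}$, $T_\mathfrak{p}=1$. (The discriminant $\Delta_E\in K^*$ of a Weierstrass model is well defined up to 12th powers in $K^*$,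 so its sign at real primes depends only on $E$.) *)

(* Defs.v *)
From HB Require Import structures.
From mathcomp Require Import all_boot all_order all_algebra all_field.
From mathcomp Require Import ring.
From mathcomp Require Import all_classical all_reals all_analysis.

Set Implicit Arguments.
Unset Strict Implicit.
Unset Printing Implicit Defensive.

Import Order.TTheory GRing.Theory Num.Theory.
Import numFieldNormedType.Exports.

Local Open Scope classical_set_scope.
Local Open Scope quotient_scope.
Local Open Scope ring_scope.

(* No group axiom is part of this record: the groups below are given by their
   operations, and an isomorphism [topgroup_iso] onto a topological group
   transports the axioms.  In particular the associativity of the
   chord-and-tangent law is not needed to state anything.
   This is a plain record because the hierarchy of the library, in which
   topological Nmodules already exist, does not accept a structure joining
   [Topological] and [GRing.BaseAddUMagma]. *)
Record topGroupLaw := TopGroupLaw {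
  tgl_sort :> Type;
  tgl_topology : Topological tgl_sort;
  tgl_law : GRing.BaseAddUMagma tgl_sort }.

HB.instance Definition _ (G : topGroupLaw) : Topological (tgl_sort G) :=
  tgl_topology G.
HB.instance Definition _ (G : topGroupLaw) :
  GRing.BaseAddUMagma (tgl_sort G) := tgl_law G.

Notation "[ 'topGroupLaw' 'of' T ]" :=
  (@TopGroupLaw T (Topological.on T) (GRing.BaseAddUMagma.on T))
  (at level 0, format "[ 'topGroupLaw'  'of'  T ]").

Definition homeomorphism (T U : topologicalType) (f : T -> U) : Prop :=
  exists g : U -> T, [/\ cancel f g, cancel g f, continuous f & continuous g].

Definition topgroup_iso (G H : topGroupLaw) (f : G -> H) : Prop :=
  [/\ f 0 = 0, {morph f : x y / x + y} & homeomorphism f].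

Definition profinite_space (T : topologicalType) : Prop :=
  [/\ compact [set: T], hausdorff_space T & totally_disconnected [set: T]].

Definition torsion (G : baseAddUMagmaType) : set G :=
  [set x | exists2 m, (0 < m)%N & x *+ m = 0].
Arguments torsion G : clear implicits.

Definition connected_component0 (G : topGroupLaw) : set G :=
  connected_component [set: G] 0.
Arguments connected_component0 G : clear implicits.

HB.instance Definition _ (V : baseAddUMagmaType) :=
  GRing.BaseAddUMagma.copy (discrete_topology V) V.

Definition discrete_group (V : Algebra.ChoiceBaseAddUMagma.type) :
    topGroupLaw :=
  [topGroupLaw of discrete_topology V].

Definition prod_group (G H : topGroupLaw) : topGroupLaw :=
  [topGroupLaw of (G * H)%type].

Section BigProduct.
Context {I : Type} (G : I -> topGroupLaw).

HB.instance Definition _ := GRing.hasAdd.Build (prod_topology G)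
  (fun x y i => x i + y i).
HB.instance Definition _ := GRing.hasZero.Build (prod_topology G) (fun=> 0).

Definition bigprod_group : topGroupLaw := [topGroupLaw of prod_topology G].

End BigProduct.

Definition power_group (G : topGroupLaw) (n : nat) : topGroupLaw :=
  bigprod_group (fun _ : 'I_n => G).

Section TorsionGroup.
Variable V : topGroupLaw.

Definition torsion_type : Type := set_type (torsion V).

Lemma torsion0 : (0 : V) \in torsion V.
Proof. by apply/mem_set; exists 1%N. Qed.

Definition torsion_zero : torsion_type := exist _ 0 torsion0.

(* The default value of [insubd] is never used when V is an abelian group,
   since the sum of two torsion elements is then a torsion element. *)
Definition torsion_add (x y : torsion_type) : torsion_type :=
  insubd torsion_zero (\val x + \val y).

HB.instance Definition _ := Choice.on torsion_type.
HB.instance Definition _ := GRing.hasAdd.Build torsion_type torsion_add.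
HB.instance Definition _ := GRing.hasZero.Build torsion_type torsion_zero.

(* Discrete: this is only used when there are finitely many torsion points. *)
Definition torsion_group : topGroupLaw :=
  [topGroupLaw of discrete_topology torsion_type].

End TorsionGroup.

(* Identifying x and y when their cosets are equal gives an equivalence
   relation without any group axiom.  As for the quotients of the library, the
   sum of two classes is the class of the sum of their representatives. *)
Section ComponentQuotient.
Variable G : topGroupLaw.

Definition coset0 (x : G) : set G :=
  [set x + y | y in connected_component0 G].

Definition coset0_rel : rel G := fun x y => `[< coset0 x = coset0 y >].

Lemma coset0_rel_equiv : equiv_class_of coset0_rel.
Proof.
split=> [x|x y|y x z]; first exact/asboolP.
- by apply/asboolP/asboolP => ->.
- by move=> /asboolP xy /asboolP yz; apply/asboolP; rewrite xy yz.
Qed.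

Canonical coset0_equiv := EquivRelPack coset0_rel_equiv.

Definition component_quotient : Type :=
  quotient_topology {eq_quot coset0_equiv}.

HB.instance Definition _ := Topological.on component_quotient.

Definition component_pi (x : G) : component_quotient :=
  \pi_({eq_quot coset0_equiv}) x.

Definition component_repr (x : component_quotient) : G :=
  repr (x : {eq_quot coset0_equiv}).

HB.instance Definition _ := GRing.hasAdd.Build component_quotient
  (fun x y => component_pi (component_repr x + component_repr y)).
HB.instance Definition _ := GRing.hasZero.Build component_quotient
  (component_pi 0).

Definition component_quotient_group : topGroupLaw :=
  [topGroupLaw of component_quotient].

End ComponentQuotient.

Section Circle.
Variable R : realType.

Definition integers : {pred R} := fun x => x \is a Num.int.

Lemma integers_zmod_closed : zmod_closed integers.
Proof. by split=> [|x y]; [exact: rpred0 | exact: rpredB]. Qed.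

HB.instance Definition _ := GRing.isZmodClosed.Build R integers
  integers_zmod_closed.

Definition circle : Type := quotient_topology (Quotient.quot integers).

HB.instance Definition _ := Topological.on circle.
HB.instance Definition _ :=
  GRing.BaseAddUMagma.copy circle (Quotient.quot integers).

Definition circle_group : topGroupLaw := [topGroupLaw of circle].

End Circle.

(* The profinite completion of Z: the inverse limit of the Z/mZ for m >= 1
   (represented as m.+1), each of them discrete. *)
Section Zhat.

Definition Zhat_ambient : topGroupLaw :=
  bigprod_group (fun m : nat => discrete_group 'I_m.+1).

Definition Zhat_compatible : set Zhat_ambient :=
  [set a | forall m k : nat, (m.+1 %| k.+1)%N ->
    ((a k : 'I_k.+1) = (a m : 'I_m.+1) %[mod m.+1])%N].

Definition Zhat : Type := set_type Zhat_compatible.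

Lemma Zhat_add_subproof (a b : Zhat) :
  (\val a + \val b : Zhat_ambient) \in Zhat_compatible.
Proof.
have ha := set_mem (valP a); have hb := set_mem (valP b).
apply/mem_set => m k mk /=.
have := ha m k mk; have := hb m k mk.
rewrite /GRing.add /= => eb ea.
by rewrite modn_dvdm// modn_mod -modnDm ea eb modnDm.
Qed.

Lemma Zhat_zero_subproof : (0 : Zhat_ambient) \in Zhat_compatible.
Proof. by apply/mem_set. Qed.

Definition Zhat_add (a b : Zhat) : Zhat :=
  exist _ (\val a + \val b : Zhat_ambient) (Zhat_add_subproof a b).

Definition Zhat_zero : Zhat := exist _ (0 : Zhat_ambient) Zhat_zero_subproof.

HB.instance Definition _ := Topological.on Zhat.
HB.instance Definition _ := GRing.hasAdd.Build Zhat Zhat_add.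
HB.instance Definition _ := GRing.hasZero.Build Zhat Zhat_zero.

Definition Zhat_group : topGroupLaw := [topGroupLaw of Zhat].

End Zhat.

Record absvalue (R : realType) (F : fieldType) := Absvalue {
  absv :> F -> R;
  absv_ge0 : forall x, 0 <= absv x;
  absv_eq0 : forall x, absv x = 0 <-> x = 0;
  absvM : {morph absv : x y / x * y};
  absvD : forall x y, absv (x + y) <= absv x + absv y }.

Section AbsvalueTheory.
Context {R : realType} {F : fieldType}.
Implicit Type v : absvalue R F.

Lemma absv1 v : v 1 = 1.
Proof.
have v1N0 : v 1 != 0 by apply/eqP => /absv_eq0/eqP; rewrite oner_eq0.
by apply: (mulfI v1N0); rewrite -absvM !mulr1.
Qed.

Lemma absvN v x : v (- x) = v x.
Proof.
suff vN1 : v (-1) = 1 by rewrite -mulN1r absvM vN1 mul1r.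
apply/eqP; rewrite -(@pexpr_eq1 _ _ 2%N)// ?absv_ge0//.
by rewrite expr2 -absvM mulrNN mulr1 absv1.
Qed.

Definition absv_space v : Type := F.

Section Metric.
Variable v : absvalue R F.
Local Notation space := (absv_space v).

HB.instance Definition _ := Choice.copy space F.

Let dist (x y : space) : R := v ((x : F) - y).

Let dist_xx x : dist x x = 0.
Proof. by apply/absv_eq0; rewrite subrr. Qed.

Let dist_positivity x y : dist x y = 0 -> x = y.
Proof. by move/absv_eq0/eqP; rewrite subr_eq0 => /eqP. Qed.

Let dist_sym x y : dist x y = dist y x.
Proof. by rewrite /dist -absvN opprB. Qed.

Let dist_triangle y x z : dist x z <= dist x y + dist y z.
Proof. by rewrite /dist -(subrKA (y : F)); exact: absvD. Qed.

HB.instance Definition _ := isMetric.Build R space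
  dist_xx dist_positivity dist_sym dist_triangle.

End Metric.

Definition nonarchimedean v : Prop :=
  forall x y, v (x + y) <= Num.max (v x) (v y).

Definition nontrivial_absv v : Prop := exists2 x, x != 0 & v x != 1.

End AbsvalueTheory.

Definition absv_equiv (R : realType) (F : fieldType) (v w : absvalue R F) :=
  forall U : set F,
    open (U : set (absv_space v)) <-> open (U : set (absv_space w)).

Section Pullback.
Context {R : realType} {F L : fieldType}.
Variables (w : absvalue R L) (f : {rmorphism F -> L}).

Let pull (x : F) : R := w (f x).

Let pull_ge0 x : 0 <= pull x. Proof. exact: absv_ge0. Qed.

Let pull_eq0 x : pull x = 0 <-> x = 0.
Proof.
rewrite absv_eq0; split=> [/eqP|->]; last by rewrite rmorph0.
by rewrite fmorph_eq0 => /eqP.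
Qed.

Let pullM : {morph pull : x y / x * y}.
Proof. by move=> x y; rewrite /pull rmorphM absvM. Qed.

Let pullD x y : pull (x + y) <= pull x + pull y.
Proof. by rewrite /pull rmorphD absvD. Qed.

Definition absv_pullback : absvalue R F :=
  Absvalue pull_ge0 pull_eq0 pullM pullD.

End Pullback.

Section RealAbsvalue.
Variable R : realType.

Let norm_eq0 (x : R) : `|x| = 0 <-> x = 0.
Proof. by split=> [/normr0_eq0|->]; rewrite ?normr0. Qed.

Definition real_absvalue : absvalue R R :=
  @Absvalue R R (fun x => `|x|) (@normr_ge0 _ _) norm_eq0 (@normrM _)
    (@ler_normD _ _).

End RealAbsvalue.

(* A prime of F, finite or infinite: an equivalence class of nontrivial
   absolute values. *)
Definition prime_class (R : realType) (F : fieldType) :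
    set (set (absvalue R F)) :=
  [set p | exists2 v, nontrivial_absv v & p = [set w | absv_equiv v w] ].

Definition prime_of (R : realType) (F : fieldType) : Type :=
  set_type (@prime_class R F).
HB.instance Definition _ (R : realType) (F : fieldType) :=
  Choice.on (prime_of R F).

Section Primes.
Context {R : realType} {F : fieldType}.
Variable p : prime_of R F.

Definition finite_prime : Prop :=
  exists2 v : absvalue R F, sval p v & nonarchimedean v.

Definition real_prime_of (s : {rmorphism F -> R}) : Prop :=
  sval p (absv_pullback (real_absvalue R) s).

(* A completion of F at p is unique up to a unique isomorphism of topological
   fields over F.  The values of [compl_absv] restrict to some absolute value
   in the class p, which one being immaterial. *)
Record completion := Completion {
  compl_field :> fieldType;
  compl_absv : absvalue R compl_field;
  compl_emb : {rmorphism F -> compl_field};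
  compl_prime : sval p (absv_pullback compl_absv compl_emb);
  compl_dense : dense (range compl_emb : set (absv_space compl_absv));
  compl_complete : forall A : set_system (absv_space compl_absv),
    ProperFilter A -> cauchy A -> exists x : absv_space compl_absv, A --> x }.

End Primes.

Record weierstrass (F : Type) := Weierstrass {
  wa1 : F; wa2 : F; wa3 : F; wa4 : F; wa6 : F }.

Definition map_weierstrass (F L : Type) (f : F -> L) (W : weierstrass F) :=
  Weierstrass (f (wa1 W)) (f (wa2 W)) (f (wa3 W)) (f (wa4 W)) (f (wa6 W)).

Definition discriminant (F : fieldType) (W : weierstrass F) : F :=
  let: Weierstrass a1 a2 a3 a4 a6 := W in
  let b2 := a1 ^+ 2 + 4 * a2 in
  let b4 := 2 * a4 + a1 * a3 in
  let b6 := a3 ^+ 2 + 4 * a6 in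
  let b8 := a1 ^+ 2 * a6 + 4 * a2 * a6 - a1 * a3 * a4 + a2 * a3 ^+ 2
            - a4 ^+ 2 in
  - b2 ^+ 2 * b8 - 8 * b4 ^+ 3 - 27 * b6 ^+ 2 + 9 * b2 * b4 * b6.

Record elliptic_curve (F : fieldType) := EllipticCurve {
  ec_model :> weierstrass F;
  ec_smooth : discriminant ec_model != 0 }.

Section Points.
Variables (F : fieldType) (W : weierstrass F).
Local Notation a1 := (wa1 W).
Local Notation a2 := (wa2 W).
Local Notation a3 := (wa3 W).
Local Notation a4 := (wa4 W).
Local Notation a6 := (wa6 W).

Definition on_curve (x y : F) : bool :=
  y ^+ 2 + a1 * x * y + a3 * y == x ^+ 3 + a2 * x ^+ 2 + a4 * x + a6.

Inductive ec_point : Type :=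
| EC_infinity
| EC_affine x y of on_curve x y.

(* The chord through the two points, or the tangent when they have the same
   x-coordinate; only used when the points are not opposite. *)
Definition slope (x1 y1 x2 y2 : F) : F :=
  if x1 == x2
  then (3 * x1 ^+ 2 + 2 * a2 * x1 + a4 - a1 * y1) / (2 * y1 + a1 * x1 + a3)
  else (y2 - y1) / (x2 - x1).

Definition sum_x (l x1 x2 : F) : F := l ^+ 2 + a1 * l - a2 - x1 - x2.

Definition sum_y (l x1 y1 x2 : F) : F :=
  - (l + a1) * sum_x l x1 x2 - (y1 - l * x1) - a3.

(* (x2, y2) = - (x1, y1) *)
Definition opposite (x1 y1 x2 y2 : F) : bool :=
  (x1 == x2) && (y1 + y2 + a1 * x2 + a3 == 0).

Let sum_on_curve_aux l x1 y1 x2 : on_curve x1 y1 ->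
  (a4 - 2 * l * (y1 - l * x1) - a1 * (y1 - l * x1) - a3 * l)
    + x1 ^+ 2 + x1 * x2 + x2 ^+ 2 - (l ^+ 2 + a1 * l - a2) * (x1 + x2) = 0 ->
  on_curve (sum_x l x1 x2) (sum_y l x1 y1 x2).
Proof.
move=> /eqP h1 h2; apply/eqP; rewrite /sum_y.
set x3 := sum_x l x1 x2; apply/subr0_eq.
transitivity
  ((y1 ^+ 2 + a1 * x1 * y1 + a3 * y1 - (x1 ^+ 3 + a2 * x1 ^+ 2 + a4 * x1 + a6))
   - (x3 - x1) * ((a4 - 2 * l * (y1 - l * x1) - a1 * (y1 - l * x1) - a3 * l)
    + x1 ^+ 2 + x1 * x2 + x2 ^+ 2 - (l ^+ 2 + a1 * l - a2) * (x1 + x2))).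
  by rewrite /x3 /sum_x; ring.
by rewrite h1 h2 subrr mulr0 subr0.
Qed.

Lemma sum_on_curve x1 y1 x2 y2 : on_curve x1 y1 -> on_curve x2 y2 ->
  ~~ opposite x1 y1 x2 y2 ->
  let l := slope x1 y1 x2 y2 in on_curve (sum_x l x1 x2) (sum_y l x1 y1 x2).
Proof.
move=> h1 h2; rewrite /opposite /slope.
have [e|x12 _] /= := eqVneq x1 x2.
  subst x2 => nopp; apply: sum_on_curve_aux => //.
  have y12 : y1 = y2.
    move/eqP: h1 (h2) => h1; rewrite /on_curve -h1 -subr_eq0.
    have -> : y2 ^+ 2 + a1 * x1 * y2 + a3 * y2
              - (y1 ^+ 2 + a1 * x1 * y1 + a3 * y1)
      = (y2 - y1) * (y1 + y2 + a1 * x1 + a3) by ring.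
    by rewrite mulf_eq0 (negPf nopp) orbF subr_eq0 => /eqP.
  have d0 : 2 * y1 + a1 * x1 + a3 != 0.
    by have -> : 2 * y1 = y1 + y2 by rewrite -y12; ring.
  by field.
apply: sum_on_curve_aux => //.
have d0 : x2 - x1 != 0 by rewrite subr_eq0 eq_sym.
apply: (mulfI d0); rewrite mulr0.
have -> : 0 = (x2 ^+ 3 + a2 * x2 ^+ 2 + a4 * x2 + a6 -
   (y2 ^+ 2 + a1 * x2 * y2 + a3 * y2))
   - (x1 ^+ 3 + a2 * x1 ^+ 2 + a4 * x1 + a6 -
   (y1 ^+ 2 + a1 * x1 * y1 + a3 * y1)).
  by move/eqP: h1 => ->; move/eqP: h2 => ->; rewrite !subrr.
by field.
Qed.

Definition ec_add (P Q : ec_point) : ec_point :=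
  match P, Q with
  | EC_infinity, _ => Q
  | _, EC_infinity => P
  | EC_affine x1 y1 h1, EC_affine x2 y2 h2 =>
      match boolP (opposite x1 y1 x2 y2) with
      | AltTrue _ => EC_infinity
      | AltFalse h => EC_affine (sum_on_curve h1 h2 h)
      end
  end.

Definition homogeneous_coord (P : ec_point) : 'rV[F]_3 :=
  match P with
  | EC_infinity => \row_i [:: 0; 1; 0]`_i
  | EC_affine x y _ => \row_i [:: x; y; 1]`_i
  end.

Lemma homogeneous_coord_neq0 P : homogeneous_coord P != 0.
Proof.
case: P => [|x y xy]; apply/eqP.
  move=> /(congr1 (fun u : 'rV[F]_3 => u 0 (inord 1))).
  by rewrite !mxE inordK//= => /eqP; rewrite oner_eq0.
move=> /(congr1 (fun u : 'rV[F]_3 => u 0 (inord 2))).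
by rewrite !mxE inordK//= => /eqP; rewrite oner_eq0.
Qed.

End Points.

Section ProjectivePlane.
Context {R : realType} {F : fieldType}.
Variable v : absvalue R F.

Definition nonzero_vectors : set 'rV[absv_space v]_3 :=
  [set u | (u : 'rV[F]_3) != 0].

Definition proportional : rel nonzero_vectors := fun u w =>
  `[< exists2 c : F, c != 0 & \val w = c *: (\val u : 'rV[F]_3) >].

Lemma proportional_equiv : equiv_class_of proportional.
Proof.
have sym u w : proportional u w -> proportional w u.
  move=> /asboolP[c c0 e]; apply/asboolP; exists c^-1.
    by rewrite invr_eq0.
  by rewrite e scalerA mulVf// scale1r.
split=> [u|u w|w u t].
- by apply/asboolP; exists 1; rewrite ?oner_eq0// scale1r.
- by apply/idP/idP; exact: sym.
- move=> /asboolP[c c0 e] /asboolP[d d0 e']; apply/asboolP.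
  by exists (d * c); rewrite ?mulf_neq0// e' e scalerA.
Qed.

Canonical proportional_equiv_rel := EquivRelPack proportional_equiv.

Definition projective_plane : Type :=
  quotient_topology {eq_quot proportional_equiv_rel}.

HB.instance Definition _ := Topological.on projective_plane.

Definition ec_projective (W : weierstrass F) (P : ec_point W) :
    projective_plane :=
  let u : nonzero_vectors :=
    exist _ (homogeneous_coord P) (mem_set (homogeneous_coord_neq0 P)) in
  \pi_({eq_quot proportional_equiv_rel}) u.

End ProjectivePlane.

(* The points over F, with the topology induced by the projective plane. *)
Definition ec_space (R : realType) (F : fieldType) (v : absvalue R F)
  (W : weierstrass F) : Type := ec_point W.

Section PointGroup.
Context {R : realType} {F : fieldType}.
Variables (v : absvalue R F) (W : weierstrass F).

HB.instance Definition _ := gen_eqMixin (ec_space v W).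
HB.instance Definition _ := gen_choiceMixin (ec_space v W).
HB.instance Definition _ := Topological.copy (ec_space v W)
  (initial_topology (@ec_projective R F v W : ec_space v W -> _)).
HB.instance Definition _ := GRing.hasAdd.Build (ec_space v W) (@ec_add F W).
HB.instance Definition _ :=
  GRing.hasZero.Build (ec_space v W) (@EC_infinity F W).

Definition ec_group : topGroupLaw := [topGroupLaw of ec_space v W].

End PointGroup.

Section Adelic.
Context {R : realType} {K : fieldType}.
Variables (E : elliptic_curve K) (Kc : forall p : prime_of R K, completion p).

Definition local_points (p : prime_of R K) : topGroupLaw :=
  ec_group (compl_absv (Kc p)) (map_weierstrass (compl_emb (Kc p)) E).

Definition adelic_points : topGroupLaw := bigprod_group local_points.

(* 'I_2 and 'I_1 are Z/2Z and the trivial group. *)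
Definition local_T (p : prime_of R K) : topGroupLaw :=
  if `[< finite_prime p >] then torsion_group (local_points p)
  else if `[< exists s : {rmorphism K -> R},
                real_prime_of p s /\ 0 < s (discriminant E) >]
  then discrete_group 'I_2
  else discrete_group 'I_1.

Definition T_group : topGroupLaw := bigprod_group local_T.

End Adelic.

(* Main.v *)
Require Import Defs.
From HB Require Import structures.
From mathcomp Require Import all_boot all_order all_algebra all_field.
From mathcomp Require Import ring lra zify.
From mathcomp Require Import all_classical all_reals all_analysis.

Set Implicit Arguments.
Unset Strict Implicit.
Unset Printing Implicit Defensive.

Import Order.TTheory GRing.Theory Num.Theory.
Import numFieldNormedType.Exports.

Local Open Scope classical_set_scope.
Local Open Scope ring_scope.

(* Every E(K_p) is a compact group. On a short Weierstrass equation the coordinate z = -x/y at O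
   is additive up to a quadratic error. Over R and C, the limit of 2^k P(z / 2^k) is therefore an
   open homomorphism exp : K_p -> E(K_p) with discrete kernel; over an l-adic field, the limit of
   z(l^k P) / l^k is a logarithm, whose kernel is the torsion subgroup.
   Group the primes p of K by the place of Q below them. Embeddings of K into an algebraically
   closed field and weak approximation identify the product of the K_p above a place with K (x) Q_l
   or K (x) R. Above l, the logarithms map the product of the E(K_p) onto a lattice of rank n, so
   that this product is Z_l^n times its torsion. Above infinity, exp has a lattice of R^n as kernel,
   and its image is (R/Z)^n. Any other coset contains a point where x (or |x|, at a complex prime) is
   maximal; this is impossible at a complex prime, and at a real prime the point is the 2-torsion
   point of the middle real root, which exists exactly when the discriminant is positive.
   The Z_l are assembled into the profinite completion of Z, which is torsion-free, whereas
   T is a product of discrete torsion groups. *)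

(** The groups come with bare operations, so associativity and continuity of the sum have to be
    proved on each E(K_p) before any structure theory; [tabgroup] records them. Limits along
    ultrafilters replace subsequences, power series and formal groups: they exist for all families
    in a compact group and for bounded families in a locally compact field, so that R, C and the
    l-adic fields share the same arguments. The rank n is never obtained by adding up local degrees.
    All primes above a place are treated together, in the coordinates of K on one basis over Q: the
    elements of K that are logarithms at every prime above l form a free module of rank n over the
    l-integral rationals, and the periods of exp form a lattice of R^n. Both bases come from one
    statement on lattices over subrings of Q. A completion at an infinite prime may carry a power of
    the usual absolute value, whereas the construction of exp by doubling relies on |2| = 2. It is
    therefore exchanged for R or C, to which it is isomorphic over K. *)

Lemma dep_funext {I : Type} {F : I -> Type} (f g : forall i, F i) : (forall i, f i = g i) -> f = g.
Proof. exact: functional_extensionality_dep. Qed.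

(** * Ultrafilters and compactness *)

Definition ultra {T : Type} (U : set_system T) : Prop :=
  ProperFilter U /\ forall A, U A \/ U (~` A).

#[local] Hint Extern 0 (ProperFilter _) =>
  match goal with uU : ultra _ |- _ => exact (proj1 uU) end : typeclass_instances.

Section Ultra.
Context {T : Type}.

Lemma ultra_of_filter (F : set_system T) : ProperFilter F ->
  exists U, ultra U /\ F `<=` U.
Proof.
move=> PF; have [U [UU FU]] := ultraFilterLemma PF; exists U; split=> //.
by split; [exact: ultra_proper | move=> A; exact: in_ultra_setVsetC].
Qed.

Lemma ultraU (U : set_system T) (A B : set T) :
  ultra U -> U (A `|` B) -> U A \/ U B.
Proof.
move=> [PU hU] AB; have [|nA] := hU A; [by left | right].
by apply: filterS2 AB nA => x /= [|//] => /[swap] /[apply].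
Qed.

Lemma ultra_bigU (U : set_system T) (I : eqType) (s : seq I) (A : I -> set T) :
  ultra U -> U [set x | exists2 i, i \in s & A i x] ->
  exists2 i, i \in s & U (A i).
Proof.
move=> uU; elim: s => [|i s IH] h.
  have [x [i]] := filter_ex h.
  by rewrite in_nil.
have : U (A i `|` [set x | exists2 i, i \in s & A i x]).
  apply: filterS h => x [j].
  rewrite inE => /orP[/eqP->|js] Aj; [by left|by right; exists j].
case/(ultraU uU) => [Ai|/IH[j js Aj]]; first by exists i; rewrite ?mem_head.
by exists j => //; rewrite inE js orbT.
Qed.

End Ultra.

Lemma ultra_map {T T' : Type} (f : T -> T') (U : set_system T) :
  ultra U -> ultra (f @ U).
Proof.
move=> [PU hU]; split; first exact: fmap_proper_filter.
by move=> A; exact: (hU (f @^-1` A)).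
Qed.

(** A free ultrafilter on the integers. Every sequence of a compact space has a limit along it,
    which stands for the passage to a convergent subsequence. *)
Lemma ultra_nat : exists U : set_system nat, ultra U /\
  forall N, U [set n | (N <= n)%N].
Proof.
have [U [uU sU]] := ultra_of_filter (@eventually_filter).
by exists U; split=> // N; apply: sU; exists N.
Qed.

Lemma compact_ultra_cvg {T : topologicalType} (A : set T) (U : set_system T) :
  compact A -> ultra U -> U A -> exists2 x, A x & U --> x.
Proof.
move=> cA [PU hU] UA; have [x [Ax cx]] := cA U PU UA; exists x => // B Bx.
have [//|nB] := hU B.
by have [y [ny /ny]] := cx _ _ nB Bx.
Qed.

Lemma ultra_cvg_compact {T : topologicalType} (A : set T) :
  (forall U : set_system T, ultra U -> U A -> exists2 x, A x & U --> x) ->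
  compact A.
Proof.
move=> h; rewrite compact_ultra => U UU UA.
have uU : ultra U.
  by split; [exact: ultra_proper | move=> B; exact: in_ultra_setVsetC].
by have [x Ax Ux] := h U uU UA; exists x.
Qed.

(** * Limits in a field with an absolute value *)

Section AbsvalueMore.
Context {R : realType} {F : fieldType} (v : absvalue R F).

Lemma absv0 : v 0 = 0. Proof. exact/absv_eq0. Qed.

Lemma absv_gt0 x : x != 0 -> 0 < v x.
Proof.
by move=> x0; rewrite lt0r absv_ge0 andbT; apply: contra x0 => /eqP/absv_eq0 ->.
Qed.

Lemma absv_le0 x : v x <= 0 -> x = 0.
Proof. by move=> h; apply/(absv_eq0 v)/le_anti; rewrite h absv_ge0. Qed.

Lemma absvV x : v x^-1 = (v x)^-1.
Proof.
have [->|x0] := eqVneq x 0; first by rewrite invr0 absv0 invr0.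
apply: (mulfI (lt0r_neq0 (absv_gt0 x0))).
by rewrite -absvM divff// absv1 divff// lt0r_neq0// absv_gt0.
Qed.

Lemma absvX x n : v (x ^+ n) = v x ^+ n.
Proof. by elim: n => [|n IH]; rewrite ?expr0 ?absv1// !exprS absvM IH. Qed.

Lemma absv_dist x y : v (x - y) = v (y - x).
Proof. by rewrite -absvN opprB. Qed.

Lemma absvB x y : v (x - y) <= v x + v y.
Proof. by rewrite -(absvN v y); exact: absvD. Qed.

Lemma absvD3 x y z : v (x - z) <= v (x - y) + v (y - z).
Proof. by rewrite -(subrKA y); exact: absvD. Qed.

Lemma absv_le_dist x y : v x <= v y + v (x - y).
Proof. by rewrite -{1}(subrK y x) addrC; exact: absvD. Qed.

Lemma absv_ge_dist x y : v y - v (x - y) <= v x.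
Proof. by rewrite lerBlDr absv_dist absv_le_dist. Qed.

Lemma absv_sum (I : Type) (r : seq I) (P : pred I) (f : I -> F) :
  v (\sum_(i <- r | P i) f i) <= \sum_(i <- r | P i) v (f i).
Proof.
apply: (big_ind2 (fun x y => v x <= y)); first by rewrite absv0.
- by move=> x1 x2 y1 y2 h1 h2; apply: le_trans (absvD _ _ _) (lerD h1 h2).
- by [].
Qed.

Lemma absvMn x n : v (x *+ n) <= v x *+ n.
Proof.
elim: n => [|n IH]; first by rewrite !mulr0n absv0.
by rewrite !mulrS; apply: le_trans (absvD _ _ _) (lerD _ IH).
Qed.

Lemma absv_nat_le n : v n%:R <= n%:R.
Proof. by rewrite -[n%:R as X in v X]/(1 *+ n); apply: le_trans (absvMn _ _) _; rewrite absv1. Qed.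

End AbsvalueMore.

Section Vlim.
Context {R : realType} {F : fieldType} (v : absvalue R F).
Context {T : Type} (U : set_system T) {FU : ProperFilter U}.
Implicit Types (f g : T -> F) (l : F).

(** Stated by inequalities on F, which keeps its field operations; [absv_space v] is reserved for
    the topology. *)
Definition vlim f l := forall e : R, 0 < e -> U [set t | v (f t - l) < e].

Definition vbounded f := exists M : R, U [set t | v (f t) <= M].

Definition vbig f := forall M : R, U [set t | M < v (f t)].

Lemma vlim_cst l : vlim (fun=> l) l.
Proof. by move=> e e0; apply: filterE => t /=; rewrite subrr absv0. Qed.

Lemma vlim_ext f g l : U [set t | f t = g t] -> vlim f l -> vlim g l.
Proof. by move=> fg h e e0; apply: filterS2 fg (h e e0) => t /= ->. Qed.
Lemma vlimD f g l m : vlim f l -> vlim g m -> vlim (fun t => f t + g t) (l + m).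
Proof.
move=> hf hg e e0; have e2 : 0 < e / 2 by rewrite divr_gt0.
apply: filterS2 (hf _ e2) (hg _ e2) => t /= h1 h2.
have -> : f t + g t - (l + m) = (f t - l) + (g t - m) by ring.
apply: le_lt_trans (absvD _ _ _) _; lra.
Qed.

Lemma vlimN f l : vlim f l -> vlim (fun t => - f t) (- l).
Proof. by move=> hf e e0; apply: filterS (hf e e0) => t /=; rewrite -opprD absvN. Qed.

Lemma vlimB f g l m : vlim f l -> vlim g m -> vlim (fun t => f t - g t) (l - m).
Proof. by move=> hf hg; apply: vlimD => //; exact: vlimN. Qed.

Lemma vlim_bounded f l : vlim f l -> vbounded f.
Proof.
move=> hf; exists (v l + 1); apply: filterS (hf 1 ltr01) => t /= h.
by apply: le_trans (absv_le_dist v _ l) _; rewrite lerD2l ltW.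
Qed.

Lemma vboundedP f : vbounded f -> exists M : R, 0 < M /\ U [set t | v (f t) <= M].
Proof.
move=> [M h]; exists (`|M| + 1); split; first by rewrite ltr_wpDl.
by apply: filterS h => t /= h; apply: le_trans h _; rewrite (le_trans (ler_norm M))// lerDl.
Qed.

Lemma vboundedD f g : vbounded f -> vbounded g -> vbounded (fun t => f t + g t).
Proof.
move=> [M hM] [N hN]; exists (M + N); apply: filterS2 hM hN => t /= h1 h2.
by apply: le_trans (absvD _ _ _) (lerD _ _).
Qed.
Lemma vlim0M f g : vlim f 0 -> vbounded g -> vlim (fun t => f t * g t) 0.
Proof.
move=> hf /vboundedP[M [M0 hM]] e e0.
apply: filterS2 (hf (e / M) (divr_gt0 e0 M0)) hM => t /=; rewrite !subr0 absvM => h1 h2.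
rewrite -(divfK (lt0r_neq0 M0) e).
apply: le_lt_trans (_ : v (f t) * M < _); first by rewrite ler_wpM2l// absv_ge0.
by rewrite ltr_pM2r.
Qed.

Lemma vlimP0 f l : vlim f l <-> vlim (fun t => f t - l) 0.
Proof. by split=> h e e0; apply: filterS (h e e0) => t /=; rewrite subr0. Qed.

Lemma vlimM f g l m : vlim f l -> vlim g m -> vlim (fun t => f t * g t) (l * m).
Proof.
move=> hf hg.
have h1 : vlim (fun t => (f t - l) * g t) 0.
  apply: vlim0M; [exact: (proj1 (vlimP0 _ _)) | exact: vlim_bounded hg].
have h2 : vlim (fun t => (g t - m) * l) 0.
  apply: vlim0M; [exact: (proj1 (vlimP0 _ _)) | exact: vlim_bounded (vlim_cst l)].
have := vlimD (vlimD h1 h2) (vlim_cst (l * m)).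
rewrite !add0r; apply: vlim_ext; apply: filterE => t /=; ring.
Qed.

Lemma vlimX f l n : vlim f l -> vlim (fun t => f t ^+ n) (l ^+ n).
Proof.
move=> h; elim: n => [|n IH]; first exact: vlim_cst.
by rewrite exprS; apply: vlim_ext (vlimM h IH); apply: filterE => t /=; rewrite exprS.
Qed.

Lemma vlim_neq0 f l : vlim f l -> l != 0 ->
  U [set t | v l / 2 < v (f t)].
Proof.
move=> hf l0; have vl := absv_gt0 v l0.
have e2 : 0 < v l / 2 by rewrite divr_gt0.
apply: filterS (hf _ e2) => t /= h; have := absv_ge_dist v (f t) l; lra.
Qed.

Lemma vlim_neq f l m : vlim f l -> l != m -> U [set t | f t != m].
Proof.
move=> hf lm; have d0 : l - m != 0 by rewrite subr_eq0.
apply: filterS (vlim_neq0 (vlimB hf (vlim_cst m)) d0) => t /= h.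
apply/eqP => e; move: h; rewrite e subrr absv0.
by have := absv_ge0 v (l - m); lra.
Qed.

Lemma vlimV f l : vlim f l -> l != 0 -> vlim (fun t => (f t)^-1) l^-1.
Proof.
move=> hf l0; have vl := absv_gt0 v l0.
apply/vlimP0.
have b : vbounded (fun t => (f t * l)^-1).
  exists ((v l / 2 * v l)^-1); apply: filterS (vlim_neq0 hf l0) => t /= h.
  rewrite absvV absvM lef_pV2 ?posrE; first by rewrite ler_wpM2r// ltW.
    by rewrite mulr_gt0// (lt_trans _ h)// divr_gt0.
  by rewrite mulr_gt0// divr_gt0.
have h0 : vlim (fun t => l - f t) 0.
  by have := vlimB (vlim_cst l) hf; rewrite subrr.
apply: vlim_ext (vlim0M h0 b); apply: filterS (vlim_neq hf l0) => t /= ft0.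
by field; rewrite ft0 l0.
Qed.

Lemma vlim_div f g l m : vlim f l -> vlim g m -> m != 0 ->
  vlim (fun t => f t / g t) (l / m).
Proof. by move=> hf hg m0; apply: vlimM => //; exact: vlimV. Qed.

Lemma vlim_unique f l m : vlim f l -> vlim f m -> l = m.
Proof.
move=> hl hm; apply/eqP; rewrite -subr_eq0; apply/eqP/(absv_eq0 v)/eqP.
rewrite eq_le absv_ge0 andbT; apply/ler_addgt0Pr => e e0; rewrite add0r.
have e2 : 0 < e / 2 by rewrite divr_gt0.
have [t [/= h1 h2]] := filter_ex (filterI (hl _ e2) (hm _ e2)).
have := absvD3 v l (f t) m; rewrite absv_dist in h1; rewrite -[v (l - m)]/(v (l - m)); lra.
Qed.

Lemma vlim_absv_le f l (c : R) : vlim f l -> U [set t | v (f t) <= c] -> v l <= c.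
Proof.
move=> hl hc; apply/ler_addgt0Pr => e e0.
have [t [/= h1 h2]] := filter_ex (filterI (hl _ e0) hc).
have := absv_le_dist v l (f t); rewrite absv_dist in h1; lra.
Qed.

Lemma vbigV f : vbig f -> vlim (fun t => (f t)^-1) 0.
Proof.
move=> h e e0; apply: filterS (h e^-1) => t /= ht.
rewrite subr0 absvV -[e]invrK ltf_pV2 ?posrE ?invr_gt0//.
by apply: lt_trans ht; rewrite invr_gt0.
Qed.

Lemma vlim_vbig f : vlim (fun t => (f t)^-1) 0 -> U [set t | f t != 0] -> vbig f.
Proof.
move=> h n0 M; have M1 : 0 < `|M| + 1 by rewrite ltr_wpDl.
have M2 : 0 < (`|M| + 1)^-1 by rewrite invr_gt0.
apply: filterS2 n0 (h _ M2) => t /= ft0; rewrite subr0 absvV ltf_pV2 ?posrE ?absv_gt0//.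
by apply: le_lt_trans; apply: le_trans (ler_norm _) _; rewrite lerDl.
Qed.

End Vlim.

Arguments vlim {R F} v {T} U f l.
Arguments vlim_cst {R F} v {T} U {FU} l.
Arguments vbounded {R F} v {T} U f.
Arguments vbig {R F} v {T} U f.

Section LocallyCompact.
Context {R : realType} {F : fieldType} (v : absvalue R F).

(** Compactness of the closed balls, in terms of ultrafilters. Completeness follows from it, see
    [loc_compact_complete]. *)
Definition loc_compact : Prop := forall U : set_system F, ultra U ->
  vbounded v U id -> exists l, vlim v U id l.

Hypothesis LC : loc_compact.

Lemma lc_vlim {T : Type} (U : set_system T) (f : T -> F) : ultra U ->
  vbounded v U f -> exists l, vlim v U f l.
Proof.
move=> uU [M hM].
have [l hl] := LC (ultra_map f uU) (ex_intro _ M hM).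
by exists l.
Qed.
End LocallyCompact.

(** * Topology of the points of a curve *)

Local Notation crd u i := ((val u : 'rV[_]_3) 0 i).

Section PlaneTopology.
Context {R : realType} {F : fieldType} (v : absvalue R F).

Lemma absv_nbhsP (x : absv_space v) (A : set (absv_space v)) :
  nbhs x A <-> exists2 e : R, 0 < e & forall y : F, v (y - x) < e -> A y.
Proof.
rewrite -(@nbhs_ballE R (absv_space v)); split=> -[e e0 h]; exists e => //.
- by move=> y xy; apply: h; rewrite /ball/= absv_dist.
- by move=> y xy; apply: h; rewrite absv_dist; exact: xy.
Qed.

Lemma rV_nbhsP n (u : 'rV[absv_space v]_n) (A : set 'rV[absv_space v]_n) :
  nbhs u A <-> exists2 e : R, 0 < e &
    forall w : 'rV[F]_n, (forall i, v (w 0 i - u 0 i) < e) -> A w.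
Proof.
rewrite -(@nbhs_ballE R 'rV[absv_space v]_n); split=> -[e e0 h]; exists e => //.
- move=> w uw; apply: h; split=> // i j; rewrite (ord1 i) /ball/= absv_dist; exact: uw.
- by move=> w [_ uw]; apply: h => i; rewrite absv_dist; exact: uw.
Qed.

Notation NZ := (set_type (@nonzero_vectors R F v)).

Lemma nonzero_nbhsP (u : NZ) (A : set NZ) :
  nbhs u A <-> exists2 e : R, 0 < e &
    forall w : NZ, (forall i, v (crd w i - crd u i) < e) -> A w.
Proof.
split.
- move=> [B [[C oC <-] Cu] CA].
  have /rV_nbhsP[e e0 h] : nbhs (val u : 'rV[absv_space v]_3) C by exact: open_nbhs_nbhs.
  by exists e => // w wu; apply: CA; exact: h.
- move=> [e e0 h].
  have : nbhs (val u : 'rV[absv_space v]_3)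
     [set w : 'rV[absv_space v]_3 | forall i, v ((w : 'rV[F]_3) 0 i - crd u i) < e].
    by apply/rV_nbhsP; exists e.
  move=> /(@initial_continuous (set_type (@nonzero_vectors R F v)) _ set_val u) hh.
  have {}hh : nbhs u [set w : NZ | forall i, v (crd w i - crd u i) < e] by exact: hh.
  by apply: filterS hh => w /=; exact: h.
Qed.

Definition proj_pi (u : NZ) : projective_plane v :=
  \pi_({eq_quot (proportional_equiv_rel v)})%qT u.

Lemma proj_piP (u w : NZ) : proj_pi u = proj_pi w <->
  exists2 c : F, c != 0 & (val w : 'rV[F]_3) = c *: (val u : 'rV[F]_3).
Proof.
split; last by move=> h; apply/eqmodP/asboolP.
by move/eqmodP => /= /asboolP.
Qed.

Lemma plane_open (B : set (projective_plane v)) :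
  open B = open ((proj_pi : NZ -> _) @^-1` B).
Proof. by []. Qed.

End PlaneTopology.

Section Coordinates.
Context {F : fieldType} {W : weierstrass F}.

Definition isO (P : ec_point W) : bool := if P is EC_infinity then true else false.
Definition Xc (P : ec_point W) : F := if P is EC_affine x y _ then x else 0.
Definition Yc (P : ec_point W) : F := if P is EC_affine x y _ then y else 0.

Lemma on_curveE (P : ec_point W) : ~~ isO P -> on_curve W (Xc P) (Yc P).
Proof. by case: P. Qed.

Lemma ec_eqP (P Q : ec_point W) :
  P = Q <-> [/\ isO P = isO Q, Xc P = Xc Q & Yc P = Yc Q].
Proof.
split; first by move=> ->.
case: P => [|x y h]; case: Q => [|x' y' h'] //= [_ e1 e2] //.
by subst x' y'; rewrite (bool_irrelevance h h').
Qed.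

End Coordinates.

Section Convergence.
Context {R : realType} {F : fieldType} (v : absvalue R F) (W : weierstrass F).
Notation E := (ec_point W).

(* Convergence in the projective topology, read in affine coordinates. *)
Definition econv {T : Type} (U : set_system T) (f : T -> E) (P : E) : Prop :=
  match P with
  | EC_infinity => forall M : R, U [set t | isO (f t) \/ M < v (Xc (f t))]
  | EC_affine x y _ => [/\ U [set t | ~~ isO (f t)], vlim v U (Xc \o f) x
                        & vlim v U (Yc \o f) y]
  end.

Notation NZ := (set_type (@nonzero_vectors R F v)).

Lemma nz_of (a b c : F) : (a != 0) || (b != 0) || (c != 0) ->
  exists u : NZ, [/\ (crd u (inord 0)) = a,
     (crd u (inord 1)) = b & (crd u (inord 2)) = c].
Proof.
move=> h; pose u : 'rV[F]_3 := \row_i [:: a; b; c]`_i.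
have u0 : (u : 'rV[absv_space v]_3) \in @nonzero_vectors R F v.
  apply/mem_set => /=; apply: contraL h => /eqP e.
  have := congr1 (fun w : 'rV[F]_3 => w 0 (inord 0)) e.
  have := congr1 (fun w : 'rV[F]_3 => w 0 (inord 1)) e.
  have := congr1 (fun w : 'rV[F]_3 => w 0 (inord 2)) e.
  by rewrite !mxE !inordK//= => -> -> ->; rewrite eqxx.
by exists (exist _ u u0); rewrite /= !mxE !inordK.
Qed.

Lemma ord3P (P : 'I_3 -> Prop) : P (inord 0) -> P (inord 1) -> P (inord 2) ->
  forall i, P i.
Proof.
move=> h0 h1 h2 i; have -> : i = inord i by rewrite inord_val.
by case: i => -[|[|[|]]].
Qed.

Definition hvec (P : E) : NZ :=
  exist _ (homogeneous_coord P) (mem_set (homogeneous_coord_neq0 P)).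

Lemma ec_projectiveE (P : E) : ec_projective v P = proj_pi (hvec P).
Proof. by []. Qed.

Lemma hvecE (P : E) :
  [/\ (crd (hvec P) (inord 0)) = Xc P,
      (crd (hvec P) (inord 1)) = (if isO P then 1 else Yc P) &
      (crd (hvec P) (inord 2)) = (~~ isO P)%:R].
Proof. by case: P => [|x y h]; rewrite /= !mxE !inordK. Qed.

Lemma ec_nbhsP (P : ec_space v W) (A : set (ec_space v W)) :
  nbhs P A <-> exists2 B : set (projective_plane v), open B &
     B (ec_projective v P) /\ forall Q : E, B (ec_projective v Q) -> A Q.
Proof.
split.
- by move=> [C [[B oB <-] BP] BA]; exists B => //; split=> // Q BQ; exact: BA.
- move=> [B oB [BP BA]]; exists ((@ec_projective R F v W) @^-1` B).
    by split=> //; exists B.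
Qed.

Local Notation a1 := (wa1 W).
Local Notation a2 := (wa2 W).
Local Notation a3 := (wa3 W).
Local Notation a4 := (wa4 W).
Local Notation a6 := (wa6 W).

(** Dividing the equation by x^2 expresses x as a polynomial in y/x and 1/x, hence bounds x as long
    as y/x is bounded and v x > 1. *)
Lemma curve_far (M : R) : exists2 N : R, 0 < N & forall x y : F,
  on_curve W x y -> N < v x -> M < v (y / x).
Proof.
pose m := `|M|; have m0 : 0 <= m by exact: normr_ge0.
have [A1 A2 A3 A4 A6] := And5 (absv_ge0 v a1) (absv_ge0 v a2) (absv_ge0 v a3) (absv_ge0 v a4) (absv_ge0 v a6).
exists (m * m + v a1 * m + v a3 * m + v a2 + v a4 + v a6 + 1).
  by rewrite ltr_wpDl// !addr_ge0// ?mulr_ge0.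
move=> x y /eqP xy Nx; rewrite ltNge; apply/negP => sM.
have x1 : 1 < v x.
  by apply: le_lt_trans Nx; rewrite lerDr !addr_ge0// ?mulr_ge0.
have x0 : x != 0 by apply/eqP => x0; move: x1; rewrite x0 absv0 ltr10.
have [s [ys {}sM]] : exists s, y = s * x /\ v s <= M by exists (y / x); rewrite divfK.
have sm : v s <= m by apply: le_trans sM (ler_norm _).
have iv : v x^-1 <= 1 by rewrite absvV invf_le1 ?ltW// (lt_trans _ x1).
have e : x = s * s + a1 * s + a3 * s * x^-1 - a2 - a4 * x^-1 - a6 * x^-1 * x^-1.
  have : (y ^+ 2 + a1 * x * y + a3 * y - (x ^+ 3 + a2 * x ^+ 2 + a4 * x + a6)) / x ^+ 2 = 0.
    by rewrite xy subrr mul0r.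
  rewrite ys => h; apply/eqP; rewrite -subr_eq0 -oppr_eq0 -h; apply/eqP; field.
  by [].
have s0 := absv_ge0 v s; have i0 := absv_ge0 v x^-1.
move: Nx; rewrite ltNge => /negP; apply; rewrite [X in v X <= _]e.
have t1 : v (s * s) <= m * m by rewrite absvM ler_pM.
have t2 : v (a1 * s) <= v a1 * m by rewrite absvM ler_wpM2l.
have t3 : v (a3 * s * x^-1) <= v a3 * m.
  rewrite !absvM -[leRHS]mulr1; by apply: ler_pM; rewrite ?mulr_ge0// ler_wpM2l.
have t4 : v (a4 * x^-1) <= v a4 by rewrite absvM -[leRHS]mulr1 ler_wpM2l.
have t6 : v (a6 * x^-1 * x^-1) <= v a6.
  by rewrite !absvM -[leRHS]mulr1 ler_pM// ?mulr_ge0// -[leRHS]mulr1 ler_wpM2l.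
have := absvB v (s * s + a1 * s + a3 * s / x - a2 - a4 / x) (a6 / x / x).
have := absvB v (s * s + a1 * s + a3 * s / x - a2) (a4 / x).
have := absvB v (s * s + a1 * s + a3 * s / x) a2.
have := absvD v (s * s + a1 * s) (a3 * s * x^-1).
have := absvD v (s * s) (a1 * s).
lra.
Qed.

Context {T : Type} (U : set_system T) {FU : ProperFilter U}.

(** For z = x/y and w = 1/y the equation of the curve reads x^3 = D y^2, where D is the denominator.
    The fraction is then 1/x, which must tend to 0 near O. *)
Lemma vlim_curve_inf (z w : T -> F) : vlim v U z 0 -> vlim v U w 0 ->
  vlim v U (fun t => z t ^+ 2 / (1 + a1 * z t + a3 * w t - a2 * z t ^+ 2
       - a4 * z t * w t - a6 * w t ^+ 2)) 0.
Proof.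
move=> hz hw.
have c x : vlim v U (fun=> x) x by exact: vlim_cst.
pose proof (h := vlim_div (vlimX 2 hz) (vlimB (vlimB (vlimB (vlimD (vlimD (c 1) (vlimM (c a1) hz)) (vlimM (c a3) hw))
 (vlimM (c a2) (vlimX 2 hz))) (vlimM (vlimM (c a4) hz) hw)) (vlimM (c a6) (vlimX 2 hw)))).
by move: h; rewrite !mulr0 !expr0n/= !mulr0 !subr0 !addr0 mul0r; apply; exact: oner_neq0.
Qed.

Lemma ord3_vlim (P : E) (u : T -> NZ) :
  (forall i, vlim v U (fun t => (crd (u t) i)) (crd (hvec P) i)) ->
  forall B : set (projective_plane v), open B -> B (ec_projective v P) ->
  U [set t | B (proj_pi (u t))].
Proof.
move=> h B; rewrite plane_open => oB BP.
have /nonzero_nbhsP[e e0 he] : nbhs (hvec P) ((@proj_pi R F v) @^-1` B) by exact: open_nbhs_nbhs.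
have hh : U [set t | forall i, v (crd (u t) i - crd (hvec P) i) < e].
  apply: filterS3 (h (inord 0) e e0) (h (inord 1) e e0) (h (inord 2) e e0) => t /= h0 h1 h2.
  exact: (@ord3P (fun i => v (crd (u t) i - crd (hvec P) i) < e)).
by apply: filterS hh => t /=; exact: he.
Qed.

Lemma nz_coord_vlim (u : NZ) i :
  vlim v (nbhs u) (fun w : NZ => (crd w i)) (crd u i).
Proof. by move=> e e0; apply/nonzero_nbhsP; exists e => // w; exact. Qed.

(** The conditions bear on ratios of coordinates, so D is saturated for proportionality and its
    image is open in the quotient as soon as D is open. *)
Lemma chart_open (i j k : 'I_3) (x y : F) (e : R) (D : set NZ) :
  D = [set u : NZ | [/\ (crd u k) != 0,
      v (crd u i / (crd u k) - x) < e &
      v (crd u j / (crd u k) - y) < e]] ->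
  exists B : set (projective_plane v), open B /\ forall u, B (proj_pi u) <-> D u.
Proof.
move=> ->; set D' := [set u : NZ | _].
exists [set q | exists2 u, D' u & q = proj_pi u].
have sat u : (exists2 u', D' u' & proj_pi u = proj_pi u') <-> D' u.
  split=> [[u' [h1 h2 h3] /proj_piP[c c0 e']]|]; last by exists u.
  move: h1 h2 h3; rewrite e' !mxE mulf_eq0 negb_or c0 /= => h1.
  have q a : (c * a) / (c * (\val u : 'rV[F]_3) 0 k) = a / (\val u : 'rV[F]_3) 0 k by field; rewrite c0 h1.
  by rewrite !q => h2 h3; split.
split; last exact: sat.
rewrite plane_open.
have -> : (proj_pi (v:=v)) @^-1` [set q | exists2 u, D' u & q = proj_pi u] = D'.
  by apply/seteqP; split=> u /=; rewrite sat.
rewrite openE => u [h1 h2 h3].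
have PF : ProperFilter (nbhs u) by exact: nbhs_pfilter.
have L m := nz_coord_vlim u m.
have v1 := @vlim_div _ _ _ _ _ PF _ _ _ _ (L i) (L k) h1.
have v2 := @vlim_div _ _ _ _ _ PF _ _ _ _ (L j) (L k) h1.
have e1 : 0 < e - v (crd u i / (crd u k) - x) by rewrite subr_gt0.
have e2 : 0 < e - v (crd u j / (crd u k) - y) by rewrite subr_gt0.
change (nbhs u D').
apply: filterS3 (vlim_neq (FU := PF) (L k) h1) (v1 _ e1) (v2 _ e2) => w /= w1 w2 w3.
split=> //.
  by apply: le_lt_trans (absvD3 v _ (crd u i / crd u k) _) _; rewrite -ltrBrDr.
by apply: le_lt_trans (absvD3 v _ (crd u j / crd u k) _) _; rewrite -ltrBrDr.
Qed.

Lemma cvg_econv (f : T -> ec_space v W) (P : ec_space v W) :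
  f @ U --> P -> econv U f P.
Proof.
move=> fP.
have key B : open B -> B (ec_projective v P) -> U [set t | B (ec_projective v (f t))].
  by move=> oB BP; apply: (fP [set Q | B (ec_projective v Q)]); apply/ec_nbhsP; exists B.
case: P fP key => [|x0 y0 h0] _ key /=.
  (* The coordinates X/Y and Z/Y of the chart Y <> 0 around O. *)
  pose z t := if isO (f t) then 0 else Xc (f t) / Yc (f t).
  pose w t := if isO (f t) then 0 else (Yc (f t))^-1.
  have hzw (e : R) : 0 < e -> U [set t | isO (f t) \/ [/\ Yc (f t) != 0, v (z t) < e & v (w t) < e]].
    move=> e0.
    have [B [oB BD]] := @chart_open (inord 0) (inord 2) (inord 1) 0 0 e _ erefl.
    have h := key B oB; rewrite ec_projectiveE BD /= in h.
    have := hvecE (EC_infinity W); rewrite /= => -[e1 e2 e3]; rewrite e1 e2 e3 in h.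
    apply: filterS (h _); last by rewrite oner_neq0 !mul0r subr0 absv0.
    move=> t /=; rewrite ec_projectiveE BD /=; have [-> -> ->] := hvecE (f t).
    rewrite /z /w; case: (f t) => [|x y hxy] /=; first by left.
    by rewrite !subr0 mul1r => hh; right.
  have z0 : vlim v U z 0.
    move=> e e0; apply: filterS (hzw e e0) => t [h|[_ + _]] /=; rewrite subr0//.
    by rewrite /z h absv0.
  have w0 : vlim v U w 0.
    move=> e e0; apply: filterS (hzw e e0) => t [h|[_ _ +]] /=; rewrite subr0//.
    by rewrite /w h absv0.
  move=> M; have M1 : 0 < `|M| + 1 by rewrite ltr_wpDl.
  have M2 : 0 < (`|M| + 1)^-1 by rewrite invr_gt0.
  have hd := vlim_curve_inf z0 w0.
  have D0 : U [set t | (1 + a1 * z t + a3 * w t - a2 * z t ^+ 2 - a4 * z t * w t - a6 * w t ^+ 2) != 0].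
    have c x : vlim v U (fun=> x) x by exact: vlim_cst.
    pose proof (h := vlimB (vlimB (vlimB (vlimD (vlimD (c 1) (vlimM (c a1) z0)) (vlimM (c a3) w0))
       (vlimM (c a2) (vlimX 2 z0))) (vlimM (vlimM (c a4) z0) w0)) (vlimM (c a6) (vlimX 2 w0))).
    rewrite !mulr0 !expr0n/= !mulr0 !subr0 !addr0 in h; exact: (vlim_neq h (oner_neq0 _)).
  apply: filterS3 (hzw 1 ltr01) D0 (hd _ M2) => t /=.
  case: (boolP (isO (f t))) => [|nO]; [by left | case=> // -[Y0 _ _] D0' hM; right].
  move: D0' hM; rewrite /z /w (negPf nO).
  have /eqP := on_curveE nO; move: (Xc (f t)) (Yc (f t)) Y0 => x y y0 hxy.
  set D := (X in X != 0) => D0' hM.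
  have zD : x ^+ 3 = D * y ^+ 2.
    have -> : D * y ^+ 2 = y ^+ 2 + a1 * x * y + a3 * y - a2 * x ^+ 2 - a4 * x - a6 by rewrite /D; field.
    by rewrite hxy; ring.
  have x0 : x != 0.
    apply/eqP => x0; move/eqP: zD; rewrite x0 expr0n/= eq_sym mulf_eq0 (negPf D0') /=.
    by rewrite expf_eq0/= (negPf y0).
  have xi : (x / y) ^+ 2 / D = x^-1.
    apply/eqP; rewrite -subr_eq0; apply/eqP.
    have -> : (x / y) ^+ 2 / D - x^-1 = (x ^+ 3 - D * y ^+ 2) / (y ^+ 2 * D * x) by field; rewrite x0 D0' y0.
    by rewrite zD subrr mul0r.
  move: hM; rewrite subr0 xi absvV ltf_pV2 ?posrE ?absv_gt0//.
  by apply: le_lt_trans; apply: le_trans (ler_norm _) _; rewrite lerDl.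
have hh (e : R) : 0 < e -> U [set t | [/\ ~~ isO (f t), v (Xc (f t) - x0) < e & v (Yc (f t) - y0) < e]].
  move=> e0.
  have [B [oB BD]] := @chart_open (inord 0) (inord 1) (inord 2) x0 y0 e _ erefl.
  have h := key B oB; rewrite ec_projectiveE BD /= in h.
  have := hvecE (EC_affine h0); rewrite /= => -[e1 e2 e3]; rewrite e1 e2 e3 in h.
  apply: filterS (h _); last by rewrite oner_neq0 !divr1 !subrr absv0.
  move=> t /=; rewrite ec_projectiveE BD /=; have [-> -> ->] := hvecE (f t).
  by case: (f t) => [|x y hxy] /=; [rewrite eqxx => -[] | rewrite !divr1 => -[]].
split; first by apply: filterS (hh 1 ltr01) => t [].
- by move=> e e0; apply: filterS (hh e e0) => t [].
- by move=> e e0; apply: filterS (hh e e0) => t [].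
Qed.

Lemma econv_cvg (f : T -> ec_space v W) (P : ec_space v W) :
  econv U f P -> f @ U --> P.
Proof.
move=> h A /ec_nbhsP[B oB [BP BA]].
change (U [set t | A (f t)]).
suff : U [set t | B (ec_projective v (f t))] by apply: filterS => t /=; exact: BA.
case: P h BP => [|x0 y0 h0] /= h BP; last first.
  have [h1 h2 h3] := h.
  apply: (@ord3_vlim (EC_affine h0) (fun t => hvec (f t))) => //.
  apply: ord3P; have [E0 E1 E2] := hvecE (EC_affine h0); rewrite ?E0 ?E1 ?E2 /=.
  - by apply: vlim_ext h2; apply: filterE => t /=; have [-> _ _] := hvecE (f t).
  - by apply: vlim_ext h3; apply: filterS h1 => t /= /negPf nO; have [_ -> _] := hvecE (f t); rewrite nO.
  - apply: vlim_ext (vlim_cst v U (1 : F)); apply: filterS h1 => t /= nO; have [_ _ ->] := hvecE (f t); by rewrite nO.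
(* The coordinates (x, y, 1) do not converge when the point tends to O; the proportional vector
   (x/y, 1, 1/y) tends to (0, 1, 0). *)
have nzu t : (((if isO (f t) then 0 else Xc (f t) / Yc (f t)) : F) != 0) || ((1 : F) != 0) ||
   (((if isO (f t) then 0 else (Yc (f t))^-1) : F) != 0) by rewrite oner_neq0 orbT.
pose u t := sval (cid (nz_of (nzu t))).
have uE t := svalP (cid (nz_of (nzu t))).
have small (e : R) : 0 < e -> U [set t | isO (f t) \/ [/\ Yc (f t) != 0,
     v (Xc (f t) / Yc (f t)) < e & v (Yc (f t))^-1 < e]].
  move=> e0; have [N N0 hN] := curve_far e^-1.
  apply: filterS (h (Num.max N 1)) => t /= [|]; first by left.
  rewrite gt_max => /andP[xN x1].
  case: (boolP (isO (f t))) => [|nO]; [by left | right].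
  have := hN _ _ (on_curveE nO) xN; move: (Xc (f t)) (Yc (f t)) x1 => x y x1 s.
  have y0 : y != 0.
    apply/eqP => y0; move: s; rewrite y0 mul0r absv0; apply/negP.
    by rewrite -leNgt invr_ge0 ltW.
  have xy : v (x / y) < e.
    have -> : x / y = (y / x)^-1 by rewrite invf_div.
    by rewrite absvV -[e]invrK ltf_pV2// posrE ?invr_gt0// (lt_trans _ s)// invr_gt0.
  split=> //; apply: le_lt_trans xy.
  by rewrite absvM -[leLHS]mul1r ler_wpM2r ?absv_ge0// ltW.
have hu : U [set t | B (proj_pi (u t))].
  apply: (@ord3_vlim (EC_infinity W)) => //.
  apply: ord3P; have [E0 E1 E2] := hvecE (EC_infinity W); rewrite ?E0 ?E1 ?E2 /=.
  - move=> e e0; apply: filterS (small e e0) => t /=; rewrite subr0; have [-> _ _] := uE t.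
    by case: (isO (f t)) => [|[//|[]]]; rewrite ?absv0.
  - by apply: vlim_ext (vlim_cst v U (1 : F)); apply: filterE => t; have [_ h1 _] := uE t; rewrite -h1.
  - move=> e e0; apply: filterS (small e e0) => t /=; rewrite subr0; have [_ _ ->] := uE t.
    by case: (isO (f t)) => [|[//|[]]]; rewrite ?absv0.
apply: filterS2 hu (small 1 ltr01) => t /= + s; rewrite ec_projectiveE.
suff -> : proj_pi (u t) = proj_pi (hvec (f t)) by [].
apply/proj_piP; exists (if isO (f t) then 1 else Yc (f t)).
  by move: s; case: (isO (f t)) => [_|[//|[]//]]; rewrite oner_neq0.
apply/rowP; have [u0 u1 u2] := uE t; have [E0 E1 E2] := hvecE (f t).
apply: ord3P; rewrite !mxE ?u0 ?u1 ?u2 ?E0 ?E1 ?E2;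
  move: s; case: (f t) => [|x y hxy] /=; rewrite ?mul1r ?mulr1 //.
- by case=> // -[y0 _ _]; rewrite mulrC divfK.
- by case=> // -[y0 _ _]; rewrite divff.
Qed.

End Convergence.

(** * The group law of a short Weierstrass curve *)

(** In [ec_add] the second branch of the match consumes a proof that the points are not opposite.
    Destructing a general [alt_spec] once avoids dependent rewriting afterwards. *)
Lemma alt_case (A : Type) (b c : bool) (t : A) (f : ~~ b -> A) (x : alt_spec b b c) :
  (b /\ match x with AltTrue _ => t | AltFalse h => f h end = t) \/
  exists h, match x with AltTrue _ => t | AltFalse h => f h end = f h.
Proof. by case: x => h; [left | right; exists h]. Qed.

Definition short_weierstrass (F : fieldType) (a b : F) : weierstrass F :=
  Weierstrass 0 0 0 a b.

Section ShortCurve.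
Context {F : fieldType} (a b : F).
Hypothesis two_neq0 : (2 : F) != 0.
Hypothesis smooth : 4 * a ^+ 3 + 27 * b ^+ 2 != 0.

Notation W := (short_weierstrass a b).
Notation E := (ec_point W).
Implicit Types P Q S : E.

Lemma short_on_curveE x y : on_curve W x y = (y ^+ 2 == x ^+ 3 + a * x + b).
Proof. by rewrite /on_curve /= !mul0r !addr0. Qed.

Lemma short_curve P : ~~ isO P -> Yc P ^+ 2 = Xc P ^+ 3 + a * Xc P + b.
Proof. by move/on_curveE; rewrite short_on_curveE => /eqP. Qed.

(** A double root x would give a = -3 x^2 and b = 2 x^3, hence a vanishing discriminant. *)
Lemma short_smooth x : x ^+ 3 + a * x + b = 0 -> 3 * x ^+ 2 + a != 0.
Proof.
move=> h; apply: contra_neq smooth => h'.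
have ea : a = - (3 * x ^+ 2) by apply/eqP; rewrite -addr_eq0 addrC h'.
have eb : b = 2 * x ^+ 3.
  have -> : b = (x ^+ 3 + a * x + b) - x ^+ 3 - a * x by ring.
  by rewrite h ea; ring.
by rewrite eb ea; ring.
Qed.

Lemma opp_on_curve x y : on_curve W x y -> on_curve W x (- y).
Proof. by rewrite !short_on_curveE sqrrN. Qed.

Definition ec_opp P : E :=
  match P with EC_infinity => EC_infinity W | EC_affine x y h => EC_affine (opp_on_curve h) end.

Lemma isO_opp P : isO (ec_opp P) = isO P. Proof. by case: P. Qed.
Lemma Xc_opp P : Xc (ec_opp P) = Xc P. Proof. by case: P. Qed.
Lemma Yc_opp P : Yc (ec_opp P) = - Yc P. Proof. by case: P => //=; rewrite oppr0. Qed.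
Lemma isO_eq P : isO P -> P = EC_infinity W. Proof. by case: P. Qed.
Lemma ec_oppK P : ec_opp (ec_opp P) = P.
Proof. by apply/ec_eqP; rewrite !isO_opp !Xc_opp !Yc_opp opprK. Qed.

(** The slope of the line through P and Q by two equations: the chord, and its form after factoring
    y_Q^2 - y_P^2 through the curve. The second survives for P = Q, so chord and tangent need no
    separate treatment; the two determine l unless Q = -P. *)
Definition ec_line (l : F) P Q : Prop :=
  (Xc Q - Xc P) * l = Yc Q - Yc P /\
  (Yc P + Yc Q) * l = Xc P ^+ 2 + Xc P * Xc Q + Xc Q ^+ 2 + a.

Definition ec_opposite P Q : bool := (Xc P == Xc Q) && (Yc P + Yc Q == 0).

Lemma ec_lineC l P Q : ec_line l P Q -> ec_line l Q P.
Proof.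
move=> [h1 h2]; split.
  by apply/eqP; rewrite -eqr_opp -mulNr !opprB; apply/eqP.
by rewrite addrC h2; ring.
Qed.

Lemma ec_oppositeC P Q : ec_opposite P Q = ec_opposite Q P.
Proof. by rewrite /ec_opposite eq_sym addrC. Qed.

Lemma ec_line_unique l l' P Q : ~~ ec_opposite P Q -> ec_line l P Q ->
  ec_line l' P Q -> l = l'.
Proof.
rewrite /ec_opposite negb_and => n [h1 h2] [h1' h2'].
case/orP: n => n; last by apply: (mulfI n); rewrite h2 h2'.
by apply: (@mulfI _ (Xc Q - Xc P)); rewrite ?h1 ?h1'// subr_eq0 eq_sym.
Qed.

Lemma same_x P Q : ~~ isO P -> ~~ isO Q -> Xc P = Xc Q -> ~~ ec_opposite P Q ->
  Yc P = Yc Q.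
Proof.
move=> hP hQ e; rewrite /ec_opposite e eqxx /= => n.
apply/eqP; rewrite -subr_eq0; have : (Yc P - Yc Q) * (Yc P + Yc Q) == 0.
  by rewrite -subr_sqr (short_curve hP) (short_curve hQ) e subrr.
by rewrite mulf_eq0 (negPf n) orbF.
Qed.

Lemma ec_addO P : ec_add P (EC_infinity W) = P. Proof. by case: P. Qed.
Lemma ec_0add P : ec_add (EC_infinity W) P = P. Proof. by case: P. Qed.

Lemma ec_add_opposite P Q : ~~ isO P -> ~~ isO Q -> ec_opposite P Q ->
  ec_add P Q = EC_infinity W.
Proof.
case: P => [//|x1 y1 h1]; case: Q => [//|x2 y2 h2] _ _; rewrite /ec_opposite /= => o.
have h : opposite W x1 y1 x2 y2 by rewrite /opposite /= mul0r !addr0.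
case: (alt_case (EC_infinity W) (fun h => EC_affine (sum_on_curve h1 h2 h)) (boolP _)) => [[_]//|[n _]].
by case: (negP n h).
Qed.

Lemma ec_add_slope P Q : ~~ isO P -> ~~ isO Q -> ~~ ec_opposite P Q ->
  exists l, [/\ ec_line l P Q, ~~ isO (ec_add P Q),
     Xc (ec_add P Q) = l ^+ 2 - Xc P - Xc Q &
     Yc (ec_add P Q) = - (l * Xc (ec_add P Q) + (Yc P - l * Xc P))].
Proof.
move=> hP hQ n; have := @same_x P Q hP hQ.
move: n (short_curve hP) (short_curve hQ).
case: P hP => [//|x1 y1 h1]; case: Q hQ => [//|x2 y2 h2] _ _.
rewrite /ec_opposite /= => n c1 c2 sx.
exists (slope W x1 y1 x2 y2).
have on : ~~ opposite W x1 y1 x2 y2 by rewrite /opposite /= mul0r !addr0.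
have ll : @ec_line (slope W x1 y1 x2 y2) (EC_affine h1) (EC_affine h2).
  rewrite /ec_line /slope /= !mul0r mulr0 !mul0r !addr0 subr0.
  have [e|x12] := eqVneq x1 x2.
    have y12 := sx e n; move: n; rewrite -e -y12 eqxx /= => n.
    rewrite !subrr mul0r; split=> //.
    have y0 : y1 != 0 by apply: contraNneq n => ->; rewrite addr0.
    by field; rewrite ?y0 ?two_neq0.
  have d : x2 - x1 != 0 by rewrite subr_eq0 eq_sym.
  split; first by rewrite mulrC divfK.
  apply: (mulfI d).
  have -> : (x2 - x1) * ((y1 + y2) * ((y2 - y1) / (x2 - x1))) = y2 ^+ 2 - y1 ^+ 2 by field.
  by rewrite c1 c2; ring.
case: (alt_case (EC_infinity W) (fun h => EC_affine (sum_on_curve h1 h2 h)) (boolP _)) => [[op' _]|[n' ->] /=].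
  by case: (negP on op').
by split=> //; rewrite /sum_y /sum_x /=; ring.
Qed.

Lemma ec_addE l P Q : ~~ isO P -> ~~ isO Q -> ~~ ec_opposite P Q ->
  ec_line l P Q -> [/\ ~~ isO (ec_add P Q),
     Xc (ec_add P Q) = l ^+ 2 - Xc P - Xc Q &
     Yc (ec_add P Q) = - (l * Xc (ec_add P Q) + (Yc P - l * Xc P))].
Proof.
move=> hP hQ n h; have [l' [h' ? ? ?]] := ec_add_slope hP hQ n.
by have -> := ec_line_unique n h h'.
Qed.

(** Vieta's formulas for the cubic left after substituting y = l x + mu, whose third root is l^2 -
    x1 - x2. They present a and b as polynomials in x1, x2, l, mu, so that later identities are
    closed by [ring]. *)
Lemma line_vieta l P Q x1 x2 mu : ~~ isO P -> ~~ isO Q -> ~~ ec_opposite P Q ->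
  ec_line l P Q -> x1 = Xc P -> x2 = Xc Q -> mu = Yc P - l * Xc P ->
  [/\ a = x1 * x2 + (x1 + x2) * (l ^+ 2 - x1 - x2) + 2 * l * mu,
      b = mu ^+ 2 - x1 * x2 * (l ^+ 2 - x1 - x2), Yc P = l * x1 + mu &
      Yc Q = l * x2 + mu].
Proof.
move=> hP hQ n [h1 h2] ex1 ex2 emu.
have eP : Yc P = l * x1 + mu by rewrite emu ex1; ring.
have eQ : Yc Q = l * x2 + mu.
  have -> : Yc Q = (Yc Q - Yc P) + Yc P by ring.
  by rewrite -h1 eP ex1 ex2; ring.
have ea : a = x1 * x2 + (x1 + x2) * (l ^+ 2 - x1 - x2) + 2 * l * mu.
  have -> : a = (Xc P ^+ 2 + Xc P * Xc Q + Xc Q ^+ 2 + a) - (x1 ^+ 2 + x1 * x2 + x2 ^+ 2) by rewrite ex1 ex2; ring.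
  by rewrite -h2 eP eQ; ring.
split=> //.
have -> : b = (Xc P ^+ 3 + a * Xc P + b) - (x1 ^+ 3 + a * x1) by rewrite ex1; ring.
by rewrite -(short_curve hP) eP ea; ring.
Qed.

Lemma ec_addC P Q : ec_add P Q = ec_add Q P.
Proof.
case: (boolP (isO P)) => [/isO_eq->|hP]; first by rewrite ec_addO ec_0add.
case: (boolP (isO Q)) => [/isO_eq->|hQ]; first by rewrite ec_addO ec_0add.
case: (boolP (ec_opposite P Q)) => [op|n].
  by rewrite !ec_add_opposite// ec_oppositeC.
have [l [ll nO eX eY]] := ec_add_slope hP hQ n.
have n' : ~~ ec_opposite Q P by rewrite ec_oppositeC.
have [nO' eX' eY'] := ec_addE hQ hP n' (ec_lineC ll).
have eXX : Xc (ec_add P Q) = Xc (ec_add Q P) by rewrite eX eX'; ring.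
apply/ec_eqP; split=> //; first by rewrite (negPf nO) (negPf nO').
rewrite eY eY' eXX; have [_ _ _] := line_vieta hP hQ n ll erefl erefl erefl => ->.
by ring.
Qed.

Lemma ec_addN P : ec_add P (ec_opp P) = EC_infinity W.
Proof.
case: (boolP (isO P)) => [/isO_eq->|hP] //.
by apply: ec_add_opposite; rewrite ?isO_opp// /ec_opposite Xc_opp Yc_opp eqxx subrr eqxx.
Qed.

Lemma oppositeP P Q : ~~ isO P -> ~~ isO Q -> reflect (P = ec_opp Q) (ec_opposite P Q).
Proof.
move=> hP hQ; apply: (iffP andP) => [[/eqP eX eY]|->].
  apply/ec_eqP; rewrite isO_opp Xc_opp Yc_opp (negPf hP) (negPf hQ); split=> //.
  by apply/eqP; rewrite -addr_eq0.
by rewrite Xc_opp Yc_opp addNr !eqxx.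
Qed.

Lemma two_eq0 (y : F) : y + y = 0 -> y = 0.
Proof. by move/eqP; rewrite -mulr2n -mulr_natl mulf_eq0 (negPf two_neq0) => /eqP. Qed.

(** The line through P + Q and -Q is the mirror image, of slope -l, of the line through P and Q; its
    third intersection is therefore -P. *)
Lemma ec_addK P Q : ec_add (ec_add P Q) (ec_opp Q) = P.
Proof.
case: (boolP (isO P)) => [/isO_eq->|hP]; first by rewrite ec_0add ec_addN.
case: (boolP (isO Q)) => [/isO_eq->|hQ]; first by rewrite !ec_addO.
case: (boolP (ec_opposite P Q)) => [op|n].
  by rewrite (ec_add_opposite hP hQ op) ec_0add; apply/esym/oppositeP.
have [l [ll nO eX eY]] := ec_add_slope hP hQ n.
have hQ' : ~~ isO (ec_opp Q) by rewrite isO_opp.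
have := line_vieta hP hQ n ll erefl erefl erefl.
move: nO eX eY; set S := ec_add P Q; set mu := Yc P - l * Xc P.
move=> nO eX eY [ea eb yP yQ].
(* Otherwise P + Q = Q: the line through P and Q would meet the curve twice at Q and y(Q) would
   vanish, against [short_smooth]. *)
have nS : ~~ ec_opposite S (ec_opp Q).
  apply/negP => /andP[]; rewrite Xc_opp Yc_opp => /eqP e1 /eqP e2.
  have yQ0 : Yc Q = 0.
    apply: two_eq0; rewrite -[RHS]oppr0 -e2 eY e1 yQ; ring.
  have c := short_curve hQ; rewrite yQ0 expr0n /= in c.
  have /eqP := short_smooth (esym c); apply.
  have ee : l ^+ 2 - Xc P - Xc Q = Xc Q by rewrite -eX.
  have emu : mu = - (l * Xc Q) by apply/eqP; rewrite -addr_eq0 addrC -yQ yQ0.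
  apply: (eq_trans (congr1 (fun z => 3 * Xc Q ^+ 2 + z) ea)); rewrite emu.
  transitivity (2 * Xc Q * (Xc Q - (l ^+ 2 - Xc P - Xc Q)) + (Xc P + Xc Q) * (l ^+ 2 - Xc P - Xc Q - Xc Q)); first by ring.
  by rewrite ee !subrr !mulr0 addr0.
have lS : ec_line (- l) S (ec_opp Q).
  rewrite /ec_line Xc_opp Yc_opp eY yQ eX; split; first by ring.
  by rewrite [X in _ = _ + X]ea; ring.
have [nO' eX' eY'] := ec_addE nO hQ' nS lS.
have eXX : Xc (ec_add S (ec_opp Q)) = Xc P by rewrite eX' Xc_opp eX; ring.
apply/ec_eqP; split=> //; first by rewrite (negPf nO') (negPf hP).
by rewrite eY' eXX eY yP; ring.
Qed.

Lemma ec_add_inj P Q S : ec_add P S = ec_add Q S -> P = Q.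
Proof. by move=> e; rewrite -(ec_addK P S) e ec_addK. Qed.

(* The parabola y = p(x) through three points P1, P2, P3 of the curve meets the curve
   in a fourth point, the opposite of (P1 + P2) + P3; hence the symmetry in P1, P2, P3. *)
Lemma ec_parabola P1 P2 P3 al be ga :
  ~~ isO P1 -> ~~ isO P2 -> ~~ isO P3 ->
  Xc P1 != Xc P2 -> Xc P1 != Xc P3 -> Xc P2 != Xc P3 ->
  Xc (ec_add P1 P2) != Xc P3 ->
  Yc P1 = al * Xc P1 ^+ 2 + be * Xc P1 + ga ->
  Yc P2 = al * Xc P2 ^+ 2 + be * Xc P2 + ga ->
  Yc P3 = al * Xc P3 ^+ 2 + be * Xc P3 + ga ->
  let x4 := (al^-1 - 2 * be) / al - Xc P1 - Xc P2 - Xc P3 in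
  [/\ ~~ isO (ec_add (ec_add P1 P2) P3), Xc (ec_add (ec_add P1 P2) P3) = x4
    & Yc (ec_add (ec_add P1 P2) P3) = - (al * x4 ^+ 2 + be * x4 + ga)].
Proof.
move=> h1 h2 h3 x12 x13 x23 xT e1 e2 e3 x4.
have n12 : ~~ ec_opposite P1 P2 by rewrite /ec_opposite (negPf x12).
have [l [ll nO eX eY]] := ec_add_slope h1 h2 n12.
have := line_vieta h1 h2 n12 ll erefl erefl erefl.
move: nO eX eY xT; set S := ec_add P1 P2; set mu := Yc P1 - l * Xc P1.
move=> nO eX eY xT [ea eb y1 y2].
have n : ~~ ec_opposite S P3 by rewrite /ec_opposite (negPf xT).
have el : l = be + al * (Xc P1 + Xc P2).
  have d : Xc P2 - Xc P1 != 0 by rewrite subr_eq0 eq_sym.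
  by apply: (mulfI d); have [-> _] := ll; rewrite e1 e2; ring.
(* At x3 the parabola deviates from the line P1 P2 by al (x3 - x1)(x3 - x2), while the cubic minus
   the square of the line is (x3 - x1)(x3 - x2)(x3 - x_S). Comparing the two factorizations of y3^2
   - (l x3 + mu)^2 gives the equation. *)
have key : al * (Yc P3 + (l * Xc P3 + mu)) = Xc P3 - Xc S.
  have d1 : Xc P3 - Xc P1 != 0 by rewrite subr_eq0 eq_sym.
  have d2 : Xc P3 - Xc P2 != 0 by rewrite subr_eq0 eq_sym.
  apply: (mulfI d1); apply: (mulfI d2).
  have -> : (Xc P3 - Xc P2) * ((Xc P3 - Xc P1) * (al * (Yc P3 + (l * Xc P3 + mu)))) =
     (Yc P3 - (l * Xc P3 + mu)) * (Yc P3 + (l * Xc P3 + mu)).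
    have -> : Yc P3 - (l * Xc P3 + mu) = al * (Xc P3 - Xc P1) * (Xc P3 - Xc P2).
      by rewrite e3 /mu e1 el; ring.
    by ring.
  rewrite -subr_sqr (short_curve h3) [X in X * Xc P3]ea [X in _ + X - _]eb eX; ring.
have al0 : al != 0.
  apply: contra_neq xT => al0; apply/eqP; rewrite eq_sym -subr_eq0 -key al0 mul0r //.
pose m := al^-1 - l.
have lm : ec_line m S P3.
  have d : Xc P3 - Xc S != 0 by rewrite subr_eq0 eq_sym.
  have L1 : (Xc P3 - Xc S) * m = Yc P3 - Yc S.
    by rewrite /m mulrBr -[X in X / al]key eY; field.
  split=> //; apply: (mulfI d).
  have -> : (Xc P3 - Xc S) * ((Yc S + Yc P3) * m) = (Yc P3 ^+ 2 - Yc S ^+ 2).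
    by rewrite mulrCA L1; ring.
  by rewrite (short_curve h3) (short_curve nO); ring.
have [nO' eX' eY'] := ec_addE nO h3 n lm.
have eXX : Xc (ec_add S P3) = x4.
  rewrite eX' eX /x4 /m el; field.
  by [].
split=> //; rewrite eY' eXX.
have [L1 _] := lm.
have -> : Yc S = Yc P3 - (Xc P3 - Xc S) * m by rewrite L1; ring.
rewrite e3 /x4 /m el; field.
by [].
Qed.

Lemma ec_addA_generic P1 P2 P3 : ~~ isO P1 -> ~~ isO P2 -> ~~ isO P3 ->
  Xc P1 != Xc P2 -> Xc P1 != Xc P3 -> Xc P2 != Xc P3 ->
  Xc (ec_add P1 P2) != Xc P3 -> Xc (ec_add P2 P3) != Xc P1 ->
  ec_add (ec_add P1 P2) P3 = ec_add P1 (ec_add P2 P3).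
Proof.
move=> h1 h2 h3 x12 x13 x23 xT xT'.
(* Interpolation of the three points by Newton's divided differences. *)
pose al := ((Yc P3 - Yc P1) / (Xc P3 - Xc P1) - (Yc P2 - Yc P1) / (Xc P2 - Xc P1)) / (Xc P3 - Xc P2).
pose be := (Yc P2 - Yc P1) / (Xc P2 - Xc P1) - al * (Xc P1 + Xc P2).
pose ga := Yc P1 - al * Xc P1 ^+ 2 - be * Xc P1.
have d1 : Xc P2 - Xc P1 != 0 by rewrite subr_eq0 eq_sym.
have d2 : Xc P3 - Xc P1 != 0 by rewrite subr_eq0 eq_sym.
have d3 : Xc P3 - Xc P2 != 0 by rewrite subr_eq0 eq_sym.
have e1 : Yc P1 = al * Xc P1 ^+ 2 + be * Xc P1 + ga by rewrite /ga; ring.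
have e2 : Yc P2 = al * Xc P2 ^+ 2 + be * Xc P2 + ga by rewrite /ga /be; field.
have e3 : Yc P3 = al * Xc P3 ^+ 2 + be * Xc P3 + ga.
  by rewrite /ga /be /al; field; rewrite d1 d2 d3.
have [n eX eY] := ec_parabola h1 h2 h3 x12 x13 x23 xT e1 e2 e3.
have x21 : Xc P2 != Xc P1 by rewrite eq_sym.
have x31 : Xc P3 != Xc P1 by rewrite eq_sym.
have [n' eX' eY'] := ec_parabola h2 h3 h1 x23 x21 x31 xT' e2 e3 e1.
rewrite [RHS]ec_addC; apply/ec_eqP; split; first by rewrite (negPf n) (negPf n').
  by rewrite eX eX'; ring.
rewrite eY eY'; congr (- _).
have -> : (al^-1 - 2 * be) / al - Xc P1 - Xc P2 - Xc P3 = (al^-1 - 2 * be) / al - Xc P2 - Xc P3 - Xc P1 by ring.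
by [].
Qed.

End ShortCurve.

(** If the preimage of a neighbourhood of f x is not a neighbourhood of x, the neighbourhoods of x
    minus this preimage generate a filter, and an ultrafilter above it contradicts the
    hypothesis. *)
Lemma ultra_continuous_at {S T : topologicalType} (f : S -> T) (x : S) :
  (forall U : set_system S, ultra U -> U --> x -> f @ U --> f x) ->
  {for x, continuous f}.
Proof.
move=> h A Ax; apply: contrapT => nA.
pose G := [set B : set S | exists2 C, nbhs x C & C `&` ~` (f @^-1` A) `<=` B].
have PG : ProperFilter G.
  apply: Build_ProperFilter_ex.
    move=> B [C Cx CB]; apply: contrapT => nB; apply: nA; apply: filterS Cx => y Cy.
    by apply: contrapT => nAy; apply: nB; exists y; exact: CB.
  split; first by exists setT; [exact: filterT|].
    move=> B B' [C Cx CB] [C' Cx' CB']; exists (C `&` C'); first exact: filterI.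
    by move=> y [[Cy Cy'] ny]; split; [exact: CB | exact: CB'].
  by move=> B B' BB' [C Cx CB]; exists C => // y /CB/BB'.
have [U [uU GU]] := ultra_of_filter PG.
have Ux : U --> x by move=> C Cx; apply: GU; exists C => // y [].
have UA : U (f @^-1` A) by exact: (h U uU Ux).
have nUA : U (~` (f @^-1` A)) by apply: GU; exists setT; [exact: filterT|move=> y []].
by have [y [/= h1 h2]] := filter_ex (filterI UA nUA).
Qed.

(** If all neighbourhoods of p and q meet, their intersections generate a filter that converges to
    both. *)
Lemma hausdorff_cvg {T : topologicalType} :
  (forall (U : set_system T) (p q : T), ProperFilter U -> U --> p -> U --> q -> p = q) ->
  hausdorff_space T.
Proof.
move=> h p q pq.
pose G := [set B : set T | exists2 C, nbhs p C & exists2 D, nbhs q D & C `&` D `<=` B].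
apply: (h G).
- apply: Build_ProperFilter_ex.
    move=> B [C Cp [D Dq CD]]; have [y yCD] := pq C D Cp Dq.
    by exists y; exact: CD.
  split; first by exists setT; [exact: filterT|exists setT; [exact: filterT|]].
    move=> B B' [C Cx [D Dx CB]] [C' Cx' [D' Dx' CB']]; exists (C `&` C'); first exact: filterI.
    exists (D `&` D'); first exact: filterI.
    by move=> y [[Cy Cy'] [Dy Dy']]; split; [exact: CB | exact: CB'].
  by move=> B B' BB' [C Cx [D Dx CB]]; exists C => //; exists D => // y /CB/BB'.
- by move=> C Cp; exists C => //; exists setT; [exact: filterT|move=> y []].
- by move=> C Cp; exists setT; [exact: filterT|exists C => // y []].
Qed.

Lemma hausdorff_unique {T : topologicalType} (U : set_system T) (p q : T) :
  hausdorff_space T -> ProperFilter U -> U --> p -> U --> q -> p = q.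
Proof.
move=> hT PU Up Uq; apply: hT => A B Ap Bq.
by have [x xAB] := filter_ex (filterI (Up _ Ap : U A) (Uq _ Bq : U B)); exists x.
Qed.

(** * Compactness of the curve *)

Section CurveCompact.
Context {R : realType} {F : fieldType} (v : absvalue R F) (W : weierstrass F).
Notation E := (ec_point W).

Lemma econv_unique {T : Type} (U : set_system T) {FU : ProperFilter U} (f : T -> E) P Q :
  econv v U f P -> econv v U f Q -> P = Q.
Proof.
have key x y (h : on_curve W x y) : econv v U f (EC_affine h) ->
    econv v U f (EC_infinity W) -> False.
  move=> [h1 h2 _] h3; have [M hM] := vlim_bounded h2.
  have [t [[/= n1 n2] [|]]] := filter_ex (filterI (filterI h1 hM) (h3 M)).
    by move=> n3; move: n1; rewrite n3.
  by rewrite ltNge n2.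
case: P Q => [|x y h] [|x' y' h'] hP hQ //; [by case: (key _ _ h')|by case: (key _ _ h)|].
have [_ h2 h3] := hP; have [_ h2' h3'] := hQ.
by apply/ec_eqP; split=> //=; [exact: vlim_unique h2 h2' | exact: vlim_unique h3 h3'].
Qed.

Lemma econv_ext {T : Type} (U : set_system T) {FU : ProperFilter U} (f g : T -> E) P :
  U [set t | f t = g t] -> econv v U f P -> econv v U g P.
Proof.
case: P => [|x y h] fg.
  by move=> h M; apply: filterS2 fg (h M) => t /= ->.
move=> [h1 h2 h3]; split; first by apply: filterS2 fg h1 => t /= ->.
  by apply: vlim_ext h2; apply: filterS fg => t /= ->.
by apply: vlim_ext h3; apply: filterS fg => t /= ->.
Qed.

Lemma econv_cst {T : Type} (U : set_system T) {FU : ProperFilter U} (P : E) :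
  econv v U (fun=> P) P.
Proof.
case: P => [|x y h] /=; first by move=> M; apply: filterE => t; left.
by split; [exact: filterS filterT | exact: vlim_cst | exact: vlim_cst].
Qed.

Lemma ec_hausdorff : hausdorff_space (ec_space v W).
Proof.
by apply: hausdorff_cvg => U p q PU /cvg_econv h1 /cvg_econv h2; exact: econv_unique h1 h2.
Qed.

Local Notation a1 := (wa1 W).
Local Notation a2 := (wa2 W).
Local Notation a3 := (wa3 W).
Local Notation a4 := (wa4 W).
Local Notation a6 := (wa6 W).

(** For given x, the ordinate y is a root of a monic quadratic polynomial whose coefficients are
    bounded in terms of M. *)
Lemma curve_bounded (M : R) : exists N : R, forall x y : F,
  on_curve W x y -> v x <= M -> v y <= N.
Proof.
pose m := `|M|; have m0 : 0 <= m by exact: normr_ge0.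
exists (1 + (m ^+ 3 + v a2 * m ^+ 2 + v a4 * m + v a6) + (v a1 * m + v a3)) => x y /eqP xy xM.
have xm : v x <= m by exact: le_trans xM (ler_norm _).
set B := m ^+ 3 + _ + _ + _; set C := v a1 * m + _.
have B0 : 0 <= B by rewrite /B !addr_ge0 ?mulr_ge0 ?exprn_ge0 ?absv_ge0.
have C0 : 0 <= C by rewrite /C addr_ge0 ?mulr_ge0 ?absv_ge0.
have hB : v (x ^+ 3 + a2 * x ^+ 2 + a4 * x + a6) <= B.
  have p k : v x ^+ k <= m ^+ k by apply: lerXn2r; rewrite ?nnegrE ?absv_ge0.
  apply: le_trans (absvD _ _ _) _; rewrite lerD2r.
  apply: le_trans (absvD _ _ _) _; apply: lerD; last by rewrite absvM ler_wpM2l ?absv_ge0.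
  apply: le_trans (absvD _ _ _) _; rewrite absvM !absvX; apply: lerD => //.
  by rewrite ler_wpM2l ?absv_ge0.
have hC : v (a1 * x + a3) <= C.
  by apply: le_trans (absvD _ _ _) _; rewrite lerD2r absvM ler_wpM2l ?absv_ge0.
have [y1|y1] := lerP (v y) 1; first by apply: le_trans y1 _; lra.
have y0 : 0 < v y by exact: lt_trans y1.
have : v y * v y <= (B + C) * v y.
  have -> : v y * v y = v (y ^+ 2) by rewrite -absvM -expr2.
  have -> : y ^+ 2 = (x ^+ 3 + a2 * x ^+ 2 + a4 * x + a6) - (a1 * x + a3) * y by rewrite -xy; ring.
  apply: le_trans (absvB _ _ _) _; rewrite [leRHS]mulrDl absvM; apply: lerD.
    by apply: le_trans hB _; rewrite -[leLHS]mulr1 ler_wpM2l// ltW.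
  by rewrite ler_wpM2r// ltW.
rewrite ler_pM2r//; lra.
Qed.

Hypothesis LC : loc_compact v.

(** Along an ultrafilter either x stays bounded, and so does y, in which case both converge; or x
    exceeds every bound and the limit is O. *)
Lemma econv_ultra {T : Type} (U : set_system T) (f : T -> E) : ultra U ->
  exists P, econv v U f P.
Proof.
move=> uU; have [PU hU] := uU.
have [h|nO] := hU [set t | isO (f t)].
  by exists (EC_infinity W) => M; apply: filterS h => t /=; left.
have [[M hM]|nM] := pselect (exists M : R, U [set t | v (Xc (f t)) <= M]); last first.
  exists (EC_infinity W) => M; have [h|h] := hU [set t | v (Xc (f t)) <= M].
    by case: nM; exists M.
  by apply: filterS h => t /= /negP; rewrite -ltNge; right.
have [N hN] := curve_bounded M.
have [x0 hx] := lc_vlim LC uU (ex_intro _ M hM).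
have [y0 hy] : exists y0, vlim v U (fun t => Yc (f t)) y0.
  apply: lc_vlim => //; exists N; apply: filterS2 nO hM => t /= /negP n1 n2.
  exact: hN (on_curveE n1) n2.
have xy : on_curve W x0 y0.
  apply/eqP.
  pose proof (L := vlimD (vlimD (vlimX 2 hy) (vlimM (vlimM (vlim_cst v U a1) hx) hy)) (vlimM (vlim_cst v U a3) hy)).
  pose proof (L' := vlimD (vlimD (vlimD (vlimX 3 hx) (vlimM (vlim_cst v U a2) (vlimX 2 hx))) (vlimM (vlim_cst v U a4) hx)) (vlim_cst v U a6)).
  apply: vlim_unique L' => //; apply: vlim_ext L.
  by apply: filterS nO => t /= /negP/on_curveE/eqP.
exists (EC_affine xy); split=> //.
by apply: filterS nO => t /negP.
Qed.

Lemma ec_compact : compact [set: ec_space v W].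
Proof.
apply: ultra_cvg_compact => U uU _.
by have [P hP] := econv_ultra id uU; exists P => //; exact: (econv_cvg hP).
Qed.

End CurveCompact.

(** * Continuity of the sum *)

Section AddContinuous.
Context {R : realType} {F : fieldType} (v : absvalue R F) (a b : F).
Hypothesis two_neq0 : (2 : F) != 0.
Hypothesis smooth : 4 * a ^+ 3 + 27 * b ^+ 2 != 0.
Hypothesis LC : loc_compact v.
Notation W := (short_weierstrass a b).
Notation E := (ec_point W).

Context {T : Type} (U : set_system T) (uU : ultra U).
Let PU : ProperFilter U := proj1 uU.
Local Existing Instance PU.
Implicit Types (f g : T -> E) (P Q : E).

Lemma econv_affine f P : ~~ isO P -> econv v U f P <->
  [/\ U [set t | ~~ isO (f t)], vlim v U (fun t => Xc (f t)) (Xc P) & vlim v U (fun t => Yc (f t)) (Yc P)].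
Proof. by case: P. Qed.

Lemma econv_opp f P : econv v U f P -> econv v U (fun t => ec_opp (f t)) (ec_opp P).
Proof.
case: P => [|x y h].
  by move=> h M; apply: filterS (h M) => t /=; rewrite isO_opp Xc_opp.
move=> /econv_affine-/(_ isT)[h1 h2 h3]; apply/econv_affine => //; split.
- by apply: filterS h1 => t /=; rewrite isO_opp.
- by apply: vlim_ext h2; apply: filterE => t /=; rewrite Xc_opp.
- by apply: vlim_ext (vlimN h3); apply: filterE => t /=; rewrite Yc_opp.
Qed.

Lemma ec_line_chord P Q : ~~ isO P -> ~~ isO Q -> Xc P != Xc Q ->
  ec_line ((Yc Q - Yc P) / (Xc Q - Xc P)) P Q.
Proof.
move=> hP hQ x12; have d : Xc Q - Xc P != 0 by rewrite subr_eq0 eq_sym.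
split; first by rewrite mulrC divfK.
apply: (mulfI d).
have -> : (Xc Q - Xc P) * ((Yc P + Yc Q) * ((Yc Q - Yc P) / (Xc Q - Xc P))) = Yc Q ^+ 2 - Yc P ^+ 2 by field.
by rewrite (short_curve hP) (short_curve hQ); ring.
Qed.

Lemma ec_line_tangent P Q : ~~ isO P -> ~~ isO Q -> Yc P + Yc Q != 0 ->
  ec_line ((Xc P ^+ 2 + Xc P * Xc Q + Xc Q ^+ 2 + a) / (Yc P + Yc Q)) P Q.
Proof.
move=> hP hQ d; split; last by rewrite mulrC divfK.
apply: (mulfI d).
have -> : (Yc P + Yc Q) * (Yc Q - Yc P) = Yc Q ^+ 2 - Yc P ^+ 2 by ring.
rewrite (short_curve hP) (short_curve hQ).
have -> : (Yc P + Yc Q) * ((Xc Q - Xc P) * ((Xc P ^+ 2 + Xc P * Xc Q + Xc Q ^+ 2 + a) / (Yc P + Yc Q))) = (Xc Q - Xc P) * (Xc P ^+ 2 + Xc P * Xc Q + Xc Q ^+ 2 + a) by field.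
by ring.
Qed.

(** Away from opposite points one of the two formulas for the slope has a denominator with nonzero
    limit: the chord if the abscissas differ in the limit, the tangent form otherwise. *)
Lemma add_econv_generic f g P Q : ~~ isO P -> ~~ isO Q -> ~~ ec_opposite P Q ->
  econv v U f P -> econv v U g Q -> econv v U (fun t => ec_add (f t) (g t)) (ec_add P Q).
Proof.
move=> hP hQ n /(econv_affine _ hP)[f1 f2 f3] /(econv_affine _ hQ)[g1 g2 g3].
suff [l [l0 [hl L0 L]]] : exists l l0, [/\ vlim v U l l0, ec_line l0 P Q &
     U [set t | ec_line (l t) (f t) (g t) /\ ~~ ec_opposite (f t) (g t)]].
  have [nO eX eY] := ec_addE two_neq0 hP hQ n L0.
  apply/econv_affine => //; split.
  - apply: filterS3 f1 g1 L => t /= h1 h2 [h3 h4].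
    by have [] := ec_addE two_neq0 h1 h2 h4 h3.
  - rewrite eX; apply: vlim_ext (vlimB (vlimB (vlimX 2 hl) f2) g2).
    apply: filterS3 f1 g1 L => t /= h1 h2 [h3 h4].
    by have [_ -> _] := ec_addE two_neq0 h1 h2 h4 h3.
  - rewrite eY eX; apply: vlim_ext (vlimN (vlimD (vlimM hl (vlimB (vlimB (vlimX 2 hl) f2) g2)) (vlimB f3 (vlimM hl f2)))).
    apply: filterS3 f1 g1 L => t /= h1 h2 [h3 h4].
    by have [_ e1 e2] := ec_addE two_neq0 h1 h2 h4 h3; rewrite e2 e1.
have [eX|x12] := eqVneq (Xc P) (Xc Q); last first.
  have d : Xc Q - Xc P != 0 by rewrite subr_eq0 eq_sym.
  exists (fun t => (Yc (g t) - Yc (f t)) / (Xc (g t) - Xc (f t))), ((Yc Q - Yc P) / (Xc Q - Xc P)).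
  split; [exact: vlim_div (vlimB g3 f3) (vlimB g2 f2) d | exact: ec_line_chord |].
  apply: filterS3 f1 g1 (vlim_neq (vlimB g2 f2) d) => t /= h1 h2; rewrite subr_eq0 eq_sym => h3.
  by split; [exact: ec_line_chord | rewrite /ec_opposite (negPf h3)].
have d : Yc P + Yc Q != 0 by move: n; rewrite /ec_opposite eX eqxx.
exists (fun t => (Xc (f t) ^+ 2 + Xc (f t) * Xc (g t) + Xc (g t) ^+ 2 + a) / (Yc (f t) + Yc (g t))).
exists ((Xc P ^+ 2 + Xc P * Xc Q + Xc Q ^+ 2 + a) / (Yc P + Yc Q)).
split; last 1 first.
- apply: filterS3 f1 g1 (vlim_neq (vlimD f3 g3) d) => t /= h1 h2 h3.
  by split; [exact: ec_line_tangent | rewrite /ec_opposite (negPf h3) andbF].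
- apply: vlim_div d; last exact: vlimD.
  exact: vlimD (vlimD (vlimD (vlimX 2 f2) (vlimM f2 g2)) (vlimX 2 g2)) (vlim_cst v U a).
- exact: ec_line_tangent.
Qed.

Lemma vlim_quot_big (k m : T -> F) (m0 : F) (M : R) : vlim v U k 0 -> vlim v U m m0 ->
  m0 != 0 -> U [set t | forall l, k t * l = m t -> M < v l].
Proof.
move=> hk hm m00; have c0 : 0 < v m0 / 2 by rewrite divr_gt0 ?absv_gt0.
have e0 : 0 < v m0 / 2 / (`|M| + 1) by rewrite divr_gt0.
apply: filterS2 (hk _ e0) (vlim_neq0 hm m00) => t /=; rewrite subr0 => h1 h2 l hl.
apply: le_lt_trans (ler_norm M) _; apply: lt_le_trans (_ : `|M| + 1 <= _); first by rewrite ltrDl.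
rewrite leNgt; apply/negP => h3.
have : v (k t) * v l <= v m0 / 2 / (`|M| + 1) * (`|M| + 1).
  by apply: ler_pM; rewrite ?absv_ge0// ltW.
rewrite divfK ?lt0r_neq0// -absvM hl; lra.
Qed.

(** The slope l tends to infinity, and with it the abscissa l^2 - x1 - x2, since x1 and x2 stay
    bounded. *)
Lemma add_econv_opposite f g P : ~~ isO P ->
  econv v U f P -> econv v U g (ec_opp P) ->
  econv v U (fun t => ec_add (f t) (g t)) (EC_infinity W).
Proof.
move=> hP /(econv_affine _ hP)[f1 f2 f3].
have hP' : ~~ isO (ec_opp P) by rewrite isO_opp.
move=> /(econv_affine _ hP')[g1 g2 g3].
have big M : U [set t | forall l, ec_line l (f t) (g t) -> M < v l].
  (* At a point of order 2 the second equation of [ec_line] serves, its right-hand side tending to 3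
     x^2 + a; elsewhere the first, its right-hand side tending to -2 y. *)
  have [y0|y0] := eqVneq (Yc P) 0.
    pose proof (L := vlimD (vlimD (vlimD (vlimX 2 f2) (vlimM f2 g2)) (vlimX 2 g2)) (vlim_cst v U a)).
    pose proof (K := vlimD f3 g3); rewrite Yc_opp subrr in K.
    apply: filterS (vlim_quot_big M K L _) => [t /= h l [_ h1]|]; first exact: h.
    have c := short_curve hP; rewrite y0 expr0n /= in c.
    have := short_smooth smooth (esym c); rewrite Xc_opp.
    by congr (_ != 0); ring.
  pose proof (L := vlimB g3 f3); pose proof (K := vlimB g2 f2).
  rewrite Xc_opp subrr in K.
  apply: filterS (vlim_quot_big M K L _) => [t /= h l [h1 _]|]; first exact: h.
  rewrite Yc_opp -opprD oppr_eq0; apply: contra_neq y0; exact: two_eq0.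
move=> M; have [B [B0 hB]] := vboundedP (vboundedD (vlim_bounded f2) (vlim_bounded g2)).
apply: filterS3 (filterI f1 g1) (big (`|M| + B + 1)) hB => t /= [h1 h2] h3 h4.
case: (boolP (ec_opposite (f t) (g t))) => [op|n].
  by left; rewrite ec_add_opposite.
right; have [l [ll _ -> _]] := ec_add_slope two_neq0 h1 h2 n.
have := h3 l ll => hl.
have -> : l ^+ 2 - Xc (f t) - Xc (g t) = l ^+ 2 - (Xc (f t) + Xc (g t)) by ring.
have := absv_ge_dist v (l ^+ 2 - (Xc (f t) + Xc (g t))) (l ^+ 2).
have -> : l ^+ 2 - (Xc (f t) + Xc (g t)) - l ^+ 2 = - (Xc (f t) + Xc (g t)) by ring.
rewrite absvN absvX expr2.
have := ler_norm M; have := normr_ge0 M.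
have : v l <= v l * v l.
  rewrite -[leLHS]mulr1 ler_wpM2l ?absv_ge0//.
  by have := normr_ge0 M; lra.
lra.
Qed.

(** In the addition formula the terms of degree 3 in x1 cancel, which leaves a numerator of size
    O(|x1|^2) over (x2 - x1)^2. A bound is enough: it keeps f + g away from O, and [add_econv_inf]
    then identifies the limit. *)
Lemma add_x_bounded f g Q : ~~ isO Q ->
  U [set t | ~~ isO (f t)] -> econv v U f (EC_infinity W) -> econv v U g Q ->
  exists M, U [set t | ~~ isO (ec_add (f t) (g t)) /\ v (Xc (ec_add (f t) (g t))) <= M].
Proof.
move=> hQ f0 hf /(econv_affine _ hQ)[g1 g2 g3].
have [B [B0 hB]] := vboundedP (vlim_bounded g2).
have [C [C0 hC]] := vboundedP (vlim_bounded g3).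
have [A0 D0] := (absv_ge0 v a, absv_ge0 v b).
pose L := 1 + v a + v b.
exists (4 * ((B + v a) * (1 + B) + 2 * v b + 2 * (L * C))).
have f0' : U [set t | Num.max (2 * B + 1) 1 < v (Xc (f t))].
  by apply: filterS2 f0 (hf (Num.max (2 * B + 1) 1)) => t /= /negPf -> [].
apply: filterS3 (filterI f0 g1) (filterI hB hC) f0' => t /= [h1 h2] [h3 h4].
rewrite gt_max => /andP[h5 h6].
set x1 := Xc (f t) in h5 h6 *; set x2 := Xc (g t) in h3 *.
set y1 := Yc (f t); set y2 := Yc (g t) in h4.
have x12 : x1 != x2 by apply: contraTneq h5 => ->; rewrite -leNgt; lra.
have n : ~~ ec_opposite (f t) (g t) by rewrite /ec_opposite (negPf x12).
have [nO eX _] := ec_addE two_neq0 h1 h2 n (ec_line_chord h1 h2 x12).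
split=> //; rewrite eX -/x1 -/x2 -/y1 -/y2.
have d : x2 - x1 != 0 by rewrite subr_eq0 eq_sym.
have c1 : y1 ^+ 2 = x1 ^+ 3 + a * x1 + b by exact: short_curve.
have c2 : y2 ^+ 2 = x2 ^+ 3 + a * x2 + b by exact: short_curve.
have -> : ((y2 - y1) / (x2 - x1)) ^+ 2 - x1 - x2 =
   ((x1 * x2 + a) * (x1 + x2) + 2 * b - 2 * (y1 * y2)) / (x2 - x1) ^+ 2.
  have -> : ((y2 - y1) / (x2 - x1)) ^+ 2 - x1 - x2 =
    (y2 ^+ 2 + y1 ^+ 2 - 2 * (y1 * y2) - (x1 + x2) * (x2 - x1) ^+ 2) / (x2 - x1) ^+ 2 by field.
  by rewrite c1 c2; congr (_ / _); ring.
have X0 : 0 < v x1 by exact: lt_trans h6.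
have X1 : 1 <= v x1 by exact: ltW.
have dl : v x1 / 2 <= v (x2 - x1).
  have := absv_ge_dist v (x1 - x2) x1; have -> : x1 - x2 - x1 = - x2 by ring.
  rewrite absvN.  rewrite (absv_dist v x1); lra.
have hy : v y1 <= L * v x1 ^+ 2.
  have : v y1 ^+ 2 <= (L * v x1 ^+ 2) ^+ 2.
    rewrite -absvX c1; apply: le_trans (absvD _ _ _) _.
    apply: le_trans (lerD (absvD _ _ _) (lexx _)) _.
    rewrite absvM absvX.
    have X3 : 1 <= v x1 ^+ 3 by rewrite exprn_ege1.
    have e1 : v x1 <= v x1 ^+ 3 by rewrite -[leLHS]expr1 ler_eXn2l.
    apply: le_trans (_ : L * v x1 ^+ 3 <= _).
      rewrite /L 2!mulrDl mul1r; apply: lerD; last by rewrite -[leLHS]mulr1 ler_wpM2l.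
      by rewrite lerD2l ler_wpM2l.
    have L1 : 1 <= L by rewrite /L -addrA lerDl addr_ge0.
    rewrite exprMn -exprM; apply: ler_pM; rewrite ?exprn_ge0 ?absv_ge0//.
    - by rewrite (le_trans _ L1).
    - by rewrite expr2 -[leLHS]mulr1 ler_wpM2l// (le_trans _ L1).
    - by apply: ler_weXn2l.
  rewrite ler_sqr ?nnegrE ?absv_ge0// mulr_ge0 ?exprn_ge0 ?absv_ge0//.
  by rewrite /L !addr_ge0.
have num : v ((x1 * x2 + a) * (x1 + x2) + 2 * b - 2 * (y1 * y2)) <=
   ((B + v a) * (1 + B) + 2 * v b + 2 * (L * C)) * v x1 ^+ 2.
  have two x : v (2 * x) <= 2 * v x by rewrite absvM ler_wpM2r ?absv_ge0// absv_nat_le.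
  have X2 : 1 <= v x1 ^+ 2 by rewrite exprn_ege1.
  apply: le_trans (absvB _ _ _) _; rewrite [leRHS]mulrDl; apply: lerD; last first.
    apply: le_trans (two _) _; rewrite -mulrA ler_pM2l// absvM mulrAC ler_pM// ?absv_ge0//.
  apply: le_trans (absvD _ _ _) _; rewrite [leRHS]mulrDl; apply: lerD; last first.
    by apply: le_trans (two _) _; rewrite -[leLHS]mulr1 ler_wpM2l// mulr_ge0.
  rewrite absvM expr2 mulrACA; apply: ler_pM; rewrite ?absv_ge0//.
    apply: le_trans (absvD _ _ _) _; rewrite [leRHS]mulrDl absvM; apply: lerD.
      by rewrite mulrC ler_wpM2r ?absv_ge0.
    by rewrite -[leLHS]mulr1 ler_wpM2l.
  apply: le_trans (absvD _ _ _) _; rewrite [leRHS]mulrDl mul1r lerD2l.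
  apply: le_trans h3 _; by rewrite -[leLHS]mulr1 ler_wpM2l// ltW.
have dd : 0 < v (x2 - x1) ^+ 2 by rewrite exprn_gt0 ?absv_gt0.
rewrite absvM absvV absvX ler_pdivrMr//; apply: le_trans num _.
rewrite (mulrC 4) -mulrA ler_wpM2l//.
  by rewrite !addr_ge0 ?mulr_ge0 ?addr_ge0// ltW.
have : (v x1 / 2) ^+ 2 <= v (x2 - x1) ^+ 2.
  by rewrite ler_sqr ?nnegrE ?absv_ge0 ?divr_ge0 ?absv_ge0.
rewrite expr_div_n => hh.
have -> : v x1 ^+ 2 = 4 * (v x1 ^+ 2 / 2 ^+ 2) by field.
by rewrite ler_pM2l.
Qed.

Lemma add_econv_affine f g P Q : ~~ isO P -> ~~ isO Q ->
  econv v U f P -> econv v U g Q -> econv v U (fun t => ec_add (f t) (g t)) (ec_add P Q).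
Proof.
move=> hP hQ hf hg; case: (boolP (ec_opposite P Q)) => [op|n]; last exact: add_econv_generic.
rewrite ec_add_opposite//; apply: (@add_econv_opposite _ _ P) => //.
suff -> : ec_opp P = Q by [].
by apply/esym/oppositeP => //; rewrite ec_oppositeC.
Qed.

(** A limit S of f + g exists by compactness and is affine by [add_x_bounded]. Subtracting g, where
    continuity between affine points is known, gives S - Q = lim f = O. *)
Lemma add_econv_inf f g Q : ~~ isO Q ->
  econv v U f (EC_infinity W) -> econv v U g Q -> econv v U (fun t => ec_add (f t) (g t)) Q.
Proof.
move=> hQ hf hg; have [_ hU] := uU.
have [f0|f0] := hU [set t | isO (f t)].
  by apply: econv_ext hg; apply: filterS f0 => t /= /isO_eq ->.
have {}f0 : U [set t | ~~ isO (f t)] by apply: filterS f0 => t /negP.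
have [S hS] := econv_ultra LC (fun t => ec_add (f t) (g t)) uU.
case: (boolP (isO S)) => [/isO_eq eS|nS].
  have [M hM] := add_x_bounded hQ f0 hf hg; rewrite eS in hS.
  have [t [[n1 n2] [|]]] := filter_ex (filterI hM (hS M)).
    by rewrite (negPf n1).
  by rewrite ltNge n2.
suff <- : S = Q by [].
have hQ' : ~~ isO (ec_opp Q) by rewrite isO_opp.
have h := add_econv_affine nS hQ' hS (econv_opp hg).
have {}h : econv v U f (ec_add S (ec_opp Q)).
  by apply: econv_ext h; apply: filterE => t /=; rewrite ec_addK.
have e := econv_unique h hf.
by rewrite -[RHS]ec_0add -e -{2}(ec_oppK Q) ec_addK.
Qed.

Lemma add_econv f g P Q : econv v U f P -> econv v U g Q ->
  econv v U (fun t => ec_add (f t) (g t)) (ec_add P Q).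
Proof.
move=> hf hg; case: (boolP (isO P)) => [/isO_eq eP|hP]; case: (boolP (isO Q)) => [/isO_eq eQ|hQ].
(* If f and g tend to O and f + g to an affine point S, then f = (f + g) - g tends to S by the
   preceding case, which is absurd. *)
- subst P Q; have [S hS] := econv_ultra LC (fun t => ec_add (f t) (g t)) uU.
  case: (boolP (isO S)) => [/isO_eq eS|nS]; first by rewrite eS in hS.
  have h := add_econv_inf nS (econv_opp hg) hS.
  have {}h : econv v U f S.
    by apply: econv_ext h; apply: filterE => t /=; rewrite ec_addC// ec_addK.
  by have := econv_unique h hf => eS; rewrite eS in nS.
- by rewrite eP in hf *; rewrite ec_0add; exact: add_econv_inf.
- rewrite eQ in hg *; rewrite ec_addO.
  by apply: econv_ext (add_econv_inf hP hg hf); apply: filterE => t; exact: ec_addC.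
- exact: add_econv_affine.
Qed.

End AddContinuous.

(** * The coordinate z = -x/y near O *)

Section Chart.
Context {R : realType} {F : fieldType} (v : absvalue R F) (a b : F).
Hypothesis two_neq0 : (2 : F) != 0.
Hypothesis smooth : 4 * a ^+ 3 + 27 * b ^+ 2 != 0.
Notation W := (short_weierstrass a b).
Notation E := (ec_point W).
Implicit Types P Q : E.

Definition zc P : F := - (Xc P / Yc P).
Definition wc P : F := - (Yc P)^-1.

(** At a point of order 2 the convention 1/0 = 0 yields z = w = 0 as at O; the condition Yc P <> 0
    keeps such points out. *)
Definition nearO (d : R) P : Prop :=
  isO P \/ [/\ Yc P != 0, v (zc P) < d & v (wc P) < d].

Lemma zcO : zc (EC_infinity W) = 0. Proof. by rewrite /zc /= mul0r oppr0. Qed.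
Lemma wcO : wc (EC_infinity W) = 0. Proof. by rewrite /wc /= invr0 oppr0. Qed.
Lemma zc_opp P : zc (ec_opp P) = - zc P.
Proof. by rewrite /zc Xc_opp Yc_opp invrN mulrN. Qed.
Lemma wc_opp P : wc (ec_opp P) = - wc P.
Proof. by rewrite /wc Yc_opp invrN. Qed.

Lemma nearO_opp d P : nearO d P -> nearO d (ec_opp P).
Proof.
case=> [h|[h1 h2 h3]]; [by left; rewrite isO_opp | right].
split.
- by rewrite Yc_opp oppr_eq0.
- by rewrite zc_opp absvN.
- by rewrite wc_opp absvN.
Qed.

Lemma nearO_O d : nearO d (EC_infinity W). Proof. by left. Qed.

Lemma nearO_le d d' P : d <= d' -> nearO d P -> nearO d' P.
Proof.
by move=> dd [h|[h1 h2 h3]]; [left | right; split=> //; exact: lt_le_trans dd].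
Qed.

Lemma nearO_Y d P : nearO d P -> ~~ isO P -> Yc P != 0.
Proof. by case=> [->|[]]. Qed.

Lemma nearO_zw d P : 0 < d -> nearO d P -> v (zc P) < d /\ v (wc P) < d.
Proof. by move=> d0 [/isO_eq ->|[]//]; rewrite zcO wcO absv0. Qed.

Lemma zw_curve d P : nearO d P -> wc P = zc P ^+ 3 + a * zc P * wc P ^+ 2 + b * wc P ^+ 3.
Proof.
case: (boolP (isO P)) => [/isO_eq -> _|nO h].
  by rewrite zcO wcO !expr0n/= !mulr0 !addr0.
have y0 := nearO_Y h nO; have c := short_curve nO.
rewrite /zc /wc.
transitivity (- (Yc P ^+ 2 / Yc P ^+ 3)); first by field.
by rewrite c; field.
Qed.

Section Filters.
Context {T : Type} (U : set_system T) {FU : ProperFilter U}.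

Lemma econv_nearO (f : T -> E) : econv v U f (EC_infinity W) ->
  forall d, 0 < d -> U [set t | nearO d (f t)].
Proof.
move=> h d d0; have [N N0 hN] := @curve_far R F v W d^-1.
apply: filterS (h (Num.max N 1)) => t /= [|]; first by left.
rewrite gt_max => /andP[xN x1].
case: (boolP (isO (f t))) => [|nO]; [by left | right].
have := hN _ _ (on_curveE nO) xN; rewrite /zc /wc !absvN.
move: (Xc (f t)) (Yc (f t)) x1 => x y x1 s.
have y0 : y != 0.
  apply/eqP => y0; move: s; rewrite y0 mul0r absv0; apply/negP.
  by rewrite -leNgt invr_ge0 ltW.
have xy : v (x / y) < d.
  have -> : x / y = (y / x)^-1 by rewrite invf_div.
  by rewrite absvV -[d]invrK ltf_pV2// posrE ?invr_gt0// (lt_trans _ s)// invr_gt0.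
split=> //; apply: le_lt_trans xy.
by rewrite absvM -[leLHS]mul1r ler_wpM2r ?absv_ge0// ltW.
Qed.

End Filters.

(* The filter of neighbourhoods of (O, O), written in the coordinates z and w. *)
Definition near_pairs : set_system (E * E) :=
  [set S | exists2 d : R, 0 < d & forall P Q, nearO d P -> nearO d Q -> S (P, Q)].

Lemma near_pairs_filter : ProperFilter near_pairs.
Proof.
apply: Build_ProperFilter_ex.
  by move=> B [d d0 h]; exists (EC_infinity W, EC_infinity W); apply: h; exact: nearO_O.
split; first by exists 1.
  move=> A B [d d0 h] [d' d0' h']; exists (Num.min d d').
    by rewrite lt_min d0.
  move=> P Q hP hQ; split.
    by apply: h; [apply: nearO_le hP | apply: nearO_le hQ]; rewrite ge_min lexx.
  by apply: h'; [apply: nearO_le hP | apply: nearO_le hQ]; rewrite ge_min lexx orbT.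
by move=> A B AB [d d0 h]; exists d => // P Q hP hQ; apply: AB; exact: h.
Qed.
Local Existing Instance near_pairs_filter.

Lemma near_pairs_lim :
  [/\ vlim v near_pairs (fun t => zc t.1) 0, vlim v near_pairs (fun t => wc t.1) 0,
      vlim v near_pairs (fun t => zc t.2) 0 & vlim v near_pairs (fun t => wc t.2) 0].
Proof.
by split=> e e0; exists e => // P Q hP hQ /=; rewrite subr0;
  [have [] := nearO_zw e0 hP|have [] := nearO_zw e0 hP|have [] := nearO_zw e0 hQ|have [] := nearO_zw e0 hQ].
Qed.

Lemma near_pairs_near d : 0 < d -> near_pairs [set t | nearO d t.1 /\ nearO d t.2].
Proof. by move=> d0; exists d. Qed.

(** [lamN] / [lamD] is the slope of the chord in the (z, w)-plane, written so that it still makes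
    sense on the diagonal. Its numerator is quadratic in the coordinates and its denominator tends
    to 1. *)
Definition lamN (t : E * E) : F := zc t.1 ^+ 2 + zc t.1 * zc t.2 + zc t.2 ^+ 2 + a * wc t.1 ^+ 2.
Definition lamD (t : E * E) : F := 1 - a * zc t.2 * (wc t.1 + wc t.2)
   - b * (wc t.1 ^+ 2 + wc t.1 * wc t.2 + wc t.2 ^+ 2).

Lemma lamD_lim : vlim v near_pairs lamD 1.
Proof.
have [z1 w1 z2 w2] := near_pairs_lim.
pose proof (h := vlimB (vlimB (vlim_cst v near_pairs 1)
  (vlimM (vlimM (vlim_cst v near_pairs a) z2) (vlimD w1 w2)))
  (vlimM (vlim_cst v near_pairs b) (vlimD (vlimD (vlimX 2 w1) (vlimM w1 w2)) (vlimX 2 w2)))).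
by move: h; rewrite ?(expr0n, mulr0, addr0, subr0, mul0r).
Qed.

Lemma lamN_lim : vlim v near_pairs lamN 0.
Proof.
have [z1 w1 z2 w2] := near_pairs_lim.
pose proof (h := vlimD (vlimD (vlimD (vlimX 2 z1) (vlimM z1 z2)) (vlimX 2 z2))
  (vlimM (vlim_cst v near_pairs a) (vlimX 2 w1))).
by move: h; rewrite ?(expr0n, mulr0, addr0, subr0, mul0r).
Qed.

Lemma chord_zw d P Q : nearO d P -> nearO d Q ->
  (wc Q - wc P) * lamD (P, Q) = (zc Q - zc P) * lamN (P, Q).
Proof.
move=> /zw_curve hP /zw_curve hQ.
have -> : (wc Q - wc P) * lamD (P, Q) = (wc Q - (a * zc Q * wc Q ^+ 2 + b * wc Q ^+ 3))
  - (wc P - (a * zc P * wc P ^+ 2 + b * wc P ^+ 3)) + (zc Q - zc P) * (a * wc P ^+ 2) by rewrite /lamD /=; ring.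
have -> : wc Q - (a * zc Q * wc Q ^+ 2 + b * wc Q ^+ 3) = zc Q ^+ 3 by rewrite [X in X - _]hQ; ring.
have -> : wc P - (a * zc P * wc P ^+ 2 + b * wc P ^+ 3) = zc P ^+ 3 by rewrite [X in X - _]hP; ring.
rewrite /lamN /=; ring.
Qed.

(** In [chord_zw] the factor [lamD] does not vanish near O, so that z determines w there, and w
    determines y. *)
Lemma zc_inj : exists2 d : R, 0 < d & forall P Q, nearO d P -> nearO d Q -> zc P = zc Q -> P = Q.
Proof.
have [d d0 h] := vlim_neq lamD_lim (oner_neq0 _).
exists d => // P Q hP hQ e.
have := chord_zw hP hQ; rewrite e subrr mul0r => /eqP.
rewrite mulf_eq0 (negPf (h P Q hP hQ)) orbF subr_eq0 => /eqP eW.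
have eY : Yc P = Yc Q by apply: invr_inj; apply: oppr_inj.
case: (boolP (isO P)) => [OP|nP].
  case: (boolP (isO Q)) => [OQ|nQ]; first by rewrite (isO_eq OP) (isO_eq OQ).
  by have := nearO_Y hQ nQ; rewrite -eY (isO_eq OP) eqxx.
case: (boolP (isO Q)) => [OQ|nQ].
  by have := nearO_Y hP nP; rewrite eY (isO_eq OQ) eqxx.
apply/ec_eqP; rewrite (negPf nP) (negPf nQ) eY; split=> //.
have y0 := nearO_Y hQ nQ.
by apply: (divIf y0); apply: oppr_inj; rewrite -{1}eY.
Qed.

Lemma zc_eq0 : exists2 d : R, 0 < d & forall P, nearO d P -> zc P = 0 -> P = EC_infinity W.
Proof.
have [d d0 h] := zc_inj; exists d => // P hP e.
by apply: h; rewrite ?e ?zcO//; exact: nearO_O.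
Qed.

(** The equation reads w (1 - a z w - b w^2) = z^3, with a factor of absolute value at least 1/2
    near O. *)
Lemma wc_le : exists2 d : R, 0 < d & forall P, nearO d P -> v (wc P) <= v (zc P) /\ v (wc P) <= 2 * v (zc P) ^+ 3.
Proof.
have [z1 w1 z2 w2] := near_pairs_lim.
pose proof (h := vlimB (vlimB (vlim_cst v near_pairs 1)
  (vlimM (vlimM (vlim_cst v near_pairs a) z1) w1))
  (vlimM (vlim_cst v near_pairs b) (vlimX 2 w1))).
rewrite ?(expr0n, mulr0, addr0, subr0, mul0r) in h.
have [d d0 hd] := vlim_neq0 h (oner_neq0 _).
exists (Num.min d (1/2)); first by rewrite lt_min d0 divr_gt0.
move=> P hP.
have hPd : nearO d P by apply: nearO_le hP; rewrite ge_min lexx.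
have := hd P P hPd hPd; rewrite /= absv1 => h1.
have eq : wc P * (1 - a * zc P * wc P - b * wc P ^+ 2) = zc P ^+ 3.
  by rewrite {1}[LHS]mulrBr mulrBr mulr1 [X in X - _ - _](zw_curve hP); ring.
have := congr1 v eq; rewrite absvM absvX => e3.
have m0 : 0 < Num.min d (1/2) :> R by rewrite lt_min d0 divr_gt0.
have [hz hw] := nearO_zw m0 hP.
have z0 := absv_ge0 v (zc P); have w0 := absv_ge0 v (wc P).
have key : v (wc P) <= 2 * v (zc P) ^+ 3.
  have : v (wc P) * (1 / 2) <= v (zc P) ^+ 3 by rewrite -e3 ler_wpM2l// ltW.
  lra.
split=> //; apply: le_trans key _.
have z2' : v (zc P) <= 1 / 2 by apply: ltW; apply: lt_le_trans hz _; rewrite ge_min lexx orbT.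
have : v (zc P) ^+ 2 <= 1 / 2.
  by rewrite expr2; apply: le_trans (_ : 1 / 2 * 1 <= _); rewrite ?mulr1// ler_pM//; lra.
rewrite exprS => h2; have : v (zc P) * v (zc P) ^+ 2 <= v (zc P) * (1 / 2) by rewrite ler_wpM2l.
lra.
Qed.

(** As |w| <= 2 |z|^3, the abscissa x = z/w has absolute value at least 1 / (2 |z|^2). *)
Lemma nearO_econv {T : Type} (U : set_system T) {FU : ProperFilter U} (f : T -> E) :
  (forall d, 0 < d -> U [set t | nearO d (f t)]) -> econv v U f (EC_infinity W).
Proof.
move=> h M; have [d d0 hd] := wc_le.
pose e := Num.min d (Num.min 1 (1 / (2 * (`|M| + 1)))).
have M1 : 0 < `|M| + 1 by rewrite ltr_wpDl.
have M2 : 0 < 2 * (`|M| + 1) by rewrite mulr_gt0.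
have e0 : 0 < e by rewrite /e !lt_min d0 ltr01 divr_gt0.
apply: filterS (h e e0) => t /= ht.
case: (boolP (isO (f t))) => [|nO]; [by left | right].
have hd' : nearO d (f t) by apply: nearO_le ht; rewrite /e ge_min lexx.
have [_ hw] := hd _ hd'.
have y0 := nearO_Y ht nO.
have [hz _] := nearO_zw e0 ht.
have hz1 : v (zc (f t)) < 1 by apply: lt_le_trans hz _; rewrite /e !ge_min lexx orbT.
have hz2 : v (zc (f t)) < 1 / (2 * (`|M| + 1)) by apply: lt_le_trans hz _; rewrite /e !ge_min lexx !orbT.
have w0 : wc (f t) != 0 by rewrite /wc oppr_eq0 invr_eq0.
have eX : Xc (f t) * wc (f t) = zc (f t) by rewrite /wc /zc; ring.
have w0' := absv_gt0 v w0.
apply: le_lt_trans (ler_norm M) _; rewrite ltNge; apply/negP => XM.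
have := congr1 v eX; rewrite absvM => eX'.
set z := v (zc (f t)) in hw hz hz1 hz2 eX'; set w := v (wc (f t)) in hw w0' eX'.
have z0 : 0 < z.
  rewrite lt0r absv_ge0 andbT; apply/eqP => z0; move: hw w0'; rewrite z0 expr0n /= mulr0 => h1 h2.
  by have := lt_le_trans h2 h1; rewrite ltxx.
have h1 : z <= `|M| * w by rewrite -eX' ler_wpM2r// ltW.
have h2 : z <= `|M| * (2 * z ^+ 3) by apply: le_trans h1 _; rewrite ler_wpM2l.
have h3 : `|M| * (2 * z ^+ 3) = z * (z * (z * (2 * `|M|))) by ring.
have h4 : z * (2 * `|M|) < 1.
  apply: le_lt_trans (_ : z * (2 * (`|M| + 1)) < _); first by rewrite ler_pM2l//; lra.
  by rewrite -ltr_pdivlMr.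
have h5 : z * (z * (2 * `|M|)) < 1.
  apply: le_lt_trans (_ : 1 * (z * (2 * `|M|)) < _); last by rewrite mul1r.
  by apply: ler_wpM2r; [rewrite !mulr_ge0// ltW | exact: ltW].
have : z * (z * (z * (2 * `|M|))) < z * 1 by rewrite ltr_pM2l.
rewrite mulr1 -h3; lra.
Qed.

(** x1, x2, x3 are the abscissas of the intersections with the line y = l x + mu. The two values are
    the denominator and the numerator of the sum of the x_i / y_i, that is, of the sum of the
    z-coordinates up to sign. *)
Lemma zsum_identity (x1 x2 l mu A B : F) : let x3 := l ^+ 2 - x1 - x2 in
  A = x1 * x2 + (x1 + x2) * x3 + 2 * l * mu -> B = mu ^+ 2 - x1 * x2 * x3 ->
  (l * x1 + mu) * (l * x2 + mu) * (l * x3 + mu) = mu ^+ 3 + A * l ^+ 2 * mu - B * l ^+ 3 /\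
  x1 * ((l * x2 + mu) * (l * x3 + mu)) + x2 * ((l * x1 + mu) * (l * x3 + mu)) +
   x3 * ((l * x1 + mu) * (l * x2 + mu)) = 2 * A * l * mu - 3 * B * l ^+ 2.
Proof. by move=> x3 -> ->; rewrite /x3; split; ring. Qed.

Lemma zsum_fraction (x1 x2 x3 y1 y2 y3 : F) : y1 != 0 -> y2 != 0 -> y3 != 0 ->
  - (x3 / - y3) - - (x1 / y1) - - (x2 / y2) =
  (x1 * (y2 * y3) + x2 * (y1 * y3) + x3 * (y1 * y2)) / (y1 * y2 * y3).
Proof. by move=> h1 h2 h3; field; rewrite oppr_eq0 h1 h2 h3. Qed.

(** The factor la, the slope of the chord in the (z, w)-plane, is quadratic in the coordinates of P
    and Q; this is the origin of the quadratic error in [zc_quasi_hom]. *)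
Lemma zc_add_formula d P Q : nearO d P -> nearO d Q -> ~~ isO P -> ~~ isO Q ->
  ~~ ec_opposite P Q -> lamD (P, Q) != 0 ->
  let la := lamN (P, Q) / lamD (P, Q) in let nu := wc P - la * zc P in
  1 + a * la ^+ 2 + b * la ^+ 3 != 0 ->
  zc (ec_add P Q) - zc P - zc Q = la * (nu * (2 * a + 3 * b * la) / (1 + a * la ^+ 2 + b * la ^+ 3)).
Proof.
move=> hP hQ nP nQ nopp D0 la nu den.
have y1 := nearO_Y hP nP; have y2 := nearO_Y hQ nQ.
have eD : la * lamD (P, Q) = lamN (P, Q) by rewrite /la divfK.
have hw : wc Q - wc P = la * (zc Q - zc P).
  by apply: (mulIf D0); rewrite (chord_zw hP hQ) -eD; ring.
have eN1 : nu * Yc P = la * Xc P - 1 by rewrite /nu /wc /zc; field.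
have eN2 : nu * Yc Q = la * Xc Q - 1.
  have -> : nu = wc Q - la * zc Q.
    have -> : nu = wc Q - (wc Q - wc P) - la * zc P by rewrite /nu; ring.
    by rewrite hw; ring.
  by rewrite /wc /zc; field.
(* On the diagonal, la is the slope of the tangent. *)
have diag : P = Q -> la * (Yc P ^+ 2 - 2 * a * Xc P - 3 * b) = 3 * Xc P ^+ 2 + a.
  move=> e; have := eD; rewrite /lamD /lamN -e /= /zc /wc => e'.
  have -> : la * (Yc P ^+ 2 - 2 * a * Xc P - 3 * b) = Yc P ^+ 2 * (la * (1 - a * - (Xc P / Yc P) * (- (Yc P)^-1 - (Yc P)^-1) -
      b * ((- (Yc P)^-1) ^+ 2 + - (Yc P)^-1 * - (Yc P)^-1 + (- (Yc P)^-1) ^+ 2))) by field.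
  by rewrite e'; field.
have samex : Xc P = Xc Q -> P = Q.
  move=> e; apply/ec_eqP; rewrite (negPf nP) (negPf nQ); split=> //.
  exact: same_x.
have c1 := short_curve nP.
(* If nu = 0 the chord w = la z + nu passes through O, so P and Q have the same abscissa 1/la and
   are equal; the tangent condition then forces this abscissa to be 0, because the denominator [den]
   is not. *)
have nu0 : nu != 0.
  apply/eqP => nu0; have e1 : la * Xc P = 1.
    by apply/eqP; rewrite -subr_eq0 -eN1 nu0 mul0r.
  have e2 : la * Xc Q = 1 by apply/eqP; rewrite -subr_eq0 -eN2 nu0 mul0r.
  have la0 : la != 0 by apply/eqP => la0; move/eqP: e1; rewrite la0 mul0r eq_sym oner_eq0.
  have eX : Xc P = Xc Q by apply: (mulfI la0); rewrite e1 e2.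
  have := diag (samex eX); rewrite c1.
  have -> : la * (Xc P ^+ 3 + a * Xc P + b - 2 * a * Xc P - 3 * b) = (la * Xc P) * (Xc P ^+ 2 - a) - 2 * b * la by ring.
  rewrite e1 mul1r => /eqP; rewrite -subr_eq0.
  have -> : Xc P ^+ 2 - a - 2 * b * la - (3 * Xc P ^+ 2 + a) =
    - (2 * (Xc P ^+ 2 * (1 + a * la ^+ 2 + b * la ^+ 3) - a * ((la * Xc P) ^+ 2 - 1) - b * la * ((la * Xc P) ^+ 2 - 1))) by ring.
  rewrite e1 expr1n subrr !mulr0 !subr0 oppr_eq0 !mulf_eq0 (negPf two_neq0) (negPf den) orbF /=.
  rewrite orbb => /eqP x0; move/eqP: e1; rewrite x0 mulr0 eq_sym oner_eq0 //.
(* The line w = la z + nu, translated to the coordinates x and y. *)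
pose l := la / nu; pose mu := - nu^-1.
have yl1 : Yc P = l * Xc P + mu by apply: (mulfI nu0); rewrite eN1 /l /mu; field.
have yl2 : Yc Q = l * Xc Q + mu by apply: (mulfI nu0); rewrite eN2 /l /mu; field.
have ll : ec_line l P Q.
  have [eX|x12] := eqVneq (Xc P) (Xc Q); last first.
    suff -> : l = (Yc Q - Yc P) / (Xc Q - Xc P) by exact: ec_line_chord.
    by rewrite yl1 yl2; field; rewrite subr_eq0 eq_sym.
  have e := samex eX; split; first by rewrite yl1 yl2; ring.
  rewrite -e /l.
  have dg := diag e; rewrite c1 in dg.
  apply: (mulfI nu0).
  have -> : nu * ((Yc P + Yc P) * (la / nu)) = 2 * la * Yc P by field.
  apply: (mulIf y1).
  have -> : 2 * la * Yc P * Yc P = 2 * la * (Xc P ^+ 3 + a * Xc P + b) by rewrite -c1; ring.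
  have -> : nu * (Xc P ^+ 2 + Xc P * Xc P + Xc P ^+ 2 + a) * Yc P = (nu * Yc P) * (3 * Xc P ^+ 2 + a) by ring.
  rewrite eN1 mulrBl mul1r -{2}dg; ring.
have [nO eX eY] := ec_addE two_neq0 nP nQ nopp ll.
have [ea eb _ _] := line_vieta nP nQ nopp ll erefl erefl (erefl (Yc P - l * Xc P)).
have emu : Yc P - l * Xc P = mu by rewrite yl1; ring.
rewrite emu in ea eb eY.
have [id1 id2] := zsum_identity ea eb.
rewrite -eX -yl1 -yl2 in id1 id2.
have den' : mu ^+ 3 + a * l ^+ 2 * mu - b * l ^+ 3 = - (1 + a * la ^+ 2 + b * la ^+ 3) / nu ^+ 3.
  by rewrite /mu /l; field.
have y3 : l * Xc (ec_add P Q) + mu != 0.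
  apply/eqP => y3; move: id1; rewrite y3 mulr0 den' => /esym/eqP.
  by rewrite mulf_eq0 oppr_eq0 (negPf den) invr_eq0 expf_eq0/= (negPf nu0).
rewrite /zc eY.
rewrite zsum_fraction//.
rewrite id1 id2 den' /mu /l; field.
by rewrite oppr_eq0 nu0 den.
Qed.

Lemma zc_quasi_hom : exists2 d : R, 0 < d & exists2 C : R, 0 < C & forall P Q M,
  nearO d P -> nearO d Q -> v (zc P) <= M -> v (zc Q) <= M ->
  v (zc (ec_add P Q) - zc P - zc Q) <= C * M ^+ 2.
Proof.
have [d1 d10 hw] := wc_le.
have [z1 w1 z2 w2] := near_pairs_lim.
pose la t := lamN t / lamD t.
have hla : vlim v near_pairs la 0.
  by have := vlim_div lamN_lim lamD_lim (oner_neq0 _); rewrite mul0r; apply.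
pose proof (hnu := vlimB w1 (vlimM hla z1)).
rewrite mulr0 subr0 in hnu.
pose proof (hden := vlimD (vlimD (vlim_cst v near_pairs 1) (vlimM (vlim_cst v near_pairs a) (vlimX 2 hla)))
   (vlimM (vlim_cst v near_pairs b) (vlimX 3 hla))).
rewrite !expr0n /= !mulr0 !addr0 in hden.
pose proof (hc := vlim_div (vlimM hnu (vlimD (vlim_cst v near_pairs (2 * a)) (vlimM (vlim_cst v near_pairs (3 * b)) hla)))
  hden (oner_neq0 _)).
rewrite !mul0r in hc.
have [d d0 hd] : near_pairs [set t | [/\ lamD t != 0, 1 / 2 < v (lamD t),
     1 + a * la t ^+ 2 + b * la t ^+ 3 != 0,
     v ((wc t.1 - la t * zc t.1) * (2 * a + 3 * b * la t) / (1 + a * la t ^+ 2 + b * la t ^+ 3)) < 1 &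
     nearO d1 t.1 /\ nearO d1 t.2]].
  have h1 : near_pairs [set t | lamD t != 0] by exact: vlim_neq lamD_lim (oner_neq0 _).
  have h2 : near_pairs [set t | v 1 / 2 < v (lamD t)] by exact: vlim_neq0 lamD_lim (oner_neq0 _).
  have h3 : near_pairs [set t | 1 + a * la t ^+ 2 + b * la t ^+ 3 != 0] by exact: vlim_neq hden (oner_neq0 _).
  pose proof (hh := filterI (filterI h1 h2) (filterI h3 (filterI (hc 1 ltr01) (near_pairs_near d10)))).
  have [d d0 hd] := hh; exists d => // P Q hP hQ.
  have [[h4 h5] [h6 [h7 h8]]] := hd P Q hP hQ; move: h5 h7; rewrite /= subr0 absv1 => h5 h7.
  by split.
(* [lamN] is at most (3 + |a|) M^2, [lamD] at least 1/2, and the factor that multiplies la is less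
   than 1 near O. *)
exists d => //; exists (2 * (3 + v a) + 1); first by have := absv_ge0 v a; lra.
move=> P Q M hP hQ PM QM.
have M0 : 0 <= M by exact: le_trans (absv_ge0 v _) PM.
have pos : 0 <= (2 * (3 + v a) + 1) * M ^+ 2.
  by rewrite mulr_ge0 ?exprn_ge0//; have := absv_ge0 v a; lra.
case: (boolP (isO P)) => [/isO_eq ->|nP].
  by rewrite ec_0add zcO subr0 subrr absv0.
case: (boolP (isO Q)) => [/isO_eq ->|nQ].
  by rewrite ec_addO zcO subr0 subrr absv0.
case: (boolP (ec_opposite P Q)) => [op|n].
  have -> : Q = ec_opp P by apply/oppositeP => //; rewrite ec_oppositeC.
  rewrite ec_addN zcO zc_opp.
  have -> : 0 - zc P - - zc P = 0 by ring.
  by rewrite absv0.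
have [h1 h2 h3 h4 [h5 h6]] := hd P Q hP hQ.
rewrite (zc_add_formula hP hQ nP nQ n h1 h3) absvM -/(la (P, Q)).
have lM : v (la (P, Q)) <= (2 * (3 + v a)) * M ^+ 2.
  rewrite /la absvM absvV.
  have hN : v (lamN (P, Q)) <= (3 + v a) * M ^+ 2.
    have [wP _] := hw P h5; have wPM := le_trans wP PM.
    rewrite /lamN /= mulrDl; do 2?[apply: le_trans (absvD _ _ _) _].
    apply: lerD; last by rewrite absvM absvX ler_wpM2l ?absv_ge0// lerXn2r ?nnegrE ?absv_ge0.
    have -> : 3 * M ^+ 2 = M ^+ 2 + M * M + M ^+ 2 by ring.
    apply: le_trans (absvD _ _ _) _; apply: lerD; last by rewrite absvX lerXn2r ?nnegrE ?absv_ge0.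
    apply: le_trans (absvD _ _ _) _; apply: lerD; first by rewrite absvX lerXn2r ?nnegrE ?absv_ge0.
    by rewrite absvM ler_pM ?absv_ge0.
  have D2 : (v (lamD (P, Q)))^-1 <= 2.
    rewrite -[leRHS]invrK lef_pV2 ?posrE ?invr_gt0//; last by exact: lt_trans h2; lra.
    by move: h2; rewrite div1r => /ltW.
  apply: le_trans (_ : (3 + v a) * M ^+ 2 * 2 <= _); last by lra.
  by apply: ler_pM; rewrite ?invr_ge0 ?absv_ge0.
apply: le_trans (_ : v (la (P, Q)) * 1 <= _).
  by rewrite ler_wpM2l ?absv_ge0// ltW.
rewrite mulr1; apply: le_trans lM _; rewrite ler_wpM2r ?exprn_ge0//; lra.
Qed.

End Chart.

Lemma pow_small (R : realType) (q C e : R) : 0 <= q -> q < 1 -> 0 < e ->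
  exists N, forall k, (N <= k)%N -> C * q ^+ k < e.
Proof.
move=> q0 q1 e0; have C1 : 0 < `|C| + 1 by rewrite ltr_wpDl.
have : (fun n => q ^+ n) @ \oo --> (0 : R) by apply: cvg_expr; rewrite ger0_norm.
move=> /cvgrPdist_lt/(_ _ (divr_gt0 e0 C1)) [N _ h]; exists N => k Nk.
have := h k Nk; rewrite sub0r normrN ger0_norm ?exprn_ge0// ltr_pdivlMr// => hk.
apply: le_lt_trans hk; rewrite mulrC ler_wpM2l ?exprn_ge0//.
by apply: le_trans (ler_norm C) _; rewrite lerDl.
Qed.

Lemma half_pow_small (R : realType) (C e : R) : 0 < e -> exists N, forall k, (N <= k)%N -> C * (1 / 2) ^+ k < e.
Proof. by apply: pow_small; lra. Qed.

Definition nat_ultra (U : set_system nat) : Prop :=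
  ultra U /\ forall N, U [set n | (N <= n)%N].

(** * Associativity of the sum *)

Section Group.
Context {R : realType} {F : fieldType} (v : absvalue R F) (a b : F).
Hypothesis two_neq0 : (2 : F) != 0.
Hypothesis smooth : 4 * a ^+ 3 + 27 * b ^+ 2 != 0.
Hypothesis LC : loc_compact v.
Notation W := (short_weierstrass a b).
Notation E := (ec_point W).
Implicit Types P Q S : E.

(** w is found by iterating w -> z^3 + a z w^2 + b w^3 from 0. The hypothesis on z keeps the
    iterates in the ball of radius 2 |z|^3 and makes the map contract by 1/2 there. *)
Lemma chart_fixpoint (z : F) : v z <= 1 -> (4 * v a + 12 * v b) * v z <= 1 / 2 ->
  exists w : F, w = z ^+ 3 + a * z * w ^+ 2 + b * w ^+ 3 /\ v w <= 2 * v z ^+ 3.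
Proof.
move=> z1 zs; set r := v z; pose phi w := z ^+ 3 + a * z * w ^+ 2 + b * w ^+ 3.
pose s := fix s k := if k is k'.+1 then phi (s k') else 0.
have [A0 B0 r0] := And3 (absv_ge0 v a) (absv_ge0 v b) (absv_ge0 v z).
rewrite -/r in z1 zs r0 *.
have r3 : 0 <= r ^+ 3 by rewrite exprn_ge0.
have r31 : r ^+ 3 <= r by rewrite exprS -[leRHS]mulr1 ler_wpM2l// exprn_ile1.
have zs1 : 4 * (v a * r) + 12 * (v b * r) <= 1 / 2 by move: zs; rewrite mulrDl !mulrA.
have ar0 : 0 <= v a * r by rewrite mulr_ge0.
have br0 : 0 <= v b * r by rewrite mulr_ge0.
have inv k : v (s k) <= 2 * r ^+ 3.
  elim: k => [|k IH] /=; first by rewrite absv0 mulr_ge0.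
  have w0 := absv_ge0 v (s k).
  have sq : v (s k) ^+ 2 <= 4 * r ^+ 3.
    apply: le_trans (_ : (2 * r ^+ 3) ^+ 2 <= _); first by rewrite lerXn2r ?nnegrE// mulr_ge0.
    have : r ^+ 3 * r ^+ 3 <= r ^+ 3 * 1 by rewrite ler_wpM2l// (le_trans r31).
    lra.
  have s1 : v (s k) <= 2 * r by apply: le_trans IH _; rewrite ler_pM2l.
  apply: le_trans (absvD _ _ _) _; rewrite absvM absvX.
  apply: le_trans (lerD (absvD _ _ _) (lexx _)) _; rewrite absvX absvM absvM absvX -/r.
  have t1 : v a * r * v (s k) ^+ 2 <= v a * r * (4 * r ^+ 3) by rewrite ler_wpM2l.
  have t2 : v b * v (s k) ^+ 3 <= v b * (8 * (r * r ^+ 3)).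
    rewrite ler_wpM2l// exprS; have -> : 8 * (r * r ^+ 3) = (2 * r) * (4 * r ^+ 3) by ring.
    by rewrite ler_pM// exprn_ge0.
  have : (4 * (v a * r) + 8 * (v b * r)) * r ^+ 3 <= 1 * r ^+ 3 by rewrite ler_wpM2r//; lra.
  have -> : (4 * (v a * r) + 8 * (v b * r)) * r ^+ 3 = v a * r * (4 * r ^+ 3) + v b * (8 * (r * r ^+ 3)) by ring.
  lra.
have half k : v (s k.+1 - s k) <= 2 * (1 / 2) ^+ k.
  elim: k => [|k IH]; first by rewrite subr0 expr0 mulr1; apply: le_trans (inv 1) _; lra.
  have -> : s k.+2 - s k.+1 = (s k.+1 - s k) * (a * z * (s k.+1 + s k) + b * (s k.+1 ^+ 2 + s k.+1 * s k + s k ^+ 2)).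
    by rewrite -[s k.+2]/(phi (s k.+1)) -[X in _ - X = _]/(phi (s k)) /phi; ring.
  rewrite absvM [X in _ <= 2 * X]exprSr [leRHS]mulrA; apply: ler_pM; rewrite ?absv_ge0//.
  have i1 := inv k.+1; have i0 := inv k; have p1 := absv_ge0 v (s k.+1); have p0 := absv_ge0 v (s k).
  have r2 : 2 * r ^+ 3 <= 2 * r by rewrite ler_pM2l.
  have q1 : v (s k.+1 + s k) <= 4 by apply: le_trans (absvD _ _ _) _; lra.
  have q2 : v (s k.+1 ^+ 2 + s k.+1 * s k + s k ^+ 2) <= 12 * r.
    apply: le_trans (absvD _ _ _) _; apply: le_trans (lerD (absvD _ _ _) (lexx _)) _.
    rewrite absvM !absvX !expr2.
    have m x y : 0 <= x -> 0 <= y -> x <= 2 * r ^+ 3 -> y <= 2 * r ^+ 3 -> x * y <= 4 * r.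
      move=> x0 y0 hx hy; have -> : 4 * r = (2 * r) * 2 by ring.
      by apply: ler_pM => //; lra.
    by have := m _ _ p1 p1 i1 i1; have := m _ _ p1 p0 i1 i0; have := m _ _ p0 p0 i0 i0; lra.
  apply: le_trans (absvD _ _ _) _; rewrite !absvM -/r.
  have t1 : v a * r * v (s k.+1 + s k) <= v a * r * 4 by rewrite ler_wpM2l.
  have t2 : v b * v (s k.+1 ^+ 2 + s k.+1 * s k + s k ^+ 2) <= v b * (12 * r) by rewrite ler_wpM2l.
  lra.
have [U [uU Un]] := ultra_nat.
have [w hw] : exists w, vlim v U s w.
  by apply: lc_vlim => //; exists (2 * r ^+ 3); apply: filterE => k /=; exact: inv.
have hd : vlim v U (fun k => phi (s k) - s k) 0.
  move=> e e0; have [N hN] := @half_pow_small R 2 e e0.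
  apply: filterS (Un N) => k Nk /=; rewrite subr0.
  by apply: le_lt_trans (half k) _; exact: hN.
pose proof (hp := vlimD (vlimD (vlim_cst v U (z ^+ 3)) (vlimM (vlim_cst v U (a * z)) (vlimX 2 hw)))
   (vlimM (vlim_cst v U b) (vlimX 3 hw))).
exists w; split.
  have e : phi w - w = 0 by apply: vlim_unique hd; exact: vlimB hp hw.
  by apply/esym/eqP; rewrite -subr_eq0 e.
by apply: vlim_absv_le hw _; apply: filterE => k /=; exact: inv.
Qed.

Lemma chart_surj (d : R) : 0 < d -> exists2 e : R, 0 < e &
  forall z, v z < e -> exists2 P : E, zc P = z & nearO v d P.
Proof.
move=> d0; pose K := 4 * v a + 12 * v b.
have K0 : 0 <= K by rewrite addr_ge0// mulr_ge0// absv_ge0.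
have K1 : 0 < 2 * (K + 1) by lra.
exists (Num.min (d / 2) (Num.min 1 (1 / (2 * (K + 1))))).
  by rewrite !lt_min ltr01 !divr_gt0.
move=> z; rewrite !lt_min => /andP[zd /andP[z1 zK]].
have [->|z0] := eqVneq z 0.
  by exists (EC_infinity W); [exact: zcO | exact: nearO_O].
have r0 := absv_ge0 v z.
have zs : K * v z <= 1 / 2.
  move: zK; rewrite ltr_pdivlMr// => h.
  have : K * v z <= (K + 1) * v z by rewrite ler_wpM2r//; lra.
  lra.
have [w [hw wle]] := chart_fixpoint (ltW z1) zs.
have w0 : w != 0.
  apply: contra_neq z0 => w0; move/eqP: hw; rewrite w0 !expr0n /= !mulr0 !addr0.
  by rewrite eq_sym expf_eq0 => /eqP.
have oc : on_curve W (z / w) (- w^-1).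
  rewrite short_on_curveE sqrrN; apply/eqP.
  have -> : w^-1 ^+ 2 = w / w ^+ 3 by field.
  by rewrite {1}hw; field.
have ez : zc (EC_affine oc) = z by rewrite /zc /= invrN invrK mulrN opprK divfK.
exists (EC_affine oc) => //.
right; rewrite /= oppr_eq0 invr_eq0 w0; split=> //.
  by rewrite ez; apply: lt_le_trans zd _; lra.
have -> : wc (EC_affine oc) = w by rewrite /wc /= invrN invrK opprK.
apply: le_lt_trans wle _; apply: le_lt_trans (_ : 2 * v z < _); last by lra.
rewrite ler_pM2l// exprS -[leRHS]mulr1 ler_wpM2l// exprn_ile1// ltW//.
Qed.

Hypothesis nontriv : exists2 pi : F, pi != 0 & v pi < 1.

(** The points of coordinate z = pi^(k + N), with N large enough for [chart_surj] to apply. *)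
Lemma O_not_isolated : exists2 A : nat -> E, injective A &
  forall U, nat_ultra U -> econv v U A (EC_infinity W).
Proof.
have [pi pi0 pi1] := nontriv; have pp := absv_gt0 v pi0.
have [d d0 hd] := @wc_le R F v a b.
have [e e0 he] := chart_surj d0.
have [N hN] := pow_small 1 (ltW pp) pi1 e0.
have hz k : v (pi ^+ (k + N)) < e by rewrite absvX -[X in X < _]mul1r hN// leq_addl.
have ex k : exists P : E, zc P = pi ^+ (k + N) /\ nearO v d P.
  by have [P h1 h2] := he _ (hz k); exists P.
have [A hA] := choice ex.
exists A.
  move=> k k' e'; have [h1 _] := hA k; have [h2 _] := hA k'.
  have : v pi ^+ (k + N) = v pi ^+ (k' + N) by rewrite -!absvX -h1 -h2 e'.
  wlog kk : k k' e' h1 h2 / (k <= k')%N.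
    by move=> w; case: (leqP k k') => [|/ltnW] kk h; [apply: w|apply/esym; apply: w].
  move=> h; apply/eqP; rewrite eqn_leq kk /= leqNgt; apply/negP => lt.
  have : v pi ^+ (k' + N) < v pi ^+ (k + N) by rewrite ltr_iXn2l// ltn_add2r.
  by rewrite h ltxx.
move=> U [uU Un].
apply: nearO_econv => // d' d'0.
have [N' hN'] := pow_small 1 (ltW pp) pi1 d'0.
apply: filterS (Un N') => k Nk /=; have [h1 h2] := hA k.
have [h3 _] := hd _ h2.
have hz' : v (zc (A k)) < d' by rewrite h1 absvX -[X in X < _]mul1r hN'// (leq_trans Nk)// leq_addr.
case: (boolP (isO (A k))) => [|nO]; [by left | right].
by split=> //; [exact: nearO_Y h2 nO | exact: le_lt_trans h3 hz'].
Qed.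

(** At most two points share an abscissa, so the ultrafilter would concentrate on a single point,
    which an injective sequence takes only once. *)
Lemma injective_not_in (A : nat -> E) (U : set_system nat) (cs : seq F) :
  injective A -> nat_ultra U ->
  ~ U [set k | isO (A k) \/ Xc (A k) \in cs].
Proof.
move=> Ai [uU Un] h.
have no S : ~ U [set k | A k = S].
  move=> hS; have [k hk] := filter_ex hS.
  have [k' [/= h1 h2]] := filter_ex (filterI hS (Un k.+1)).
  by have e := Ai k k' (etrans hk (esym h1)); move: h2; rewrite e ltnn.
case: (ultraU uU h) => [h1|h1].
  by apply: (no (EC_infinity W)); apply: filterS h1 => k /= /isO_eq.
have h2 : U [set k | exists2 c, c \in cs & Xc (A k) = c /\ ~~ isO (A k)].
  have nO : U [set k | ~ isO (A k)].
    case: (proj2 uU [set k | isO (A k)]) => // h3.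
    by case: (no (EC_infinity W)); apply: filterS h3 => k /= /isO_eq.
  by apply: filterS2 h1 nO => k /= hc /negP hO; exists (Xc (A k)).
have [c _ hc] := ultra_bigU uU h2.
have [m [/= m1 m2]] := filter_ex hc.
have : U ([set k | A k = A m] `|` [set k | A k = ec_opp (A m)]).
  apply: filterS hc => k /= [k1 k2].
  have e : Xc (A k) = Xc (A m) by rewrite k1 m1.
  case: (boolP (ec_opposite (A k) (A m))) => [/(oppositeP k2 m2)|n]; [by right | left].
  apply/ec_eqP; rewrite (negPf k2) (negPf m2); split=> //; exact: same_x n.
by case/(ultraU uU); exact: no.
Qed.

Definition ec_seq_cont (f : E -> E) : Prop :=
  forall (U : set_system nat) (s : nat -> E) P, ultra U -> econv v U s P ->
    econv v U (fun k => f (s k)) (f P).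

(* Translates of points tending to O avoid any finite set of abscissas. This lets the associativity
   of the sum in general position be extended by continuity. *)
Lemma ec_eq_generic (f g : E -> E) (cs : seq F) : ec_seq_cont f -> ec_seq_cont g ->
  (forall P, ~~ isO P -> Xc P \notin cs -> f P = g P) -> forall P, f P = g P.
Proof.
move=> cf cg fg P; have [A Ai hA] := O_not_isolated.
have [U nU] : exists U, nat_ultra U by have [U []] := ultra_nat; exists U.
have [uU Un] := nU; have [PU hU] := uU.
pose s k := ec_add P (A k).
have si : injective s.
  by move=> k k' e; apply: Ai; apply: (@ec_add_inj _ a b two_neq0 smooth _ _ P);
     rewrite !(ec_addC two_neq0 _ P).
have hs : econv v U s P.
  have hP : econv v U (fun=> P) P by exact: econv_cst.
  have := add_econv two_neq0 smooth LC uU hP (hA U nU).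
  by rewrite ec_addO.
apply: (econv_unique (cf U s P uU hs)).
apply: econv_ext (cg U s P uU hs).
case: (hU [set k | isO (s k) \/ Xc (s k) \in cs]) => h.
  by case: (injective_not_in si nU h).
apply: filterS h => k /= /not_orP[/negP h1 /negP h2].
by rewrite fg.
Qed.

Lemma ec_seq_cont_id : ec_seq_cont id. Proof. by move=> U s P. Qed.

Lemma ec_seq_cont_cst Q : ec_seq_cont (fun=> Q).
Proof. by move=> U s P [PU _] _; exact: econv_cst. Qed.

Lemma ec_seq_cont_add f g : ec_seq_cont f -> ec_seq_cont g ->
  ec_seq_cont (fun P => ec_add (f P) (g P)).
Proof. by move=> cf cg U s P uU hs; apply: add_econv => //; [exact: cf | exact: cg]. Qed.

Lemma ec_addA P1 P2 P3 : ec_add (ec_add P1 P2) P3 = ec_add P1 (ec_add P2 P3).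
Proof.
have [cI cC cA] := And3 ec_seq_cont_id ec_seq_cont_cst ec_seq_cont_add.
move: P1; apply: (@ec_eq_generic (fun P1 => ec_add (ec_add P1 P2) P3) (fun P1 => ec_add P1 (ec_add P2 P3)) [::]).
- exact: cA (cA _ _ cI (cC P2)) (cC P3).
- exact: cA _ _ cI (cC _).
move=> P1 h1 _; move: P2.
apply: (@ec_eq_generic (fun P2 => ec_add (ec_add P1 P2) P3) (fun P2 => ec_add P1 (ec_add P2 P3)) [:: Xc P1]).
- exact: cA (cA _ _ (cC P1) cI) (cC P3).
- exact: cA _ _ (cC P1) (cA _ _ cI (cC P3)).
move=> P2 h2; rewrite inE eq_sym => x12; move: P3.
(* [D] inverts the addition of P2: avoiding the abscissas of D P1, D (-P1) and D O prevents P2 + P3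
   from being P1, -P1 or O, as [ec_addA_generic] requires. *)
pose D P := ec_add P (ec_opp P2).
apply: (@ec_eq_generic (fun P3 => ec_add (ec_add P1 P2) P3) (fun P3 => ec_add P1 (ec_add P2 P3))
  [:: Xc P1; Xc P2; Xc (ec_add P1 P2); Xc (D P1); Xc (D (ec_opp P1)); Xc (D (EC_infinity W))]).
- exact: cA _ _ (cC _) cI.
- exact: cA _ _ (cC P1) (cA _ _ (cC P2) cI).
move=> P3 h3; rewrite !inE !negb_or => /and5P[x31 x32 x3T x3D1 /andP[x3D2 x3D3]].
have eD : P3 = D (ec_add P2 P3) by rewrite /D (ec_addC two_neq0 P2) ec_addK.
apply: ec_addA_generic => //; try by rewrite eq_sym.
case: (boolP (isO (ec_add P2 P3))) => [/isO_eq e|nO].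
  by move: x3D3; rewrite -e -eD eqxx.
apply/eqP => e; case: (boolP (ec_opposite (ec_add P2 P3) P1)) => [/(oppositeP nO h1) e'|n].
  by move: x3D2; rewrite -e' -eD eqxx.
have e' : ec_add P2 P3 = P1.
  apply/ec_eqP; rewrite (negPf nO) (negPf h1); split=> //; exact: same_x n.
by move: x3D1; rewrite -e' -eD eqxx.
Qed.

End Group.

(** * Topological abelian groups, their products and isomorphisms *)

Record tabgroup (G : topGroupLaw) : Prop := TabGroup {
  tab_addA : associative (fun x y : G => x + y);
  tab_addC : commutative (fun x y : G => x + y);
  tab_add0 : left_id (0 : G) (fun x y : G => x + y);
  tab_opp : exists2 o : G -> G, continuous o & forall x : G, o x + x = 0;
  tab_cont : forall (T : Type) (U : set_system T) (f g : T -> G) (x y : G),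
    ultra U -> f @ U --> x -> g @ U --> y -> (fun t => f t + g t) @ U --> x + y }.

Section ShortGroup.
Context {R : realType} {F : fieldType} (v : absvalue R F) (a b : F).
Hypothesis two_neq0 : (2 : F) != 0.
Hypothesis smooth : 4 * a ^+ 3 + 27 * b ^+ 2 != 0.
Hypothesis LC : loc_compact v.
Hypothesis nontriv : exists2 pi : F, pi != 0 & v pi < 1.

Lemma short_tabgroup : tabgroup (ec_group v (short_weierstrass a b)).
Proof.
split.
- by move=> x y z; apply/esym; exact: ec_addA two_neq0 smooth LC nontriv x y z.
- by move=> x y; exact: ec_addC.
- by move=> x; exact: ec_0add.
- exists (@ec_opp F a b); last by move=> x; rewrite /GRing.add/= ec_addC// ec_addN.
  move=> x; apply: ultra_continuous_at => U uU Ux.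
  apply: econv_cvg; apply: (@econv_opp R F v a b _ U uU id).
  exact: cvg_econv.
- move=> T U f g x y uU fx gy; apply: econv_cvg.
  apply: add_econv => //; exact: cvg_econv.
Qed.

End ShortGroup.

Lemma cvg_comp_at {T : Type} {X Y : topologicalType} (U : set_system T) (f : T -> X)
    (g : X -> Y) (x : X) : {for x, continuous g} -> f @ U --> x -> (fun t => g (f t)) @ U --> g x.
Proof. by move=> gx fx A Ax; exact: (fx _ (gx _ Ax)). Qed.

Lemma cvg_eqfun {T : Type} {X : topologicalType} (U : set_system T) (f g : T -> X) (x : X) :
  (forall t, f t = g t) -> f @ U --> x -> g @ U --> x.
Proof. by move=> /funext ->. Qed.

Lemma prod_cvg {T I : Type} (K : I -> topologicalType) (U : set_system T)
    {FU : Filter U} (f : T -> prod_topology K) (x : prod_topology K) :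
  (forall i, (fun t => f t i) @ U --> x i) -> f @ U --> x.
Proof.
move=> h; apply/cvg_sup => i A [B [[C oC <-] Cx] BA].
have hU : U ((fun t => f t i) @^-1` C) by apply: (h i); exact: open_nbhs_nbhs.
change (U (f @^-1` A)).
by apply: filterS hU => t Ct; exact: BA.
Qed.

Lemma proj_nbhs {I : Type} (K : I -> topologicalType) (x : prod_topology K) i A :
  nbhs (x i) A -> nbhs x [set y : prod_topology K | A (y i)].
Proof.
move=> h; have /cvg_sup/(_ i) c : nbhs x --> x by [].
by have := c _ (@initial_continuous _ _ (fun y : prod_topology K => y i) x _ h).
Qed.

Lemma proj_cvg {T I : Type} (K : I -> topologicalType) (U : set_system T)
    (f : T -> prod_topology K) (x : prod_topology K) (i : I) :
  f @ U --> x -> (fun t => f t i) @ U --> x i.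
Proof. by move=> fx A Ax; exact: (fx _ (proj_nbhs Ax)). Qed.

Lemma bprod_cvg {T I : Type} (G : I -> topGroupLaw) (U : set_system T)
    {FU : Filter U} (f : T -> bigprod_group G) (x : bigprod_group G) :
  (forall i, (fun t => f t i) @ U --> x i) -> f @ U --> x.
Proof. exact: prod_cvg. Qed.

Lemma bproj_cvg {T I : Type} (G : I -> topGroupLaw) (U : set_system T)
    (f : T -> bigprod_group G) (x : bigprod_group G) (i : I) :
  f @ U --> x -> (fun t => f t i) @ U --> x i.
Proof. exact: proj_cvg. Qed.

Lemma compact_ultra_cvgT {T : topologicalType} (U : set_system T) :
  compact [set: T] -> ultra U -> exists x : T, U --> x.
Proof.
move=> cT uU.
have [x _ Ux] := compact_ultra_cvg cT uU (@filterT _ U _).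
by exists x.
Qed.

Lemma pair_cvg {T : Type} {X Y : topologicalType} (U : set_system T) {FU : Filter U}
    (f : T -> X) (g : T -> Y) (x : X) (y : Y) :
  f @ U --> x -> g @ U --> y -> (fun t => (f t, g t)) @ U --> (x, y).
Proof. by move=> fx gy; exact: cvg_pair. Qed.

Lemma fst_cvg {T : Type} {X Y : topologicalType} (U : set_system T)
    (f : T -> X * Y) (x : X * Y) : f @ U --> x -> (fun t => (f t).1) @ U --> x.1.
Proof. by apply: cvg_comp_at; exact: cvg_fst. Qed.

Lemma snd_cvg {T : Type} {X Y : topologicalType} (U : set_system T)
    (f : T -> X * Y) (x : X * Y) : f @ U --> x -> (fun t => (f t).2) @ U --> x.2.
Proof. by apply: cvg_comp_at; exact: cvg_snd. Qed.

Lemma continuous_ultra {X Y : topologicalType} (f : X -> Y) :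
  (forall U : set_system X, ultra U -> forall x : X, (fun t => t) @ U --> x -> f @ U --> f x) -> continuous f.
Proof. by move=> h x; apply: ultra_continuous_at => U uU; exact: h. Qed.

Lemma compact_bijective_homeo {X Y : topologicalType} (f : X -> Y) :
  compact [set: X] -> hausdorff_space Y -> injective f -> (forall y, exists x, f x = y) ->
  continuous f -> homeomorphism f.
Proof.
move=> cX hY fi fs fc; have [g hg] := choice fs.
have fg : cancel g f by [].
have gf : cancel f g by move=> x; exact: fi.
exists g; split=> //.
apply: continuous_ultra => U uU y Uy.
have [x hx] := compact_ultra_cvgT cX (ultra_map g uU).
suff <- : x = g y by [].
rewrite -(gf x); congr g; have [PU _] := uU.
apply: (hausdorff_unique hY PU) Uy.
exact: (@cvg_eqfun _ _ U (fun t => f (g t)) id _ fg (cvg_comp_at (fc x) hx)).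
Qed.

Definition isoG (G H : topGroupLaw) : Prop := exists f : G -> H, topgroup_iso f.

Lemma compact_isoG (G H : topGroupLaw) (f : G -> H) :
  compact [set: G] -> hausdorff_space H -> f 0 = 0 -> {morph f : x y / x + y} ->
  injective f -> (forall y, exists x, f x = y) -> continuous f -> topgroup_iso f.
Proof. by move=> cG hH f0 fD fi fs fc; split=> //; exact: compact_bijective_homeo. Qed.

Lemma isoG_refl G : isoG G G.
Proof. by exists id; split=> //; exists id; split=> //; move=> x; exact: cvg_id. Qed.

Lemma isoG_sym G H : isoG G H -> isoG H G.
Proof.
move=> [f [f0 fD [g [gf fg fc gc]]]]; exists g; split.
- by rewrite -f0 gf.
- by move=> x y; rewrite -{1}(fg x) -{1}(fg y) -fD gf.
- by exists f.
Qed.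

Lemma topgroup_iso_comp (G H K : topGroupLaw) (f : G -> H) (f' : H -> K) :
  topgroup_iso f -> topgroup_iso f' -> topgroup_iso (fun x => f' (f x)).
Proof.
move=> [f0 fD [g [gf fg fc gc]]] [f0' fD' [g' [gf' fg' fc' gc']]].
split; first by rewrite f0 f0'.
  by move=> x y; rewrite fD fD'.
exists (fun y => g (g' y)); split.
- by move=> x; rewrite gf' gf.
- by move=> x; rewrite fg fg'.
- by move=> x; apply: (cvg_comp_at (fc' _)); exact: fc.
- by move=> x; apply: (cvg_comp_at (gc _)); exact: gc'.
Qed.

Lemma isoG_trans H G K : isoG G H -> isoG H K -> isoG G K.
Proof. by move=> [f fI] [g gI]; exists (fun x => g (f x)); exact: topgroup_iso_comp. Qed.

Lemma isoG_compact G H : isoG G H -> compact [set: H] -> compact [set: G].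
Proof.
move=> [f [_ _ [g [gf fg fc gc]]]] cH; apply: ultra_cvg_compact => U uU _.
have [y hy] := compact_ultra_cvgT cH (ultra_map f uU); exists (g y) => //.
exact: (@cvg_eqfun _ _ U (fun t => g (f t)) id _ gf (cvg_comp_at (gc y) hy)).
Qed.
Lemma isoG_tab G H : isoG G H -> tabgroup H -> tabgroup G.
Proof.
move=> [f [f0 fD [g [gf fg fc gc]]]] [hA hC h0 [opp oc oN] hcont].
have fi : injective f := can_inj gf.
split.
- by move=> x y z; apply: fi; rewrite !fD hA.
- by move=> x y; apply: fi; rewrite !fD hC.
- by move=> x; apply: fi; rewrite !fD f0 h0.
- exists (fun x => g (opp (f x))).
    move=> x; apply: (cvg_comp_at (gc _)); apply: (cvg_comp_at (oc _)); exact: fc.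
  by move=> x; apply: fi; rewrite fD fg oN f0.
- move=> T U h k x y uU hx ky; rewrite -(gf (x + y)).
  have h1 := hcont T U (f \o h) (f \o k) _ _ uU (cvg_comp_at (fc _) hx) (cvg_comp_at (fc _) ky).
  rewrite fD; have h2 := cvg_comp_at (gc _) h1.
  move=> A /h2 hA'; change (U [set t | A (h t + k t)]).
  have {}hA' : U [set t | A (g (f (h t) + f (k t)))] by [].
  by apply: filterS hA' => t /=; rewrite -fD gf.
Qed.

Lemma isoG_prod G G' H H' : isoG G G' -> isoG H H' -> isoG (prod_group G H) (prod_group G' H').
Proof.
move=> [f [f0 fD [g [gf fg fc gc]]]] [f' [f0' fD' [g' [gf' fg' fc' gc']]]].
exists (fun x : prod_group G H => (f x.1, f' x.2) : prod_group G' H'); split.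
- by rewrite /= f0 f0'.
- by move=> [x1 x2] [y1 y2] /=; rewrite fD fD'.
- exists (fun x : prod_group G' H' => (g x.1, g' x.2)); split.
  + by move=> [x1 x2] /=; rewrite gf gf'.
  + by move=> [x1 x2] /=; rewrite fg fg'.
  + apply: continuous_ultra => U uU x Ux; apply: pair_cvg.
      by apply: (cvg_comp_at (fc _)); exact: (fst_cvg Ux).
    by apply: (cvg_comp_at (fc' _)); exact: (snd_cvg Ux).
  + apply: continuous_ultra => U uU x Ux; apply: pair_cvg.
      by apply: (cvg_comp_at (gc _)); exact: (fst_cvg Ux).
    by apply: (cvg_comp_at (gc' _)); exact: (snd_cvg Ux).
Qed.

Lemma bigprod_morph {I : Type} (G : I -> topGroupLaw) (x y : bigprod_group G) i :
  (x + y) i = x i + y i.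
Proof. by []. Qed.

Lemma isoG_bigprod {I : Type} (G H : I -> topGroupLaw) :
  (forall i, isoG (G i) (H i)) -> isoG (bigprod_group G) (bigprod_group H).
Proof.
move=> h; have [f hf] : exists f : forall i, G i -> H i, forall i, topgroup_iso (f i).
  by exists (fun i => sval (cid (h i))) => i; exact: svalP (cid (h i)).
have hg i : exists g : H i -> G i, [/\ cancel (f i) g, cancel g (f i), continuous (f i) & continuous g].
  by have [_ _] := hf i.
have {hg}[g hg] : exists g : forall i, H i -> G i, forall i, [/\ cancel (f i) (g i), cancel (g i) (f i), continuous (f i) & continuous (g i)].
  by exists (fun i => sval (cid (hg i))) => i; exact: svalP (cid (hg i)).
exists (fun (x : bigprod_group G) i => f i (x i)); split.
- by apply: dep_funext => i; have [] := hf i.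
- by move=> x y; apply: dep_funext => i; have [_ fD _] := hf i; exact: fD.
- exists (fun (x : bigprod_group H) i => g i (x i)); split.
  + by move=> x; apply: dep_funext => i; have [gf _ _ _] := hg i; exact: gf.
  + by move=> x; apply: dep_funext => i; have [_ fg _ _] := hg i; exact: fg.
  + apply: continuous_ultra => U uU x Ux; apply: bprod_cvg => i.
    have [_ _ fc _] := hg i; exact: (cvg_comp_at (fc _) (@bproj_cvg _ _ G U (fun t => t) x i Ux)).
  + apply: continuous_ultra => U uU x Ux; apply: bprod_cvg => i.
    have [_ _ _ gc] := hg i; exact: (cvg_comp_at (gc _) (@bproj_cvg _ _ H U (fun t => t) x i Ux)).
Qed.

Lemma isoG_bigprod_prod {I : Type} (G H : I -> topGroupLaw) :
  isoG (bigprod_group (fun i => prod_group (G i) (H i)))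
       (prod_group (bigprod_group G) (bigprod_group H)).
Proof.
exists (fun x : bigprod_group (fun i => prod_group (G i) (H i)) =>
   ((fun i => (x i).1, fun i => (x i).2) : prod_group (bigprod_group G) (bigprod_group H))); split=> //.
exists (fun x : prod_group (bigprod_group G) (bigprod_group H) => fun i => (x.1 i, x.2 i)); split.
- by move=> x; apply: dep_funext => i /=; case: (x i).
- by move=> [x y].
- apply: continuous_ultra => U uU x Ux; apply: pair_cvg; apply: bprod_cvg => i.
    exact: (fst_cvg (@bproj_cvg _ _ (fun i => prod_group (G i) (H i)) U (fun t => t) x i Ux)).
  exact: (snd_cvg (@bproj_cvg _ _ (fun i => prod_group (G i) (H i)) U (fun t => t) x i Ux)).
- apply: continuous_ultra => U uU x Ux; apply: bprod_cvg => i; apply: pair_cvg.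
    exact: (@bproj_cvg _ _ G U (fun t => t.1) x.1 i (fst_cvg Ux)).
  exact: (@bproj_cvg _ _ H U (fun t => t.2) x.2 i (snd_cvg Ux)).
Qed.

Lemma isoG_swap {I J : Type} (G : I -> J -> topGroupLaw) :
  isoG (bigprod_group (fun i => bigprod_group (fun j => G i j)))
       (bigprod_group (fun j => bigprod_group (fun i => G i j))).
Proof.
exists (fun x : bigprod_group (fun i => bigprod_group (fun j => G i j)) => fun j i => x i j); split=> //.
exists (fun x : bigprod_group (fun j => bigprod_group (fun i => G i j)) => fun i j => x j i); split=> //.
- apply: continuous_ultra => U uU x Ux; apply: bprod_cvg => j; apply: bprod_cvg => i.
  exact: (@bproj_cvg _ _ (G i) U (fun t => t i) (x i) j (@bproj_cvg _ _ (fun i => bigprod_group (fun j => G i j)) U (fun t => t) x i Ux)).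
- apply: continuous_ultra => U uU x Ux; apply: bprod_cvg => i; apply: bprod_cvg => j.
  exact: (@bproj_cvg _ _ (fun i => G i j) U (fun t => t j) (x j) i (@bproj_cvg _ _ (fun j => bigprod_group (fun i => G i j)) U (fun t => t) x j Ux)).
Qed.

Lemma isoG_regroup {I J : Type} (p : I -> J) (G : I -> topGroupLaw) :
  isoG (bigprod_group G)
       (bigprod_group (fun j => bigprod_group (fun i : {i | p i = j} => G (sval i)))).
Proof.
exists (fun x : bigprod_group G => fun j (i : {i | p i = j}) => x (sval i)); split=> //.
exists (fun x : bigprod_group (fun j => bigprod_group (fun i : {i | p i = j} => G (sval i))) =>
   fun i => x (p i) (exist _ i erefl)); split=> //.
- move=> x; apply: dep_funext => j; apply: dep_funext => -[i e] /=.
  by case: j / e.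
- apply: continuous_ultra => U uU x Ux; apply: bprod_cvg => j; apply: bprod_cvg => i.
  exact: (@bproj_cvg _ _ G U (fun t => t) x (sval i) Ux).
- apply: continuous_ultra => U uU x Ux; apply: bprod_cvg => i.
  exact: (@bproj_cvg _ _ (fun k : {k | p k = p i} => G (sval k)) U (fun t => t (p i)) (x (p i)) (exist _ i erefl) (@bproj_cvg _ _ (fun j => bigprod_group (fun i : {i | p i = j} => G (sval i))) U (fun t => t) x (p i) Ux)).
Qed.

Lemma isoG_option {I : Type} (G : option I -> topGroupLaw) :
  isoG (bigprod_group G) (prod_group (G None) (bigprod_group (fun i => G (Some i)))).
Proof.
exists (fun x : bigprod_group G => ((x None, fun i => x (Some i)) : prod_group (G None) (bigprod_group (fun i => G (Some i))))).
split=> //.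
exists (fun (x : prod_group (G None) (bigprod_group (fun i => G (Some i)))) o =>
  match o return G o with None => x.1 | Some i => x.2 i end); split=> //.
- by move=> x; apply: dep_funext => -[i|].
- by move=> [x y].
- apply: continuous_ultra => U uU x Ux; apply: pair_cvg; first exact: (@bproj_cvg _ _ G U (fun t => t) x None Ux).
  by apply: bprod_cvg => i; exact: (@bproj_cvg _ _ G U (fun t => t) x (Some i) Ux).
- apply: continuous_ultra => U uU x Ux; apply: bprod_cvg => -[i|].
    exact: (@bproj_cvg _ _ (fun i => G (Some i)) U (fun t => t.2) x.2 i (snd_cvg Ux)).
  exact: (fst_cvg Ux).
Qed.

Lemma bigprod_tab {I : Type} (G : I -> topGroupLaw) : (forall i, tabgroup (G i)) ->
  tabgroup (bigprod_group G).
Proof.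
move=> h; split.
- by move=> x y z; apply: dep_funext => i; exact: (tab_addA (h i)).
- by move=> x y; apply: dep_funext => i; exact: (tab_addC (h i)).
- by move=> x; apply: dep_funext => i; exact: (tab_add0 (h i)).
- pose o i := sval (cid2 (tab_opp (h i))).
  have oc i : continuous (o i) by rewrite /o; case: cid2.
  have oN i x : o i x + x = 0 by rewrite /o; case: cid2.
  exists (fun (x : bigprod_group G) i => o i (x i)).
    apply: continuous_ultra => U uU x Ux; apply: bprod_cvg => i.
    exact: (cvg_comp_at (oc i _) (@bproj_cvg _ _ G U (fun t => t) x i Ux)).
  by move=> x; apply: dep_funext => i; exact: oN.
- move=> T U f g x y uU fx gy; apply: bprod_cvg => i.
  exact: (@tab_cont _ (h i) T U (fun t => f t i) (fun t => g t i) (x i) (y i) uU (@bproj_cvg _ _ G U f x i fx) (@bproj_cvg _ _ G U g y i gy)).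
Qed.

Lemma bigprod_compact {I : Type} (G : I -> topGroupLaw) : (forall i, compact [set: G i]) ->
  compact [set: bigprod_group G].
Proof.
move=> h; apply: ultra_cvg_compact => U uU _.
have hx i : exists x : G i, (fun y : bigprod_group G => y i) @ U --> x.
  by have [x hx] := compact_ultra_cvgT (h i) (ultra_map (fun y : bigprod_group G => y i) uU); exists x.
exists (fun i => sval (cid (hx i))) => //.
by apply: (@bprod_cvg _ _ G U _ (fun t => t)) => i; exact: svalP (cid (hx i)).
Qed.

Lemma bigprod_hausdorff {I : Type} (G : I -> topGroupLaw) : (forall i, hausdorff_space (G i)) ->
  hausdorff_space (bigprod_group G).
Proof.
move=> h; apply: hausdorff_cvg => U p q PU Up Uq; apply: dep_funext => i.
apply: (hausdorff_unique (h i) (fmap_proper_filter (fun y : bigprod_group G => y i) PU)).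
  exact: (@bproj_cvg _ _ G U (fun t => t) p i Up).
exact: (@bproj_cvg _ _ G U (fun t => t) q i Uq).
Qed.

Lemma prod_compact (G H : topGroupLaw) : compact [set: G] -> compact [set: H] ->
  compact [set: prod_group G H].
Proof.
move=> cG cH; apply: ultra_cvg_compact => U uU _.
have [x hx] := compact_ultra_cvgT cG (ultra_map fst uU).
have [y hy] := compact_ultra_cvgT cH (ultra_map snd uU).
have FU : Filter U by exact: filter_filter.
exists (x, y) => //; have h := @pair_cvg _ _ _ U FU fst snd x y hx hy.
by apply: (@cvg_eqfun _ _ U _ id _ _ h) => -[].
Qed.

Lemma prod_hausdorff (G H : topGroupLaw) : hausdorff_space G -> hausdorff_space H ->
  hausdorff_space (prod_group G H).
Proof.
move=> hG hH; apply: hausdorff_cvg => U [p p'] [q q'] PU Up Uq; congr (_, _).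
  by apply: (hausdorff_unique hG (fmap_proper_filter fst PU));
    [exact: (@fst_cvg _ _ _ U id (p, p')) | exact: (@fst_cvg _ _ _ U id (q, q'))].
by apply: (hausdorff_unique hH (fmap_proper_filter snd PU));
  [exact: (@snd_cvg _ _ _ U id (p, p')) | exact: (@snd_cvg _ _ _ U id (q, q'))].
Qed.

(** * Changes of Weierstrass equation and of field *)

Lemma ec_add_gen (F : fieldType) (W : weierstrass F) x1 y1 x2 y2
    (h1 : on_curve W x1 y1) (h2 : on_curve W x2 y2) :
  ec_add (EC_affine h1) (EC_affine h2) =
    (if opposite W x1 y1 x2 y2 then EC_infinity W else ec_add (EC_affine h1) (EC_affine h2)) /\
  (~~ opposite W x1 y1 x2 y2 -> exists h, let l := slope W x1 y1 x2 y2 in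
    ec_add (EC_affine h1) (EC_affine h2) = @EC_affine F W (sum_x W l x1 x2) (sum_y W l x1 y1 x2) h).
Proof.
rewrite /ec_add.
case: (alt_case (EC_infinity W) (fun h => EC_affine (sum_on_curve h1 h2 h)) (boolP _)) => [[op e]|[n e]].
  by rewrite e op; split.
rewrite e; split; first by rewrite (negPf n).
by move=> _; exists (sum_on_curve h1 h2 n).
Qed.

Lemma ec_affine_eq (F : fieldType) (W : weierstrass F) x y x' y'
   (h : on_curve W x y) (h' : on_curve W x' y') : x = x' -> y = y' -> EC_affine h = EC_affine h'.
Proof. by move=> ex ey; apply/ec_eqP. Qed.

Section Transport.
Context {R : realType} {F F' : fieldType} (v : absvalue R F) (v' : absvalue R F').
Context (phi : {rmorphism F -> F'}) (psi : F' -> F) (r s t : F').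
Context (W : weierstrass F) (W' : weierstrass F').
Local Notation b1 := (wa1 W').
Local Notation b2 := (wa2 W').
Local Notation b3 := (wa3 W').
Local Notation b4 := (wa4 W').
Local Notation b6 := (wa6 W').
(** [c1] to [c6] relate the coefficients under the substitution x -> x + r, y -> y + s x + t,
    combined with the map [phi] of fields. An identical [phi] gives the reduction to the short form,
    and r = s = t = 0 a change of completion. *)
Hypothesis c1 : phi (wa1 W) = b1 + 2 * s.
Hypothesis c3 : phi (wa3 W) = 2 * t + b1 * r + b3.
Hypothesis c2 : phi (wa2 W) = 3 * r + b2 - s ^+ 2 - b1 * s.
Hypothesis c4 : phi (wa4 W) = 3 * r ^+ 2 + 2 * b2 * r + b4 - 2 * s * t - b1 * t - b1 * r * s - b3 * s.
Hypothesis c6 : phi (wa6 W) = r ^+ 3 + b2 * r ^+ 2 + b4 * r + b6 - t ^+ 2 - b1 * r * t - b3 * t.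
Hypothesis psiK : cancel psi phi.
Hypothesis phi_lim : forall (T : Type) (U : set_system T) (f : T -> F) l,
  ProperFilter U -> vlim v U f l -> vlim v' U (fun z => phi (f z)) (phi l).

Local Notation X x := (phi x + r).
Local Notation Y x y := (phi y + s * phi x + t).

Lemma transport_curve x y : on_curve W' (X x) (Y x y) = on_curve W x y.
Proof.
rewrite /on_curve -subr_eq0 -[RHS]subr_eq0 -(fmorph_eq0 phi); congr (_ == 0).
rewrite !(rmorphB, rmorphD, rmorphM, rmorphXn) /= c1 c2 c3 c4 c6; ring.
Qed.

Definition transport (P : ec_point W) : ec_point W' :=
  match P with
  | EC_infinity => EC_infinity W'
  | EC_affine x y h => EC_affine (etrans (transport_curve x y) h : is_true _)
  end.

Lemma transport_opposite x1 y1 x2 y2 :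
  opposite W' (X x1) (Y x1 y1) (X x2) (Y x2 y2) = opposite W x1 y1 x2 y2.
Proof.
rewrite /opposite (inj_eq (addIr _)) fmorph_eq; case: eqVneq => //= ->.
rewrite -(fmorph_eq0 phi); congr (_ == 0).
rewrite !(rmorphB, rmorphD, rmorphM, rmorphXn) /= c1 c3; ring.
Qed.

Lemma transport_slope x1 y1 x2 y2 : on_curve W x1 y1 -> on_curve W x2 y2 ->
  ~~ opposite W x1 y1 x2 y2 ->
  slope W' (X x1) (Y x1 y1) (X x2) (Y x2 y2) = phi (slope W x1 y1 x2 y2) + s.
Proof.
move=> h1 h2; rewrite /slope /opposite (inj_eq (addIr _)) fmorph_eq.
have [e|x12 _] /= := eqVneq x1 x2; last first.
  have d : x2 - x1 != 0 by rewrite subr_eq0 eq_sym.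
  have d' : phi x2 - phi x1 != 0 by rewrite -rmorphB fmorph_eq0.
  rewrite fmorph_div !rmorphB.
  have -> : Y x2 y2 - Y x1 y1 = (phi y2 - phi y1) + s * (phi x2 - phi x1) by ring.
  have -> : X x2 - X x1 = phi x2 - phi x1 by ring.
  by field.
subst x2 => nopp.
have y12 : y1 = y2.
  move/eqP: h1 h2 => h1; rewrite /on_curve -h1 -subr_eq0.
  have -> : y2 ^+ 2 + wa1 W * x1 * y2 + wa3 W * y2 - (y1 ^+ 2 + wa1 W * x1 * y1 + wa3 W * y1)
     = (y2 - y1) * (y1 + y2 + wa1 W * x1 + wa3 W) by ring.
  by rewrite mulf_eq0 (negPf nopp) orbF subr_eq0 => /eqP.
have d : 2 * y1 + wa1 W * x1 + wa3 W != 0.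
  by have -> : 2 * y1 = y1 + y2 by rewrite -y12; ring.
have d' : phi (2 * y1 + wa1 W * x1 + wa3 W) != 0 by rewrite fmorph_eq0.
rewrite fmorph_div.
have -> : 2 * Y x1 y1 + b1 * X x1 + b3 = phi (2 * y1 + wa1 W * x1 + wa3 W).
  by rewrite !(rmorph_nat, rmorphB, rmorphD, rmorphM, rmorphXn, rmorph1) /= c1 c3; ring.
apply: (mulIf d'); rewrite [RHS]mulrDl !divfK//.
rewrite !(rmorph_nat, rmorphB, rmorphD, rmorphM, rmorphXn, rmorph1) /= c1 c2 c3 c4; ring.
Qed.

Lemma transportD P Q : transport (ec_add P Q) = ec_add (transport P) (transport Q).
Proof.
case: P => [|x1 y1 h1] //; case: Q => [|x2 y2 h2] //.
have [e1 e2] := ec_add_gen h1 h2.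
have [e1' e2'] := ec_add_gen (etrans (transport_curve x1 y1) h1 : is_true _) (etrans (transport_curve x2 y2) h2 : is_true _).
rewrite transport_opposite in e1' e2'.
case: (boolP (opposite W x1 y1 x2 y2)) => n.
  by rewrite n in e1 e1'; rewrite e1 /transport e1'.
have [h e] := e2 n; have [h' e'] := e2' n.
rewrite e /transport e'; move: h' e' => h' _; apply: ec_affine_eq.
  rewrite transport_slope// /sum_x !(rmorphB, rmorphD, rmorphM, rmorphXn) /= c1 c2; ring.
rewrite transport_slope// /sum_y /sum_x !(rmorphB, rmorphD, rmorphM, rmorphXn, rmorphN) /= c1 c2 c3; ring.
Qed.

Lemma transport_inj : injective transport.
Proof.
case=> [|x1 y1 h1] [|x2 y2 h2] //= [] /addIr/fmorph_inj ex.
by move=> ey; apply: ec_affine_eq => //; move: ey; rewrite ex => /addIr/addIr/fmorph_inj.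
Qed.

Lemma transport_surj Q : exists P, transport P = Q.
Proof.
case: Q => [|x y h]; first by exists (EC_infinity W).
have ex : X (psi (x - r)) = x by rewrite psiK subrK.
have ey : Y (psi (x - r)) (psi (y - s * (x - r) - t)) = y by rewrite !psiK; ring.
have h' : on_curve W (psi (x - r)) (psi (y - s * (x - r) - t)).
  by rewrite -transport_curve ex ey.
by exists (EC_affine h'); apply: ec_affine_eq.
Qed.

Lemma transport_econv {T : Type} (U : set_system T) (f : T -> ec_point W) P :
  ultra U -> econv v U f P -> econv v' U (fun z => transport (f z)) (transport P).
Proof.
move=> uU; have [PU hU] := uU.
have iT Q : isO (transport Q) = isO Q by case: Q.
case: P => [|x y h] /=; last first.
  move=> [h1 h2 h3]; split.
  - by apply: filterS h1 => z /=; rewrite iT.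
  - apply: vlim_ext (vlimD (phi_lim PU h2) (vlim_cst v' U r)).
    by apply: filterS h1 => z /=; case: (f z).
  - apply: vlim_ext (vlimD (vlimD (phi_lim PU h3) (vlimM (vlim_cst v' U s) (phi_lim PU h2))) (vlim_cst v' U t)).
    by apply: filterS h1 => z /=; case: (f z).
move=> h M; case: (hU [set z | isO (f z)]) => [h1|h1].
  by apply: filterS h1 => z /=; left; rewrite iT.
have big : vbig v U (fun z => Xc (f z)).
  by move=> N; apply: filterS2 h1 (h N) => z /= n [].
have n0 : U [set z | Xc (f z) != 0].
  by apply: filterS (big 0) => z /=; apply: contraTneq => ->; rewrite absv0 ltxx.
have big' : vbig v' U (fun z => phi (Xc (f z))).
  apply: vlim_vbig.
    rewrite -(rmorph0 phi); apply: vlim_ext (phi_lim PU (vbigV big)).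
    by apply: filterE => z /=; rewrite fmorphV.
  by apply: filterS n0 => z /=; rewrite fmorph_eq0.
apply: filterS2 h1 (big' (M + v' r)) => z /= n h2; right.
have -> : Xc (transport (f z)) = X (Xc (f z)) by case: (f z) n.
have := absv_ge_dist v' (X (Xc (f z))) (phi (Xc (f z))).
have -> : X (Xc (f z)) - phi (Xc (f z)) = r by ring.
lra.
Qed.

Lemma transport_isoG : loc_compact v -> isoG (ec_group v W) (ec_group v' W').
Proof.
move=> LC; exists transport; apply: compact_isoG.
- exact: ec_compact.
- exact: ec_hausdorff.
- by [].
- exact: transportD.
- exact: transport_inj.
- exact: transport_surj.
- apply: continuous_ultra => U uU x Ux.
  by apply: econv_cvg; apply: transport_econv => //; exact: cvg_econv.
Qed.

End Transport.

(** Completion of the square and of the cube. The scaling factor is 1, so the discriminant itself is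
    preserved, not only its class; its sign is needed at the real primes. *)
Lemma short_reduction (R : realType) (F : fieldType) (v : absvalue R F) (W : weierstrass F) :
  (2 : F) != 0 -> (3 : F) != 0 -> discriminant W != 0 -> loc_compact v ->
  exists a b, [/\ 4 * a ^+ 3 + 27 * b ^+ 2 != 0,
     discriminant W = - (16 * (4 * a ^+ 3 + 27 * b ^+ 2)) &
     isoG (ec_group v W) (ec_group v (short_weierstrass a b))].
Proof.
move=> n2 n3 dW LC.
pose s := wa1 W / 2; pose t := wa3 W / 2; pose r := (wa2 W + s ^+ 2) / 3.
pose a := wa4 W + 2 * s * t - 3 * r ^+ 2.
pose b := wa6 W + t ^+ 2 - r ^+ 3 - a * r.
have eD : discriminant W = - (16 * (4 * a ^+ 3 + 27 * b ^+ 2)).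
  case: W @s @t @r @a @b {dW} => a1 a2 a3 a4 a6 /=.
  by field; rewrite n2 n3.
exists a, b; split=> //.
  by apply: contra_neq dW; rewrite eD => ->; rewrite mulr0 oppr0.
apply: (@transport_isoG _ _ _ v v idfun idfun r s t) => //=.
- by rewrite /s; field.
- by rewrite /t; field.
- by rewrite /r; field.
- by rewrite /a; ring.
- by rewrite /b; ring.
Qed.

Lemma ec_group_facts (R : realType) (F : fieldType) (v : absvalue R F) (W : weierstrass F) :
  (2 : F) != 0 -> (3 : F) != 0 -> discriminant W != 0 -> loc_compact v ->
  (exists2 pi : F, pi != 0 & v pi < 1) ->
  [/\ tabgroup (ec_group v W), compact [set: ec_group v W] & hausdorff_space (ec_group v W)].
Proof.
move=> n2 n3 dW LC nt; split; [|exact: ec_compact|exact: ec_hausdorff].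
have [a [b [sm _ ii]]] := short_reduction n2 n3 dW LC.
by apply: isoG_tab ii _; exact: short_tabgroup.
Qed.

(** * Exponential and logarithm *)

Section Zsort.
Context {G : topGroupLaw} (HG : tabgroup G).

(* A copy of G that carries the structure of zmodType given by HG. *)
Definition zsort_of (_ : tabgroup G) : Type := tgl_sort G.
Local Notation zsort := (zsort_of HG).

HB.instance Definition _ := Topological.copy zsort (tgl_sort G).

Definition zopp : zsort -> zsort := sval (cid2 (tab_opp HG)).

Lemma zaddA : associative (fun x y : zsort => (x : G) + y : zsort). Proof. exact: tab_addA HG. Qed.
Lemma zaddC : commutative (fun x y : zsort => (x : G) + y : zsort). Proof. exact: tab_addC HG. Qed.
Lemma zadd0 : left_id (0 : G) (fun x y : zsort => (x : G) + y : zsort). Proof. exact: tab_add0 HG. Qed.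
Lemma zaddN : left_inverse (0 : G) zopp (fun x y : zsort => (x : G) + y : zsort).
Proof. by rewrite /zopp; case: cid2. Qed.

HB.instance Definition _ := GRing.isZmodule.Build zsort zaddA zaddC zadd0 zaddN.

Lemma zcvgD {T : Type} (U : set_system T) (f g : T -> zsort) (x y : zsort) :
  ultra U -> f @ U --> x -> g @ U --> y -> (fun t => f t + g t) @ U --> x + y.
Proof. exact: (tab_cont HG). Qed.

Lemma zcvgN {T : Type} (U : set_system T) (f : T -> zsort) (x : zsort) :
  f @ U --> x -> (fun t => - f t) @ U --> - x.
Proof.
apply: (@cvg_comp_at T zsort zsort).
have : continuous zopp by rewrite /zopp; case: cid2.
exact.
Qed.

Lemma zcvgB {T : Type} (U : set_system T) (f g : T -> zsort) (x y : zsort) :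
  ultra U -> f @ U --> x -> g @ U --> y -> (fun t => f t - g t) @ U --> x - y.
Proof. by move=> uU fx gy; apply: zcvgD => //; exact: zcvgN. Qed.

Lemma zcvgMn {T : Type} (U : set_system T) (f : T -> zsort) (x : zsort) n :
  ultra U -> f @ U --> x -> (fun t => f t *+ n) @ U --> x *+ n.
Proof.
move=> uU fx; elim: n => [|n IH].
  by apply: (@cvg_eqfun _ _ U (fun=> 0)) => //; exact: cvg_cst.
rewrite mulrS; apply: (@cvg_eqfun _ _ U (fun t => f t + f t *+ n)).
  by move=> t; rewrite mulrS.
exact: zcvgD.
Qed.

Lemma zcvgP {T : Type} (U : set_system T) (f : T -> zsort) (x : zsort) :
  ultra U -> f @ U --> x <-> (fun t => f t - x) @ U --> (0 : zsort).
Proof.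
move=> uU.
have cx : (fun=> x : zsort) @ U --> x by exact: cvg_cst.
split=> h; first by rewrite -(subrr x); exact: zcvgB.
rewrite -[x in X in _ --> X]add0r; apply: (@cvg_eqfun _ _ U (fun t => (f t - x) + x)).
  by move=> t; rewrite subrK.
exact: zcvgD.
Qed.

(** Translates continuity along ultrafilters into neighbourhoods: otherwise the pairs of small
    elements that violate the conclusion generate a filter, and an ultrafilter above it contradicts
    the continuity of x + y or x - y at 0. *)
Lemma znbhs_split (A : set zsort) : nbhs (0 : zsort) A ->
  exists2 B, nbhs (0 : zsort) B & forall x y, B x -> B y -> A (x + y) /\ A (x - y).
Proof.
move=> A0; apply: contrapT => h.
have P B : nbhs (0 : zsort) B -> exists xy : zsort * zsort,
    [/\ B xy.1, B xy.2 & ~ (A (xy.1 + xy.2) /\ A (xy.1 - xy.2))].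
  move=> B0; apply: contrapT => h'; apply: h; exists B => // x y Bx By.
  by apply: contrapT => nA; apply: h'; exists (x, y).
pose V := [set S : set (zsort * zsort) | exists2 B, nbhs (0 : zsort) B &
   forall xy, B xy.1 -> B xy.2 -> ~ (A (xy.1 + xy.2) /\ A (xy.1 - xy.2)) -> S xy].
have PV : ProperFilter V.
  apply: Build_ProperFilter_ex.
    by move=> S [B B0 hB]; have [xy [h1 h2 h3]] := P B B0; exists xy; exact: hB.
  split; first by exists setT => //; exact: filterT.
    move=> S S' [B B0 hB] [B' B0' hB']; exists (B `&` B'); first exact: filterI.
    by move=> xy [h1 h1'] [h2 h2'] h3; split; [exact: hB | exact: hB'].
  by move=> S S' SS' [B B0 hB]; exists B => // xy h1 h2 h3; apply: SS'; exact: hB.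
have [U [uU VU]] := ultra_of_filter PV.
have c1 : fst @ U --> (0 : zsort) by move=> B B0; apply: VU; exists B.
have c2 : snd @ U --> (0 : zsort) by move=> B B0; apply: VU; exists B.
have s1 := zcvgD uU c1 c2; have s2 := zcvgB uU c1 c2.
rewrite addr0 in s1; rewrite subr0 in s2.
have u1 : U [set xy | A (xy.1 + xy.2)] by exact: s1.
have u2 : U [set xy | A (xy.1 - xy.2)] by exact: s2.
have u3 : U [set xy | ~ (A (xy.1 + xy.2) /\ A (xy.1 - xy.2))].
  by apply: VU; exists setT => //; exact: filterT.
by have [xy [[/= h1 h2] h3]] := filter_ex (filterI (filterI u1 u2) u3); apply: h3.
Qed.

End Zsort.

Section Chart.
Context {G : topGroupLaw} (HG : tabgroup G).
Context {R : realType} {F : fieldType} (v : absvalue R F).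
Notation Z := (zsort_of HG).

(** What exp and log need of the coordinate: the sets of P in N with v (z P) < d form a basis at 0,
    small values are attained, and the group law is addition up to a quadratic error. The two
    constructions see the curve only through this record. *)
Record chart (z : Z -> F) (N : set Z) (C : R) : Prop := {
  ch_C : 0 < C;
  ch_nb : forall d : R, 0 < d -> nbhs (0 : Z) [set P | N P /\ v (z P) < d];
  ch_basis : forall A, nbhs (0 : Z) A -> exists2 d : R, 0 < d & forall P, N P -> v (z P) < d -> A P;
  ch_surj : exists2 e : R, 0 < e & forall t, v t < e -> exists P, N P /\ z P = t;
  ch_quasi : forall P Q M, N P -> N Q -> v (z P) <= M -> v (z Q) <= M ->
     v (z (P + Q) - z P - z Q) <= C * M ^+ 2;
  ch_inj : forall P, N P -> z P = 0 -> P = 0;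
  ch_opp : forall P, N P -> N (- P) /\ z (- P) = - z P;
  ch_0 : z 0 = 0 }.

End Chart.

Lemma short_chart (R : realType) (F : fieldType) (v : absvalue R F) (a b : F)
   (HG : tabgroup (ec_group v (short_weierstrass a b))) :
  (2 : F) != 0 -> 4 * a ^+ 3 + 27 * b ^+ 2 != 0 -> loc_compact v ->
  exists (z : zsort_of HG -> F) N C, chart v z N C.
Proof.
move=> n2 sm LC.
have oppE (P : zsort_of HG) : - P = ec_opp P :> ec_point _.
  have h : (P : zsort_of HG) + (ec_opp P : zsort_of HG) = 0 by exact: ec_addN.
  by apply: (addrI P); rewrite subrr; exact: (esym h).
have [d1 d10 h1] := @wc_le R F v a b.
have [d2 d20 [C C0 h2]] := @zc_quasi_hom R F v a b n2.
have [d3 d30 h3] := @zc_eq0 R F v a b.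
pose d := Num.min d1 (Num.min d2 d3).
have d0 : 0 < d by rewrite !lt_min d10 d20.
have le1 : d <= d1 by rewrite /d ge_min lexx.
have le2 : d <= d2 by rewrite /d !ge_min lexx orbT.
have le3 : d <= d3 by rewrite /d !ge_min lexx !orbT.
exists (@zc F a b), (nearO v d), C.
(* Near O one has |w| <= |z|, so that smallness of z alone brings the point close to O. *)
have shrink P e : nearO v d P -> v (@zc F a b P) < e -> nearO v e P.
  move=> hP ze; case: (boolP (isO P)) => [|nO]; [by left | right].
  have [hw _] := h1 _ (nearO_le le1 hP).
  by split=> //; [exact: nearO_Y hP nO | exact: le_lt_trans hw ze].
split=> //.
- move=> e e0; pose m := Num.min d e.
  have m0 : 0 < m by rewrite lt_min d0.
  have hid : econv v (nbhs (0 : ec_space v (short_weierstrass a b))) id (EC_infinity _).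
    by apply: cvg_econv; exact: cvg_id.
  have hm := @econv_nearO R F v a b _ _ _ _ hid m m0.
  suff : nbhs (0 : ec_space v (short_weierstrass a b)) [set P | nearO v d P /\ v (@zc F a b P) < e] by [].
  refine (@filterS _ _ (nbhs_filter (0 : ec_space v (short_weierstrass a b))) _ _ _ (hm _)); move=> P /= hP; split; first by apply: nearO_le hP; rewrite ge_min lexx.
  by have [hz _] := nearO_zw m0 hP; apply: lt_le_trans hz _; rewrite ge_min lexx orbT.
- move=> A A0.
  pose V := [set S : set (ec_point (short_weierstrass a b)) | exists2 e : R, 0 < e & forall P, nearO v e P -> S P].
  have PV : ProperFilter V.
    apply: Build_ProperFilter_ex.
      by move=> S [e e0 h]; exists (EC_infinity _); apply: h; exact: nearO_O.
    split; first by exists 1.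
      move=> S S' [e e0 h] [e' e0' h']; exists (Num.min e e'); first by rewrite lt_min e0.
      move=> P hP; split; [apply: h | apply: h']; apply: nearO_le hP; by rewrite ge_min lexx ?orbT.
    by move=> S S' SS' [e e0 h]; exists e => // P hP; apply: SS'; exact: h.
  have hc : econv v V id (EC_infinity _).
    by apply: nearO_econv => // e e0; exists e.
  have [e e0 he] : V A by exact: (@econv_cvg R F v _ _ V _ id _ hc A A0).
  by exists e => // P hP hz; apply: he; exact: shrink hz.
- have [e e0 he] := @chart_surj R F v a b LC d d0.
  by exists e => // t ht; have [P hz hP] := he t ht; exists P.
- by move=> P Q M hP hQ; apply: h2; [exact: nearO_le hP | exact: nearO_le hQ].
- by move=> P hP; apply: h3; exact: nearO_le hP.
- by move=> P hP; rewrite !oppE; split; [exact: nearO_opp | exact: zc_opp].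
- exact: zcO.
Qed.

Section Exp.
Context {G : topGroupLaw} (HG : tabgroup G).
Context {R : realType} {F : fieldType} (v : absvalue R F).
Notation Z := (zsort_of HG).
Context (z : Z -> F) (N : set Z) (C : R).
Hypothesis ch : chart v z N C.
Hypothesis cG : compact [set: G].
Hypothesis hG : hausdorff_space G.
Hypothesis LC : loc_compact v.
Hypothesis v2 : v 2 = 2.

Let C0 : 0 < C := ch_C ch.

Lemma chart_near : exists2 e : R, 0 < e & forall P Q, N P -> N Q -> v (z P) < e -> v (z Q) < e ->
  N (P + Q) /\ N (P - Q).
Proof.
have h1 := ch_nb ch ltr01.
have hN : nbhs (0 : Z) N by apply: filterS h1 => P [].
have [B B0 hB] := znbhs_split hN.
have [e e0 he] := ch_basis ch B0.
by exists e => // P Q hP hQ zP zQ; apply: hB; exact: he.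
Qed.

Lemma chart_cvg {T : Type} (U : set_system T) {FU : ProperFilter U} (f : T -> Z) :
  U [set t | N (f t)] -> (forall d : R, 0 < d -> U [set t | v (z (f t)) < d]) ->
  f @ U --> (0 : Z).
Proof.
move=> h1 h2 A A0; have [e e0 he] := ch_basis ch A0.
change (U [set t | A (f t)]).
by apply: filterS2 h1 (h2 e e0) => t /= ? ?; exact: he.
Qed.

Lemma cvg_chart {T : Type} (U : set_system T) {FU : ProperFilter U} (f : T -> Z) (d : R) :
  f @ U --> (0 : Z) -> 0 < d -> U [set t | N (f t) /\ v (z (f t)) < d].
Proof. by move=> h d0; exact: (h _ (ch_nb ch d0)). Qed.

(** The quadratic errors of successive doublings sum up as a geometric series. The bound is stable:
    with m the size before doubling, C (2m)^2 + 2 (2 C m^2) = 2 C (2m)^2. *)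
Lemma doubling : exists2 e : R, 0 < e & forall P k, N P -> 2 ^+ k * v (z P) < e ->
  N (P *+ 2 ^ k) /\ v (z (P *+ 2 ^ k) - 2 ^+ k * z P) <= 2 * C * (2 ^+ k * v (z P)) ^+ 2.
Proof.
have [e0 e00 he0] := chart_near.
exists (Num.min (e0 / 2) (1 / (2 * C))).
  by rewrite lt_min !divr_gt0// mulr_gt0.
move=> P; elim=> [|k IH] hP hk.
  by rewrite expn0 expr0 mulr1n !mul1r subrr absv0; split=> //; rewrite mulr_ge0 ?exprn_ge0 ?absv_ge0// mulr_ge0// ltW.
set m := 2 ^+ k * v (z P) in IH; have m0 : 0 <= m by rewrite mulr_ge0 ?exprn_ge0 ?absv_ge0.
have e2 : 2 ^+ k.+1 * v (z P) = 2 * m by rewrite exprS mulrA.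
rewrite e2 lt_min in hk; case/andP: hk => hk1 hk2.
have [hN hv] : N (P *+ 2 ^ k) /\ v (z (P *+ 2 ^ k) - 2 ^+ k * z P) <= 2 * C * m ^+ 2.
  by apply: IH => //; rewrite lt_min; apply/andP; split; lra.
set Q := P *+ 2 ^ k in hN hv *.
have C2 : 0 < 2 * C by rewrite mulr_gt0.
have hm : 2 * C * m ^+ 2 <= m.
  rewrite ltr_pdivlMr// in hk2.
  have : (m * (2 * C)) * m <= 1 * m by rewrite ler_wpM2r//; lra.
  by rewrite mul1r expr2; lra.
have hz : v (z Q) <= 2 * m.
  apply: le_trans (absv_le_dist v _ (2 ^+ k * z P)) _.
  rewrite absvM absvX v2 -/m; lra.
have hz0 : v (z Q) < e0 by lra.
have [hN' _] := he0 Q Q hN hN hz0 hz0.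
have -> : P *+ 2 ^ k.+1 = Q + Q by rewrite expnS mul2n -addnn mulrnDr.
split=> //.
have q := ch_quasi ch hN hN hz hz.
have -> : z (Q + Q) - 2 ^+ k.+1 * z P = (z (Q + Q) - z Q - z Q) + 2 * (z Q - 2 ^+ k * z P) by rewrite exprS; ring.
apply: le_trans (absvD _ _ _) _; rewrite absvM v2 e2.
have -> : 2 * C * (2 * m) ^+ 2 = C * (2 * m) ^+ 2 + 2 * (2 * C * m ^+ 2) by ring.
by rewrite lerD// ler_pM2l.
Qed.

(** Two applications of [ch_quasi], for the sizes M and 3M, whence 10 = 1 + 9. *)
Lemma triple : exists2 e : R, 0 < e & forall P Q S M, N P -> N Q -> N S ->
  v (z P) <= M -> v (z Q) <= M -> v (z S) <= M -> M < e ->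
  N (P - Q - S) /\ v (z (P - Q - S) - (z P - z Q - z S)) <= 10 * C * M ^+ 2.
Proof.
have [e0 e00 he0] := chart_near.
exists (Num.min (e0 / 3) (1 / C)); first by rewrite lt_min !divr_gt0.
move=> P Q S M hP hQ hS zP zQ zS; rewrite lt_min => /andP[M1 M2].
have M0 : 0 <= M by exact: le_trans (absv_ge0 v _) zP.
have [hQ' zQ'] := ch_opp ch hQ; have [hS' zS'] := ch_opp ch hS.
have zQM : v (z (- Q)) <= M by rewrite zQ' absvN.
have zSM : v (z (- S)) <= M by rewrite zS' absvN.
have q1 := ch_quasi ch hP hQ' zP zQM.
have CM : C * M ^+ 2 <= M.
  rewrite ltr_pdivlMr// in M2.
  have : (M * C) * M <= 1 * M by rewrite ler_wpM2r// ltW.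
  by rewrite mul1r expr2; lra.
have [hPQ _] : N (P - Q) /\ N (P - - Q).
  by apply: he0 => //; [apply: le_lt_trans zP _ | apply: le_lt_trans zQM _]; lra.
have z3 : v (z (P - Q)) <= 3 * M.
  have -> : z (P - Q) = (z (P - Q) - z P - z (- Q)) + z P + z (- Q) by ring.
  have := absvD v (z (P - Q) - z P - z (- Q) + z P) (z (- Q)).
  have := absvD v (z (P - Q) - z P - z (- Q)) (z P).
  lra.
have zS3 : v (z (- S)) <= 3 * M by lra.
have [hr _] : N (P - Q + - S) /\ N (P - Q - - S).
  by apply: he0 => //; [apply: le_lt_trans z3 _ | apply: le_lt_trans zS3 _]; lra.
split=> //.
have q2 := ch_quasi ch hPQ hS' z3 zS3.
have -> : z (P - Q - S) - (z P - z Q - z S) = (z (P - Q - S) - z (P - Q) - z (- S)) + (z (P - Q) - z P - z (- Q)).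
  by rewrite zQ' zS'; ring.
apply: le_trans (absvD _ _ _) _.
have -> : 10 * C * M ^+ 2 = C * (3 * M) ^+ 2 + C * M ^+ 2 by ring.
exact: lerD.
Qed.

(* E t is the limit of 2^k p(t / 2^k), where p(s) is the point of coordinate s. *)
Theorem chart_exp : exists E : F -> Z, [/\ {morph E : s t / s + t},
  (forall (T : Type) (U : set_system T) f l, ultra U -> vlim v U f l -> (fun t => E (f t)) @ U --> E l),
  (exists2 d : R, 0 < d & forall t, v t < d -> E t = 0 -> t = 0) &
  forall d : R, 0 < d -> nbhs (0 : Z) [set E t | t in [set t | v t < d]] ].
Proof.
have [e1 e10 hdbl] := doubling.
have [e2 e20 htri] := triple.
have [e3 e30 hsurj] := ch_surj ch.
have [U [uU Un]] := ultra_nat; have [PU _] := uU.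
have Pex t : exists P : Z, v t < e3 -> N P /\ z P = t.
  have [ht|] := pselect (v t < e3); last by exists 0.
  by have [P hP] := hsurj t ht; exists P.
have [p hp] := choice Pex.
pose s t k := p (t / 2 ^+ k) *+ 2 ^ k.
have lex t : exists x : Z, s t @ U --> x.
  have [x hx] := compact_ultra_cvgT cG (ultra_map (s t) uU); by exists x.
have [E hE] := choice lex.
have v2n n : v (2 ^+ n) = 2 ^+ n by rewrite absvX v2.
have p2 n : 0 < 2 ^+ n :> R by rewrite exprn_gt0.
have small t d : 0 < d -> U [set k | v (t / 2 ^+ k) < d].
  move=> d0; have [K hK] := @half_pow_small R (v t) d d0.
  apply: filterS (Un K) => k Kk /=.
  by rewrite absvM absvV v2n -exprVn -div1r; exact: hK.
have sE t : v t < e1 -> U [set k | N (s t k) /\ v (z (s t k) - t) <= 2 * C * v t ^+ 2].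
  move=> t1; apply: filterS (small t e3 e30) => k /= /hp[h1 h2].
  have n2 : (2 : F) ^+ k != 0.
    rewrite expf_neq0//; apply/eqP => h0; have := v2; rewrite h0 absv0 => /esym/eqP.
    by rewrite pnatr_eq0.
  have h3 : 2 ^+ k * v (z (p (t / 2 ^+ k))) = v t.
    by rewrite h2 absvM absvV v2n mulrC divfK// lt0r_neq0.
  have [|h4 h5] := hdbl _ k h1; first by rewrite h3.
  by move: h5; rewrite h3 h2 [2 ^+ k * _]mulrC divfK.
(* Nothing is known about the continuity of z away from 0, so the bound on s t k passes to the limit
   through E t = s t k + (E t - s t k), whose last term is close to 0. The error tends to 2 C |t|^2
   + C (2 |t|)^2 = 6 C |t|^2. *)
have Ez : exists2 d, 0 < d & forall t, v t < d -> N (E t) /\ v (z (E t) - t) <= 6 * C * v t ^+ 2.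
  have [e0 e00 he0] := chart_near.
  exists (Num.min e1 (Num.min (e0 / 2) (1 / (2 * C)))).
    by rewrite !lt_min e10 !divr_gt0// mulr_gt0.
  move=> t; rewrite !lt_min => /and3P[t1 t2 t3].
  have t0 := absv_ge0 v t.
  have hs := sE t t1.
  have Ct : 2 * C * v t ^+ 2 <= v t.
    rewrite ltr_pdivlMr ?mulr_gt0// in t3.
    have : (v t * (2 * C)) * v t <= 1 * v t by rewrite ler_wpM2r// ltW.
    by rewrite mul1r expr2; lra.
  have cD : (fun k => E t - s t k) @ U --> (0 : Z).
    rewrite -(subrr (E t)); apply: zcvgB => //; exact: cvg_cst.
  have main (d : R) : 0 < d -> N (E t) /\ v (z (E t) - t) <= 2 * C * v t ^+ 2 + d + C * (2 * v t + d) ^+ 2.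
    move=> d0; have m0 : 0 < Num.min d e0 by rewrite lt_min d0.
    have [k [[h1 h2] [h3]]] := filter_ex (filterI hs (cvg_chart cD m0)).
    rewrite lt_min => /andP[h4 h5].
    have h6 : v (z (s t k)) <= 2 * v t.
      by apply: le_trans (absv_le_dist v _ t) _; lra.
    have -> : E t = s t k + (E t - s t k) by rewrite addrC subrK.
    have h7 : 2 * v t < e0 by lra.
    split; first by have [] := he0 _ _ h1 h3 (le_lt_trans h6 h7) h5.
    have h8 : v (z (s t k)) <= 2 * v t + d by lra.
    have h9 : v (z (E t - s t k)) <= 2 * v t + d by lra.
    have q := @ch_quasi _ _ _ _ _ _ _ _ ch (s t k) (E t - s t k) (2 * v t + d) h1 h3 h8 h9.
    set A := z (_ + _) in q *.
    have -> : A - t = (A - z (s t k) - z (E t - s t k)) + (z (s t k) - t) + z (E t - s t k) by ring.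
    have := absvD v ((A - z (s t k) - z (E t - s t k)) + (z (s t k) - t)) (z (E t - s t k)).
    have := absvD v (A - z (s t k) - z (E t - s t k)) (z (s t k) - t).
    lra.
  split; first by have [] := main 1 ltr01.
  apply/ler_addgt0Pr => d d0.
  (* For d' <= 1 the excess d' + C (4 |t| d' + d'^2) is at most d' (1 + C (4 |t| + 1)), hence at
     most d. *)
  pose d' := Num.min 1 (d / (1 + C * (4 * v t + 1))).
  have K0 : 0 < 1 + C * (4 * v t + 1) by rewrite ltr_pwDl// mulr_ge0 ?ltW//; lra.
  have d'0 : 0 < d' by rewrite lt_min ltr01 divr_gt0.
  have [_ h] := main d' d'0; apply: le_trans h _.
  have d'1 : d' <= 1 by rewrite ge_min lexx.
  have d'2 : d' * (1 + C * (4 * v t + 1)) <= d.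
    by rewrite -ler_pdivlMr// ge_min lexx orbT.
  have d'3 : d' * d' <= d' by rewrite -[leRHS]mulr1 ler_pM2l.
  have : C * (d' * d') <= C * d' by rewrite ler_pM2l.
  rewrite !expr2 in d'2 *; move: d'2; lra.
(* The defect p((x + y)/2^k) - p(x/2^k) - p(y/2^k) has a coordinate of size O(4^-k); multiplied by
   2^k it still tends to 0. *)
have ED : {morph E : x y / x + y}.
  move=> x y; apply/eqP; rewrite -subr_eq0 opprD addrA; apply/eqP.
  pose D k := s (x + y) k - s x k - s y k.
  have D1 : D @ U --> E (x + y) - E x - E y by apply: zcvgB => //; exact: zcvgB.
  suff D2 : D @ U --> (0 : Z) by exact: (hausdorff_unique hG (fmap_proper_filter D PU) D1 D2).
  pose B := v x + v y; have B0 : 0 <= B by rewrite addr_ge0 ?absv_ge0.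
  pose K := 10 * C * B ^+ 2; have K0 : 0 <= K by rewrite mulr_ge0 ?exprn_ge0// mulr_ge0// ltW.
  have key (d : R) : 0 < d -> U [set k | N (D k) /\ v (z (D k)) < d].
    move=> d0.
    have m0 : 0 < Num.min e1 (Num.min 1 (d / (1 + 2 * C))).
      by rewrite !lt_min e10 ltr01 divr_gt0// ltr_pwDl// mulr_ge0// ltW.
    have [K1 hK1] := @half_pow_small R K _ m0.
    have [K2 hK2] := @half_pow_small R B _ e20.
    have U1 := filterI (small (x + y) _ e30) (filterI (small x _ e30) (small y _ e30)).
    refine (@filterS3 _ _ PU _ _ _ _ _ (U1 _ _) (Un K1) (Un K2)); move=> k /= [/hp[n1 z1] [/hp[n2 z2] /hp[n3 z3]]] k1 k2.
    pose q : R := (1 / 2) ^+ k.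
    have q0 : 0 <= q by rewrite exprn_ge0//; lra.
    have vq t : v (t / 2 ^+ k) = v t * q by rewrite absvM absvV v2n -exprVn -div1r.
    have le1 : v (x + y) <= B by exact: absvD.
    have le2 : v x <= B by rewrite lerDl absv_ge0.
    have le3 : v y <= B by rewrite lerDr absv_ge0.
    have [nD zD] := htri (p ((x + y) / 2 ^+ k)) (p (x / 2 ^+ k)) (p (y / 2 ^+ k)) (B * q) n1 n2 n3
       ltac:(by rewrite z1 vq ler_wpM2r) ltac:(by rewrite z2 vq ler_wpM2r) ltac:(by rewrite z3 vq ler_wpM2r) (hK2 k k2).
    rewrite z1 z2 z3 in zD.
    have e0 : (x + y) / 2 ^+ k - x / 2 ^+ k - y / 2 ^+ k = 0 by rewrite mulrDl; ring.
    rewrite e0 subr0 in zD.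
    have eD : D k = (p ((x + y) / 2 ^+ k) - p (x / 2 ^+ k) - p (y / 2 ^+ k)) *+ 2 ^ k.
      by rewrite /D /s !mulrnBl.
    set Q := (X in z X) in zD; rewrite -/Q in nD eD.
    have qq : 2 ^+ k * q = 1 by rewrite /q -exprMn mulrC divfK ?expr1n// pnatr_eq0.
    have zQ : 2 ^+ k * v (z Q) <= K * q.
      apply: le_trans (ler_wpM2l (ltW (p2 k)) zD) _.
      have -> : 2 ^+ k * (10 * C * (B * q) ^+ 2) = (2 ^+ k * q) * (K * q) by rewrite /K; ring.
      by rewrite qq mul1r.
    have := hK1 k k1; rewrite !lt_min -/q => /and3P[s1 s2 s3].
    have [nn zz] := hdbl Q k nD (le_lt_trans zQ s1).
    rewrite eD; split=> //.
    rewrite ltr_pdivlMr in s3; last by rewrite ltr_pwDl// mulr_ge0// ltW.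
    set m := 2 ^+ k * v (z Q) in zQ zz; have m0' : 0 <= m by rewrite mulr_ge0 ?absv_ge0// ltW.
    have hz : v (z (Q *+ 2 ^ k)) <= m + 2 * C * m ^+ 2.
      apply: le_trans (absv_le_dist v _ (2 ^+ k * z Q)) _.
      by rewrite absvM v2n -/m lerD2l.
    apply: le_lt_trans hz _; apply: le_lt_trans s3.
    have mm : m ^+ 2 <= K * q.
      by rewrite expr2 -[leRHS]mulr1; apply: ler_pM => //; exact: le_trans zQ (ltW s2).
    have : 2 * C * m ^+ 2 <= 2 * C * (K * q) by rewrite ler_wpM2l// mulr_ge0// ltW.
    lra.
  apply: chart_cvg; first by apply: filterS (key 1 ltr01) => k [].
  by move=> d d0; apply: filterS (key d d0) => k [].
have E0 : E 0 = 0 by apply: (addrI (E 0)); rewrite -ED !addr0.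
have EN t : E (- t) = - E t by apply/eqP; rewrite -addr_eq0 -ED addNr E0.
have [dz dz0 hEz] := Ez.
have Econt (T : Type) (V : set_system T) f l : ultra V -> vlim v V f l -> (fun t => E (f t)) @ V --> E l.
  move=> uV hf; have [PV _] := uV; apply: (proj2 (@zcvgP _ HG _ V (fun t => E (f t)) (E l) uV)).
  have h0 : vlim v V (fun t => f t - l) 0 by exact: (proj1 (vlimP0 _ _ _)).
  apply: (@cvg_eqfun _ _ V (fun t => E (f t - l))); first by move=> t; rewrite ED EN.
  apply: chart_cvg.
    by apply: filterS (h0 dz dz0) => t /=; rewrite subr0 => /hEz[].
  move=> d d0.
  have m0 : 0 < Num.min dz (Num.min 1 (d / (1 + 6 * C))).
    by rewrite !lt_min dz0 ltr01 divr_gt0// ltr_pwDl// mulr_ge0// ltW.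
  apply: filterS (h0 _ m0) => t /=; rewrite subr0 !lt_min => /and3P[h1 h2 h3].
  have [_ h4] := hEz _ h1.
  rewrite ltr_pdivlMr in h3; last by rewrite ltr_pwDl// mulr_ge0// ltW.
  apply: le_lt_trans h3.
  have p0 := absv_ge0 v (f t - l).
  have : v (f t - l) ^+ 2 <= v (f t - l) by rewrite expr2 -[leRHS]mulr1 ler_wpM2l// ltW.
  move=> hh; have : C * v (f t - l) ^+ 2 <= C * v (f t - l) by rewrite ler_pM2l.
  have := absv_le_dist v (z (E (f t - l))) (f t - l); lra.
exists E; split=> //.
  exists (Num.min dz (1 / (6 * C))); first by rewrite lt_min dz0 divr_gt0// mulr_gt0.
  move=> t; rewrite lt_min => /andP[t1 t2] Et.
  have [_ h] := hEz t t1; rewrite Et (ch_0 ch) sub0r absvN in h.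
  apply/eqP/negP => /negP t0; have tp := absv_gt0 v t0.
  rewrite ltr_pdivlMr ?mulr_gt0// in t2.
  have : (v t * (6 * C)) * v t < 1 * v t by rewrite ltr_pM2r.
  by rewrite mul1r; move: h; rewrite expr2; lra.
move=> d d0.
have [e0 e00 he0] := chart_near.
pose eta := Num.min (d / 2) (Num.min (dz) (Num.min (e0 / 2) (1 / (20 * C)))).
have eta0 : 0 < eta by rewrite !lt_min dz0 !divr_gt0// mulr_gt0.
apply: filterS (ch_nb ch eta0) => P [nP zP].
(* Successive approximation: subtracting E (z Q) from Q at least halves its coordinate. The
   coordinates subtracted have a limit t of partial sums, and P = E t. *)
have step Q : N Q -> v (z Q) < eta -> N (Q - E (z Q)) /\ v (z (Q - E (z Q))) <= v (z Q) / 2.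
  move=> nQ; rewrite /eta !lt_min => /and4P[z1 z2 z3 z4].
  have q0 := absv_ge0 v (z Q).
  have [nE zE] := hEz _ z2.
  have hC : 10 * C * v (z Q) ^+ 2 <= v (z Q) / 2.
    rewrite ltr_pdivlMr ?mulr_gt0// in z4.
    have : (v (z Q) * (20 * C)) * v (z Q) <= 1 * v (z Q) by rewrite ler_wpM2r// ltW.
    by rewrite mul1r expr2; lra.
  have zE2 : v (z (E (z Q))) <= 2 * v (z Q).
    have := absv_le_dist v (z (E (z Q))) (z Q).
    have : 0 <= C * v (z Q) ^+ 2 by rewrite mulr_ge0 ?exprn_ge0// ltW.
    lra.
  have [nE' zE'] := ch_opp ch nE.
  have [_ nD] := he0 Q (E (z Q)) nQ nE ltac:(lra) ltac:(lra).
  split=> //.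
  have q := @ch_quasi _ _ _ _ _ _ _ _ ch Q (- E (z Q)) (2 * v (z Q)) nQ nE' ltac:(lra) ltac:(by rewrite zE' absvN).
  rewrite zE' in q; set A := z (Q - E (z Q)) in q *.
  have -> : A = (A - z Q - - z (E (z Q))) - (z (E (z Q)) - z Q) by ring.
  apply: le_trans (absvB _ _ _) _; lra.
pose Q := fix Q k := if k is k'.+1 then Q k' - E (z (Q k')) else P.
have hQ k : N (Q k) /\ v (z (Q k)) <= (1 / 2) ^+ k * v (z P).
  elim: k => [|k [n1 z1]]; first by rewrite expr0 mul1r.
  have z2 : (1 / 2 : R) ^+ k * v (z P) <= v (z P).
    by rewrite -[leRHS]mul1r ler_wpM2r ?absv_ge0// exprn_ile1//; lra.
  have [n3 z3] := step (Q k) n1 (le_lt_trans (le_trans z1 z2) zP).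
  by split=> //; apply: le_trans z3 _; rewrite exprS; lra.
pose T k := \sum_(i < k) z (Q i).
have hT k : P = E (T k) + Q k.
  elim: k => [|k IH]; first by rewrite /T big_ord0 E0 add0r.
  by rewrite /T big_ord_recr /= -/(T k) ED -addrA (addrC (E (z _))) subrK.
have bT k : v (T k) <= 2 * v (z P) - 2 * ((1 / 2) ^+ k * v (z P)).
  elim: k => [|k IH]; first by rewrite /T big_ord0 absv0 expr0 mul1r subrr.
  rewrite /T big_ord_recr /= -/(T k); apply: le_trans (absvD _ _ _) _.
  have [_ h] := hQ k; rewrite exprS; lra.
have bT2 k : v (T k) <= 2 * v (z P).
  apply: le_trans (bT k) _; rewrite gerBl mulr_ge0// mulr_ge0 ?absv_ge0// exprn_ge0//; lra.
have [t ht] : exists t, vlim v U T t.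
  apply: lc_vlim => //; exists (2 * v (z P)); apply: filterE => k; exact: bT2.
exists t.
  have : v t <= 2 * v (z P).
    apply: (vlim_absv_le ht); apply: filterE => k; exact: bT2.
  move=> /= h; move: zP; rewrite /eta !lt_min => /and4P[h1 _ _ _]; lra.
have cQ : Q @ U --> (0 : Z).
  apply: chart_cvg; first by apply: filterE => k; have [] := hQ k.
  move=> r r0; have [K hK] := @half_pow_small R (v (z P)) r r0.
  apply: filterS (Un K) => k Kk /=; have [_ h] := hQ k.
  by apply: le_lt_trans h _; rewrite mulrC; exact: hK.
have c1 := zcvgD uU (Econt _ U T t uU ht) cQ.
rewrite addr0 in c1.
have c2 : (fun k => E (T k) + Q k) @ U --> P.
  by apply: (@cvg_eqfun _ _ U (fun=> P)); [exact: hT | exact: cvg_cst].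
by apply: (hausdorff_unique hG (fmap_proper_filter (fun k => E (T k) + Q k) PU)).
Qed.

End Exp.

Section Log.
Context {G : topGroupLaw} (HG : tabgroup G).
Context {R : realType} {F : fieldType} (v : absvalue R F).
Notation Z := (zsort_of HG).
Context (z : Z -> F) (N : set Z) (C : R).
Hypothesis ch : chart v z N C.
Hypothesis cG : compact [set: G].
Hypothesis LC : loc_compact v.
Hypothesis um : nonarchimedean v.
Context (l : nat).
Hypothesis l_gt0 : 0 < v l%:R.
Hypothesis l_lt1 : v l%:R < 1.
Hypothesis char0 : forall m, (0 < m)%N -> (m%:R : F) != 0.

Let C0 : 0 < C := ch_C ch.
Let q := v l%:R.

Lemma absv_maxD (x y : F) M : v x <= M -> v y <= M -> v (x + y) <= M.
Proof. by move=> hx hy; apply: le_trans (um x y) _; rewrite ge_max hx. Qed.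
Lemma small_subgroup (d : R) : 0 < d -> exists2 eta, 0 < eta <= d &
  forall P Q M, N P -> N Q -> v (z P) <= M -> v (z Q) <= M -> M < eta ->
   [/\ N (P + Q), N (P - Q) & v (z (P + Q)) <= M].
Proof.
move=> d0; have [e0 e00 he0] := chart_near ch.
exists (Num.min d (Num.min e0 (1 / C))).
  by rewrite !lt_min d0 e00 divr_gt0// ge_min lexx.
move=> P Q M nP nQ zP zQ; rewrite !lt_min => /and3P[m1 m2 m3].
have [h1 h2] := he0 P Q nP nQ (le_lt_trans zP m2) (le_lt_trans zQ m2).
have M0 := le_trans (absv_ge0 v _) zP.
split=> //.
have := ch_quasi ch nP nQ zP zQ => h.
have CM : C * M ^+ 2 <= M.
  rewrite ltr_pdivlMr// in m3.
  have : (M * C) * M <= 1 * M by rewrite ler_wpM2r// ltW.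
  by rewrite mul1r expr2; lra.
have -> : z (P + Q) = (z (P + Q) - z P - z Q) + z P + z Q by ring.
by apply: absv_maxD => //; apply: absv_maxD => //; exact: le_trans h CM.
Qed.

(* On a small subgroup H, L P is the limit of z(l^k P) / l^k. *)
Theorem chart_log : exists L : Z -> F, [/\ {morph L : x y / x + y},
  (forall d : R, 0 < d -> nbhs (0 : Z) [set P | v (L P) < d]),
  (forall P, L P = 0 -> exists2 m, (0 < m)%N & P *+ m = 0),
  (exists2 d : R, 0 < d & forall t, v t < d -> exists P, L P = t) &
  nbhs (0 : Z) [set P | L P = 0 -> P = 0]].
Proof.
have q0 : 0 < q by []. have q1 : q < 1 by [].
have [e3 e30 hsurj] := ch_surj ch.
(* The radius q / (2 C) makes the error C M^2 at most M / 2 even after a division by l, whose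
   absolute value is q; see [Ceta]. *)
have [|eta /andP[eta0 eta1] heta] := @small_subgroup (q / (2 * C)).
  by rewrite divr_gt0// mulr_gt0.
have Ceta M : M < eta -> 0 <= M -> C / q * M ^+ 2 <= M / 2.
  move=> M1 M0; have : M <= q / (2 * C) by rewrite ltW// (lt_le_trans M1).
  rewrite ler_pdivlMr ?mulr_gt0// => h.
  have -> : C / q * M ^+ 2 = (M * (2 * C)) * (M / 2 / q) by rewrite expr2; field; exact: lt0r_neq0.
  rewrite [leRHS](_ : _ = q * (M / 2 / q)); last by field; exact: lt0r_neq0.
  by rewrite ler_wpM2r// divr_ge0 ?(ltW q0)// divr_ge0.
have CMq M : M < eta -> 0 <= M -> C * M ^+ 2 <= q * M.
  move=> M1 M0; have := Ceta M M1 M0.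
  have -> : C / q * M ^+ 2 = (C * M ^+ 2) / q by rewrite mulrAC.
  rewrite ler_pdivrMr// => h; apply: le_trans h _.
  have := mulr_ge0 M0 (ltW q0); lra.
pose H := [set P : Z | N P /\ v (z P) < eta].
have H0 : H 0.
  have := nbhs_singleton (ch_nb ch eta0); exact.
have HD P Q : H P -> H Q -> H (P + Q).
  move=> [n1 z1] [n2 z2].
  have hm : Num.max (v (z P)) (v (z Q)) < eta by rewrite gt_max z1.
  have hm1 : v (z P) <= Num.max (v (z P)) (v (z Q)) by rewrite le_max lexx.
  have hm2 : v (z Q) <= Num.max (v (z P)) (v (z Q)) by rewrite le_max lexx orbT.
  have [h1 h2 h3] := heta P Q _ n1 n2 hm1 hm2 hm.
  by split=> //; apply: le_lt_trans h3 _; rewrite gt_max z1.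
have HN P : H P -> H (- P).
  by move=> [/(ch_opp ch)[n1 e] z1]; split=> //; rewrite e absvN.
have HB P Q : H P -> H Q -> H (P - Q) by move=> hP /HN; exact: HD.
have HMn P j : H P -> H (P *+ j).
  by move=> hP; elim: j => [//|j IH]; rewrite mulrS; exact: HD.
have zMn P j : H P -> v (z (P *+ j)) <= v (z P) /\ v (z (P *+ j) - j%:R * z P) <= C * v (z P) ^+ 2.
  move=> hP; have [nP zP] := hP; have z0 := absv_ge0 v (z P).
  elim: j => [|j [IH1 IH2]].
    by rewrite !mulr0n (ch_0 ch) absv0 mul0r subrr absv0; split=> //; rewrite mulr_ge0 ?exprn_ge0// ltW.
  have [n1 _] := HMn P j hP.
  have [h1 h2 h3] := heta _ _ _ n1 nP IH1 (lexx _) zP.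
  rewrite mulrSr; split=> //.
  have := ch_quasi ch n1 nP IH1 (lexx _) => h.
  have -> : z (P *+ j + P) - j.+1%:R * z P = (z (P *+ j + P) - z (P *+ j) - z P) + (z (P *+ j) - j%:R * z P).
    by rewrite -natr1; ring.
  exact: absv_maxD.
have zl P : H P -> v (z (P *+ l)) <= q * v (z P).
  move=> hP; have [_ h] := zMn P l hP.
  have -> : z (P *+ l) = (z (P *+ l) - l%:R * z P) + l%:R * z P by ring.
  apply: absv_maxD; last by rewrite absvM.
  by apply: le_trans h _; apply: CMq; [case: hP | exact: absv_ge0].
have zlk P k : H P -> v (z (P *+ l ^ k)) <= q ^+ k * v (z P).
  move=> hP; elim: k => [|k IH]; first by rewrite expn0 mulr1n expr0 mul1r.
  rewrite expnSr mulrnA; apply: le_trans (zl _ (HMn P _ hP)) _.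
  by rewrite exprS -mulrA ler_pM2l.
have lF0 : (l%:R : F) != 0 by apply/eqP => h; move: q0; rewrite /q h absv0 ltxx.
have lk0 k : (l%:R : F) ^+ k != 0 by rewrite expf_neq0.
have qk k : 0 < q ^+ k by rewrite exprn_gt0.
have qk1 k : q ^+ k <= 1 by rewrite exprn_ile1// ltW.
pose b P k := z (P *+ l ^ k) / l%:R ^+ k.
(* From k to k + 1 the change is at most C (q^k |z P|)^2 / q^(k+1), hence at most (C / q) |z P|^2.
   By the ultrametric inequality these changes do not accumulate. *)
have bz P k : H P -> v (b P k - z P) <= C / q * v (z P) ^+ 2.
  move=> hP; elim: k => [|k IH].
    by rewrite /b expn0 expr0 divr1 mulr1n subrr absv0 mulr_ge0 ?exprn_ge0 ?absv_ge0// divr_ge0// ltW.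
  have -> : b P k.+1 - z P = (b P k.+1 - b P k) + (b P k - z P) by ring.
  apply: absv_maxD => //.
  have [_] := zMn _ l (HMn P (l ^ k)%N hP).
  set Q := P *+ l ^ k; rewrite -mulrnA -expnSr => h.
  have -> : b P k.+1 - b P k = (z (P *+ l ^ k.+1) - l%:R * z Q) / l%:R ^+ k.+1.
    by rewrite /b -/Q exprS; field; rewrite lk0 lF0.
  rewrite absvM absvV absvX -/q ler_pdivrMr//; apply: le_trans h _.
  have hQ : v (z Q) <= q ^+ k * v (z P) by exact: zlk.
  have : v (z Q) ^+ 2 <= (q ^+ k * v (z P)) ^+ 2 by rewrite ler_pXn2r// nnegrE ?absv_ge0// mulr_ge0 ?absv_ge0// ltW.
  move=> h2; have : C * v (z Q) ^+ 2 <= C * (q ^+ k * v (z P)) ^+ 2 by rewrite ler_pM2l.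
  move=> h3; apply: le_trans h3 _.
  have -> : C / q * v (z P) ^+ 2 * q ^+ k.+1 = (C * v (z P) ^+ 2) * q ^+ k * 1.
    by rewrite [q ^+ k.+1]exprS; field; exact: lt0r_neq0.
  have -> : C * (q ^+ k * v (z P)) ^+ 2 = (C * v (z P) ^+ 2) * q ^+ k * q ^+ k by ring.
  by apply: ler_wpM2l => //; do 2?[apply: mulr_ge0]; rewrite ?exprn_ge0 ?absv_ge0 ?(ltW C0) ?(ltW q0).
have [U [uU Un]] := ultra_nat.
have Lex P : exists t, H P -> vlim v U (b P) t.
  have [hP|] := pselect (H P); last by exists 0.
  suff [t ht] : exists t, vlim v U (b P) t by exists t.
  apply: lc_vlim => //; exists (v (z P)); apply: filterE => k /=.
  have -> : b P k = (b P k - z P) + z P by ring.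
  apply: absv_maxD => //; apply: le_trans (bz P k hP) _.
  have [_ h] := hP; apply: le_trans (Ceta _ h (absv_ge0 _ _)) _.
  by rewrite ler_pdivrMr// ler_peMr ?absv_ge0// ler1n.
have [L0 hL0] := choice Lex.
have L0z P : H P -> v (L0 P - z P) <= C / q * v (z P) ^+ 2.
  move=> hP; have h : vlim v U (fun k => b P k - z P) (L0 P - z P).
    by apply: vlimB; [exact: hL0 | exact: vlim_cst].
  by apply: (vlim_absv_le h); apply: filterE => k /=; exact: bz.
have L0_le P : H P -> v (L0 P) <= v (z P).
  move=> hP; have -> : L0 P = (L0 P - z P) + z P by ring.
  apply: absv_maxD => //; apply: le_trans (L0z P hP) _.
  have [_ h] := hP; apply: le_trans (Ceta _ h (absv_ge0 _ _)) _.
  by rewrite ler_pdivrMr// ler_peMr ?absv_ge0// ler1n.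
(* The points l^k P and l^k Q have size O(q^k): the error of additivity is O(q^(2k)), and O(q^k)
   after division by l^k. *)
have L0D P Q : H P -> H Q -> L0 (P + Q) = L0 P + L0 Q.
  move=> hP hQ; apply/eqP; rewrite -subr_eq0 opprD addrA; apply/eqP.
  have h1 : vlim v U (fun k => b (P + Q) k - b P k - b Q k) (L0 (P + Q) - L0 P - L0 Q).
    by apply: vlimB; [apply: vlimB|]; apply: hL0 => //; exact: HD.
  apply: (vlim_unique h1) => d d0.
  pose M := Num.max (v (z P)) (v (z Q)).
  have M0 : 0 <= M by rewrite le_max absv_ge0.
  have [K hK] := @pow_small R q (C * M ^+ 2) d (ltW q0) q1 d0.
  apply: filterS (Un K) => k Kk /=; rewrite subr0.
  have [n1 _] := HMn P (l ^ k)%N hP; have [n2 _] := HMn Q (l ^ k)%N hQ.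
  have le1 : v (z (P *+ l ^ k)) <= q ^+ k * M.
    by apply: le_trans (zlk P k hP) _; rewrite ler_wpM2l ?le_max ?lexx// ltW.
  have le2 : v (z (Q *+ l ^ k)) <= q ^+ k * M.
    by apply: le_trans (zlk Q k hQ) _; rewrite ler_wpM2l ?le_max ?lexx ?orbT// ltW.
  have := ch_quasi ch n1 n2 le1 le2 => h.
  have -> : b (P + Q) k - b P k - b Q k = (z (P *+ l ^ k + Q *+ l ^ k) - z (P *+ l ^ k) - z (Q *+ l ^ k)) / l%:R ^+ k.
    by rewrite /b mulrnDl; ring.
  rewrite absvM absvV absvX -/q; apply: le_lt_trans (hK k Kk).
  rewrite ler_pdivrMr//; apply: le_trans h _.
  by rewrite le_eqVlt; apply/orP; left; apply/eqP; ring.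
have L00 : L0 0 = 0 by apply: (addrI (L0 0)); rewrite -L0D// !addr0.
have L0B P Q : H P -> H Q -> L0 (P - Q) = L0 P - L0 Q.
  move=> hP hQ; apply/eqP; rewrite -subr_eq0 opprB addrC; apply/eqP.
  have := L0D (P - Q) Q (HB _ _ hP hQ) hQ; rewrite subrK => ->; ring.
have L0Mn P j : H P -> L0 (P *+ j) = L0 P *+ j.
  by move=> hP; elim: j => [|j IH]; rewrite ?mulr0n// !mulrS L0D ?IH//; exact: HMn.
have L0ker P : H P -> L0 P = 0 -> P = 0.
  move=> hP h; have [nP zP] := hP; apply: (ch_inj ch nP).
  have := L0z P hP; rewrite h sub0r absvN => h2.
  apply/eqP/negP => /negP z0; have := absv_gt0 v z0.
  have := Ceta _ zP (absv_ge0 _ _); lra.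
have Hnb : nbhs (0 : Z) H by exact: (ch_nb ch eta0).
have L0nb (d : R) : 0 < d -> nbhs (0 : Z) [set P | H P /\ v (L0 P) < d].
  move=> d0; have m0 : 0 < Num.min eta d by rewrite lt_min eta0.
  apply: filterS (ch_nb ch m0) => P [nP]; rewrite lt_min => /andP[h1 h2].
  have hP : H P by []. by split=> //; exact: le_lt_trans (L0_le P hP) h2.
(* The point of coordinate t_k has logarithm t_k up to |t_k| / 2. The sums of these points have a
   limit by compactness of the group, and its logarithm is t by continuity. *)
have L0surj t : v t < Num.min eta e3 -> exists2 P, H P & L0 P = t.
  move=> ht0.
  have Pex s : exists P : Z, v s < Num.min eta e3 -> H P /\ z P = s.
    have [|] := pselect (v s < Num.min eta e3); last by exists 0.
    rewrite lt_min => /andP[h1 h2]; have [P [h3 h4]] := hsurj s h2.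
    by exists P => _; rewrite /H /= h4.
  have [p hp] := choice Pex.
  pose tt := fix tt k := if k is k'.+1 then tt k' - L0 (p (tt k')) else t.
  have htt k : v (tt k) <= (1/2) ^+ k * v t.
    elim: k => [|k IH]; first by rewrite expr0 mul1r.
    have h1 : v (tt k) < Num.min eta e3.
      apply: le_lt_trans ht0; apply: le_trans IH _.
      by rewrite -[leRHS]mul1r ler_wpM2r ?absv_ge0// exprn_ile1//; lra.
    have [h2 h3] := hp _ h1.
    rewrite /= -absvN opprB -{2}h3; apply: le_trans (L0z _ h2) _; rewrite h3.
    have h4 : v (tt k) < eta by move: h1; rewrite lt_min => /andP[].
    apply: le_trans (Ceta _ h4 (absv_ge0 _ _)) _; rewrite exprS; lra.
  have htt2 k : v (tt k) < Num.min eta e3.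
    apply: le_lt_trans ht0; apply: le_trans (htt k) _.
    by rewrite -[leRHS]mul1r ler_wpM2r ?absv_ge0// exprn_ile1//; lra.
  pose S k := \sum_(i < k) p (tt i).
  have HS k : H (S k).
    rewrite /S; elim: k => [|k IH]; first by rewrite big_ord0.
    rewrite big_ord_recr; apply: HD IH _; exact: (proj1 (hp _ (htt2 k))).
  have LS k : L0 (S k) = t - tt k.
    rewrite /S; elim: k => [|k IH]; first by rewrite big_ord0 /= subrr.
    rewrite big_ord_recr /= L0D; [|exact: HS|exact: (proj1 (hp _ (htt2 k)))].
    rewrite IH; ring.
  have [x hx] := compact_ultra_cvgT cG (ultra_map S uU).
  have cS : (fun k => x - S k) @ U --> (0 : Z).
    by rewrite -(subrr (x : Z)); apply: zcvgB => //; exact: cvg_cst.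
  have Hx : H x.
    have Ux : U [set k | H (x - S k)] by exact: (cS _ Hnb).
    have [k hk] := filter_ex Ux.
    by rewrite -[x](subrK (S k)); apply: HD.
  exists x => //.
  have t1 : vlim v U (fun k => L0 (S k)) t.
    have -> : (fun k => L0 (S k)) = (fun k => t - tt k) by apply/funext => k; rewrite LS.
    rewrite -[t in vlim _ _ _ t]subr0; apply: vlimB => [|d d0]; first exact: vlim_cst.
    have [K hK] := @half_pow_small R (v t) d d0.
    apply: filterS (Un K) => k Kk /=; rewrite subr0; apply: le_lt_trans (htt k) _.
    by rewrite mulrC; exact: hK.
  apply: (vlim_unique _ t1) => d d0.
  have Ux : U [set k | H (x - S k) /\ v (L0 (x - S k)) < d] by exact: (cS _ (L0nb d d0)).
  apply: filterS Ux => k /= [_]; rewrite L0B// -absvN opprB; exact.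
(* The multiples of x accumulate at some y, so two of them differ by an element of the open subgroup
   H. *)
have tors1 (x : Z) : exists2 m, (0 < m)%N & H (x *+ m).
  have [y hy] := compact_ultra_cvgT cG (ultra_map (fun k => x *+ k) uU).
  pose y' : Z := y.
  have cS := proj1 (@zcvgP _ HG _ U (fun k => x *+ k) y' uU) hy.
  have Uy : U [set k | H (x *+ k - y')] by exact: (cS _ Hnb).
  have [i hi] := filter_ex Uy.
  have [j [hj ij]] := filter_ex (filterI Uy (Un i.+1)).
  exists (j - i)%N; first by rewrite subn_gt0.
  rewrite mulrnBr; last exact: ltnW.
  have -> : x *+ j - x *+ i = (x *+ j - y') - (x *+ i - y') by rewrite opprB addrA subrK.
  exact: HB.
(* The exponent can be chosen uniformly: otherwise take x_k none of whose first k multiples lies in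
   H. Their limit y has a multiple m y in H, and H is open, so m x_k lies in H for many k >= m. *)
have [M hM] : exists M, forall x : Z, exists2 m, (0 < m <= M)%N & H (x *+ m).
  apply: contrapT => hn.
  have ex M : exists x : Z, forall m, (0 < m <= M)%N -> ~ H (x *+ m).
    apply: contrapT => h; apply: hn; exists M => x; apply: contrapT => h2.
    by apply: h; exists x => m hm hH; apply: h2; exists m.
  have [x hx] := choice ex.
  have [y hy] := compact_ultra_cvgT cG (ultra_map x uU).
  pose y' : Z := y.
  have [m m0 hm] := tors1 y'.
  have cS := proj1 (@zcvgP _ HG _ U (fun k => x k *+ m) (y' *+ m) uU) (@zcvgMn _ HG _ U _ y' m uU hy).
  have Uy : U [set k | H (x k *+ m - y' *+ m)] by exact: (cS _ Hnb).
  have [j [hj ij]] := filter_ex (filterI Uy (Un m)).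
  by apply: (hx j m); rewrite ?m0// -[x j *+ m](subrK (y' *+ m)); exact: HD.
pose n0 := M`!.
have n00 : (0 < n0)%N by exact: fact_gt0.
have Hn0 x : H (x *+ n0).
  have [m /andP[m0 mM] hm] := hM x.
  have /dvdnP[c ->] : (m %| n0)%N by apply: dvdn_fact; rewrite m0.
  by rewrite mulnC mulrnA; exact: HMn.
have nF := char0 n00.
(* The factorial n0 carries all of G into H, and division by n0 extends the logarithm from H to
   G. *)
pose L P := L0 (P *+ n0) / n0%:R.
have LH P : H P -> L P = L0 P.
  by move=> hP; rewrite /L L0Mn// -[L0 P *+ _]mulr_natr mulfK.
exists L; split.
- by move=> x y; rewrite /L mulrnDl L0D// mulrDl.
- by move=> d d0; apply: filterS (L0nb d d0) => P [hP]; rewrite /= LH.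
- move=> P /eqP; rewrite /L mulf_eq0 invr_eq0 (negPf nF) orbF => /eqP h.
  by exists n0 => //; apply: L0ker.
- exists (Num.min eta e3); first by rewrite lt_min eta0.
  by move=> t ht; have [P hP e] := L0surj t ht; exists P; rewrite LH.
- by apply: filterS Hnb => P hP; rewrite /= LH//; exact: L0ker.
Qed.

End Log.

(** * Primes of number fields *)

Section AbsvEquiv.
Context {R : realType} {F : fieldType}.
Implicit Types v w : absvalue R F.

(** Continuity at 0, hence uniform continuity, of the identity from F with v to F with w. *)
Definition dominates v w : Prop :=
  forall e : R, 0 < e -> exists2 d : R, 0 < d & forall x, v x < d -> w x < e.

Lemma absv_openP v (A : set F) : open (A : set (absv_space v)) <->
  forall x, A x -> exists2 e : R, 0 < e & forall y, v (y - x) < e -> A y.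
Proof.
rewrite openE; split=> h x Ax; first exact/absv_nbhsP/h.
by apply/absv_nbhsP; exact: h.
Qed.

Lemma absv_equiv_dominates v w : absv_equiv v w -> dominates v w.
Proof.
move=> vw e e0.
have : open ([set x | w x < e] : set (absv_space v)).
  apply/(vw [set x | w x < e])/absv_openP => x /= xe.
  exists (e - w x); first by rewrite subr_gt0.
  move=> y yx; have := absv_le_dist w y x; lra.
move=> /absv_openP /(_ 0); rewrite /= absv0 => /(_ e0)[d d0 hd].
by exists d => // x xd; apply: hd; rewrite subr0.
Qed.

Lemma dominates_equiv v w : dominates v w -> dominates w v -> absv_equiv v w.
Proof.
move=> vw wv A; split=> /absv_openP h; apply/absv_openP => x /h[e /[dup]].
  by move=> _ e0 he; have [d d0 hd] := wv e e0; exists d => // y /hd/he.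
by move=> _ e0 he; have [d d0 hd] := vw e e0; exists d => // y /hd/he.
Qed.

Lemma absv_equiv_sym v w : absv_equiv v w -> absv_equiv w v.
Proof. by move=> h A; split=> /h. Qed.

Lemma absv_equiv_trans v w u : absv_equiv v w -> absv_equiv w u -> absv_equiv v u.
Proof. by move=> h h' A; split=> [/h/h'|/h'/h]. Qed.

Lemma nontrivial_lt1 v : nontrivial_absv v -> exists2 x, x != 0 & v x < 1.
Proof.
move=> [x x0 vx]; have [h|h] := ltP (v x) 1; first by exists x.
exists x^-1; rewrite ?invr_eq0// absvV invf_lt1 ?absv_gt0//.
by rewrite lt_neqAle eq_sym vx.
Qed.

Lemma absv_pow_lt v x (e : R) : v x < 1 -> 0 < e -> exists k, v (x ^+ k) < e.
Proof.
move=> x1 e0; have [N hN] := @pow_small R (v x) 1 e (absv_ge0 v x) x1 e0.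
by exists N; rewrite absvX -[X in X < _]mul1r; exact: hN.
Qed.

Lemma dominates_lt1 v w x : dominates v w -> v x < 1 -> w x < 1.
Proof.
move=> vw x1; have [d d0 hd] := vw 1 ltr01.
have [k hk] := absv_pow_lt x1 d0.
rewrite ltNge; apply/negP => h; have := hd _ hk.
by rewrite absvX ltNge exprn_ege1.
Qed.

(** Fix y with v y < 1, so that also w y < 1. Comparing x with powers of y shows first that the
    implication has a converse, then that small values of one absolute value are small for the
    other. *)
Lemma lt1_equiv v w : nontrivial_absv v -> (forall x, v x < 1 -> w x < 1) -> absv_equiv v w.
Proof.
move=> nv vw; have [y y0 y1] := nontrivial_lt1 nv.
have wy := vw y y1; have vy0 := absv_gt0 v y0; have wy0 := absv_gt0 w y0.
have wv x : w x < 1 -> v x < 1.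
  move=> wx; rewrite ltNge; apply/negP => vx.
  have x0 : x != 0 by apply/eqP => h; move: vx; rewrite h absv0 ler10.
  have [k hk] := absv_pow_lt wx wy0.
  have : w (y / x ^+ k) < 1.
    apply: vw; rewrite absvM absvV absvX ltr_pdivrMr ?exprn_gt0 ?absv_gt0// mul1r.
    by apply: lt_le_trans y1 _; rewrite exprn_ege1.
  rewrite absvM absvV ltr_pdivrMr ?absv_gt0 ?expf_neq0// mul1r => h.
  by have := lt_trans h hk; rewrite ltxx.
have dom (u1 u2 : absvalue R F) : u1 y < 1 -> u2 y < 1 -> (forall x, u1 x < 1 -> u2 x < 1) -> dominates u1 u2.
  move=> h1 h2 h e e0; have [k hk] := absv_pow_lt h2 e0.
  exists (u1 (y ^+ k)); first by rewrite absv_gt0// expf_neq0.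
  move=> x hx; apply: lt_trans hk.
  have : u2 (x / y ^+ k) < 1.
    by apply: h; rewrite absvM absvV ltr_pdivrMr ?mul1r ?absv_gt0 ?expf_neq0.
  by rewrite absvM absvV ltr_pdivrMr ?mul1r ?absv_gt0 ?expf_neq0.
by apply: dominates_equiv; exact: dom.
Qed.

Lemma inequiv_lt1 v w : nontrivial_absv v -> ~ absv_equiv v w -> exists2 x, v x < 1 & 1 <= w x.
Proof.
move=> nv nvw; apply: contrapT => h; apply: nvw; apply: lt1_equiv => // x x1.
by rewrite ltNge; apply/negP => hx; apply: h; exists x.
Qed.

Lemma absv_geom v x (e : R) : v x < 1 -> 0 < e -> exists N, forall k, (N <= k)%N -> v (x ^+ k) < e.
Proof.
move=> x1 e0; have [N hN] := @pow_small R (v x) 1 e (absv_ge0 v x) x1 e0.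
by exists N => k /hN; rewrite absvX mul1r.
Qed.

(** A step function: x^k / (1 + x^k) tends to 0 where |x| < 1 and to 1 where |x| > 1. *)
Lemma absv_step v x : (v x < 1 -> forall e : R, 0 < e -> exists N, forall k, (N <= k)%N -> v (x ^+ k / (1 + x ^+ k)) < e)
  /\ (1 < v x -> forall e : R, 0 < e -> exists N, forall k, (N <= k)%N -> v (x ^+ k / (1 + x ^+ k) - 1) < e).
Proof.
have aux y e : 0 < e -> e <= 1 -> v y < e / 2 -> 1 + y != 0 /\ v (y / (1 + y)) < e.
  move=> e0 e1 ye.
  have h : 1 / 2 < v (1 + y).
    by have := absv_le_dist v 1 (1 + y); rewrite absv1 absv_dist addrAC subrr add0r; lra.
  split; first by apply/eqP => h0; move: h; rewrite h0 absv0; lra.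
  by rewrite absvM absvV ltr_pdivrMr; [nra | lra].
split=> hx e e0.
  have m0 : 0 < Num.min e 1 / 2 by rewrite divr_gt0// lt_min e0 ltr01.
  have [N hN] := absv_geom hx m0.
  exists N => k /hN h; have [||_] := aux _ (Num.min e 1) _ _ h.
  - by rewrite lt_min e0 ltr01.
  - by rewrite ge_min lexx orbT.
  by rewrite lt_min => /andP[].
have m0 : 0 < Num.min e 1 / 2 by rewrite divr_gt0// lt_min e0 ltr01.
have x0 : x != 0 by apply/eqP => h; move: hx; rewrite h absv0; lra.
have hx' : v x^-1 < 1 by rewrite absvV invf_lt1// absv_gt0.
have [N hN] := absv_geom hx' m0.
exists N => k /hN h; have [||n0] := aux _ (Num.min e 1) _ _ h.
- by rewrite lt_min e0 ltr01.
- by rewrite ge_min lexx orbT.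
rewrite lt_min => /andP[h1 _].
have xk : x ^+ k != 0 by rewrite expf_neq0.
have n1 : 1 + x ^+ k != 0.
  apply: contraNneq n0 => h0; rewrite exprVn.
  have -> : 1 + (x ^+ k)^-1 = (1 + x ^+ k) / x ^+ k by field.
  by rewrite h0 mul0r.
have -> : x ^+ k / (1 + x ^+ k) - 1 = - (x^-1 ^+ k / (1 + x^-1 ^+ k)).
  have n1' : x ^+ k + 1 != 0 by rewrite addrC.
  by rewrite exprVn; field; rewrite ?xk ?n1 ?n1'.
by rewrite absvN.
Qed.

(** Induction of Artin and Whaples. Let z serve for the first m values, and let y separate v from f
    m: the element is z^k y if f m z <= 1, and z^k y / (1 + z^k) otherwise. *)
Lemma separate v (f : nat -> absvalue R F) m : nontrivial_absv v ->
  (forall j, (j < m)%N -> nontrivial_absv (f j) /\ ~ absv_equiv v (f j)) ->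
  exists2 z, 1 < v z & forall j, (j < m)%N -> f j z < 1.
Proof.
move=> nv; elim: m => [|m IH] h.
  have [x x0 x1] := nontrivial_lt1 nv; exists x^-1 => //.
  by rewrite absvV invf_gt1 ?absv_gt0.
have [|z z1 hz] := IH; first by move=> j jm; apply: h; rewrite ltnS ltnW.
have [nw nvw] := h m (ltnSn m).
have [y y1 hy] : exists2 y, 1 < v y & f m y < 1.
  have [a a1 a2] := inequiv_lt1 nv nvw.
  have [b b1 b2] := inequiv_lt1 nw (fun e => nvw (absv_equiv_sym e)).
  have a0 : a != 0 by apply/eqP => e; move: a2; rewrite e absv0 ler10.
  exists (b / a); rewrite absvM absvV.
    by rewrite ltr_pdivlMr ?absv_gt0// mul1r (lt_le_trans a1).
  by rewrite ltr_pdivrMr ?absv_gt0// mul1r (lt_le_trans b1).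
have fin (P : nat -> nat -> Prop) : (forall j, (j < m)%N -> exists N, forall k, (N <= k)%N -> P j k) ->
    exists N, forall j k, (j < m)%N -> (N <= k)%N -> P j k.
  elim: (m) => [|i IHi] hP; first by exists 0%N.
  have [|N1 h1] := IHi; first by move=> j ji; apply: hP; rewrite ltnS ltnW.
  have [N2 h2] := hP i (ltnSn i).
  exists (maxn N1 N2) => j k; rewrite ltnS leq_eqVlt geq_max => /orP[/eqP->|ji] /andP[k1 k2]; [exact: h2 | exact: h1].
have pos j : 0 < 1 / (1 + f j y) :> R by rewrite divr_gt0// ltr_pwDl// absv_ge0.
have bnd j t : f j t < 1 / (1 + f j y) -> f j (t * y) < 1.
  rewrite ltr_pdivlMr ?ltr_pwDl ?absv_ge0// absvM => h1.
  by have := absv_ge0 (f j) t; lra.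
have [hm|hm] := leP (f m z) 1.
  have [N hN] : exists N, forall j k, (j < m)%N -> (N <= k)%N -> f j (z ^+ k * y) < 1.
    apply: fin => j jm; have [N hN] := absv_geom (hz j jm) (pos j).
    by exists N => k /hN; exact: bnd.
  exists (z ^+ N * y); first by rewrite absvM absvX (lt_le_trans y1)// ler_peMl ?absv_ge0// exprn_ege1// ltW.
  move=> j; rewrite ltnS leq_eqVlt => /orP[/eqP->|jm]; last exact: hN.
  by rewrite absvM absvX (le_lt_trans _ hy)// ler_piMl ?absv_ge0// exprn_ile1 ?absv_ge0.
have [N hN] : exists N, forall j k, (j < m)%N -> (N <= k)%N -> f j (z ^+ k / (1 + z ^+ k) * y) < 1.
  apply: fin => j jm; have [N hN] := (absv_step (f j) z).1 (hz j jm) _ (pos j).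
  by exists N => k /hN; exact: bnd.
have e1 : 0 < (v y - 1) / v y by rewrite divr_gt0; lra.
have [N1 hN1] := (absv_step v z).2 z1 _ e1.
have e2 : 0 < (1 - f m y) / (1 + f m y) by have p0 := absv_ge0 (f m) y; rewrite divr_gt0//; lra.
have [N2 hN2] := (absv_step (f m) z).2 hm _ e2.
pose k := maxn N (maxn N1 N2); exists (z ^+ k / (1 + z ^+ k) * y).
  have := hN1 k ltac:(by rewrite !leq_max leqnn orbT).
  set t := z ^+ k / _; rewrite ltr_pdivlMr; last by lra.
  move=> h1; have := absv_le_dist v y (t * y).
  have -> : y - t * y = - ((t - 1) * y) by ring.
  by rewrite absvN !absvM; lra.
move=> j; rewrite ltnS leq_eqVlt => /orP[/eqP->|jm]; last by apply: hN => //; rewrite leq_max leqnn.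
have := hN2 k ltac:(by rewrite !leq_max leqnn !orbT).
set t := z ^+ k / _; rewrite ltr_pdivlMr; last by have := absv_ge0 (f m) y; lra.
move=> h1; have := absv_le_dist (f m) (t * y) y.
have -> : t * y - y = (t - 1) * y by ring.
rewrite !absvM; have := absv_ge0 (f m) (t - 1); lra.
Qed.

(** x is the sum of the a_j x_j, where x_j is close to 1 for f j and close to 0 for the other
    values. The element x_j is a step function of one given by [separate]. *)
Lemma weak_approximation (f : nat -> absvalue R F) m :
  (forall j, (j < m)%N -> nontrivial_absv (f j)) ->
  (forall i j, (i < m)%N -> (j < m)%N -> absv_equiv (f i) (f j) -> i = j) ->
  forall (a : nat -> F) (e : R), 0 < e -> exists x, forall i, (i < m)%N -> f i (x - a i) < e.
Proof.
move=> nf inj a e e0.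
have sep i (d : R) : 0 < d -> exists x, (i < m)%N -> f i (x - 1) < d /\ forall j, (j < m)%N -> j != i -> f j x < d.
  move=> d0; have [im|] := boolP (i < m)%N; last by exists 0.
  (* g lists the absolute values other than f i. *)
  pose g j := if (j < i)%N then f j else f j.+1.
  have [|z z1 hz] := @separate (f i) g m.-1 (nf i im).
    move=> j jm; rewrite /g; case: (ltnP j i) => ji.
      split; first by apply: nf; lia.
      by move=> /(inj i j im ltac:(lia)) eij; move: ji; rewrite eij ltnn.
    split; first by apply: nf; lia.
    by move=> /(inj i j.+1 im ltac:(lia)) eij; move: ji; rewrite eij ltnn.
  have hz' j : (j < m)%N -> j != i -> f j z < 1.
    move=> jm ji; have [h|h] := ltnP j i.
      by have := hz j ltac:(lia); rewrite /g h.
    have h2 : (i < j)%N by lia.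
    have := hz j.-1 ltac:(lia); rewrite /g ifF ?prednK//; lia.
  have [N1 hN1] := (absv_step (f i) z).2 z1 d d0.
  suff [N hN] : exists N, forall k, (N <= k)%N -> forall j, (j < m)%N -> j != i -> f j (z ^+ k / (1 + z ^+ k)) < d.
    exists (z ^+ (maxn N N1) / (1 + z ^+ (maxn N N1))) => _; split.
      by apply: hN1; rewrite leq_max leqnn orbT.
    by apply: hN; rewrite leq_max leqnn.
  elim: (m) hz' => [|m' IH] hz'; first by exists 0%N.
  have [|N hN] := IH; first by move=> j jm; apply: hz'; rewrite ltnS ltnW.
  have [e1|ne] := eqVneq m' i.
    exists N => k kN j; rewrite ltnS leq_eqVlt => /orP[/eqP->|jm]; last exact: hN.
    by rewrite e1 eqxx.
  have [N2 hN2] := (absv_step (f m') z).1 (hz' m' (ltnSn _) ne) d d0.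
  exists (maxn N N2) => k; rewrite geq_max => /andP[k1 k2] j.
  rewrite ltnS leq_eqVlt => /orP[/eqP-> _|jm]; [exact: hN2 | exact: hN].
pose B : R := 1 + \sum_(i < m) \sum_(j < m) f i (a j).
have B0 : 0 < B by rewrite ltr_pwDl// sumr_ge0// => i _; rewrite sumr_ge0// => j _; exact: absv_ge0.
have d0 : 0 < e / (B * m.+1%:R) by rewrite divr_gt0// mulr_gt0.
have [x hx] := choice (fun i => sep i _ d0).
exists (\sum_(j < m) a j * x j) => i im.
have -> : \sum_(j < m) a j * x j - a i = \sum_(j < m) a j * (x j - (j == i :> nat)%:R).
  rewrite [RHS](eq_bigr (fun j : 'I_m => a j * x j - a j * (j == i :> nat)%:R)); last by move=> j _; rewrite mulrBr.
  rewrite sumrB; congr (_ - _); rewrite (bigD1 (Ordinal im))//= eqxx mulr1 big1 ?addr0// => j.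
  by rewrite -val_eqE /= => /negPf->; rewrite mulr0.
apply: le_lt_trans (_ : \sum_(j < m) (B * (e / (B * m.+1%:R))) < e).
  apply: le_trans (absv_sum _ _ _ _) _; apply: ler_sum => j _.
  rewrite absvM; apply: ler_pM; rewrite ?absv_ge0//.
    rewrite /B (bigD1 (Ordinal im))//= (bigD1 j)//=.
    have : 0 <= \sum_(i0 < m | i0 != j) f i (a i0) by rewrite sumr_ge0// => *; exact: absv_ge0.
    have : 0 <= \sum_(i0 < m | i0 != Ordinal im) \sum_(j0 < m) f i0 (a j0).
      by rewrite sumr_ge0// => *; rewrite sumr_ge0// => *; exact: absv_ge0.
    lra.
  apply: ltW; have [h1 h2] := hx j (ltn_ord j); have [ji|ji] := eqVneq (j : nat) i.
    by rewrite -ji.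
  by rewrite subr0; apply: h2 => //; rewrite eq_sym.
rewrite sumr_const card_ord -[_ *+ m]mulr_natr.
have -> : B * (e / (B * m.+1%:R)) * m%:R = e * (m%:R / m.+1%:R).
  have hm : (m.+1%:R : R) != 0 by rewrite pnatr_eq0.
  have hB : B != 0 by rewrite lt0r_neq0.
  by move: (m.+1%:R) hm => M hM; field; rewrite ?hM ?hB.
by rewrite -[ltRHS]mulr1 ltr_pM2l// ltr_pdivrMr// mul1r ltr_nat.
Qed.

End AbsvEquiv.

(** * Number fields and their embeddings *)

Section NumberField.
Variable K : fieldExtType rat.
Let n := \dim {:K}.

Lemma primitive_element : exists theta : K, <<1; theta>>%VS = fullv.
Proof.
have sep : separable 1%VS {:K}%VS.
  apply/separableP => y _; apply: pcharf0_separable => p.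
  apply/negP => /andP[pp /eqP h]; have : (p%:R : rat)%:A = 0 :> K.
    by rewrite scaler_nat h.
  by move/eqP; rewrite scaler_eq0 oner_eq0 orbF pnatr_eq0; case: p pp {h}.
exists (separable_generator 1%VS {:K}%VS).
by rewrite -eq_adjoin_separable_generator ?sub1v.
Qed.

Let ev (theta : K) (q : {poly rat}) := (map_poly (in_alg K) q).[theta].

Lemma primitive_eval : exists (theta : K) (mu : {poly rat}), [/\
  forall x, exists2 q : {poly rat}, (size q <= n)%N & ev theta q = x,
  forall q : {poly rat}, (size q <= n)%N -> ev theta q = 0 -> q = 0,
  size mu = n.+1 /\ separable_poly mu &
  forall q : {poly rat}, ev theta q = 0 -> mu %| q].
Proof.
have [theta gen] := primitive_element; exists theta.
have deg : adjoin_degree 1 theta = n.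
  by have := dim_Fadjoin 1%AS theta; rewrite gen dimv1 muln1 => <-.
have /polyOver1P[mu hmu] := minPolyOver 1%AS theta.
exists mu; split.
- move=> x; have hx : x \in <<1; theta>>%VS by rewrite gen memvf.
  have /polyOver1P[q hq] := Fadjoin_polyOver 1%VS theta x.
  exists q; last by rewrite /ev -hq; exact: (@Fadjoin_poly_eq _ _ 1%AS).
  by rewrite -(size_map_poly (in_alg K)) -hq -deg size_Fadjoin_poly.
- move=> q sq q0; apply/eqP; rewrite -(map_poly_eq0 (in_alg K)).
  rewrite -(@root_small_adjoin_poly _ _ 1%AS theta).
  + exact/eqP.
  + by apply/polyOver1P; exists q.
  + by rewrite size_map_poly deg.
- split.
    by rewrite -(size_map_poly (in_alg K)) -hmu size_minPoly deg.
  rewrite -(separable_map (in_alg K)) -hmu.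
  apply: (@pcharf0_separable _ _ 1%AS) => p.
  apply/negP => /andP[pp /eqP h]; have : (p%:R : rat)%:A = 0 :> K.
    by rewrite scaler_nat h.
  by move/eqP; rewrite scaler_eq0 oner_eq0 orbF pnatr_eq0; case: p pp {h}.
- move=> q q0; rewrite -(dvdp_map (in_alg K)) -hmu.
  apply: minPoly_dvdp; first by apply/polyOver1P; exists q.
  exact/eqP.
Qed.

(** The basis consists of powers of a primitive element and serves for every Om. The conjugates of
    an element are its coordinates multiplied by the Vandermonde matrix of the roots of the minimal
    polynomial; B comes from the inverse matrix. Coordinates and conjugates thus control each
    other. *)
Theorem embeddings : exists e : 'I_n -> K, [/\
  forall a : 'I_n -> rat, \sum_i a i *: e i = 0 -> forall i, a i = 0,
  forall x, exists a : 'I_n -> rat, x = \sum_i a i *: e i &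
  forall Om : numClosedFieldType, exists (s : 'I_n -> {rmorphism K -> Om}) (B : 'I_n -> 'I_n -> Om),
    forall (a : 'I_n -> rat) i, ratr (a i) = \sum_j B i j * s j (\sum_k a k *: e k)].
Proof.
have [theta [mu [hex huniq [smu sepmu] hdvd]]] := primitive_eval.
exists (fun i => theta ^+ i).
have evE (a : 'I_n -> rat) (q : {poly rat}) : (size q <= n)%N -> (forall i : 'I_n, q`_i = a i) -> ev theta q = \sum_i a i *: theta ^+ i.
  move=> sq qa; rewrite /ev (horner_coef_wide _ (n := n)) ?size_map_poly//.
  by apply: eq_bigr => i _; rewrite coef_map qa /= mulr_algl.
pose mk (a : 'I_n -> rat) : {poly rat} := \poly_(k < n) (if insub k is Some i then a i else 0).
have mkE a (i : 'I_n) : (mk a)`_i = a i by rewrite coef_poly ltn_ord valK.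
have smk a : (size (mk a) <= n)%N by exact: size_poly.
split.
- move=> a h i; rewrite -mkE (huniq (mk a)) ?coef0//.
  by rewrite (evE a).
- move=> x; have [q sq qx] := hex x; exists (fun i => q`_i).
  by rewrite -qx; exact: evE.
move=> Om.
have [r hr] := closed_field_poly_normal (map_poly (ratr : rat -> Om) mu).
have lc0 : lead_coef (map_poly (ratr : rat -> Om) mu) != 0.
  by rewrite lead_coef_eq0 map_poly_eq0 -size_poly_eq0 smu.
have sr : size r = n.
  have : size (map_poly (ratr : rat -> Om) mu) = n.+1 by rewrite size_map_poly.
  by rewrite hr size_scale// size_prod_XsubC => -[].
have ur : uniq r.
  rewrite -separable_prod_XsubC.
  have := sepmu; rewrite -(separable_map (ratr : {rmorphism rat -> Om})) hr.
  by rewrite (eqp_separable (eqp_scale _ lc0)).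
have rootr j : (j < n)%N -> root (map_poly (ratr : rat -> Om) mu) (r`_j).
  by move=> jn; rewrite hr rootZ// root_prod_XsubC mem_nth// sr.
have hex' x : exists q, ev theta q = x by have [q _ e] := hex x; exists q.
have [q hq] := choice hex'.
have evD a b : ev theta (a - b) = ev theta a - ev theta b by rewrite /ev rmorphB hornerD hornerN.
have evM a b : ev theta (a * b) = ev theta a * ev theta b by rewrite /ev rmorphM hornerM.
have ev1 : ev theta 1 = 1 by rewrite /ev rmorph1 hornerC.
pose sv (z : Om) (p : {poly rat}) := (map_poly (ratr : rat -> Om) p).[z].
have svD z a b : sv z (a - b) = sv z a - sv z b by rewrite /sv rmorphB hornerD hornerN.
have svM z a b : sv z (a * b) = sv z a * sv z b by rewrite /sv rmorphM hornerM.
have sv1 z : sv z 1 = 1 by rewrite /sv rmorph1 hornerC.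
have svE z p p' : root (map_poly (ratr : rat -> Om) mu) z -> ev theta p = ev theta p' -> sv z p = sv z p'.
  move=> rz e; apply/eqP; rewrite -subr_eq0 -svD; apply/eqP.
  have /hdvd/dvdpP[t ->] : ev theta (p - p') = 0 by rewrite evD e subrr.
  by rewrite svM /sv (rootP rz) mulr0.
have sex (j : 'I_n) : exists s : {rmorphism K -> Om}, forall p, s (ev theta p) = sv r`_j p.
  have rj := rootr j (ltn_ord j).
  pose f x := sv r`_j (q x).
  have fE p : f (ev theta p) = sv r`_j p by apply: svE => //; rewrite hq.
  have fB : zmod_morphism f.
    by move=> x y; rewrite -{1}(hq x) -{1}(hq y) -evD fE svD.
  have fM : monoid_morphism f.
    split; first by rewrite -ev1 fE sv1.
    by move=> x y; rewrite -{1}(hq x) -{1}(hq y) -evM fE svM.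
  pose F : {rmorphism K -> Om} := HB.pack f (GRing.isZmodMorphism.Build K Om f fB) (GRing.isMonoidMorphism.Build K Om f fM).
  by exists F.
have [s hs] := choice sex.
pose V := Vandermonde n (\row_(j < n) r`_j).
have uV : V \in unitmx.
  rewrite unitmxE unitfE det_Vandermonde; apply/prodf_neq0 => i _; apply/prodf_neq0 => j ij.
  rewrite !mxE subr_eq0 nth_uniq ?sr//; apply: contraTneq ij => ->; by rewrite ltnn.
exists s, (fun i j => (invmx V) j i) => a i.
rewrite -(evE a (mk a))//.
have key : \row_j s j (ev theta (mk a)) = (\row_k ratr (a k)) *m V.
  apply/rowP => j; rewrite !mxE hs /sv (horner_coef_wide _ (n := n)) ?size_map_poly//.
  by apply: eq_bigr => k _; rewrite coef_map mkE !mxE.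
have := congr1 (fun M => (M *m invmx V) 0 i) key; rewrite mulmxK// !mxE => <-.
by apply: eq_bigr => j _; rewrite !mxE mulrC.
Qed.

End NumberField.

(* A subring A of algC that is maximal among those not containing 1 / l is a valuation ring. Up to
   units of A, each x != 0 satisfies x^m l^b = l^a, and the valuation of x is (a - b) / m. *)
Section Chevalley.
Variable l : nat.
Hypothesis l_prime : prime l.
Local Notation L := (l%:R : algC).

Lemma natl_neq0 : L != 0.
Proof. by rewrite pnatr_eq0 -lt0n prime_gt0. Qed.

(** 1 is only asked to belong to A when A has elements, so that the union of an empty chain is still
    avoiding. *)
Definition avoiding (A : set algC) : Prop :=
  (forall x y, A x -> A y -> [/\ A 1, A (x - y) & A (x * y)]) /\ ~ A L^-1.

Lemma maximal_avoiding : exists A, [/\ avoiding A, A 1 & forall B, A `<` B -> ~ avoiding B].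
Proof.
have [] := @Zorn_bigcup algC avoiding.
  move=> F hF tot; split=> [x y [X FX Xx] [Y FY Yy]|[X FX]]; last by have [_] := hF X FX.
  have [XY|YX] := tot X Y FX FY.
    have [/(_ x y (XY _ Xx) Yy)[h1 h2 h3] _] := hF Y FY.
    by split; exists Y.
  have [/(_ x y Xx (YX _ Yy))[h1 h2 h3] _] := hF X FX.
  by split; exists X.
move=> A [hA mA]; exists A; split=> //.
(* A maximal A without 1 would be empty, and the ring of integers would enlarge it. *)
apply: contrapT => nA1.
have A0 x : ~ A x by move=> Ax; apply: nA1; have [/(_ x x Ax Ax)[]] := hA.
apply: (mA [set x | x \is a Num.int]).
  split; first by move=> x /A0.
  by move=> /(_ 1 (rpred1 _))/A0.
split=> [x y xi yi|]; first by split; rewrite /= ?rpred1 ?rpredB ?rpredM.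
move=> /= /intrP[m hm]; have : (l%:R * L^-1 : algC) = 1 by rewrite divff// natl_neq0.
rewrite hm => /eqP; rewrite -[l%:R]/((l%:Z)%:~R) -rmorphM /= (eqr_int _ _ 1) => /eqP h.
have := prime_gt1 l_prime; have := congr1 absz h; rewrite abszM /= => /eqP.
by rewrite muln_eq1 => /andP[/eqP-> _].
Qed.

Variable A : set algC.
Hypothesis avA : avoiding A.
Hypothesis A1 : A 1.
Hypothesis maxA : forall B, A `<` B -> ~ avoiding B.

Lemma avB x y : A x -> A y -> A (x - y).
Proof. by move=> hx hy; have [/(_ x y hx hy)[]] := avA. Qed.
Lemma avM x y : A x -> A y -> A (x * y).
Proof. by move=> hx hy; have [/(_ x y hx hy)[]] := avA. Qed.
Lemma av0 : A 0. Proof. by rewrite -(subrr 1); exact: avB. Qed.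
Lemma avN x : A x -> A (- x). Proof. by move=> hx; rewrite -sub0r; apply: avB => //; exact: av0. Qed.
Lemma avD x y : A x -> A y -> A (x + y).
Proof. by move=> hx hy; rewrite -[y]opprK; apply: avB => //; exact: avN. Qed.
Lemma avX x k : A x -> A (x ^+ k).
Proof. by move=> hx; elim: k => [|k IH]; rewrite ?expr0// exprS; exact: avM. Qed.
Lemma av_nat m : A m%:R.
Proof. by elim: m => [|m IH]; [exact: av0 | rewrite -natr1; exact: avD]. Qed.
Lemma av_sum (I : Type) (r : seq I) (P : pred I) F : (forall i, P i -> A (F i)) -> A (\sum_(i <- r | P i) F i).
Proof. by move=> h; apply: (big_ind A) => //; [exact: av0 | exact: avD]. Qed.
Lemma av_linv : ~ A L^-1. Proof. by have [_] := avA. Qed.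

Lemma av_extend (B : set algC) x : A `<=` B -> B x ->
  (forall x y, B x -> B y -> [/\ B 1, B (x - y) & B (x * y)]) -> ~ A x -> B L^-1.
Proof.
move=> AB Bx hB nAx; apply: contrapT => nB; apply: (@maxA B) => //.
by split=> // BA; apply: nAx; exact: BA.
Qed.

(** If s = 1 - L b were not a unit, A[1/s] would contain 1/L, that is, s^k / L would lie in A for
    some k. Since s^k = 1 - L b' with b' in A, so would 1/L. *)
Lemma av_unit b : A b -> A (1 - L * b)^-1.
Proof.
move=> Ab; apply: contrapT => ns; pose s := 1 - L * b.
have As : A s by apply: avB => //; apply: avM => //; exact: av_nat.
have s0 : s != 0.
  apply/eqP => h; apply: av_linv; suff <- : b = L^-1 by [].
  by apply: (mulfI natl_neq0); rewrite divff ?natl_neq0//; apply/eqP; rewrite eq_sym -subr_eq0; apply/eqP.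
pose B := [set y : algC | exists c k, A c /\ y = c / s ^+ k].
have : B L^-1.
  apply: (@av_extend B s^-1) => //.
  - by move=> c Ac; exists c, 0%N; rewrite expr0 divr1.
  - by exists 1, 1%N; rewrite expr1 div1r.
  move=> x y [c [k [Ac ->]]] [d [m [Ad ->]]]; split.
  - by exists 1, 0%N; rewrite expr0 divr1.
  - exists (c * s ^+ m - d * s ^+ k), (k + m)%N; split.
      by apply: avB; apply: avM => //; exact: avX.
    by rewrite exprD; field; rewrite !expf_neq0.
  - exists (c * d), (k + m)%N; split; first exact: avM.
    by rewrite exprD; field; rewrite !expf_neq0.
move=> [c [k [Ac hc]]].
have [b' Ab' hb'] : exists2 b', A b' & s ^+ k = 1 - L * b'.
  elim: (k) => [|j [b' Ab' IH]]; first by exists 0; [exact: av0 | rewrite expr0 mulr0 subr0].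
  exists (b + b' - L * b * b').
    by apply: avB; [exact: avD | apply: avM => //; apply: avM => //; exact: av_nat].
  by rewrite exprS IH /s; ring.
apply: av_linv; suff -> : L^-1 = c + b' by exact: avD.
have sk0 : s ^+ k != 0 by rewrite expf_neq0.
have : s ^+ k * L^-1 = c by rewrite hc mulrC divfK.
rewrite hb' mulrBl mul1r mulrAC divff ?natl_neq0// mul1r => <-; ring.
Qed.

Definition Apoly (p : {poly algC}) := forall i, A p`_i.

Lemma not_adjoin x : ~ A x -> exists2 p, Apoly p & p.[x] = L^-1.
Proof.
move=> nAx.
have : [set y | exists2 p, Apoly p & p.[x] = y] L^-1; last by [].
apply: (@av_extend _ x) => //.
- move=> c Ac; exists c%:P; last by rewrite hornerC.
  by move=> i; rewrite coefC; case: ifP => // _; exact: av0.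
- exists 'X; last by rewrite hornerX.
  by move=> i; rewrite coefX; case: eqP => _ //; exact: av0.
move=> _ _ [p Ap <-] [q Aq <-]; split.
- exists 1; last by rewrite hornerC.
  by move=> i; rewrite coef1; case: eqP => _ //; exact: av0.
- exists (p - q); last by rewrite hornerD hornerN.
  by move=> i; rewrite coefB; exact: avB.
- exists (p * q); last by rewrite hornerM.
  by move=> i; rewrite coefM; apply: av_sum => j _; exact: avM.
Qed.

(** Chevalley's descent on the sum of the degrees. If deg q <= deg p = n, the relation q(1/x) = 1/L
    expresses x^n by lower powers of x, because 1 - L q_0 is a unit; substituting it in p lowers the
    degree of p. *)
Lemma no_two_sided x p q : x != 0 -> Apoly p -> Apoly q -> p.[x] = L^-1 -> q.[x^-1] = L^-1 -> False.
Proof.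
move: {2}(size p + size q)%N (leqnn (size p + size q)) => N.
elim: N x p q => [|N IH] x p q.
  rewrite leqn0 addn_eq0 => /andP[/eqP sp _] _ _ _ /esym.
  have -> : p = 0 by apply/eqP; rewrite -size_poly_eq0 sp.
  rewrite horner0 => /eqP.
  by rewrite invr_eq0 (negPf natl_neq0).
move=> sN x0 Ap Aq px qx.
wlog le : x p q sN x0 Ap Aq px qx / (size q <= size p)%N.
  move=> H; have [le|lt] := leqP (size q) (size p); first exact: (H x p q).
  apply: (H x^-1 q p) => //; rewrite ?invr_eq0 ?invrK 1?addnC//; exact: ltnW.
have [q1|q1] := leqP (size q) 1.
  apply: av_linv; rewrite -qx (size1_polyC q1) hornerC.
  exact: Aq.
pose n := (size p).-1; pose m := (size q).-1.
have sp : size p = n.+1 by rewrite prednK//; lia.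
have sq : size q = m.+1 by rewrite prednK//; lia.
have mn : (m <= n)%N by lia.
have n0 : (0 < m)%N by rewrite -ltnS -sq.
pose u := (1 - L * q`_0)^-1.
have Au : A u by apply: av_unit.
have u0 : 1 - L * q`_0 != 0.
  apply/eqP => h; apply: av_linv; suff <- : q`_0 = L^-1 by [].
  by apply: (mulfI natl_neq0); rewrite divff ?natl_neq0//; apply/eqP; rewrite eq_sym -subr_eq0; apply/eqP.
(* t is the polynomial of degree less than n with t(x) = x^n. *)
pose t : {poly algC} := \sum_(j < m) (L * u * q`_j.+1) *: 'X^(n - j.+1).
have tx : t.[x] = x ^+ n.
  have : q.[x^-1] = q`_0 + \sum_(j < m) q`_j.+1 * x^-1 ^+ j.+1.
    by rewrite (horner_coef_wide _ (n := m.+1)) ?sq// big_ord_recl expr0 mulr1.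
  rewrite qx => e.
  have e2 : 1 - L * q`_0 = L * \sum_(j < m) q`_j.+1 * x^-1 ^+ j.+1.
    move: (congr1 (fun z => L * z) e); rewrite divff ?natl_neq0// mulrDr => h.
    by rewrite [X in X - _]h addrC addKr.
  rewrite /t horner_sum (eq_bigr (fun j : 'I_m => (L * u * x ^+ n) * (q`_j.+1 * x^-1 ^+ j.+1))); last first.
    move=> j _; rewrite hornerZ hornerXn exprVn.
    have -> : x ^+ n = x ^+ (n - j.+1) * x ^+ j.+1 by rewrite -exprD subnK// (leq_trans _ mn).
    by field; rewrite expf_neq0.
  rewrite -mulr_sumr; set S := \sum_(j < m) _ in e2 *.
  rewrite (_ : L * u * x ^+ n * S = u * (L * S) * x ^+ n); last by ring.
  by rewrite -e2 mulVf// mul1r.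
pose p' := \poly_(i < n) p`_i + p`_n *: t.
have At : Apoly t.
  move=> i; rewrite /t coef_sum; apply: av_sum => j _; rewrite coefZ coefXn.
  apply: avM; last by case: eqP => _ //; exact: av0.
  by apply: avM => //; apply: avM => //; exact: av_nat.
apply: (IH x p' q) => //.
- have st : (size t <= n)%N.
    apply: (leq_trans (size_sum _ _ _)); apply/bigmax_leqP => j _.
    by apply: leq_trans (size_scale_leq _ _) _; rewrite size_polyXn; have := ltn_ord j; lia.
  have : (size p' <= n)%N.
    apply: leq_trans (size_polyD _ _) _; rewrite geq_max size_poly /=.
    exact: leq_trans (size_scale_leq _ _) st.
  by move=> ?; move: sN; rewrite sp; lia.
- move=> i; rewrite coefD coefZ coef_poly; apply: avD; last by apply: avM.
  by case: ifP => _ //; exact: av0.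
- rewrite -px /p' hornerD hornerZ tx horner_poly [RHS](horner_coef_wide _ (n := n.+1)) ?sp//.
  by rewrite big_ord_recr.
Qed.

Lemma av_valuation x : A x \/ A x^-1.
Proof.
have [->|x0] := eqVneq x 0; first by left; exact: av0.
apply: contrapT => h.
have [p Ap px] := @not_adjoin x ltac:(by move=> h'; apply: h; left).
have [q Aq qx] := @not_adjoin x^-1 ltac:(by move=> h'; apply: h; right).
exact: (no_two_sided x0 Ap Aq px qx).
Qed.

(** For nonzero x and y: equality up to a unit of A, that is, equality of valuations. *)
Definition aeq (x y : algC) := A (x / y) /\ A (y / x).

Lemma aeq_refl x : x != 0 -> aeq x x. Proof. by move=> x0; rewrite /aeq divff. Qed.
Lemma aeq_sym x y : aeq x y -> aeq y x. Proof. by case. Qed.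
Lemma aeqM x y x' y' : aeq x y -> aeq x' y' -> aeq (x * x') (y * y').
Proof.
by move=> [a b] [c d]; split; [rewrite invfM mulrACA; exact: avM | rewrite invfM mulrACA; exact: avM].
Qed.
Lemma aeqX x y k : aeq x y -> aeq (x ^+ k) (y ^+ k).
Proof. by move=> [a b]; split; rewrite -exprVn -exprMn; exact: avX. Qed.
Lemma aeq_trans y x z : y != 0 -> aeq x y -> aeq y z -> aeq x z.
Proof.
move=> y0 [a b] [c d]; split.
  by have := avM a c; rewrite mulrA divfK.
by have := avM d b; rewrite mulrA divfK.
Qed.

Lemma aeq_l a b : aeq (L ^+ a) (L ^+ b) -> a = b.
Proof.
have aux i j : (i < j)%N -> ~ aeq (L ^+ i) (L ^+ j).
  move=> ij [h _]; apply: av_linv.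
  have -> : L^-1 = L ^+ (j - i).-1 * (L ^+ i / L ^+ j).
    have -> : L ^+ j = L ^+ i * (L * L ^+ (j - i).-1).
      by rewrite -exprS prednK ?subn_gt0// -exprD subnKC// ltnW.
    by field; rewrite natl_neq0 !expf_neq0 ?natl_neq0.
  by apply: avM => //; apply: avX; exact: av_nat.
move=> h; have [ab|ba|//] := ltngtP a b; first by case: (aux _ _ ab).
by case: (aux _ _ ba); exact: aeq_sym.
Qed.

(** The part of m prime to l divides some 1 - L b by Bezout's theorem, and is a unit by
    [av_unit]. *)
Lemma nat_aeq m : (0 < m)%N -> exists a, aeq m%:R (L ^+ a).
Proof.
move=> m0; have [/= m' cm e] := pfactor_coprime l_prime m0.
exists (logn l m); move: (logn l m) e => j e; rewrite e natrM natrX -[X in aeq _ X]mul1r.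
apply: aeqM; last by apply: aeq_refl; rewrite expf_neq0 ?natl_neq0.
have m'0 : (0 < m')%N by move: m0; rewrite e muln_gt0 => /andP[].
split; first by rewrite divr1; exact: av_nat.
have [c d hc hd] := egcdnP l m'0; rewrite gcdnC (eqP cm) in hc.
rewrite div1r.
have e2 : (c%:R * m'%:R : algC) = 1 - L * (- d%:R).
  by rewrite -natrM hc natrD natrM; ring.
have m'n : (m'%:R : algC) != 0 by rewrite pnatr_eq0 -lt0n.
have c0 : (c%:R : algC) != 0.
  by rewrite pnatr_eq0; apply/eqP => h; move: hc; rewrite h mul0n addn1.
have -> : (m'%:R : algC)^-1 = c%:R * (c%:R * m'%:R)^-1 by rewrite invfM mulrA divff// mul1r.
apply: avM; first exact: av_nat.
by rewrite e2; apply: av_unit; apply: avN; exact: av_nat.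
Qed.

Lemma aeqN x y : aeq x y -> aeq (- x) y.
Proof. by move=> [a b]; split; rewrite ?invrN ?mulrN ?mulNr; exact: avN. Qed.

Lemma rat_aeq (r : rat) : r != 0 -> exists a b, aeq (ratr r * L ^+ b) (L ^+ a).
Proof.
move=> r0; have n0 : (0 < `|numq r|)%N by rewrite absz_gt0 numq_eq0.
have d0 : (0 < `|denq r|)%N by rewrite absz_gt0 denq_neq0.
have [a ha] := nat_aeq n0; have [b hb] := nat_aeq d0.
exists a, b.
have hn : aeq (numq r)%:~R (L ^+ a).
  have [e|e] : (numq r)%:~R = (`|numq r|%N)%:R :> algC \/ (numq r)%:~R = - (`|numq r|%N)%:R :> algC.
    by case: (intP (numq r)) => [|k|k]; [left | left | right; rewrite abszN rmorphN].
    by rewrite e.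
  by rewrite e; exact: aeqN.
have hd : aeq (denq r)%:~R (L ^+ b) by rewrite -absz_denq.
have dn : ((denq r)%:~R : algC) != 0 by rewrite intr_eq0 denq_neq0.
have lb : L ^+ b != 0 by rewrite expf_neq0 ?natl_neq0.
have -> : L ^+ a = (L ^+ a / L ^+ b) * L ^+ b by rewrite divfK.
apply: aeqM; last exact: aeq_refl.
rewrite /ratr; apply: aeqM => //.
by case: hd => h1 h2; split; rewrite invrK mulrC.
Qed.

(** The maximal ideal of the valuation ring A. *)
Definition mm z := z = 0 \/ ~ A z^-1.

Lemma mm_A z : mm z -> A z.
Proof. by move=> [->|h]; [exact: av0 | case: (av_valuation z)]. Qed.

Lemma mmM a z : A a -> mm z -> mm (a * z).
Proof.
move=> Aa [->|h]; first by left; rewrite mulr0.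
have [->|a0] := eqVneq a 0; first by left; rewrite mul0r.
right=> h2; apply: h; have := avM Aa h2.
by rewrite invfM mulrA divff// mul1r.
Qed.

Lemma mmD x y : mm x -> mm y -> mm (x + y).
Proof.
move=> mx my; have [->|x0] := eqVneq x 0; first by rewrite add0r.
have [->|y0] := eqVneq y 0; first by rewrite addr0.
have [h|h] := av_valuation (x / y).
  have -> : x + y = (x / y + 1) * y by field.
  by apply: mmM => //; exact: avD.
have -> : x + y = ((x / y)^-1 + 1) * x by field; rewrite x0 y0.
by apply: mmM => //; exact: avD.
Qed.

Lemma mm_unit z : mm z -> 1 + z != 0.
Proof.
move=> h; apply/eqP => e; have {}e : z = -1 by apply/eqP; rewrite -addr_eq0 addrC e.
case: h => [z0|]; last by rewrite e invrN invr1; apply; exact: avN.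
by move: z0; rewrite e => /eqP; rewrite oppr_eq0 oner_eq0.
Qed.

(** A sum of terms of pairwise distinct valuations equals its dominant term up to a factor in 1 +
    [mm]; in particular it is not zero. *)
Lemma dominant (t : nat -> algC) (s : seq nat) : uniq s -> (forall i, i \in s -> t i != 0) ->
  (forall i j, i \in s -> j \in s -> i != j -> ~ aeq (t i) (t j)) -> s != [::] ->
  exists i m, [/\ i \in s, mm m & \sum_(k <- s) t k = t i * (1 + m)].
Proof.
elim: s => [//|i s IH] /= /andP[is_ us] t0 na _.
have [s0|sn] := eqVneq s [::].
  by exists i, 0; rewrite s0 big_seq1 addr0 mulr1 mem_head; split=> //; left.
have [||j [m [js hm e]]] := IH us _ _ sn.
- by move=> k ks; apply: t0; rewrite inE ks orbT.
- by move=> k k' ks ks'; apply: na; rewrite inE ?ks ?ks' orbT.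
have ij : i != j by apply: contraNneq is_ => ->.
have js' : j \in i :: s by rewrite inE js orbT.
have nij := na i j (mem_head _ _) js' ij.
have ti := t0 i (mem_head _ _); have tj := t0 j js'.
rewrite big_cons e; have [h|h] := pselect (A (t j / t i)).
  have m1 : mm (t j / t i).
    by right => h2; apply: nij; split=> //; move: h2; rewrite invfM invrK mulrC.
  exists i, (t j / t i * (1 + m)); split; first exact: mem_head.
    by rewrite mulrC; apply: mmM => //; apply: avD => //; exact: mm_A.
  by field.
exists j, (m + t i / t j); split=> //.
  by apply: mmD => //; right; rewrite invfM invrK mulrC.
by field.
Qed.

(** By [dominant], two terms of the vanishing sum p(x), for p the minimal polynomial of x, agree up
    to a unit. Their quotient is a rational number times x^(j - i), and a rational number is a power
    of l up to a unit. *)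
Lemma power_aeq x : x != 0 -> exists m a b, (0 < m)%N /\ aeq (x ^+ m * L ^+ b) (L ^+ a).
Proof.
move=> x0; have [p [_ mp rp]] := minCpolyP x.
have p0 : root (map_poly ratr p) x by rewrite rp dvdpp.
pose t i : algC := ratr p`_i * x ^+ i.
pose s := [seq i <- iota 0 (size p) | p`_i != 0].
have st : \sum_(k <- s) t k = 0.
  transitivity ((map_poly (ratr : rat -> algC) p).[x]); last exact/rootP.
  rewrite big_filter horner_coef size_map_poly -(big_mkord xpredT (fun i => (map_poly ratr p)`_i * x ^+ i)).
  have h0 : \sum_(i <- iota 0 (size p) | ~~ (p`_i != 0)) (map_poly ratr p)`_i * x ^+ i = 0.
    have e0 : ratr 0 = 0 :> algC by exact: rmorph0.
    by apply: big1 => i /negPn/eqP h; rewrite coef_map /= h e0 mul0r.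
  rewrite /index_iota subn0 [RHS](bigID (fun i => p`_i != 0))/= h0 addr0.
  by apply: eq_bigr => i _; rewrite coef_map.
have ts i : i \in s -> t i != 0.
  by rewrite mem_filter => /andP[h _]; rewrite mulf_neq0 ?expf_neq0// fmorph_eq0.
have sn : s != [::].
  have : (size p).-1 \in s.
    by rewrite mem_filter mem_iota add0n /= -lead_coefE lead_coef_eq0 monic_neq0// prednK ?leqnn// size_poly_gt0 monic_neq0.
  by case: (s).
have lx k : L ^+ k != 0 by rewrite expf_neq0 ?natl_neq0.
have [i [j [is_ js ij hij]]] : exists i j, [/\ i \in s, j \in s, (i < j)%N & aeq (t i) (t j)].
  apply: contrapT => h.
  have us : uniq s by rewrite filter_uniq ?iota_uniq.
  have hn i j : i \in s -> j \in s -> i != j -> ~ aeq (t i) (t j).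
    move=> is_ js; rewrite neq_ltn => /orP[] ij hij; apply: h; first by exists i, j.
    by exists j, i; split=> //; exact: aeq_sym.
  have [i [m [is_ hm]]] := dominant us ts hn sn.
  by rewrite st => /esym/eqP; rewrite mulf_eq0 (negPf (ts i is_)) (negPf (mm_unit hm)).
have pn k : k \in s -> p`_k != 0 by rewrite mem_filter => /andP[].
have [a [b hab]] := rat_aeq (pn i is_); have [c [d hcd]] := rat_aeq (pn j js).
have pr k : k \in s -> (ratr p`_k : algC) != 0 by move=> /pn ?; rewrite fmorph_eq0.
exists (j - i)%N, (a + d)%N, (c + b)%N; rewrite subn_gt0; split=> //.
have h1 : aeq (L ^+ (c + b) * x ^+ j) (t j * L ^+ (b + d)).
  have := aeqM (aeq_sym hcd) (aeq_refl (mulf_neq0 (lx b) (expf_neq0 j x0))).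
  by rewrite /t !exprD; congr aeq; ring.
have h2 : aeq (t i * L ^+ (b + d)) (L ^+ (a + d) * x ^+ i).
  have := aeqM hab (aeq_refl (mulf_neq0 (lx d) (expf_neq0 i x0))).
  by rewrite /t !exprD; congr aeq; ring.
have h3 := aeqM (aeq_sym hij) (aeq_refl (lx (b + d)%N)).
have n1 : t j * L ^+ (b + d) != 0 by rewrite mulf_neq0// ts.
have n2 : t i * L ^+ (b + d) != 0 by rewrite mulf_neq0// ts.
have h4 := aeq_trans n2 (aeq_trans n1 h1 h3) h2.
have xi : x ^+ i != 0 by rewrite expf_neq0.
have := aeqM h4 (aeq_refl (invr_neq0 xi)).
have -> : x ^+ j = x ^+ (j - i) * x ^+ i by rewrite -exprD subnK// ltnW.
by congr aeq; rewrite -?mulrA ?divff// ?mulr1//; ring.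
Qed.

Variable R : realType.

Lemma power_aeq_choice x : exists mab : nat * nat * nat, x != 0 -> (0 < mab.1.1)%N /\ aeq (x ^+ mab.1.1 * L ^+ mab.2) (L ^+ mab.1.2).
Proof.
have [->|x0] := eqVneq x 0; first by exists (0,0,0)%N.
by have [m [a [b h]]] := power_aeq x0; exists (m, a, b).
Qed.

Let mab x := sval (cid (power_aeq_choice x)).
Let mabP x : x != 0 -> (0 < (mab x).1.1)%N /\
  aeq (x ^+ (mab x).1.1 * L ^+ (mab x).2) (L ^+ (mab x).1.2).
Proof. exact: svalP (cid (power_aeq_choice x)). Qed.

Definition ord_l x : R := ((mab x).1.2%:R - (mab x).2%:R) / (mab x).1.1%:R.

Lemma ord_unique x m a b : x != 0 -> (0 < m)%N -> aeq (x ^+ m * L ^+ b) (L ^+ a) ->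
  ord_l x = (a%:R - b%:R) / m%:R.
Proof.
move=> x0 m0 h; rewrite /ord_l; case: (mab x) (mabP x0) => -[m' a'] b' /= [m'0 h'].
have lx k : L ^+ k != 0 by rewrite expf_neq0 ?natl_neq0.
have e : (a * m' + b' * m = a' * m + b * m')%N.
  apply: aeq_l; apply: (@aeq_trans (x ^+ (m * m') * L ^+ (b * m' + b' * m))).
  - by rewrite mulf_neq0// expf_neq0.
  - have := aeqM (aeqX m' (aeq_sym h)) (aeq_refl (lx (b' * m)%N)).
    by rewrite exprMn -!exprM !exprD mulrA.
  - have := aeqM (aeqX m h') (aeq_refl (lx (b * m')%N)).
    by congr aeq; rewrite ?exprMn -?exprM ?exprD ?[(m' * m)%N]mulnC; ring.
have mR : (m%:R : R) != 0 by rewrite pnatr_eq0 -lt0n.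
have mR' : (m'%:R : R) != 0 by rewrite pnatr_eq0 -lt0n.
apply/eqP; rewrite eqr_div//; apply/eqP.
have := congr1 (fun k => k%:R : R) e; rewrite !natrD !natrM; lra.
Qed.

Lemma ordM x y : x != 0 -> y != 0 -> ord_l (x * y) = ord_l x + ord_l y.
Proof.
move=> x0 y0; rewrite {2 3}/ord_l.
case: (mab x) (mabP x0) => -[m a] b /= [m0 h].
case: (mab y) (mabP y0) => -[m' a'] b' /= [m'0 h'].
rewrite (@ord_unique _ (m * m') (a * m' + a' * m) (b * m' + b' * m)) ?mulf_neq0 ?muln_gt0 ?m0//.
  have mR : (m%:R : R) != 0 by rewrite pnatr_eq0 -lt0n.
  have mR' : (m'%:R : R) != 0 by rewrite pnatr_eq0 -lt0n.
  by rewrite !natrD !natrM; field; rewrite mR mR'.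
have := aeqM (aeqX m' h) (aeqX m h'); congr aeq; last by rewrite exprD !exprM.
by rewrite !exprMn !exprD !exprM [(_ ^+ m') ^+ m]exprAC; ring.
Qed.

Lemma ord_A z : z != 0 -> A z -> 0 <= ord_l z.
Proof.
move=> z0 Az; rewrite /ord_l; case: (mab z) (mabP z0) => -[m a] b /= [m0 [h1 h2]].
rewrite divr_ge0// subr_ge0 ler_nat leqNgt; apply/negP => ab.
apply: av_linv.
have -> : L^-1 = z ^+ m * (L ^+ a / (z ^+ m * L ^+ b)) * L ^+ (b - a).-1.
  have -> : L ^+ b = L ^+ a * (L * L ^+ (b - a).-1) by rewrite -exprS prednK ?subn_gt0// -exprD subnKC// ltnW.
  by field; rewrite natl_neq0 !expf_neq0 ?natl_neq0.
by apply: avM; [apply: avM => //|]; apply: avX => //; exact: av_nat.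
Qed.

Let w x : R := if x == 0 then 0 else expR (- ord_l x).

Lemma ladic_aux : exists2 w : absvalue R algC, nonarchimedean w & w L < 1.
Proof.
have w_ge0 x : 0 <= w x by rewrite /w; case: ifP => // _; exact: expR_ge0.
have w_eq0 x : w x = 0 <-> x = 0.
  rewrite /w; case: eqP => [|h]; first by [].
  by split=> // e; have := expR_gt0 (- ord_l x); rewrite e ltxx.
have wM : {morph w : x y / x * y}.
  move=> x y; rewrite /w mulf_eq0; case: eqP => [_|/eqP x0] /=; first by rewrite mul0r.
  case: eqP => [_|/eqP y0] /=; first by rewrite mulr0.
  by rewrite ordM// opprD expRD.
have wA z : A z -> w z <= 1.
  rewrite /w; case: eqP => [//|/eqP z0] Az.
  by rewrite -expR0 ler_expR oppr_le0 ord_A.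
have wU x y : w (x + y) <= Num.max (w x) (w y).
  have [->|x0] := eqVneq x 0; first by rewrite add0r le_max lexx orbT.
  have [->|y0] := eqVneq y 0; first by rewrite addr0 le_max lexx.
  rewrite le_max; have [h|h] := av_valuation (x / y); apply/orP.
    right; have -> : x + y = (x / y + 1) * y by field.
    by rewrite wM ler_piMl//; apply: wA; exact: avD.
  left; have -> : x + y = ((x / y)^-1 + 1) * x by field; rewrite x0 y0.
  by rewrite wM ler_piMl//; apply: wA; exact: avD.
have wD x y : w (x + y) <= w x + w y.
  by apply: le_trans (wU x y) _; rewrite ge_max lerDl lerDr !w_ge0.
exists (Absvalue w_ge0 w_eq0 wM wD) => //=.
have e1 : ord_l L = 1.
  rewrite (@ord_unique _ 1 1 0) ?natl_neq0 ?subr0 ?divr1//.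
  by rewrite expr0 mulr1; apply: aeq_refl; rewrite expf_neq0 ?natl_neq0.
by rewrite /w (negPf natl_neq0) e1 -expR0 ltr_expR oppr_lt0.
Qed.

End Chevalley.

Theorem ladic_absvalue (R : realType) (l : nat) : prime l ->
  exists2 w : absvalue R algC, nonarchimedean w & w l%:R < 1.
Proof.
move=> pl; have [A [h1 h2 h3]] := maximal_avoiding pl.
exact: (@ladic_aux l pl A h1 h2 h3 R).
Qed.

(** * Primes as classes of absolute values *)

Section Primes.
Context {R : realType} {K : fieldType}.
Implicit Types p q : prime_of R K.

Lemma prime_equiv p v w : sval p v -> sval p w -> absv_equiv v w.
Proof.
case: p => C /= CP; have [u nu ->] := set_mem CP => /= uv uw.
exact: absv_equiv_trans (absv_equiv_sym uv) uw.
Qed.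

Lemma equiv_prime p v w : sval p v -> absv_equiv v w -> sval p w.
Proof.
case: p => C /= CP; have [u nu ->] := set_mem CP => /= uv vw.
exact: absv_equiv_trans uv vw.
Qed.

Lemma prime_eq p q v w : sval p v -> sval q w -> absv_equiv v w -> p = q.
Proof.
move=> pv qw vw; apply: val_inj; apply/seteqP; split=> u /= pu.
  by apply: (equiv_prime qw); exact: absv_equiv_trans (absv_equiv_sym vw) (prime_equiv pv pu).
by apply: (equiv_prime pv); exact: absv_equiv_trans vw (prime_equiv qw pu).
Qed.

Lemma equiv_nontrivial (v w : absvalue R K) : absv_equiv v w -> nontrivial_absv v -> nontrivial_absv w.
Proof.
move=> vw /nontrivial_lt1[x x0 x1]; exists x => //.
by rewrite lt_eqF// (dominates_lt1 (absv_equiv_dominates vw)).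
Qed.

Lemma prime_nontrivial p v : sval p v -> nontrivial_absv v.
Proof.
case: p => C /= CP; have [u nu ->] := set_mem CP => /= uv.
exact: equiv_nontrivial uv nu.
Qed.

Definition class_prime (v : absvalue R K) (nv : nontrivial_absv v) : prime_of R K :=
  exist _ [set w | absv_equiv v w] (mem_set (ex_intro2 _ _ v nv erefl)).

Lemma class_primeP v (nv : nontrivial_absv v) : sval (class_prime nv) v.
Proof. by []. Qed.

End Primes.

Lemma rmorph_ratA (K : fieldExtType rat) (Om : numFieldType) (s : {rmorphism K -> Om}) (q : rat) :
  s (q%:A) = ratr q.
Proof.
have -> : (q%:A : K) = (numq q)%:~R / (denq q)%:~R.
  by rewrite -{1}[q]divq_num_den -[_%:A]/(in_alg K _) rmorphM fmorphV !rmorph_int.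
by rewrite rmorphM fmorphV !rmorph_int.
Qed.

(** * The primes of K above a place of Q *)

Section Above.
Context {R : realType} {K : fieldExtType rat}.
Let n := \dim {:K}.
Context (e : 'I_n -> K).
Hypothesis span : forall x, exists a : 'I_n -> rat, x = \sum_i a i *: e i.
Context {Om : numClosedFieldType} (w : absvalue R Om).
Context (s : 'I_n -> {rmorphism K -> Om}) (B : 'I_n -> 'I_n -> Om).
Hypothesis sB : forall (a : 'I_n -> rat) i, ratr (a i) = \sum_j B i j * s j (\sum_k a k *: e k).
Context (Kc : forall p : prime_of R K, completion p).

Definition prime_absv p := absv_pullback (compl_absv (Kc p)) (compl_emb (Kc p)).

Lemma prime_absvP p : sval p (prime_absv p). Proof. exact: compl_prime. Qed.

Definition ratw := absv_pullback w (ratr : {rmorphism rat -> Om}).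

(** When [ratw] is nontrivial this one-sided condition amounts to the equivalence of [ratw] with the
    restriction of v to Q; see [over_equiv_rat]. *)
Definition over (v : absvalue R K) := dominates ratw (absv_pullback v (in_alg K)).

Hypothesis nw : nontrivial_absv ratw.

Lemma over_conj j : over (absv_pullback w (s j)).
Proof.
by move=> d d0; exists d => // x; rewrite /= rmorph_ratA.
Qed.

Lemma over_small v : over v -> forall d : R, 0 < d -> exists2 c : R, 0 < c &
  forall a : 'I_n -> rat, (forall i, ratw (a i) < c) -> v (\sum_i a i *: e i) < d.
Proof.
move=> ov d d0; pose M := 1 + \sum_i v (e i).
have M0 : 0 < M by rewrite ltr_pwDl// sumr_ge0// => i _; exact: absv_ge0.
have vM i : v (e i) <= M.
  rewrite /M (bigD1 i)//= addrCA lerDl addr_ge0// sumr_ge0// => *; exact: absv_ge0.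
have d1 : 0 < d / (M * n.+1%:R) by rewrite divr_gt0// mulr_gt0.
have [c c0 hc] := ov _ d1; exists c => // a ha.
apply: le_lt_trans (_ : \sum_(i < n) (d / (M * n.+1%:R) * M) < d).
  apply: le_trans (absv_sum _ _ _ _) _; apply: ler_sum => i _.
  rewrite -mulr_algl absvM; apply: ler_pM; rewrite ?absv_ge0//.
  exact: ltW (hc _ (ha i)).
rewrite sumr_const card_ord -[_ *+ n]mulr_natr.
have -> : d / (M * n.+1%:R) * M * n%:R = d * (n%:R / n.+1%:R).
  have hn : (n.+1%:R : R) != 0 by rewrite pnatr_eq0.
  have hM : M != 0 by rewrite lt0r_neq0.
  by move: (n.+1%:R) hn => m hm; field; rewrite ?hM ?hm.
by rewrite -[ltRHS]mulr1 ltr_pM2l// ltr_pdivrMr// mul1r ltr_nat.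
Qed.

(** By [sB] the coordinates are linear forms in the conjugates; M bounds the sums of the absolute
    values of their coefficients. *)
Lemma conj_small (d : R) : 0 < d -> exists2 c : R, 0 < c &
  forall a : 'I_n -> rat, (forall j, w (s j (\sum_i a i *: e i)) < c) -> forall i, ratw (a i) < d.
Proof.
move=> d0; pose M := 1 + \sum_i \sum_j w (B i j).
have M0 : 0 < M by rewrite ltr_pwDl// sumr_ge0// => i _; rewrite sumr_ge0// => j _; exact: absv_ge0.
have vM i : \sum_j w (B i j) < M.
  have -> : M = 1 + (\sum_j w (B i j) + \sum_(i0 < n | i0 != i) \sum_j w (B i0 j)).
    by rewrite /M [in LHS](bigD1 i).
  have : 0 <= \sum_(i0 < n | i0 != i) \sum_j w (B i0 j).
    by rewrite sumr_ge0// => *; rewrite sumr_ge0// => *; exact: absv_ge0.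
  lra.
exists (d / M); first by rewrite divr_gt0.
move=> a ha i; rewrite /= sB.
apply: le_lt_trans (_ : \sum_j w (B i j) * (d / M) < d).
  apply: le_trans (absv_sum _ _ _ _) _; apply: ler_sum => j _.
  by rewrite absvM ler_wpM2l ?absv_ge0// ltW.
rewrite -mulr_suml mulrA ltr_pdivrMr// mulrC ltr_pM2l//.
Qed.

Lemma conj_nontrivial j : nontrivial_absv (absv_pullback w (s j)).
Proof.
have [q q0 hq] := nw; exists (q%:A); first by rewrite scaler_eq0 negb_or q0 oner_eq0.
by rewrite /= rmorph_ratA.
Qed.

(** Otherwise [separate] yields z with v z > 1 and all conjugates of absolute value less than 1.
    Then z^N has small conjugates, hence small coordinates, hence v (z^N) < 1. *)
Lemma over_is_conj v : nontrivial_absv v -> over v -> exists j, absv_equiv (absv_pullback w (s j)) v.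
Proof.
move=> nv ov; apply: contrapT => h.
pose f k := if insub k is Some j then absv_pullback w (s j) else v.
have [|z z1 hz] := @separate R K v f n nv.
  move=> j jn; rewrite /f insubT; split; first exact: conj_nontrivial.
  by move=> /absv_equiv_sym h2; apply: h; exists (Sub j jn).
have [c c0 hc] := over_small ov ltr01.
have [d d0 hd] := conj_small c0.
have [N hN] : exists N, forall j : 'I_n, w (s j (z ^+ N)) < d.
  have hk (j : 'I_n) : exists N, forall k, (N <= k)%N -> w (s j (z ^+ k)) < d.
    have := hz j (ltn_ord j); rewrite /f valK /= => zj.
    have [N hN] := @absv_geom R K (absv_pullback w (s j)) z d zj d0.
    by exists N.
  have [N hN] := choice hk.
  exists (\max_j N j) => j; apply: hN; exact: leq_bigmax.
have [a ha] := span (z ^+ N).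
have := hc a (hd a ltac:(by move=> j; rewrite -ha; exact: hN)).
by rewrite -ha absvX ltNge exprn_ege1// ltW.
Qed.

Lemma over_equiv v v' : absv_equiv v v' -> over v -> over v'.
Proof.
move=> /absv_equiv_dominates vv' ov d d0; have [c c0 hc] := vv' d d0.
by have [b b0 hb] := ov c c0; exists b => // q /hb/hc.
Qed.

Definition above p := over (prime_absv p).

Definition conj_prime j := class_prime (conj_nontrivial j).

Lemma conj_prime_equiv j : absv_equiv (absv_pullback w (s j)) (prime_absv (conj_prime j)).
Proof. exact: prime_equiv (class_primeP _) (prime_absvP _). Qed.

Lemma above_conj j : above (conj_prime j).
Proof. exact: over_equiv (conj_prime_equiv j) (over_conj j). Qed.

Lemma above_is_conj p : above p -> exists j, p = conj_prime j.
Proof.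
move=> ap; have [j hj] := over_is_conj (prime_nontrivial (prime_absvP p)) ap.
exists j; apply: prime_eq (prime_absvP p) (class_primeP _) (absv_equiv_sym hj).
Qed.

Lemma above_small (d : R) : 0 < d -> exists2 c : R, 0 < c &
  forall a : 'I_n -> rat, (forall i, ratw (a i) < c) ->
  forall p, above p -> prime_absv p (\sum_i a i *: e i) < d.
Proof.
move=> d0.
have ex j : exists c : R, 0 < c /\ forall a : 'I_n -> rat, (forall i, ratw (a i) < c) ->
    prime_absv (conj_prime j) (\sum_i a i *: e i) < d.
  by have [c c0 hc] := over_small (above_conj j) d0; exists c.
have [c hc] := choice ex.
have m0 : 0 < \big[Num.min/1]_j c j.
  by elim/big_ind: _ => // [x y x0 y0|j _]; [rewrite lt_min x0 | case: (hc j)].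
exists (\big[Num.min/1]_j c j) => // a ha p /above_is_conj[j ->].
by apply: (hc j).2 => i; apply: lt_le_trans (ha i) _; exact: bigmin_le.
Qed.

Lemma small_above (d : R) : 0 < d -> exists2 c : R, 0 < c &
  forall a : 'I_n -> rat, (forall p, above p -> prime_absv p (\sum_i a i *: e i) < c) ->
  forall i, ratw (a i) < d.
Proof.
move=> d0; have [b b0 hb] := conj_small d0.
have ex j : exists c : R, 0 < c /\ forall x, prime_absv (conj_prime j) x < c -> w (s j x) < b.
  have [c c0 hc] := absv_equiv_dominates (absv_equiv_sym (conj_prime_equiv j)) b0.
  by exists c.
have [c hc] := choice ex.
have m0 : 0 < \big[Num.min/1]_j c j.
  by elim/big_ind: _ => // [x y x0 y0|j _]; [rewrite lt_min x0 | case: (hc j)].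
exists (\big[Num.min/1]_j c j) => // a ha; apply: hb => j; apply: (hc j).2.
by apply: lt_le_trans (ha _ (above_conj j)) _; exact: bigmin_le.
Qed.

Lemma above_dense (y : forall p, Kc p) (d : R) : 0 < d -> exists x,
  forall p, above p -> compl_absv (Kc p) (compl_emb (Kc p) x - y p) < d.
Proof.
move=> d0; have d2 : 0 < d / 2 by rewrite divr_gt0.
(* Several embeddings may define the same prime, while weak approximation requires pairwise
   inequivalent absolute values. *)
pose ps := undup [seq conj_prime j | j <- enum 'I_n].
have [[p0 _]|emp] := pselect (exists p0 : prime_of R K, True); last first.
  by exists 0 => p; exfalso; apply: emp; exists p.
pose f k := prime_absv (nth p0 ps k).
have ex p : exists x, compl_absv (Kc p) (compl_emb (Kc p) x - y p) < d / 2.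
  have /(_ [set z | compl_absv (Kc p) ((z : Kc p) - y p) < d / 2])[||z [hz [x _ xz]]] := @compl_dense _ _ _ (Kc p).
  - by exists (y p); rewrite /= subrr absv0.
  - apply/absv_openP => x /= hx; exists (d / 2 - compl_absv (Kc p) (x - y p)); first by rewrite subr_gt0.
    move=> z zx; have := absvD (compl_absv (Kc p)) (z - x) (x - y p).
    have -> : z - x + (x - y p) = z - y p by ring.
    lra.
  by exists x; rewrite xz.
have [a ha] := choice ex.
have [||x hx] := @weak_approximation R K f (size ps) _ _ (fun k => a (nth p0 ps k)) _ d2.
- by move=> j jm; apply: prime_nontrivial (prime_absvP _).
- move=> i j im jm /(prime_eq (prime_absvP _) (prime_absvP _))/eqP.
  by rewrite nth_uniq ?undup_uniq// => /eqP.
exists x => p /above_is_conj[j hj].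
have pin : p \in ps by rewrite mem_undup hj map_f// mem_enum.
have := hx (index p ps); rewrite index_mem pin /f nth_index// => /(_ isT) h1.
have := absvD (compl_absv (Kc p)) (compl_emb (Kc p) (x - a p)) (compl_emb (Kc p) (a p) - y p).
rewrite rmorphB addrA subrK; have := ha p; move: h1; rewrite /= rmorphB; lra.
Qed.

End Above.

(** If x > 1, the powers of sqrt x grow at least linearly, so x^t grows at least quadratically in t.
    This takes the place of t-th roots and logarithms in the arguments on absolute values. *)
Lemma linear_growth_le1 (R : realType) (x C : R) : 0 <= x ->
  (forall t : nat, x ^+ t <= C * t.+1%:R) -> x <= 1.
Proof.
move=> x0 h; rewrite leNgt; apply/negP => x1.
pose d := Num.min 1 (Num.sqrt x - 1).
have sx : 1 < Num.sqrt x by rewrite -sqrtr1 ltr_sqrt// (lt_trans ltr01).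
have d0 : 0 < d by rewrite lt_min ltr01 subr_gt0.
have ge t : (d * t.+1%:R) ^+ 2 <= x ^+ t.
  have h1 : d * t.+1%:R <= Num.sqrt x ^+ t.
    elim: t => [|t IH]; first by rewrite mulr1 expr0 ge_min lexx.
    rewrite exprSr -natr1 mulrDr mulr1.
    have : d <= Num.sqrt x - 1 by rewrite ge_min lexx orbT.
    have : 1 <= Num.sqrt x ^+ t by rewrite exprn_ege1// ltW.
    set y := Num.sqrt x ^+ t in IH *; move=> h1 h2.
    have : y * (Num.sqrt x - 1) >= 1 * d by apply: ler_pM => //; exact: ltW.
    lra.
  rewrite -[x in _ <= x ^+ t]sqr_sqrtr// exprAC.
  by rewrite ler_pXn2r// nnegrE ?exprn_ge0 ?sqrtr_ge0// mulr_ge0// ltW.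
have hC t : t.+1%:R <= C / d ^+ 2.
  rewrite ler_pdivlMr ?exprn_gt0//.
  have := le_trans (ge t) (h t); rewrite exprMn.
  have -> : d ^+ 2 * t.+1%:R ^+ 2 = (t.+1%:R * d ^+ 2) * t.+1%:R by rewrite expr2; ring.
  by rewrite ler_pM2r.
have := hC (Num.truncn (C / d ^+ 2)); rewrite leNgt => /negP; apply.
exact: truncnS_gt.
Qed.

(** * Absolute values of the rational numbers *)

Section NatValues.
Context {R : realType} {F : fieldType} (v : absvalue R F).

(** The binomial formula bounds |x + y|^t by (t + 1) M^t, with M the larger of |x| and |y|. *)
Lemma nonarch_of_nat : (forall m, v m%:R <= 1) -> nonarchimedean v.
Proof.
move=> h x y; set M := Num.max _ _.
have xM : v x <= M by rewrite le_max lexx.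
have yM : v y <= M by rewrite le_max lexx orbT.
have [M0|M0] := leP M 0.
  have x0 : x = 0 by apply: absv_le0 (le_trans xM M0).
  have y0 : y = 0 by apply: absv_le0 (le_trans yM M0).
  by rewrite /M x0 y0 addr0 absv0 maxxx.
rewrite -[leRHS]mul1r -ler_pdivrMr//.
apply: (@linear_growth_le1 R _ 1); first by rewrite divr_ge0 ?absv_ge0// ltW.
move=> t; rewrite mul1r expr_div_n ler_pdivrMr ?exprn_gt0//.
rewrite -absvX exprDn; apply: le_trans (absv_sum _ _ _ _) _.
apply: le_trans (_ : \sum_(i < t.+1) M ^+ t <= _); last first.
  by rewrite sumr_const card_ord mulr_natl.
apply: ler_sum => i _; rewrite -mulr_natr !absvM !absvX.
rewrite -[leRHS]mulr1; apply: ler_pM; rewrite ?mulr_ge0 ?exprn_ge0 ?absv_ge0//.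
have -> : M ^+ t = M ^+ (t - i) * M ^+ i by rewrite -exprD subnK// -ltnS.
by apply: ler_pM; rewrite ?exprn_ge0 ?absv_ge0//; apply: lerXn2r; rewrite ?nnegrE ?absv_ge0// ltW.
Qed.

(** Expansion of m in base k, with s + 1 digits of absolute value at most k. *)
Lemma digits_bound (k s m : nat) : (1 < k)%N -> (m < k ^ s.+1)%N ->
  v m%:R <= k%:R * s.+1%:R * Num.max 1 (v k%:R) ^+ s.
Proof.
move=> k1; set c := Num.max _ _; have c1 : 1 <= c by rewrite le_max lexx.
elim: s m => [|s IH] m hm.
  rewrite expr0 !mulr1; apply: le_trans (absv_nat_le _ _) _.
  by rewrite ler_nat ltnW// -[k]expn1.
rewrite (divn_eq m k) natrD natrM; apply: le_trans (absvD _ _ _) _.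
have q : (m %/ k < k ^ s.+1)%N by rewrite ltn_divLR ?(ltn_trans _ k1)// -expnSr.
have h1 := IH _ q.
have h2 : v (m %% k)%:R <= k%:R.
  by apply: le_trans (absv_nat_le _ _) _; rewrite ler_nat ltnW// ltn_mod (ltn_trans _ k1).
have cs : 1 <= c ^+ s.+1 by rewrite exprn_ege1.
rewrite absvM -[s.+2%:R]natr1 mulrDr mulr1 mulrDl; apply: lerD.
  rewrite exprSr mulrA; apply: ler_pM; rewrite ?absv_ge0//.
  by rewrite le_max lexx orbT.
by apply: le_trans h2 _; rewrite ler_peMr.
Qed.

(** In base k the number m^t has at most m t + 1 digits, so |m|^t grows at most linearly with t. *)
Lemma nat_le1 (k : nat) : (1 < k)%N -> v k%:R <= 1 -> forall m, v m%:R <= 1.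
Proof.
move=> k1 vk m; have [->|m0] := posnP m; first by rewrite absv0.
apply: (@linear_growth_le1 R _ (k%:R * m.+1%:R)); first exact: absv_ge0.
move=> t; rewrite -absvX -natrX.
have hm : (m ^ t < k ^ (m * t).+1)%N.
  apply: leq_ltn_trans (_ : k ^ (m * t) < _)%N; last by rewrite ltn_exp2l.
  by rewrite expnM; case: t => [//|t]; rewrite leq_exp2r// ltnW// ltn_expl.
apply: le_trans (digits_bound k1 hm) _.
rewrite max_l// expr1n mulr1 -mulrA ler_pM2l ?ltr0n ?(ltn_trans _ k1)// -natrM ler_nat.
by rewrite mulSn mulnS; lia.
Qed.

(** Bernoulli's inequality (1 + 1/m)^r >= 1 + r/m, cleared of denominators. *)
Lemma bernoulli_nat (m r : nat) : ((m + r) * m ^ r <= m * m.+1 ^ r)%N.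
Proof.
elim: r => [|r IH]; first by rewrite addn0 !expn0.
have h : (m.+1 * ((m + r) * m ^ r) <= m.+1 * (m * m.+1 ^ r))%N by rewrite leq_mul2l IH orbT.
rewrite !expnS; set a := (m ^ r)%N in h *; set b := (m.+1 ^ r)%N in h *; nia.
Qed.

Hypothesis arch : exists m, 1 < v m%:R.

Lemma arch_gt1 (k : nat) : (1 < k)%N -> 1 < v k%:R.
Proof.
move=> k1; rewrite ltNge; apply/negP => h; have [m] := arch.
by rewrite ltNge (nat_le1 k1 h).
Qed.

Lemma arch_le (m k : nat) : (1 < k)%N -> (m <= k)%N -> v m%:R <= v k%:R.
Proof.
move=> k1 mk; have c1 := arch_gt1 k1; have c0 := lt_trans ltr01 c1.
rewrite -[leRHS]mul1r -ler_pdivrMr//.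
apply: (@linear_growth_le1 R _ k%:R); first by rewrite divr_ge0 ?absv_ge0.
move=> t; rewrite expr_div_n ler_pdivrMr ?exprn_gt0// -absvX -natrX.
have hm : (m ^ t < k ^ t.+1)%N.
  apply: leq_ltn_trans (_ : k ^ t < _)%N; last by rewrite ltn_exp2l.
  by case: t => [//|t]; rewrite leq_exp2r.
apply: le_trans (digits_bound k1 hm) _.
by rewrite max_r// ltW.
Qed.

(** For r = m^2 Bernoulli's inequality gives m^(r+1) <= (m+1)^r <= k^r. If |k| <= |m|, this would
    imply |k|^(r+1) <= |k|^r, although |k| > 1. *)
Lemma arch_lt (m k : nat) : (m < k)%N -> v m%:R < v k%:R.
Proof.
move=> mk; have [k1|k1] := leqP k 1.
  have [-> ->] : m = 0%N /\ k = 1%N by lia.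
  by rewrite absv0 absv1.
have c1 := arch_gt1 k1; have [m0|m0] := posnP m.
  by rewrite m0 absv0 (lt_trans ltr01).
pose r := (m * m)%N.
have h : (m ^ r.+1 <= k ^ r)%N.
  apply: leq_trans (_ : m.+1 ^ r <= _)%N.
    rewrite -(leq_pmul2l m0); apply: leq_trans (bernoulli_nat m r).
    rewrite expnS mulnA leq_mul2r; apply/orP; right; rewrite /r; lia.
  by rewrite leq_exp2r// /r muln_gt0 m0.
have r0 : (0 < r)%N by rewrite muln_gt0 m0.
have kr : (1 < k ^ r)%N by rewrite -(expn0 k) ltn_exp2l.
have := arch_le kr h; rewrite !natrX !absvX => h2.
rewrite ltNge; apply/negP => h3.
have : v k%:R ^+ r.+1 <= v k%:R ^+ r.
  apply: le_trans h2; apply: lerXn2r => //; rewrite nnegrE absv_ge0//.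
by rewrite exprS ger_pMl ?exprn_gt0 ?(lt_trans ltr01)// leNgt c1.
Qed.

End NatValues.

Section Nonarch.
Context {R : realType} {F : fieldType} (v : absvalue R F) (l : nat).
Hypothesis um : nonarchimedean v.

Lemma nonarch_nat m : v m%:R <= 1.
Proof.
elim: m => [|m IH]; first by rewrite absv0.
by rewrite -natr1; apply: le_trans (um _ _) _; rewrite ge_max IH absv1 lexx.
Qed.

Lemma nonarch_int (m : int) : v m%:~R <= 1.
Proof. by case: (intP m) => [|k|k]; rewrite ?rmorphN ?absvN; exact: nonarch_nat. Qed.

Hypothesis pl : prime l.
Hypothesis vl : v l%:R < 1.

Lemma coprime_unit m : coprime l m -> v m%:R = 1.
Proof.
move=> cm; apply/eqP; rewrite eq_le nonarch_nat /= leNgt; apply/negP => h.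
have m0 : (0 < m)%N.
  by rewrite lt0n; apply/eqP => m0; move: cm (prime_gt1 pl); rewrite m0 /coprime gcdn0 => /eqP->.
have [c d hc _] := egcdnP l m0; rewrite gcdnC (eqP cm) in hc.
have : v (c%:R * m%:R - d%:R * l%:R) < 1.
  apply: le_lt_trans (um _ _) _; rewrite absvN !absvM gt_max; apply/andP; split.
    by apply: le_lt_trans h; rewrite ler_piMl ?absv_ge0// nonarch_nat.
  by apply: le_lt_trans vl; rewrite ler_piMl ?absv_ge0// nonarch_nat.
by rewrite -!natrM hc natrD addrC addKr absv1 ltxx.
Qed.

End Nonarch.

Lemma residue_unique (R : realType) (F : fieldType) (v : absvalue R F) l l' :
  nonarchimedean v -> prime l -> prime l' -> v l%:R < 1 -> v l'%:R < 1 -> l = l'.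
Proof.
move=> um pl pl' h h'; apply/eqP; apply: contraTT h' => ll'.
by rewrite (coprime_unit um pl h) ?ltxx// prime_coprime// dvdn_prime2.
Qed.

Section Rat.
Context {R : realType}.
Implicit Types v w : absvalue R rat.

Lemma absv_int (F : fieldType) (v : absvalue R F) (m : int) : v m%:~R = v `|m|%:R.
Proof. by case: (intP m) => [|k|k]; rewrite ?abszN ?rmorphN ?absvN. Qed.

Lemma absv_rat v q : v q = v `|numq q|%:R / v `|denq q|%:R.
Proof. by rewrite -{1}[q]divq_num_den absvM absvV !absv_int. Qed.

Lemma natq_gt0 v m : (0 < m)%N -> 0 < v m%:R.
Proof. by move=> m0; apply: absv_gt0; rewrite pnatr_eq0 -lt0n. Qed.

Lemma denq_pos q : (0 < `|denq q|)%N. Proof. by rewrite absz_gt0 denq_neq0. Qed.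

(** By [arch_lt], |q| < 1 means that the numerator of q is smaller than its denominator, whatever
    the archimedean absolute value. *)
Lemma arch_equiv v w : (exists m, 1 < v m%:R) -> (exists m, 1 < w m%:R) -> absv_equiv v w.
Proof.
move=> av aw; apply: lt1_equiv.
  by have [m hm] := av; exists m%:R; [apply/eqP => h; move: hm; rewrite h absv0 ltr10 | rewrite gt_eqF].
move=> q; rewrite (absv_rat v q) (absv_rat w q) !ltr_pdivrMr ?natq_gt0 ?denq_pos// !mul1r => h.
apply: arch_lt => //; rewrite ltnNge; apply/negP.
rewrite leq_eqVlt => /orP[/eqP e|/(arch_lt av) h2]; first by move: h; rewrite e ltxx.
by have := lt_trans h h2; rewrite ltxx.
Qed.

Section Nonarch.
Variable l : nat.
Hypothesis pl : prime l.

Lemma nonarch_lt1 v q : nonarchimedean v -> v l%:R < 1 -> v q <= 1 -> ~~ (l %| `|denq q|)%N.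
Proof.
move=> um vl; rewrite absv_rat ler_pdivrMr ?natq_gt0 ?denq_pos// mul1r => h.
apply/negP => ld; have := coprime_num_den q => cnd.
have nl : v `|numq q|%:R = 1.
  apply: (coprime_unit um pl vl); rewrite prime_coprime//; apply/negP => ln.
  by have := dvdn_gcd l `|numq q| `|denq q|; rewrite ln ld (eqP cnd) dvdn1 => /eqP h1; move: pl; rewrite h1.
move: h; rewrite nl leNgt => /negP; apply.
have /dvdnP[c ->] := ld; rewrite natrM absvM; apply: le_lt_trans vl.
by rewrite ler_piMl ?absv_ge0// nonarch_nat.
Qed.

Lemma nonarch_equiv v w : nonarchimedean v -> nonarchimedean w ->
  v l%:R < 1 -> w l%:R < 1 -> absv_equiv v w.
Proof.
move=> uv uw vl wl; apply: lt1_equiv.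
  by exists l%:R; [rewrite pnatr_eq0 -lt0n prime_gt0 | rewrite lt_eqF].
move=> q q1; have hd := nonarch_lt1 uv vl (ltW q1).
have cd : coprime l `|denq q| by rewrite prime_coprime.
have ln : (l %| `|numq q|)%N.
  apply: contraTT q1 => nn; rewrite absv_rat !(coprime_unit uv pl vl) ?prime_coprime//.
  by rewrite divr1 ltxx.
rewrite absv_rat (coprime_unit uw pl wl cd) divr1.
have /dvdnP[c ->] := ln; rewrite natrM absvM; apply: le_lt_trans wl.
by rewrite ler_piMl ?absv_ge0// nonarch_nat.
Qed.

Lemma residue_approx v q j : nonarchimedean v -> v l%:R < 1 -> v q <= 1 ->
  exists2 c, (c < l ^ j)%N & v (q - c%:R) <= v l%:R ^+ j.
Proof.
move=> uv vl q1; have hd := nonarch_lt1 uv vl q1.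
have cd : coprime l `|denq q| by rewrite prime_coprime.
have cj : coprime `|denq q| (l ^ j) by rewrite coprime_sym coprimeXl.
have [d x hx _] := egcdnP (l ^ j) (denq_pos q).
rewrite (eqP cj) in hx.
have lj : (0 < l ^ j)%N by rewrite expn_gt0 prime_gt0.
(* c is the numerator of q times the inverse d of its denominator, modulo l^j. *)
pose c := absz ((numq q * d%:Z) %% (l ^ j)%:Z)%Z.
have c0 : c%:Z = ((numq q * d%:Z) %% (l ^ j)%:Z)%Z.
  by rewrite /c gez0_abs// modz_ge0// eqz_nat -lt0n.
exists c.
  by rewrite -ltz_nat c0 ltz_pmod// ltz_nat.
have dq : (denq q)%:~R = (`|denq q|)%:R :> rat by rewrite -{1}[denq q]absz_denq.
have e : (q - c%:R) * (denq q)%:~R = l%:R ^+ j * (((numq q * d%:Z) %/ (l ^ j)%:Z)%Z * denq q - numq q * x%:Z)%:~R.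
  have e1 : q * (denq q)%:~R = (numq q)%:~R by rewrite -{1}[q]divq_num_den divfK// intr_eq0 denq_neq0.
  rewrite mulrBl e1.
  have e2 : (c%:Z + ((numq q * d%:Z) %/ (l ^ j)%:Z)%Z * (l ^ j)%:Z = numq q * d%:Z)%R.
    by rewrite c0 addrC -divz_eq.
  have e3 : (d%:Z * denq q = x%:Z * (l ^ j)%:Z + 1)%R.
    by rewrite -absz_denq -!PoszM hx PoszD.
  set Q := (_ %/ _)%Z in e2 *.
  have e4 : numq q - c%:Z * denq q = (l ^ j)%:Z * (Q * denq q - numq q * x%:Z).
    have -> : c%:Z = numq q * d%:Z - Q * (l ^ j)%:Z by rewrite -e2 addrK.
    rewrite mulrBl -mulrA e3; ring.
  have := congr1 (fun z : int => z%:~R : rat) e4.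
  by rewrite rmorphB !rmorphM /= -natrX.
have := congr1 v e; rewrite !absvM dq (coprime_unit uv pl vl cd) mulr1 absvX => ->.
by rewrite ler_piMr ?exprn_ge0 ?absv_ge0// nonarch_int.
Qed.

End Nonarch.

Lemma residue_char v : nontrivial_absv v -> nonarchimedean v -> exists2 l, prime l & v l%:R < 1.
Proof.
move=> nv um; apply: contrapT => h.
have u m : (0 < m)%N -> v m%:R = 1.
  elim/ltn_ind: m => m IH m0.
  have [m1|m1] := leqP m 1; first by rewrite (_ : m = 1%N) ?absv1//; lia.
  have /dvdnP[c mc] := pdiv_dvd m; have pp := pdiv_prime m1.
  have vp : v (pdiv m)%:R = 1.
    apply/eqP; rewrite eq_le nonarch_nat//= leNgt; apply/negP => h2.
    by apply: h; exists (pdiv m).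
  rewrite mc natrM absvM vp mulr1; apply: IH; last by move: m0; rewrite mc muln_gt0 => /andP[].
  rewrite {1}mc ltn_Pmulr ?prime_gt1//; by move: m0; rewrite mc muln_gt0 => /andP[].
have [q q0] := nv; rewrite absv_rat !u ?divr1 ?eqxx ?denq_pos//.
by rewrite absz_gt0 numq_eq0.
Qed.

End Rat.

Lemma completion_cauchy (R : realType) (F : fieldType) (p : prime_of R F) (Kp : completion p)
   (U : set_system Kp) : ProperFilter U ->
  (forall d : R, 0 < d -> exists x, U [set y | compl_absv Kp (y - x) < d]) ->
  exists l, vlim (compl_absv Kp) U id l.
Proof.
move=> PU h; have [|l hl] := @compl_complete _ _ _ Kp U PU.
  apply: cauchy_exP => d d0; have [x hx] := h d d0; exists x.
  by apply: filterS hx => y /=; rewrite /ball /= absv_dist.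
by exists l => d d0; apply: hl; apply/absv_nbhsP; exists d.
Qed.

(** * Local compactness of the l-adic completions *)

Section FiniteLC.
Context {R : realType} {K : fieldExtType rat}.
Let n := \dim {:K}.
Context (e : 'I_n -> K).
Hypothesis span : forall x, exists a : 'I_n -> rat, x = \sum_i a i *: e i.
Context {Om : numClosedFieldType} (w : absvalue R Om).
Context (s : 'I_n -> {rmorphism K -> Om}) (B : 'I_n -> 'I_n -> Om).
Hypothesis sB : forall (a : 'I_n -> rat) i, ratr (a i) = \sum_j B i j * s j (\sum_k a k *: e k).
Context (Kc : forall p : prime_of R K, completion p).
Hypothesis nw : nontrivial_absv (ratw w).
Context (l : nat).
Hypothesis pl : prime l.
Hypothesis uw : nonarchimedean (ratw w).
Hypothesis wl : ratw w l%:R < 1.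

Local Notation vp := (prime_absv Kc).

Lemma natl_small (c : R) (M : R) : 0 < c -> exists k, forall p, above w Kc p -> vp p (l%:R ^+ k) * M < c.
Proof.
move=> c0; have c1 : 0 < c / (`|M| + 1) by rewrite divr_gt0// ltr_wpDl.
have ex (j : 'I_n) : exists N, forall k, (N <= k)%N -> vp (conj_prime s nw j) (l%:R ^+ k) < c / (`|M| + 1).
  apply: absv_geom => //.
  have h : (absv_pullback w (s j)) l%:R < 1 by move: wl; rewrite /= !rmorph_nat.
  exact: dominates_lt1 (absv_equiv_dominates (conj_prime_equiv s Kc nw j)) h.
have [N hN] := choice ex.
exists (\max_j N j) => p /(above_is_conj span sB nw)[j ->].
have := hN j (\max_j N j) (leq_bigmax _); rewrite ltr_pdivlMr ?ltr_wpDl// => h.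
apply: le_lt_trans h; apply: ler_wpM2l; first exact: absv_ge0.
by apply: le_trans (ler_norm _) _; rewrite lerDl.
Qed.

(** The ball of radius M is covered by finitely many balls of radius d, centred at the elements of K
    with coordinates f_i / l^k, 0 <= f_i < l^j. An ultrafilter on the ball selects one of them for
    each d, hence is Cauchy. *)
Lemma finite_loc_compact p : above w Kc p -> loc_compact (compl_absv (Kc p)).
Proof.
move=> ap U uU [M hM].
apply: completion_cauchy => d d0.
have d2 : 0 < Num.min (d / 2) (1 / 2) by rewrite lt_min !divr_gt0.
have [c c0 hc] := small_above sB Kc nw ltr01.
have [k hk] := natl_small (M + 1) c0.
have [b b0 hb] := above_small span sB Kc nw d2.
have lq0 : 0 < ratw w l%:R by apply: natq_gt0; rewrite prime_gt0.
have [j hj] := @pow_small R (ratw w l%:R) (1 / ratw w l%:R ^+ k) b (ltW lq0) wl b0.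
pose zz (f : {ffun 'I_n -> 'I_(l ^ j)}) : K := \sum_i ((f i)%:R / l%:R ^+ k) *: e i.
have key y : compl_absv (Kc p) y <= M -> exists f, compl_absv (Kc p) (y - compl_emb (Kc p) (zz f)) < d.
  move=> yM; have [x0 hx0] : exists x, compl_absv (Kc p) (compl_emb (Kc p) x - y) < Num.min (d / 4) (1 / 4).
    have m0 : 0 < Num.min (d / 4) (1 / 4) by rewrite lt_min !divr_gt0.
    have [q hq] : exists yy : forall q, Kc q, yy p = y.
      exists (fun q => if pselect (p = q) is left e then ecast q (Kc q) e y else 0).
      by case: pselect => // e'; rewrite (Prop_irrelevance e' erefl).
    have [x hx] := above_dense span sB nw q m0.
    by exists x; have := hx p ap; rewrite hq.
  have m0 : 0 < Num.min (d / 4) (1 / 4) by rewrite lt_min !divr_gt0.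
  (* x is close to y at p and to 0 at the other primes above l. Being bounded at all of them, it has
     coordinates whose denominators are bounded powers of l. *)
  have [x hx] := above_dense span sB nw (fun q => compl_emb (Kc q) (if q == p then x0 else 0)) m0.
  have hxp : compl_absv (Kc p) (compl_emb (Kc p) x - y) < Num.min (d / 2) (1 / 2).
    have := hx p ap; rewrite eqxx; move: hx0; rewrite !lt_min => /andP[h1 h2] /andP[h3 h4].
    have := absvD (compl_absv (Kc p)) (compl_emb (Kc p) x - compl_emb (Kc p) x0) (compl_emb (Kc p) x0 - y).
    by rewrite addrA subrK => h5; apply/andP; split; lra.
  have M0 : 0 <= M := le_trans (absv_ge0 _ _) yM.
  have bx q : above w Kc q -> vp q x <= M + 1.
    move=> aq; have [->|qp] := eqVneq q p.
      have := absv_le_dist (compl_absv (Kc p)) (compl_emb (Kc p) x) y.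
      by move: hxp; rewrite lt_min /= => /andP[_ h1]; lra.
    have := hx q aq; rewrite (negPf qp) rmorph0 subr0 lt_min /= => /andP[_ h1]; lra.
  have [a ha] := span x.
  have lk0 : (l%:R : rat) ^+ k != 0 by rewrite expf_neq0// pnatr_eq0 -lt0n prime_gt0.
  have ha1 i : ratw w (l%:R ^+ k * a i) <= 1.
    apply: ltW; apply: (hc (fun i => l%:R ^+ k * a i)) => q aq.
    have -> : \sum_i0 (l%:R ^+ k * a i0) *: e i0 = l%:R ^+ k * x.
      rewrite ha mulr_sumr; apply: eq_bigr => i0 _.
      by rewrite -scalerA -[LHS]mulr_algl -[_%:A]/(in_alg K _) rmorphXn rmorph_nat.
    rewrite absvM; apply: le_lt_trans (hk q aq); apply: ler_wpM2l; first exact: absv_ge0.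
    exact: bx.
  have ex i : exists f : 'I_(l ^ j), ratw w (l%:R ^+ k * a i - f%:R) <= ratw w l%:R ^+ j.
    by have [m mj hm] := residue_approx pl j uw wl (ha1 i); exists (Ordinal mj).
  have [f hf] := choice ex.
  exists [ffun i => f i].
  have : vp p (\sum_i (a i - (f i)%:R / l%:R ^+ k) *: e i) < Num.min (d / 2) (1 / 2).
    apply: hb => // i.
    have -> : a i - (f i)%:R / l%:R ^+ k = (l%:R ^+ k * a i - (f i)%:R) / l%:R ^+ k by field.
    rewrite absvM absvV absvX.
    apply: le_lt_trans (hj j (leqnn j)); rewrite mulrC mul1r ler_pM2l ?invr_gt0 ?exprn_gt0//.
  have -> : \sum_i (a i - (f i)%:R / l%:R ^+ k) *: e i = x - zz [ffun i => f i].
    by rewrite ha /zz -sumrB; apply: eq_bigr => i _; rewrite ffunE scalerBl.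
  rewrite /= rmorphB; move: hxp; rewrite !lt_min => /andP[h1 _] /andP[h2 _].
  have := absvD (compl_absv (Kc p)) (y - compl_emb (Kc p) x) (compl_emb (Kc p) x - compl_emb (Kc p) (zz [ffun i => f i])).
  rewrite addrA subrK (absv_dist _ y (compl_emb (Kc p) x)); lra.
have : U [set y | exists2 f, f \in enum {: {ffun 'I_n -> 'I_(l ^ j)}} & compl_absv (Kc p) (y - compl_emb (Kc p) (zz f)) < d].
  by apply: filterS hM => y /= /key[f hf]; exists f; rewrite ?mem_enum.
by move/(ultra_bigU uU) => [f _ hf]; exists (compl_emb (Kc p) (zz f)).
Qed.

End FiniteLC.

Section Classify.
Context {R : realType} {K : fieldExtType rat}.
Implicit Type v : absvalue R K.

Definition archv v := exists m, 1 < v m%:R.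

Lemma equiv_arch v v' : absv_equiv v v' -> archv v -> archv v'.
Proof.
move=> vv' [m hm]; exists m.
have m0 : (m%:R : K) != 0 by apply/eqP => h; move: hm; rewrite h absv0 ltr10.
have : v (m%:R)^-1 < 1 by rewrite absvV invf_lt1// absv_gt0.
move/(dominates_lt1 (absv_equiv_dominates vv')); rewrite absvV invf_lt1// absv_gt0//.
Qed.

Lemma over_equiv_rat (Om : numClosedFieldType) (w : absvalue R Om) v :
  nontrivial_absv (ratw w) -> over w v -> absv_equiv (ratw w) (absv_pullback v (in_alg K)).
Proof. by move=> nw ov; apply: lt1_equiv => // x; exact: dominates_lt1. Qed.

Lemma pull_natE v m : absv_pullback v (in_alg K) m%:R = v m%:R.
Proof. by rewrite /= -[_%:A]/(in_alg K _) rmorph_nat. Qed.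

Lemma ratw_natE (Om : numClosedFieldType) (w : absvalue R Om) m : ratw w m%:R = w m%:R.
Proof. by rewrite /= rmorph_nat. Qed.

Lemma arch_over (Om : numClosedFieldType) (w : absvalue R Om) v :
  (exists m, 1 < w m%:R) -> over w v <-> archv v.
Proof.
move=> aw; have aw' : exists m, 1 < ratw w m%:R by have [m hm] := aw; exists m; rewrite ratw_natE.
have nw : nontrivial_absv (ratw w).
  have [m hm] := aw'; exists m%:R; last by rewrite gt_eqF.
  by apply/eqP => h; move: hm; rewrite h absv0 ltr10.
split=> [ov|av].
  have [m hm] := aw'; exists m; rewrite -pull_natE.
  have m0 : (m%:R : rat) != 0 by apply/eqP => h; move: hm; rewrite h absv0 ltr10.
  have : ratw w (m%:R)^-1 < 1 by rewrite absvV invf_lt1// absv_gt0.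
  move/(dominates_lt1 ov); rewrite absvV invf_lt1// absv_gt0//.
apply: absv_equiv_dominates; apply: arch_equiv => //.
by have [m hm] := av; exists m; rewrite pull_natE.
Qed.

Lemma nonarch_over (Om : numClosedFieldType) (w : absvalue R Om) l v :
  prime l -> nonarchimedean w -> w l%:R < 1 -> over w v <-> ~ archv v /\ v l%:R < 1.
Proof.
move=> pl uw wl.
have uw' : nonarchimedean (ratw w) by move=> x y /=; rewrite rmorphD.
have wl' : ratw w l%:R < 1 by rewrite ratw_natE.
have nw : nontrivial_absv (ratw w).
  by exists l%:R; [rewrite pnatr_eq0 -lt0n prime_gt0 | rewrite lt_eqF].
split=> [ov|[nav vl]].
  split; last by rewrite -pull_natE; apply: dominates_lt1 ov _.
  move=> [m hm].
  have m0 : (m%:R : rat) != 0.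
    by apply/eqP => h; move: hm; rewrite -pull_natE h absv0 ltr10.
  have : absv_pullback v (in_alg K) (m%:R)^-1 < 1 by rewrite absvV invf_lt1// ?absv_gt0// pull_natE.
  move/(dominates_lt1 (absv_equiv_dominates (absv_equiv_sym (over_equiv_rat nw ov)))).
  by rewrite absvV invf_lt1 ?absv_gt0// ltNge nonarch_nat.
have um : nonarchimedean v.
  by apply: nonarch_of_nat => m; rewrite leNgt; apply/negP => h; apply: nav; exists m.
apply: absv_equiv_dominates; apply: (nonarch_equiv pl) => //.
  by move=> x y /=; rewrite scalerDl.
by rewrite pull_natE.
Qed.

(** If v were trivial on Q it would be bounded on K, which is spanned by finitely many elements;
    then no power could grow and v would be trivial. *)
Lemma nonarch_residue v : nontrivial_absv v -> ~ archv v -> exists2 l, prime l & v l%:R < 1.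
Proof.
move=> nv nav.
have um : nonarchimedean v.
  by apply: nonarch_of_nat => m; rewrite leNgt; apply/negP => h; apply: nav; exists m.
have um' : nonarchimedean (absv_pullback v (in_alg K)) by move=> x y /=; rewrite scalerDl.
have [h|h] := pselect (nontrivial_absv (absv_pullback v (in_alg K))).
  by have [l pl hl] := residue_char h um'; exists l => //; rewrite -pull_natE.
have v1 q : v (q%:A) <= 1.
  have [->|q0] := eqVneq q 0; first by rewrite scale0r absv0.
  rewrite leNgt; apply/negP => hq; apply: h; exists q => //; rewrite gt_eqF//.
exfalso; have [x x0 x1] := nontrivial_lt1 nv.
have [e [_ span _]] := embeddings K.
pose M := \sum_i v (e i).
have bd y : v y <= M.
  have [a ->] := span y; apply: le_trans (absv_sum _ _ _ _) _; apply: ler_sum => i _.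
  by rewrite -mulr_algl absvM ler_piMl ?absv_ge0.
have vx : 1 < v x^-1 by rewrite absvV invf_gt1 ?absv_gt0.
suff : v x^-1 <= 1 by rewrite leNgt vx.
apply: (@linear_growth_le1 R _ M); first exact: absv_ge0.
move=> t; rewrite -absvX; apply: le_trans (bd _) _.
by rewrite ler_peMr ?ler1n//; exact: le_trans (absv_ge0 _ _) (bd 0).
Qed.

Lemma finite_primeP (p : prime_of R K) v : sval p v -> finite_prime p <-> ~ archv v.
Proof.
move=> pv; split=> [[u pu uu] av|nav].
  have [m] := equiv_arch (prime_equiv pv pu) av.
  by rewrite ltNge nonarch_nat.
exists v => //; apply: nonarch_of_nat => m; rewrite leNgt; apply/negP => h; apply: nav; exists m => //.
Qed.

End Classify.

From mathcomp Require Import complex.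

(** * Uniqueness of completions *)

Section Unique.
Context {R : realType} {K F F' : fieldType} (v : absvalue R F) (v' : absvalue R F').
Context (iota : {rmorphism K -> F}) (iota' : {rmorphism K -> F'}).

Definition cauchy_complete {L : fieldType} (u : absvalue R L) := forall U : set_system L,
  ProperFilter U -> (forall d : R, 0 < d -> exists x, U [set y | u (y - x) < d]) ->
  exists l, vlim u U id l.

Definition dense_emb {L : fieldType} (u : absvalue R L) (f : K -> L) :=
  forall y (d : R), 0 < d -> exists x, u (f x - y) < d.

(** The graph of the isomorphism to be constructed: y and y' are approximated by the same elements
    of K. *)
Definition close_pair (y : F) (y' : F') := forall d : R, 0 < d ->
  exists x, v (iota x - y) < d /\ v' (iota' x - y') < d.

Hypothesis dn : dense_emb v iota.
Hypothesis dom : dominates (absv_pullback v iota) (absv_pullback v' iota').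

Lemma close_pair_ex y : cauchy_complete v' -> exists y', close_pair y y'.
Proof.
move=> cpl'.
pose V := [set S : set F' | exists2 d : R, 0 < d & forall x, v (iota x - y) < d -> S (iota' x)].
have PV : ProperFilter V.
  apply: Build_ProperFilter_ex.
    by move=> S [d d0 h]; have [x hx] := dn y d0; exists (iota' x); exact: h.
  split; first by exists 1.
    move=> S S' [d d0 h] [d' d0' h']; exists (Num.min d d'); first by rewrite lt_min d0.
    by move=> x; rewrite lt_min => /andP[h1 h2]; split; [exact: h | exact: h'].
  by move=> S S' SS' [d d0 h]; exists d => // x hx; apply: SS'; exact: h.
have [|l hl] := cpl' V PV.
  move=> e e0; have [d d0 hd] := dom e0; have d2 : 0 < d / 2 by rewrite divr_gt0.
  have [x hx] := dn y d2; exists (iota' x), (d / 2) => // z hz.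
  rewrite /= -rmorphB; apply: hd; rewrite /= rmorphB.
  have := absvD v (iota z - y) (y - iota x); rewrite addrA subrK (absv_dist v y); lra.
exists l => d d0; have [c c0 hc] := hl d d0.
have m0 : 0 < Num.min c d by rewrite lt_min c0.
have [x hx] := dn y m0; exists x; move: hx; rewrite lt_min => /andP[h1 h2].
by split=> //; exact: hc.
Qed.

Lemma close_pair_unique y y1 y2 : close_pair y y1 -> close_pair y y2 -> y1 = y2.
Proof.
move=> h1 h2; apply/eqP; rewrite -subr_eq0; apply/eqP/(absv_eq0 v')/eqP.
rewrite eq_le absv_ge0 andbT; apply/ler_addgt0Pr => e e0; rewrite add0r.
have e3 : 0 < e / 3 by rewrite divr_gt0.
have [d d0 hd] := dom e3.
have m0 : 0 < Num.min (d / 2) (e / 3) by rewrite lt_min !divr_gt0.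
have [x1 []] := h1 _ m0; have [x2 []] := h2 _ m0.
rewrite !lt_min => /andP[a1 _] /andP[_ a2] /andP[b1 _] /andP[_ b2].
have : v' (iota' x1 - iota' x2) < e / 3.
  rewrite -rmorphB; apply: hd; rewrite /= rmorphB.
  have := absvD v (iota x1 - y) (y - iota x2); rewrite addrA subrK (absv_dist v y); lra.
have := absvD3 v' y1 (iota' x1) y2; have := absvD3 v' (iota' x1) (iota' x2) y2.
rewrite (absv_dist v' y1 (iota' x1)); lra.
Qed.

Lemma close_pairB y1 y2 z1 z2 : close_pair y1 z1 -> close_pair y2 z2 -> close_pair (y1 - y2) (z1 - z2).
Proof.
move=> h1 h2 d d0; have d2 : 0 < d / 2 by rewrite divr_gt0.
have [x1 [a1 b1]] := h1 _ d2; have [x2 [a2 b2]] := h2 _ d2.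
exists (x1 - x2); rewrite !rmorphB; split.
  have := absvB v (iota x1 - y1) (iota x2 - y2).
  have -> : iota x1 - y1 - (iota x2 - y2) = iota x1 - iota x2 - (y1 - y2) by ring.
  lra.
have := absvB v' (iota' x1 - z1) (iota' x2 - z2).
have -> : iota' x1 - z1 - (iota' x2 - z2) = iota' x1 - iota' x2 - (z1 - z2) by ring.
lra.
Qed.

Lemma prod_close (L : fieldType) (u : absvalue R L) (a b a' b' : L) (d : R) : 0 < d ->
  u (a' - a) < Num.min 1 (d / (1 + u a + u b)) -> u (b' - b) < Num.min 1 (d / (1 + u a + u b)) ->
  u (a' * b' - a * b) < d.
Proof.
move=> d0; have a0 := absv_ge0 u a; have b0 := absv_ge0 u b.
have p0 : 0 < 1 + u a + u b by lra.
rewrite !lt_min !ltr_pdivlMr// => /andP[h1 h2] /andP[h3 h4].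
have -> : a' * b' - a * b = (a' - a) * (b' - b) + (a' - a) * b + a * (b' - b) by ring.
have := absvD u ((a' - a) * (b' - b) + (a' - a) * b) (a * (b' - b)).
have := absvD u ((a' - a) * (b' - b)) ((a' - a) * b).
rewrite !absvM.
set p := u (a' - a) in h1 h2 *; set q := u (b' - b) in h3 h4 *.
have q0 : 0 <= q by exact: absv_ge0. have pp0 : 0 <= p by exact: absv_ge0.
set m := Num.max p q.
have pm : p <= m by rewrite le_max lexx. have qm : q <= m by rewrite le_max lexx orbT.
have hm : m * (1 + u a + u b) < d by rewrite /m; case: (leP p q).
have : p * q <= m * 1 by apply: ler_pM => //; rewrite ltW.
have : p * u b <= m * u b by rewrite ler_wpM2r.
have : u a * q <= u a * m by rewrite ler_wpM2l.
lra.
Qed.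

Lemma close_pairM y1 y2 z1 z2 : close_pair y1 z1 -> close_pair y2 z2 -> close_pair (y1 * y2) (z1 * z2).
Proof.
move=> h1 h2 d d0.
have m0 : 0 < Num.min (Num.min 1 (d / (1 + v y1 + v y2))) (Num.min 1 (d / (1 + v' z1 + v' z2))).
  by rewrite !lt_min ltr01 !divr_gt0// -addrA ltr_pwDl// addr_ge0 ?absv_ge0.
have [x1 []] := h1 _ m0; rewrite lt_min => /andP[a1 _]; rewrite lt_min => /andP[_ b1].
have [x2 []] := h2 _ m0; rewrite lt_min => /andP[a2 _]; rewrite lt_min => /andP[_ b2].
by exists (x1 * x2); rewrite !rmorphM; split; exact: prod_close.
Qed.

Lemma close_pair_emb x : close_pair (iota x) (iota' x).
Proof. by move=> d d0; exists x; rewrite !subrr !absv0. Qed.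

End Unique.

Lemma close_pair_sym (R : realType) (K F F' : fieldType) (v : absvalue R F) (v' : absvalue R F')
  (iota : {rmorphism K -> F}) (iota' : {rmorphism K -> F'}) y y' :
  close_pair v v' iota iota' y y' -> close_pair v' v iota' iota y' y.
Proof. by move=> h d /h[x [h1 h2]]; exists x. Qed.

Theorem completion_unique (R : realType) (K F F' : fieldType) (v : absvalue R F) (v' : absvalue R F')
   (iota : {rmorphism K -> F}) (iota' : {rmorphism K -> F'}) :
  dense_emb v iota -> dense_emb v' iota' -> cauchy_complete v -> cauchy_complete v' ->
  absv_equiv (absv_pullback v iota) (absv_pullback v' iota') ->
  exists (phi : {rmorphism F -> F'}) (psi : F' -> F), [/\ cancel psi phi,
     forall x, phi (iota x) = iota' x & dominates v (absv_pullback v' phi)].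
Proof.
move=> dn dn' cp cp' eqv.
have dom := absv_equiv_dominates eqv; have dom' := absv_equiv_dominates (absv_equiv_sym eqv).
have [phi hphi] := choice (fun y => close_pair_ex dn dom y cp').
have [psi hpsi] := choice (fun y => close_pair_ex dn' dom' y cp).
have uq y y1 y2 h1 h2 := @close_pair_unique R K F F' v v' iota iota' dom y y1 y2 h1 h2.
have fB : zmod_morphism phi by move=> x y; apply: uq (hphi _) (close_pairB (hphi x) (hphi y)).
have fM : monoid_morphism phi.
  split; last by move=> x y; apply: uq (hphi _) (close_pairM (hphi x) (hphi y)).
  by apply: uq (hphi _) _; rewrite -(rmorph1 iota) -(rmorph1 iota'); exact: close_pair_emb.
pose P : {rmorphism F -> F'} := HB.pack phi (GRing.isZmodMorphism.Build F F' phi fB) (GRing.isMonoidMorphism.Build F F' phi fM).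
exists P, psi; split.
- by move=> y; apply: uq (hphi _) (close_pair_sym (hpsi y)).
- by move=> x; apply: uq (hphi _) _; exact: close_pair_emb.
move=> d d0; have d2 : 0 < d / 2 by rewrite divr_gt0.
have [c c0 hc] := dom _ d2; exists (c / 2); first by rewrite divr_gt0.
move=> y hy; have m0 : 0 < Num.min (c / 2) (d / 2) by rewrite lt_min !divr_gt0.
have [x []] := hphi y _ m0; rewrite !lt_min => /andP[h1 _] /andP[_ h2].
have h3 : v' (iota' x) < d / 2.
  apply: hc; rewrite /=; have := absv_le_dist v (iota x) y; lra.
rewrite /=; have := absv_le_dist v' (phi y) (iota' x); rewrite absv_dist; lra.
Qed.

Lemma loc_compact_complete (R : realType) (F : fieldType) (v : absvalue R F) :
  loc_compact v -> cauchy_complete v.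
Proof.
move=> LC U PU h; have [V [uV UV]] := ultra_of_filter PU; have [PV _] := uV.
have [x0 h0] := h 1 ltr01.
have [|l hl] := LC V uV.
  exists (1 + v x0); apply: filterS (UV _ h0) => y /= hy.
  have := absv_le_dist v y x0; lra.
exists l => d d0; have d3 : 0 < d / 3 by rewrite divr_gt0.
have [x hx] := h _ d3.
have [y [/= h1 h2]] := filter_ex (filterI (hl _ d3) (UV _ hx)).
apply: filterS hx => z /= hz.
have := absvD3 v z x l; have := absvD3 v x y l; rewrite (absv_dist v x y); lra.
Qed.

(** * R and C as completions *)

Section RealComplex.
Variable R : realType.

Lemma real_loc_compact : loc_compact (real_absvalue R).
Proof.
move=> U uU [M hM].
have [|x _ hx] := @compact_ultra_cvg R `[- M, M]%classic U (@segment_compact R (- M) M) uU.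
  by apply: filterS hM => y /=; rewrite in_itv /= ler_norml.
exists x => d d0; have : nbhs x (ball x d) by exact: nbhsx_ballx.
move/hx => h; apply: filterS h => y.
by rewrite /ball /= distrC.
Qed.

Import Normc.

Definition complex_absvalue : absvalue R R[i] :=
  @Absvalue R R[i] (@normc R) (fun x => let: Complex a b := x in sqrtr_ge0 _)
    (fun x => conj (@eq0_normc R x) (fun e => etrans (congr1 (@normc R) e) (@normc0 R)))
    (@normcM R) (@le_normcD R).

Lemma normc_ge (z : R[i]) : `|complex.Re z| <= normc z /\ `|complex.Im z| <= normc z.
Proof.
case: z => a b /=; split; rewrite -sqrtr_sqr ler_sqrt ?addr_ge0 ?sqr_ge0//.
  by rewrite lerDl sqr_ge0.
by rewrite lerDr sqr_ge0.
Qed.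

Lemma normc_le (z : R[i]) : normc z <= `|complex.Re z| + `|complex.Im z|.
Proof.
case: z => a b /=; rewrite -[leRHS]ger0_norm ?addr_ge0// -sqrtr_sqr ler_sqrt ?sqr_ge0//.
by rewrite sqrrD !real_normK ?num_real// addrAC lerDl mulrn_wge0// mulr_ge0.
Qed.

Lemma normc_real (a : R) : normc (real_complex R a) = `|a|.
Proof. by rewrite /= expr0n addr0 sqrtr_sqr. Qed.

Lemma complex_loc_compact : loc_compact complex_absvalue.
Proof.
move=> U uU [M hM].
have [a ha] : exists a, vlim (real_absvalue R) U (fun z : R[i] => complex.Re z) a.
  apply: (lc_vlim real_loc_compact uU); exists M; apply: filterS hM => z /= hz.
  exact: le_trans (normc_ge z).1 hz.
have [b hb] : exists a, vlim (real_absvalue R) U (fun z : R[i] => complex.Im z) a.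
  apply: (lc_vlim real_loc_compact uU); exists M; apply: filterS hM => z /= hz.
  exact: le_trans (normc_ge z).2 hz.
exists (Complex a b) => d d0; have d2 : 0 < d / 2 by rewrite divr_gt0.
apply: filterS2 (ha _ d2) (hb _ d2) => -[x y] /= hx hy.
apply: le_lt_trans (normc_le (Complex (x - a) (y - b))) _ => /=; lra.
Qed.

End RealComplex.

Section Completion.
Context {R : realType} {K : fieldExtType rat} (p : prime_of R K).

Lemma cauchy_complete_filter (F : fieldType) (v : absvalue R F) : cauchy_complete v ->
  forall A : set_system (absv_space v), ProperFilter A -> cauchy A -> exists x : absv_space v, A --> x.
Proof.
move=> cp A PA cA; have [|l hl] := cp A PA.
  move=> d d0; have [x hx] := (@cauchyP R (absv_space v) A PA).1 cA d d0.
  by exists x; apply: filterS hx => y; rewrite /ball /= absv_dist.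
exists l => S /absv_nbhsP[d d0 hd].
by apply: filterS (hl _ d0) => y /=; exact: hd.
Qed.

Lemma dense_emb_dense (F : fieldType) (v : absvalue R F) (f : K -> F) :
  dense_emb v f -> dense (range f : set (absv_space v)).
Proof.
move=> h A [y Ay] /absv_openP /(_ y Ay)[d d0 hd]; have [x hx] := h y d d0.
by exists (f x); split; [exact: hd | exists x].
Qed.

Lemma compl_dense_emb (Kp : completion p) : dense_emb (compl_absv Kp) (compl_emb Kp).
Proof.
move=> y d d0; have /(_ [set z | compl_absv Kp ((z : Kp) - y) < d])[||z [hz [x _ xz]]] := @compl_dense _ _ _ Kp.
- by exists y; rewrite /= subrr absv0.
- apply/absv_openP => x /= hx; exists (d - compl_absv Kp (x - y)); first by rewrite subr_gt0.
  by move=> z zx; have := absvD3 (compl_absv Kp) z x y; lra.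
by exists x; rewrite xz.
Qed.

Lemma compl_cauchy_complete (Kp : completion p) : cauchy_complete (compl_absv Kp).
Proof. by move=> U PU; exact: completion_cauchy. Qed.

(** This is what allows the given completion at an infinite prime to be exchanged for R or C. *)
Lemma completion_isoG (E : weierstrass K) (Kp Kp' : completion p) : loc_compact (compl_absv Kp) ->
  isoG (ec_group (compl_absv Kp) (map_weierstrass (compl_emb Kp) E))
       (ec_group (compl_absv Kp') (map_weierstrass (compl_emb Kp') E)).
Proof.
move=> LC.
have eqv := prime_equiv (compl_prime Kp) (compl_prime Kp').
have [phi [psi [psiK phiE dphi]]] := completion_unique (@compl_dense_emb Kp) (@compl_dense_emb Kp')
  (@compl_cauchy_complete Kp) (@compl_cauchy_complete Kp') eqv.
apply: (@transport_isoG _ _ _ (compl_absv Kp) (compl_absv Kp') phi psi 0 0 0); rewrite /= ?phiE ?mulr0 ?addr0//.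
- by ring.
- by ring.
- by ring.
- by ring.
move=> T U f l PU h d d0; have [c c0 hc] := dphi d d0.
by apply: filterS (h c c0) => t /=; rewrite -rmorphB; exact: hc.
Qed.

Lemma ratr_dense (y d : R) : 0 < d -> exists q : rat, `|ratr q - y| < d.
Proof.
move=> d0; have [|q] := @rat_in_itvoo R (y - d) (y + d); first by lra.
by rewrite in_itv /= => /andP[h1 h2]; exists q; rewrite ltr_norml; apply/andP; split; lra.
Qed.

Lemma real_emb_dense (s : {rmorphism K -> R}) : dense_emb (real_absvalue R) s.
Proof.
move=> y d d0; have [q hq] := ratr_dense y d0; exists (q%:A).
by rewrite /= rmorph_ratA.
Qed.

Definition real_completion (s : {rmorphism K -> R}) (ps : real_prime_of p s) : completion p :=
  @Completion R K p R (real_absvalue R) s ps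
   (dense_emb_dense (@real_emb_dense s))
   (cauchy_complete_filter (loc_compact_complete (@real_loc_compact R))).

(** 1 and s x span C over R. The coefficient q of x is approximated from the imaginary part, then
    the rational term q' from the real part. *)
Lemma complex_emb_dense (s : {rmorphism K -> R[i]}) :
  (exists x, complex.Im (s x) != 0) -> dense_emb (complex_absvalue R) s.
Proof.
move=> [x x0] [a b] d d0; set A := complex.Re (s x); set B := complex.Im (s x) in x0.
have c0 : 0 < d / 2 / (1 + `|A| + `|B|) by rewrite !divr_gt0// -addrA ltr_pwDl// addr_ge0.
have [q hq] := ratr_dense (b / B) c0.
have [q' hq'] := ratr_dense (a - ratr q * A) (divr_gt0 d0 (ltr0n R 4)).
exists (q'%:A + q%:A * x).
have rc (t : rat) : ratr t = Complex (ratr t) 0 :> R[i] by rewrite -(fmorph_rat (real_complex R)).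
have -> : s (q'%:A + q%:A * x) - Complex a b = Complex (ratr q' - (a - ratr q * A)) (ratr q * B - b).
  rewrite rmorphD rmorphM /= !rmorph_ratA !rc /A /B; case: (s x) => A' B' /=.
  by apply/eqP; rewrite eq_complex /=; apply/andP; split; apply/eqP; ring.
apply: le_lt_trans (normc_le _) _ => /=.
have -> : ratr q * B - b = (ratr q - b / B) * B by rewrite mulrBl divfK.
rewrite normrM; have B0 : 0 < `|B| by rewrite normr_gt0.
have : `|ratr q - b / B| * `|B| <= d / 2.
  move: hq; rewrite ltr_pdivlMr -?addrA ?ltr_pwDl ?addr_ge0// => /ltW; apply: le_trans.
  by rewrite ler_wpM2l// addrA lerDr addr_ge0//.
lra.
Qed.

Definition complex_completion (s : {rmorphism K -> R[i]}) (ps : sval p (absv_pullback (complex_absvalue R) s))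
    (ns : exists x, complex.Im (s x) != 0) : completion p :=
  @Completion R K p R[i] (complex_absvalue R) s ps
   (dense_emb_dense (complex_emb_dense ns))
   (cauchy_complete_filter (loc_compact_complete (@complex_loc_compact R))).

Lemma real_or_complex (s : {rmorphism K -> R[i]}) : sval p (absv_pullback (complex_absvalue R) s) ->
  (exists x, complex.Im (s x) != 0) \/ exists r : {rmorphism K -> R}, real_prime_of p r.
Proof.
move=> ps; have [|h] := pselect (exists x, complex.Im (s x) != 0); first by left.
right; have sR x : s x = real_complex R (complex.Re (s x)).
  have : complex.Im (s x) = 0 by apply/eqP/negP => /negP h'; apply: h; exists x.
  by case: (s x) => a b /= ->.
pose r x := complex.Re (s x).
have rB : zmod_morphism r by move=> x y; rewrite /r rmorphB; case: (s x) (s y) => [a b] [c d].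
have rM : monoid_morphism r.
  split; first by rewrite /r rmorph1.
  by move=> x y; rewrite /r rmorphM (sR x) (sR y) -rmorphM.
pose P : {rmorphism K -> R} := HB.pack r (GRing.isZmodMorphism.Build K R r rB) (GRing.isMonoidMorphism.Build K R r rM).
exists P; apply: equiv_prime ps _ => U.
suff E : forall x, absv_pullback (complex_absvalue R) s x = absv_pullback (real_absvalue R) P x.
  split=> /absv_openP h'; apply/absv_openP => x /h'[d d0 hd]; exists d => // y hy; apply: hd; move: hy; rewrite E//.
by move=> x; rewrite /= {1}sR normc_real.
Qed.

End Completion.

(** * The primes above l *)

Section Lattice.
Variables (R0 : set rat) (n : nat) (M : set 'rV[rat]_n) (N : rat).
Hypothesis R1 : R0 1.
Hypothesis RB : forall x y, R0 x -> R0 y -> R0 (x - y).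
Hypothesis RM : forall x y, R0 x -> R0 y -> R0 (x * y).
Hypothesis MB : forall x y, M x -> M y -> M (x - y).
Hypothesis MZ : forall r x, R0 r -> M x -> M (r *: x).
Hypothesis N0 : N != 0.
Hypothesis MN : forall i, M (N *: delta_mx 0 i).
Hypothesis NM : forall x, M x -> forall i, R0 (N * x 0 i).

Lemma R0_zero : R0 0. Proof. by rewrite -(subrr 1); exact: RB. Qed.
Lemma R0_opp x : R0 x -> R0 (- x). Proof. by rewrite -sub0r => ?; apply: RB => //; exact: R0_zero. Qed.
Lemma R0_add x y : R0 x -> R0 y -> R0 (x + y).
Proof. by move=> hx hy; rewrite -[y]opprK; apply: RB => //; exact: R0_opp. Qed.
Lemma R0_nat m : R0 m%:R.
Proof. by elim: m => [|m IH]; [exact: R0_zero | rewrite -natr1; exact: R0_add]. Qed.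
Lemma R0_int (m : int) : R0 m%:~R.
Proof. by case: (intP m) => [|k|k]; [exact: R0_zero | exact: R0_nat | rewrite rmorphN; apply: R0_opp; exact: R0_nat]. Qed.

Lemma numq_denq (x : rat) : (numq x)%:~R = (denq x)%:~R * x.
Proof.
have d0 : (denq x)%:~R != 0 :> rat by rewrite intr_eq0 denq_neq0.
by rewrite -[LHS](divfK d0) divq_num_den mulrC.
Qed.

(** The least positive integer g of I divides the numerators of all elements of I; their
    denominators are invertible in R0. *)
Lemma R0_principal (I : set rat) : (forall x y, I x -> I y -> I (x - y)) ->
  (forall r x, R0 r -> I x -> I (r * x)) -> (forall x, I x -> R0 x) -> (exists2 x, I x & x != 0) ->
  exists2 g, I g /\ g != 0 & forall x, I x -> exists2 r, R0 r & x = r * g.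
Proof.
move=> IB IM IR [x Ix x0].
have Inat : exists m, (0 < m)%N && `[< I m%:R >].
  exists `|numq x|%N; rewrite absz_gt0 numq_eq0 x0 /=; apply/asboolP.
  have h : I (numq x)%:~R.
    by rewrite numq_denq; apply: IM => //; exact: R0_int.
  case: (intP (numq x)) h => [|k|k] // h; rewrite abszN.
  have -> : `|k.+1|%:R = -1 * (- (k.+1%:Z))%:~R :> rat by rewrite rmorphN mulN1r opprK.
  by apply: IM => //; exact: R0_opp.
pose g := ex_minn Inat; have : (0 < g)%N && `[< I g%:R >] by rewrite /g; case: ex_minnP.
move=> /andP[g0 /asboolP Ig].
have gmin m : (0 < m)%N -> I m%:R -> (g <= m)%N.
  by move=> m0 Im; rewrite /g; case: ex_minnP => k _; apply; rewrite m0; exact/asboolP.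
have gdvd (m : int) : I m%:~R -> (g%:Z %| m)%Z.
  move=> Im; apply/dvdz_mod0P; have gz : (g%:Z != 0) by rewrite eqz_nat -lt0n.
  have r0 : (0 <= (m %% g)%Z) by exact: modz_ge0.
  have rg : ((m %% g)%Z < g%:Z) by apply: ltz_pmod; rewrite ltz_nat.
  have Ir : I ((m %% g)%Z)%:~R.
    have -> : (m %% g)%Z = m - (m %/ g)%Z * g by rewrite {2}(divz_eq m g) addrC addKr.
    by rewrite rmorphB rmorphM /=; apply: IB => //; apply: IM => //; exact: R0_int.
  move: r0 rg Ir; case: (m %% g)%Z => // r _ rg Ir.
  have [->//|rp] := posnP r.
  by have := gmin r rp Ir; rewrite ltz_nat in rg; rewrite leqNgt rg.
exists g%:R; first by split; rewrite ?pnatr_eq0 -?lt0n.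
move=> y Iy; have d0 : (denq y)%:~R != 0 :> rat by rewrite intr_eq0 denq_neq0.
have Iny : I (numq y)%:~R.
  by rewrite numq_denq; apply: IM => //; exact: R0_int.
have /dvdzP[c hc] := gdvd _ Iny.
exists (c%:~R / (denq y)%:~R).
  apply: RM; first exact: R0_int.
  have [u [w huw]] := Bezoutz (numq y) (denq y).
  have cop : gcdz (numq y) (denq y) = 1 by rewrite /gcdz (eqP (coprime_num_den y)).
  (* Bezout's relation between numerator and denominator shows that R0, which contains y, contains 1
     / denq y. *)
  have -> : (denq y)%:~R^-1 = u%:~R * y + w%:~R :> rat.
    apply: (mulIf d0); rewrite mulVf// mulrDl -mulrA [y * _]mulrC -numq_denq.
    by rewrite -!rmorphM -rmorphD huw cop.
  by apply: R0_add; [apply: RM; [exact: R0_int | exact: IR] | exact: R0_int].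
by rewrite -{1}[y]divq_num_den hc rmorphM /= mulrAC.
Qed.
(** A triangular basis, as in the Hermite normal form: b_i gives a generator of the i-th coordinates
    of the elements of M whose earlier coordinates vanish. The cases of interest are the l-integral
    rationals and Z. *)
Theorem lattice_basis : exists b : 'I_n -> 'rV[rat]_n, [/\ forall i, M (b i),
  forall x, M x -> exists2 c : 'I_n -> rat, (forall i, R0 (c i)) & x = \sum_i c i *: b i &
  forall c : 'I_n -> rat, \sum_i c i *: b i = 0 -> forall i, c i = 0].
Proof.
pose tri (i : nat) (x : 'rV[rat]_n) := forall j : 'I_n, (j < i)%N -> x 0 j = 0.
have ex (i : 'I_n) : exists b : 'rV[rat]_n, [/\ M b, tri i b, b 0 i != 0 &
    forall x, M x -> tri i x -> exists2 r, R0 r & x 0 i = r * b 0 i].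
  pose I := [set t : rat | exists x, [/\ M x, tri i x & t = N * x 0 i]].
  have [||||g [[x [Mx tx gx]] g0] hg] := @R0_principal I.
  - move=> _ _ [x [Mx tx ->]] [y [My ty ->]]; exists (x - y); split; first exact: MB.
      by move=> j ji; rewrite !mxE tx// ty// subr0.
    by rewrite !mxE; ring.
  - move=> r _ Rr [x [Mx tx ->]]; exists (r *: x); split; first exact: MZ.
      by move=> j ji; rewrite !mxE tx// mulr0.
    by rewrite !mxE; ring.
  - by move=> _ [x [Mx _ ->]]; exact: NM.
  - exists (N * N); last by rewrite mulf_neq0.
    exists (N *: delta_mx 0 i); split=> //; last by rewrite !mxE !eqxx mulr1.
    by move=> j ji; rewrite !mxE eqxx /= [j == i](ltn_eqF _)// mulr0.
  exists x; split=> //.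
    by apply: contraNneq g0 => e; rewrite gx e mulr0.
  move=> y My ty; have [|r Rr hr] := hg (N * y 0 i); first by exists y.
  exists r => //; apply: (mulfI N0); rewrite hr gx; ring.
have [b hb] := choice ex; exists b; split; first by move=> i; case: (hb i).
- suff gen k : (k <= n)%N -> forall x, M x -> tri (n - k)%N x -> exists2 c : 'I_n -> rat, (forall i, R0 (c i)) & x = \sum_i c i *: b i.
    by move=> x Mx; apply: (gen n) => // j; rewrite subnn.
  elim: k => [_|k IH kn] x Mx tx.
    exists (fun=> 0) => [_|]; first exact: R0_zero.
    rewrite big1 => [|i _]; last by rewrite scale0r.
    by apply/rowP => j; rewrite mxE tx// subn0.
  have ik : (n - k.+1 < n)%N by lia.
  pose i := Ordinal ik; have [Mb tb bi0 hbi] := hb i.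
  have [r Rr xr] := hbi x Mx tx.
  have [||c Rc hc] := IH (ltnW kn) (x - r *: b i).
  - by apply: MB => //; exact: MZ.
  - move=> j; rewrite -subSS subSn// ltnS leq_eqVlt => /orP[/eqP ji|ji]; last by rewrite !mxE tx// tb// mulr0 subr0.
    have -> : j = i by apply: val_inj.
    by rewrite !mxE xr subrr.
  exists (fun j => c j + r *+ (j == i)).
    by move=> j; apply: R0_add => //; case: eqP => _ //; exact: R0_zero.
  rewrite -[LHS](subrK (r *: b i)) hc.
  rewrite [RHS](eq_bigr (fun j => c j *: b j + (r *+ (j == i)) *: b j)); last by move=> j _; rewrite scalerDl.
  rewrite big_split /=; congr (_ + _); rewrite (bigD1 i)//= eqxx big1 ?addr0// => j /negPf->.
  by rewrite mulr0n scale0r.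
- move=> c h; suff gen k : (k <= n)%N -> forall j : 'I_n, (j < k)%N -> c j = 0.
    by move=> i; exact: (gen n).
  elim: k => [//|k IH] kn j; rewrite ltnS leq_eqVlt => /orP[/eqP jk|]; last exact: (IH (ltnW kn)).
  have := congr1 (fun x : 'rV[rat]_n => x 0 j) h; rewrite summxE mxE (bigD1 j)//= mxE.
  rewrite big1 ?addr0; last first.
    move=> i ij; rewrite mxE; have [lt|ge] := ltnP i j.
      by rewrite (IH (ltnW kn)) ?mul0r// -jk.
    have [_ tb _ _] := hb i; rewrite tb ?mulr0//; rewrite ltn_neqAle ge andbT.
    by apply: contra_neq ij => /val_inj.
  by have [_ _ b0 _] := hb j; move/eqP; rewrite mulf_eq0 (negPf b0) orbF => /eqP.
Qed.

End Lattice.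

(** * Inverse limits of cyclic groups: q = id gives Zhat, and q k = l^k - 1 gives Z_l *)

Section InverseLimit.
Variable q : nat -> nat.

Definition ilim_ambient : topGroupLaw := bigprod_group (fun k : nat => discrete_group 'I_(q k).+1).

Definition ilim_compatible : set ilim_ambient :=
  [set a | forall j k : nat, ((q j).+1 %| (q k).+1)%N ->
    ((a k : 'I_(q k).+1) = (a j : 'I_(q j).+1) %[mod (q j).+1])%N].

Definition ilim : Type := set_type ilim_compatible.

Lemma ilim_add_subproof (a b : ilim) : (\val a + \val b : ilim_ambient) \in ilim_compatible.
Proof.
have ha := set_mem (valP a); have hb := set_mem (valP b).
apply/mem_set => m k mk /=.
have := ha m k mk; have := hb m k mk.
rewrite /GRing.add /= => eb ea.
by rewrite modn_dvdm// modn_mod -modnDm ea eb modnDm.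
Qed.

Lemma ilim_zero_subproof : (0 : ilim_ambient) \in ilim_compatible.
Proof. by apply/mem_set. Qed.

Definition ilim_add (a b : ilim) : ilim := exist _ (\val a + \val b : ilim_ambient) (ilim_add_subproof a b).
Definition ilim_zero : ilim := exist _ (0 : ilim_ambient) ilim_zero_subproof.

HB.instance Definition _ := Topological.on ilim.
HB.instance Definition _ := GRing.hasAdd.Build ilim ilim_add.
HB.instance Definition _ := GRing.hasZero.Build ilim ilim_zero.

Definition ilim_group : topGroupLaw := [topGroupLaw of ilim].

End InverseLimit.

Lemma eventually_eq_cvg {T : Type} {X : topologicalType} (U : set_system T) {FU : Filter U} (f : T -> X) (x : X) :
  U [set t | f t = x] -> f @ U --> x.
Proof. by move=> h A /nbhs_singleton Ax; change (U [set t | A (f t)]); apply: filterS h => t /= ->. Qed.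

Lemma set_type_cvg {T : Type} {X : topologicalType} (A : set X) (U : set_system T) {FU : Filter U}
    (f : T -> set_type A) (x : set_type A) : (fun t => \val (f t)) @ U --> \val x -> f @ U --> x.
Proof.
move=> h S [B [[C oC <-] Cx] BS]; change (U [set t | S (f t)]).
have UC : U [set t | C (\val (f t))] by apply: (h C); apply: open_nbhs_nbhs; split.
by apply: filterS UC => t /= Ct; exact: BS.
Qed.

Lemma set_type_val_cvg {T : Type} {X : topologicalType} (A : set X) (U : set_system T)
    (f : T -> set_type A) (x : set_type A) : f @ U --> x -> (fun t => \val (f t)) @ U --> \val x.
Proof. exact: (cvg_comp_at (@initial_continuous _ _ (fun y : set_type A => \val y) x)). Qed.

Lemma discrete_cvg {T : Type} (V : Algebra.ChoiceBaseAddUMagma.type) (U : set_system T)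
   (f : T -> discrete_group V) (x : discrete_group V) : f @ U --> x -> U [set t | f t = x].
Proof.
move=> h; apply: (h [set x]).
by apply: open_nbhs_nbhs; split => //; exact: discrete_open.
Qed.

Lemma ilim_cvg {T : Type} q (U : set_system T) {FU : Filter U} (f : T -> ilim_group q) (x : ilim_group q) :
  (forall k, U [set t | (\val (f t) : ilim_ambient q) k = (\val x : ilim_ambient q) k]) -> f @ U --> x.
Proof.
move=> h; apply: set_type_cvg; apply: bprod_cvg => k; exact: (@eventually_eq_cvg _ _ U FU _ _ (h k)).
Qed.

Lemma ilim_proj {T : Type} q (U : set_system T) {FU : Filter U} (f : T -> ilim_group q) (x : ilim_group q) k :
  f @ U --> x -> U [set t | (\val (f t) : ilim_ambient q) k = (\val x : ilim_ambient q) k].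
Proof.
move=> /set_type_val_cvg h; apply: (@discrete_cvg _ 'I_(q k).+1 U).
exact: (@bproj_cvg _ _ _ U (fun t => \val (f t)) (\val x) k h).
Qed.

Lemma ilim_hausdorff q : hausdorff_space (ilim_group q).
Proof.
apply: hausdorff_cvg => U a b PU Ua Ub; apply/val_inj; apply: dep_funext => k.
have [t [/= h1 h2]] := filter_ex (filterI (ilim_proj k Ua) (ilim_proj k Ub)).
by rewrite -h1 -h2.
Qed.

Section Torsion.
Context {G : topGroupLaw} (HG : tabgroup G).
Notation Z := (zsort_of HG).

Definition tors (x : Z) := exists2 m, (0 < m)%N & x *+ m = 0.

Lemma torsP (x : G) : torsion G x <-> tors (x : Z). Proof. by []. Qed.

Lemma torsD x y : tors x -> tors y -> tors (x + y).
Proof.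
move=> [m m0 hm] [k k0 hk]; exists (m * k)%N; first by rewrite muln_gt0 m0.
by rewrite mulrnDl mulrnA hm mul0rn mulnC mulrnA hk mul0rn addr0.
Qed.
Lemma torsN x : tors x -> tors (- x).
Proof. by move=> [m m0 hm]; exists m; rewrite // mulNrn hm oppr0. Qed.
Lemma tors0 : tors 0. Proof. by exists 1%N. Qed.
Lemma torsB x y : tors x -> tors y -> tors (x - y).
Proof. by move=> hx hy; apply: torsD => //; exact: torsN. Qed.
Lemma torsMn x m : tors x -> tors (x *+ m).
Proof. by move=> hx; elim: m => [|m IH]; [exact: tors0 | rewrite mulrS; exact: torsD]. Qed.
Lemma tors_div x m : (0 < m)%N -> tors (x *+ m) -> tors x.
Proof. by move=> m0 [k k0 hk]; exists (m * k)%N; rewrite ?muln_gt0 ?m0// mulrnA. Qed.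

Lemma torsion_addE (x y : torsion_group G) :
  val (x + y : torsion_type G) = ((val x : Z) + (val y : Z) : Z).
Proof.
apply: insubdK; apply/mem_set; apply/torsP; apply: torsD; apply/torsP.
  exact: set_mem (valP (x : torsion_type G)).
exact: set_mem (valP (y : torsion_type G)).
Qed.

End Torsion.

Lemma nbhs_ultra {X : topologicalType} (x : X) (A : set X) :
  (forall U : set_system X, ultra U -> U --> x -> U A) -> nbhs x A.
Proof.
move=> h; apply: contrapT => nA.
pose V := [set S : set X | exists2 B, nbhs x B & B `&` ~` A `<=` S].
have PV : ProperFilter V.
  apply: Build_ProperFilter_ex.
    move=> S [B xB BS]; apply: contrapT => hS; apply: nA; apply: filterS xB => y By.
    by apply: contrapT => nAy; apply: hS; exists y; apply: BS.
  split; first by exists setT => //; exact: filterT.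
    move=> S S' [B xB BS] [B' xB' BS']; exists (B `&` B'); first exact: filterI.
    by move=> y [[h1 h2] h3]; split; [apply: BS | apply: BS'].
  by move=> S S' SS' [B xB BS]; exists B => // y hy; apply: SS'; exact: BS.
have [U [uU VU]] := ultra_of_filter PV.
have c : U --> x by move=> B xB; apply: VU; exists B => // y [].
have U1 := h U uU c.
have U2 : U (~` A) by apply: VU; exists setT; [exact: filterT | move=> y []].
by have [y [h1 h2]] := filter_ex (filterI U1 U2).
Qed.

Lemma subr_exchange (V : zmodType) (x y a b : V) : (x - y) - (x - a) + (y - b) = a - b.
Proof. by rewrite opprB [x - y + (a - x)]addrC !addrA !subrK. Qed.

(** * Compact groups that are Z_l^n up to torsion *)

Section LadicCore.
Context {G : topGroupLaw} (HG : tabgroup G).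
Notation Z := (zsort_of HG).
Hypothesis cG : compact [set: G].
Hypothesis hG : hausdorff_space G.
Variables (l n : nat) (g : 'I_n -> Z).
Hypothesis pl : prime l.

(** The subgroup l^k G + torsion. The hypotheses [gen] and [indep] say that the quotient of G by it
    is free over Z/l^k on the g_i, and [sep] that these subgroups have only torsion in common. *)
Definition divtors k (P : Z) := exists Q t, tors t /\ P = Q *+ l ^ k + t.

Hypothesis gen : forall P k, exists r : 'I_n -> nat, divtors k (P - \sum_i g i *+ r i).
Hypothesis indep : forall (r : 'I_n -> int) k, divtors k (\sum_i g i *~ r i) -> forall i, (l ^ k %| `|r i|)%N.
Hypothesis sep : forall P, (forall k, divtors k P) -> tors P.
Hypothesis op : forall k, nbhs (0 : Z) (divtors k).
Hypothesis disc : nbhs (0 : Z) [set P | tors P -> P = 0].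

Lemma divtorsD k P Q : divtors k P -> divtors k Q -> divtors k (P + Q).
Proof.
move=> [P' [t [ht ->]]] [Q' [t' [ht' ->]]]; exists (P' + Q'), (t + t'); split; first exact: torsD.
by rewrite mulrnDl addrACA.
Qed.
Lemma divtorsN k P : divtors k P -> divtors k (- P).
Proof. by move=> [P' [t [ht ->]]]; exists (- P'), (- t); split; [exact: torsN | rewrite opprD mulNrn]. Qed.
Lemma divtorsB k P Q : divtors k P -> divtors k Q -> divtors k (P - Q).
Proof. by move=> h1 /divtorsN; exact: divtorsD. Qed.
Lemma divtors_tors k P : tors P -> divtors k P.
Proof. by move=> h; exists 0, P; rewrite mul0rn add0r. Qed.
Lemma divtors_mul k P : divtors k (P *+ l ^ k).
Proof. by exists P, 0; rewrite addr0; split=> //; exact: tors0. Qed.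
Lemma divtors_lim {T : Type} (U : set_system T) (f : T -> Z) (x : Z) k : ultra U -> f @ U --> x ->
  U [set t | divtors k (f t)] -> divtors k x.
Proof.
move=> uU fx h.
have U1 : U [set t | divtors k (f t - x)] by exact: (proj1 (@zcvgP _ HG _ U f x uU) fx _ (op k)).
have [t [/= h1 h2]] := filter_ex (filterI h U1).
by rewrite -[x](subKr (f t)); apply: divtorsB.
Qed.

(** The torsion subgroup is closed by [sep] and [op], and discrete by [disc], in a compact group. *)
Lemma tors_bounded : exists2 N, (0 < N)%N & forall t : Z, tors t -> t *+ N = 0.
Proof.
have [M hM] : exists M, forall t : Z, tors t -> exists2 m, (0 < m <= M)%N & t *+ m = 0.
  apply: contrapT => hn.
  have ex M : exists t : Z, tors t /\ forall m, (0 < m <= M)%N -> t *+ m != 0.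
    apply: contrapT => h; apply: hn; exists M => t ht; apply: contrapT => h2.
    by apply: h; exists t; split=> // m hm; apply/eqP => e; apply: h2; exists m.
  have [t ht] := choice ex.
  have [U [uU Un]] := ultra_nat.
  have [y hy] := compact_ultra_cvgT cG (ultra_map t uU).
  pose y' : Z := y.
  have ty : tors y'.
    apply: sep => k; apply: (@divtors_lim _ U t y' k uU hy).
    by apply: filterE => M; apply: divtors_tors; case: (ht M).
  have U1 : U [set M | tors (t M - y') -> t M - y' = 0].
    exact: (proj1 (@zcvgP _ HG _ U t y' uU) hy _ disc).
  have [m m0 hm] := ty.
  have [M [/= h1 h2]] := filter_ex (filterI U1 (Un m)).
  have [tM hM] := ht M; have e : t M = y' by apply/eqP; rewrite -subr_eq0 h1//; exact: torsB.
  by have := hM m; rewrite m0 h2 e hm eqxx => /(_ isT).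
exists M`!; first exact: fact_gt0.
move=> t /hM[m /andP[m0 mM] hm].
have /dvdnP[c ->] : (m %| M`!)%N by apply: dvdn_fact; rewrite m0.
by rewrite mulnC mulrnA hm mul0rn.
Qed.

Section Retract.
Variables (N a m : nat).
Hypothesis N0 : (0 < N)%N.
Hypothesis NT : forall t : Z, tors t -> t *+ N = 0.
Hypothesis Nam : N = (m * l ^ a)%N.
Hypothesis clm : coprime l m.

Let h i : Z := g i *+ m.

Lemma m_gt0 : (0 < m)%N.
Proof. by move: N0; rewrite Nam muln_gt0 => /andP[]. Qed.

Lemma m_inverse k : exists c d, (c * m = d * l ^ k + 1)%N.
Proof.
have [c d hc _] := egcdnP (l ^ k) m_gt0; exists c, d.
by rewrite hc; congr (_ + _)%N; rewrite gcdnC; apply/eqP; exact: coprimeXl.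
Qed.

Lemma gen' P k : exists r : 'I_n -> nat, divtors k (P - \sum_i h i *+ r i).
Proof.
have [r hr] := gen P k; have [c [d e]] := m_inverse k.
exists (fun i => r i * c)%N.
have -> : P - \sum_i h i *+ (r i * c) = (P - \sum_i g i *+ r i) - (\sum_i g i *+ (r i * d)) *+ l ^ k.
  rewrite -addrA -opprD; congr (_ - _).
  rewrite -sumrMnl -big_split /=; apply: eq_bigr => i _.
  rewrite /h -!mulrnA -mulrnDr; congr (_ *+ _).
  by rewrite mulnCA [(m * c)%N]mulnC e -mulnA mulnDr muln1 addnC.
by apply: divtorsB => //; exact: divtors_mul.
Qed.

Lemma indep' (r : 'I_n -> int) k : divtors k (\sum_i h i *~ r i) -> forall i, (l ^ k %| `|r i|)%N.
Proof.
have -> : \sum_i h i *~ r i = \sum_i g i *~ (m%:Z * r i).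
  by apply: eq_bigr => i _; rewrite /h pmulrn mulrzA.
move=> /indep hk i; have := hk i; rewrite abszM /= Gauss_dvdr//.
exact: coprimeXl.
Qed.

(** Modulo torsion m acts invertibly, being prime to l: Q is a limit of the multiples c_k P, with
    c_k an inverse of m modulo l^k. *)
Lemma m_divisible (P : Z) : exists (Q : Z) (t : Z), tors t /\ P = Q *+ m + t.
Proof.
have [cd hcd] := choice m_inverse.
have [dd hdd] := choice hcd.
have [U [uU Un]] := ultra_nat.
have [X hX] := compact_ultra_cvgT cG (ultra_map (fun k => P *+ cd k) uU).
pose X' : Z := X; exists X', (P - X' *+ m); split; last by rewrite addrC subrK.
apply: sep => k.
have hl : (fun j => P - (P *+ cd j) *+ m) @ U --> P - X' *+ m.
  by apply: zcvgB => //; [exact: cvg_cst | exact: zcvgMn].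
apply: (@divtors_lim _ U _ _ k uU hl); apply: filterS (Un k) => j kj /=.
rewrite -mulrnA hdd mulrnDr mulr1n opprD addrCA subrr addr0.
apply: divtorsN; rewrite -(subnK kj) expnD mulnA mulrnA; exact: divtors_mul.
Qed.

(* If m l^a kills the torsion, with m prime to l, then the closed subgroup generated by the m g_i
   is a complement of the torsion subgroup. *)
Definition complement (P : Z) := exists (c : 'I_n -> int) (Q : Z), P = \sum_i h i *~ c i + Q *+ N.

Lemma complementB P Q : complement P -> complement Q -> complement (P - Q).
Proof.
move=> [c [X ->]] [d [Y ->]]; exists (fun i => c i - d i), (X - Y).
rewrite opprD addrACA mulrnBl -sumrB; congr (_ + _).
by apply: eq_bigr => i _; rewrite mulrzBr.
Qed.

Lemma complement0 : complement 0.
Proof. by exists (fun=> 0), 0; rewrite mul0rn addr0 big1// => i _; rewrite mulr0z. Qed.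

Lemma complementN P : complement P -> complement (- P).
Proof. by rewrite -sub0r; apply: complementB; exact: complement0. Qed.

Lemma complementD P Q : complement P -> complement Q -> complement (P + Q).
Proof. by move=> hP /complementN hQ; rewrite -[Q]opprK; exact: complementB. Qed.

(** If P is torsion, the sum of the c_i h_i lies in l^a G + torsion, so l^a divides the c_i. As h_i
    = m g_i and N = m l^a, P is N times an element, which is torsion itself and hence killed by
    N. *)
Lemma complement_tors P : complement P -> tors P -> P = 0.
Proof.
move=> [c [Q e]] tP.
have hc : forall i, (l ^ a %| `|c i|)%N.
  apply: indep'; exists (- (Q *+ m)), P; split=> //.
  by rewrite e Nam mulrnA mulNrn addrCA addNr addr0.
have [b hb] : exists b : 'I_n -> int, forall i, c i = b i * (l ^ a)%:Z.
  have hb i : exists b, c i = b * (l ^ a)%:Z.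
    by have /dvdzP[b hb] : ((l ^ a)%:Z %| c i)%Z; [rewrite dvdzE; exact: hc | exists b].
  by have [b hb'] := choice hb; exists b.
have eP : P = (\sum_i g i *~ b i + Q) *+ N.
  rewrite e mulrnDl -sumrMnl; congr (_ + _); apply: eq_bigr => i _.
  by rewrite hb /h Nam !pmulrn -!mulrzA; congr (_ *~ _); rewrite PoszM; ring.
by move: tP; rewrite {1}eP => /(tors_div N0)/NT; rewrite -eP.
Qed.

Lemma complement_ex P : exists2 t, tors t & complement (P - t).
Proof.
have [r [Q [t [ht e]]]] := gen' P a.
have [Q' [t' [ht' eQ]]] := m_divisible Q.
exists (t + t' *+ l ^ a); first by apply: torsD => //; exact: torsMn.
exists (fun i => (r i)%:Z), Q'.
have -> : \sum_i h i *~ (r i)%:Z = \sum_i h i *+ r i by apply: eq_bigr => i _; rewrite -pmulrn.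
rewrite -[P in LHS](subrK (\sum_i h i *+ r i)) e eQ mulrnDl -mulrnA -Nam.
by rewrite opprD addrA (addrAC _ (\sum_i _)) addrK (addrAC _ (\sum_i _)) addrK addrC.
Qed.

(** The coefficients can be reduced modulo N, since N h_i is absorbed in Q *+ N. The ultrafilter
    then selects one of finitely many families, and Q has a limit by compactness. *)
Lemma complement_lim {T : Type} (U : set_system T) (f : T -> Z) (x : Z) : ultra U -> f @ U --> x ->
  U [set t | complement (f t)] -> complement x.
Proof.
move=> uU fx hU; have [PU _] := uU.
have red P : complement P -> exists (c : {ffun 'I_n -> 'I_N}) Q, P = \sum_i h i *+ c i + Q *+ N.
  move=> [c [Q ->]].
  have ci i : (`|(c i %% N)%Z| < N)%N.
    rewrite -ltz_nat gez0_abs ?modz_ge0 ?ltz_pmod ?ltz_nat// eqz_nat; lia.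
  exists [ffun i => Ordinal (ci i)], (\sum_i h i *~ (c i %/ N)%Z + Q).
  rewrite mulrnDl addrA -sumrMnl -big_split /=; congr (_ + _); apply: eq_bigr => i _.
  rewrite ffunE /= pmulrn gez0_abs ?modz_ge0// ?eqz_nat -?lt0n//.
  by rewrite pmulrn -mulrzA -mulrzDr addrC -divz_eq.
have [c _ hc] : exists2 c, c \in enum {: {ffun 'I_n -> 'I_N}} &
    U [set t | exists Q, f t = \sum_i h i *+ c i + Q *+ N].
  apply: (ultra_bigU uU); apply: filterS hU => t /= /red[c [Q e]].
  by exists c; rewrite ?mem_enum//; exists Q.
have [q hq] : exists q : T -> Z, forall t, (exists Q, f t = \sum_i h i *+ c i + Q *+ N) -> f t = \sum_i h i *+ c i + q t *+ N.
  have hx t : exists q : Z, (exists Q : Z, f t = \sum_i h i *+ c i + Q *+ N) -> f t = \sum_i h i *+ c i + q *+ N.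
    by have [[Q e]|] := pselect (exists Q : Z, f t = \sum_i h i *+ c i + Q *+ N); [exists Q | exists 0].
  by have [q hq] := choice hx; exists q.
have [Q hQ] := compact_ultra_cvgT cG (ultra_map q uU).
pose Q' : Z := Q.
exists (fun i => (c i)%:Z), Q'.
have -> : \sum_i h i *~ (c i)%:Z = \sum_i h i *+ c i by apply: eq_bigr => i _; rewrite -pmulrn.
have c1 : (fun t => \sum_i h i *+ c i + q t *+ N) @ U --> \sum_i h i *+ c i + Q' *+ N.
  by apply: zcvgD => //; [exact: cvg_cst | exact: zcvgMn].
apply: (hausdorff_unique hG (fmap_proper_filter f PU) fx).
move=> B /c1 hB; change (U [set t | B (f t)]).
have hB' : U [set t | B (\sum_i h i *+ c i + q t *+ N)] by exact: hB.
by apply: filterS2 hc hB' => t /= /hq ->.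
Qed.

(** When P tends to 0, the limit of its torsion part t P is torsion and lies in the complement,
    hence is 0; as the torsion is discrete, t P is 0 for P near 0. *)
Lemma complement_open : nbhs (0 : Z) complement.
Proof.
apply: nbhs_ultra => U uU U0.
have tex (P : Z) : exists t : Z, tors t /\ complement (P - t) by have [t] := complement_ex P; exists t.
have [t ht] := choice tex.
have [x hx] := compact_ultra_cvgT cG (ultra_map t uU).
pose x' : Z := x.
have tx : tors x'.
  apply: sep => k; apply: (@divtors_lim _ U t x' k uU hx).
  by apply: filterE => M; apply: divtors_tors; case: (ht M).
have c1 : (fun P : Z => P - t P) @ U --> (0 - x' : Z) by apply: zcvgB.
have A1 : complement (0 - x').
  by apply: (@complement_lim _ U _ _ uU c1); apply: filterE => P; case: (ht P).
have x0 : x' = 0.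
  by apply: oppr_inj; rewrite oppr0 -[LHS]sub0r; apply: complement_tors => //; rewrite sub0r; exact: torsN.
rewrite x0 in tx; have hx0 : t @ U --> (0 : Z) by rewrite -x0.
have U1 : U [set P | tors (t P) -> t P = 0] by exact: (hx0 _ disc).
apply: filterS U1 => P /=; have [tP aP] := ht P => /(_ tP) e.
by rewrite e subr0 in aP.
Qed.

(** The components of P are the coefficients of its classes modulo l^k G + torsion on the m g_i, for
    all k, and its torsion part along the complement. *)
Lemma ladic_structure_aux : isoG G
  (prod_group (power_group (ilim_group (fun k => (l ^ k).-1)) n) (torsion_group G)).
Proof.
have lk k : (l ^ k).-1.+1 = (l ^ k)%N by rewrite prednK// expn_gt0 prime_gt0.
pose rd k x : 'I_(l ^ k).-1.+1 := inord (x %% l ^ k).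
have rdE k x : nat_of_ord (rd k x) = (x %% l ^ k)%N.
  by rewrite inordK// lk ltn_mod expn_gt0 prime_gt0.
have rdS P k (r : 'I_n -> nat) : P - \sum_i h i *+ rd k (r i) =
    (P - \sum_i h i *+ r i) + (\sum_i h i *+ (r i %/ l ^ k)) *+ l ^ k.
  rewrite -addrA; congr (_ + _); apply/eqP; rewrite eqr_oppLR opprD opprK eq_sym subr_eq; apply/eqP.
  rewrite -sumrMnl -big_split /=; apply: eq_bigr => i _.
  by move: (h i) => hi; rewrite rdE -mulrnA -mulrnDr addnC -divn_eq.
have digit P k : exists r : 'I_n -> 'I_(l ^ k).-1.+1, divtors k (P - \sum_i h i *+ r i).
  have [r hr] := gen' P k.
  exists (fun i => rd k (r i)); rewrite rdS.
  by apply: divtorsD => //; exact: divtors_mul.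
have duniq k (r r' : 'I_n -> 'I_(l ^ k).-1.+1) P P' : divtors k (P - P') ->
    divtors k (P - \sum_i h i *+ r i) -> divtors k (P' - \sum_i h i *+ r' i) -> r =1 r'.
  move=> PP' hr hr' i.
  have : divtors k (\sum_i h i *~ ((r i)%:Z - (r' i)%:Z)).
    have -> : \sum_i h i *~ ((r i)%:Z - (r' i)%:Z) = \sum_i h i *+ r i - \sum_i h i *+ r' i.
      by rewrite -sumrB; apply: eq_bigr => j _; rewrite mulrzBr -!pmulrn.
    have -> : \sum_i h i *+ r i - \sum_i h i *+ r' i = (P - P') - (P - \sum_i h i *+ r i) + (P' - \sum_i h i *+ r' i).
      by rewrite subr_exchange.
    by apply: divtorsD => //; exact: divtorsB.
  move=> /indep' /(_ i) hd; apply/val_inj => /=.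
  have bd (x : 'I_(l ^ k).-1.+1) : (x < l ^ k)%N.
    by have := ltn_ord x; move: (nat_of_ord x) => y; rewrite lk.
  have h1 := bd (r i); have h2 := bd (r' i).
  have /dvdnP[c] := hd; move: (nat_of_ord (r i)) (nat_of_ord (r' i)) h1 h2 => x y h1 h2.
  case: c => [|c]; first by lia.
  rewrite mulSn; lia.
have [cc hcc] : exists cc : Z -> forall k, 'I_n -> 'I_(l ^ k).-1.+1, forall P k, divtors k (P - \sum_i h i *+ cc P k i).
  exists (fun P k => sval (cid (digit P k))) => P k; exact: svalP (cid (digit P k)).
have tex (P : Z) : exists t : Z, tors t /\ complement (P - t) by have [t] := complement_ex P; exists t.
have [r hr] := choice tex.
have runiq P P' t t' : complement (P - P') -> tors t -> tors t' -> complement (P - t) -> complement (P' - t') -> t = t'.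
  move=> cP ht ht' c1 c2; apply/eqP; rewrite -subr_eq0; apply/eqP; apply: complement_tors; last exact: torsB.
  have -> : t - t' = (P - P') - (P - t) + (P' - t').
    by rewrite subr_exchange.
  by apply: complementD => //; exact: complementB.
have compat P i : (fun k => cc P k i : discrete_group 'I_(l ^ k).-1.+1) \in @ilim_compatible (fun k => (l ^ k).-1).
  apply/mem_set => j k jk.
  suff : (cc P k i = cc P j i %[mod l ^ j])%N.
    by move: (nat_of_ord (cc P k i)) (nat_of_ord (cc P j i)) => x y; rewrite /= lk.
  have jk' : (j <= k)%N.
    have := jk; rewrite /= !lk => jk'.
    by move: jk'; rewrite dvdn_Pexp2l// prime_gt1.
  pose rr (i : 'I_n) := rd j (cc P k i).
  have e : rr =1 cc P j.
    apply: (duniq j rr (cc P j) P P) => //; first by rewrite subrr; apply: divtors_tors; exact: tors0.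
    have [Q [t [ht eq]]] := hcc P k.
    rewrite rdS.
    apply: divtorsD; last exact: divtors_mul.
    rewrite eq; apply: divtorsD; last exact: divtors_tors.
    by rewrite -(subnK jk') expnD mulrnA; exact: divtors_mul.
  by have := e i; rewrite /rr => <-; rewrite rdE modn_mod.
have rT P : (r P : G) \in torsion G by apply/mem_set/torsP; case: (hr P).
pose Phi (P : G) : prod_group (power_group (ilim_group (fun k => (l ^ k).-1)) n) (torsion_group G) :=
  ((fun i => exist _ (fun k => cc P k i) (compat P i) : ilim _) , exist _ (r P : G) (rT P) : torsion_type G).
exists Phi; apply: compact_isoG => //.
- apply: prod_hausdorff; first by apply: bigprod_hausdorff => i; exact: ilim_hausdorff.
  exact: discrete_hausdorff.
- congr (_, _).
    apply: dep_funext => i; apply/val_inj; apply: dep_funext => k /=.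
    apply: (duniq k (cc 0 k) (fun=> 0) 0 0) => //.
      by rewrite subrr; apply: divtors_tors; exact: tors0.
    by rewrite big1 ?subrr//; apply: divtors_tors; exact: tors0.
  apply/val_inj => /=; have [h1 h2] := hr 0.
  apply: (runiq 0 0) => //; rewrite ?subrr; [exact: complement0 | exact: tors0 | exact: complement0].
- move=> P Q; congr (_, _).
    apply: dep_funext => i; apply/val_inj; apply: dep_funext => k.
    rewrite /=; apply: (duniq k (cc ((P : Z) + (Q : Z)) k) (fun i => (cc P k i : 'I_(l ^ k).-1.+1) + (cc Q k i : 'I_(l ^ k).-1.+1)) ((P : Z) + (Q : Z)) ((P : Z) + (Q : Z))) => //.
      by rewrite subrr; apply: divtors_tors; exact: tors0.
    have e j : h j *+ (cc P k j + cc Q k j)%R = h j *+ cc P k j + h j *+ cc Q k j - (h j *+ ((cc P k j + cc Q k j) %/ l ^ k)%N) *+ l ^ k.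
      apply/eqP; rewrite eq_sym subr_eq; apply/eqP.
      by move: (h j) => hj; rewrite -!mulrnA -!mulrnDr; congr (_ *+ _) => /=; move: (nat_of_ord (cc P k j) + nat_of_ord (cc Q k j))%N => x; rewrite lk addnC -divn_eq.
    have -> : (P : Z) + (Q : Z) - \sum_j h j *+ (cc P k j + cc Q k j)%R =
       ((P : Z) - \sum_j h j *+ cc P k j) + ((Q : Z) - \sum_j h j *+ cc Q k j) + (\sum_j h j *+ ((cc P k j + cc Q k j) %/ l ^ k)%N) *+ l ^ k.
      rewrite (eq_bigr _ (fun j _ => e j)) sumrB big_split /= sumrMnl.
      by rewrite opprB addrA addrAC opprD addrACA.
    by apply: divtorsD; [apply: divtorsD | exact: divtors_mul].
  apply/val_inj; rewrite torsion_addE /=.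
  have [h1 h2] := hr ((P : Z) + (Q : Z)); have [h3 h4] := hr P; have [h5 h6] := hr Q.
  apply: (runiq ((P : Z) + (Q : Z)) ((P : Z) + (Q : Z))) => //.
  + by rewrite subrr; exact: complement0.
  + exact: torsD.
  + by rewrite opprD addrACA; exact: complementD.
- move=> P Q e.
  have e1 k i : cc P k i = cc Q k i.
    by have := congr1 (fun z => (val (z.1 i) : ilim_ambient _) k) e.
  have e2 : r P = r Q by exact: (congr1 (fun z : prod_group _ (torsion_group G) => val (z.2 : torsion_type G)) e).
  have tPQ : tors ((P : Z) - (Q : Z)).
    apply: sep => k.
    have -> : (P : Z) - (Q : Z) = ((P : Z) - \sum_i h i *+ cc P k i) - ((Q : Z) - \sum_i h i *+ cc Q k i).
      by rewrite (eq_bigr _ (fun i _ => congr1 (fun z : 'I_(l ^ k).-1.+1 => h i *+ z) (e1 k i))) opprB addrA subrK.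
    exact: divtorsB.
  have [h3 h4] := hr P; have [h5 h6] := hr Q.
  have cPQ : complement ((P : Z) - (Q : Z)).
    have -> : (P : Z) - (Q : Z) = ((P : Z) - r P) - ((Q : Z) - r Q) by rewrite e2 opprB addrA subrK.
    exact: complementB.
  exact: (subr0_eq (complement_tors cPQ tPQ)).
- move=> [y t].
  pose zz k i : 'I_(l ^ k).-1.+1 := (val (y i : ilim _) : ilim_ambient _) k.
  have zzP j k i : (k <= j)%N -> rd k (zz j i) = zz k i.
    move=> kj; apply/val_inj; rewrite [LHS]rdE /=.
    have := set_mem (valP (y i : ilim _)) k j; rewrite /= -/(zz j i) -/(zz k i) => hz.
    have {}hz := hz ltac:(by rewrite !lk dvdn_exp2l).
    have := ltn_ord (zz k i); move: hz; move: (nat_of_ord (zz j i)) (nat_of_ord (zz k i)) => u w.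
    by rewrite lk => -> h1; rewrite modn_small.
  have [U [uU Un]] := ultra_nat.
  have [X0 hX] := compact_ultra_cvgT cG (ultra_map (fun k => \sum_i h i *+ zz k i) uU).
  pose X : Z := X0.
  have ccX k : cc X k =1 zz k.
    have U1 : U [set j | divtors k (\sum_i h i *+ zz j i - X)].
      exact: (proj1 (@zcvgP _ HG _ U (fun j => \sum_i h i *+ zz j i) X uU) hX _ (op k)).
    have [j [/= h1 kj]] := filter_ex (filterI U1 (Un k)).
    apply: (duniq k (cc X k) (zz k) X (\sum_i h i *+ zz j i)) => //.
      by rewrite -opprB; exact: divtorsN.
    rewrite (eq_bigr (fun i => h i *+ zz j i))//; have <- : \sum_i h i *+ rd k (zz j i) = \sum_i h i *+ zz k i.
      by apply: eq_bigr => i _; rewrite zzP.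
    by rewrite rdS subrr add0r; exact: divtors_mul.
  pose t' : Z := val (t : torsion_type G).
  have tt' : tors t' by apply/torsP; exact: set_mem (valP (t : torsion_type G)).
  have [rX cX] := hr X.
  pose P : Z := X - r X + t'.
  have ccP k : cc P k =1 zz k.
    move=> i; rewrite -ccX; apply: (duniq k (cc P k) (cc X k) P X) => //.
    have -> : P - X = t' - r X by rewrite /P addrC !addrA addNr add0r addrC.
    apply: divtors_tors.
    exact: torsB.
  have rP : r P = t'.
    have [h1 h2] := hr P; apply: (runiq P P) => //; first by rewrite subrr; exact: complement0.
    by rewrite /P addrK.
  exists P; congr (_, _); last exact/val_inj.
  apply: dep_funext => i; apply/val_inj; apply: dep_funext => k.
  by rewrite /= ccP.
- apply: continuous_ultra => U uU x hx.
  have hx0 := proj1 (@zcvgP _ HG _ U (fun t => t) x uU) hx.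
  apply: pair_cvg.
    apply: bprod_cvg => i; apply: ilim_cvg => k /=.
    have U1 : U [set t | divtors k ((t : Z) - (x : Z))] by exact: (hx0 _ (op k)).
    by apply: filterS U1 => t /= ht; apply: (duniq k (cc t k) (cc x k) t x).
  apply: eventually_eq_cvg.
  have U1 : U [set t | complement ((t : Z) - (x : Z))] by exact: (hx0 _ complement_open).
  apply: filterS U1 => t /= ht; apply/val_inj => /=.
  by have [h1 h2] := hr t; have [h3 h4] := hr x; apply: (runiq t x).
Qed.

End Retract.

Theorem ladic_structure : isoG G
  (prod_group (power_group (ilim_group (fun k => (l ^ k).-1)) n) (torsion_group G)).
Proof.
have [N N0 NT] := tors_bounded.
have [/= m cm e] := pfactor_coprime pl N0.
exact: (@ladic_structure_aux N (logn l N) m N0 NT e cm).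
Qed.

End LadicCore.

Lemma isoG_compact_snd (G H T : topGroupLaw) : compact [set: G] -> isoG G (prod_group H T) -> compact [set: T].
Proof.
move=> cG ii; have cP := isoG_compact (isoG_sym ii) cG.
apply: ultra_cvg_compact => U uU _.
have [x hx] := compact_ultra_cvgT cP (ultra_map (fun t : T => ((0 : H), t) : prod_group H T) uU).
by exists x.2 => //; exact: (snd_cvg hx).
Qed.

(** The indices being finitely many, the product of the orders of the components kills a family of
    torsion elements. Compactness of the discrete source makes the bijection a homeomorphism. *)
Lemma torsion_bigprod {I : Type} (G : I -> topGroupLaw) : (forall i, tabgroup (G i)) ->
  (exists (m : nat) (f : 'I_m -> I), forall i, exists j, f j = i) ->
  compact [set: torsion_group (bigprod_group G)] ->
  isoG (torsion_group (bigprod_group G)) (bigprod_group (fun i => torsion_group (G i))).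
Proof.
move=> tG [m [f fs]] cT; have tB := bigprod_tab tG.
have valT (x : torsion_group (bigprod_group G)) i : (val (x : torsion_type _) : bigprod_group G) i \in torsion (G i).
  have [k k0 e] := set_mem (valP (x : torsion_type (bigprod_group G))).
  apply/mem_set; exists k => //.
  have aux j : (val (x : torsion_type _) *+ j : bigprod_group G) i = (val (x : torsion_type _) : bigprod_group G) i *+ j.
    elim: j => [//|j IH]; have := @mulrS (zsort_of tB) (val (x : torsion_type _)) j.
    move=> /(congr1 (fun y : bigprod_group G => y i)) ->.
    rewrite bigprod_morph IH.
    exact: esym (@mulrS (zsort_of (tG i)) ((val (x : torsion_type _) : bigprod_group G) i) j).
  by rewrite -aux e.
pose Phi (x : torsion_group (bigprod_group G)) : bigprod_group (fun i => torsion_group (G i)) :=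
  fun i => exist _ ((val (x : torsion_type _) : bigprod_group G) i) (valT x i) : torsion_type (G i).
exists Phi; apply: compact_isoG => //.
- by apply: bigprod_hausdorff => i; exact: discrete_hausdorff.
- by apply: dep_funext => i; apply/val_inj.
- move=> x y; apply: dep_funext => i; apply/val_inj.
  rewrite /= (torsion_addE tB) bigprod_morph; rewrite (torsion_addE (tG i)).
  by [].
- move=> x y e; apply/val_inj; apply: dep_funext => i.
  exact: (congr1 (fun z : bigprod_group (fun i => torsion_group (G i)) => val (z i : torsion_type (G i))) e).
- move=> y.
  pose x0 : bigprod_group G := fun i => val (y i : torsion_type (G i)).
  have hx0 : x0 \in torsion (bigprod_group G).
    have hk i : exists k, (0 < k)%N /\ (x0 i : zsort_of (tG i)) *+ k = 0.
      by have [k k0 e] := set_mem (valP (y i : torsion_type (G i))); exists k.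
    have [k hk'] := choice hk.
    pose N := (\prod_(j < m) k (f j))%N.
    apply/mem_set; exists N; first by apply: prodn_gt0 => j; case: (hk' (f j)).
    have aux j i : ((x0 : zsort_of tB) *+ j : bigprod_group G) i = (x0 i : zsort_of (tG i)) *+ j.
      elim: j => [//|j IH]; have := @mulrS (zsort_of tB) x0 j.
      move=> /(congr1 (fun y : bigprod_group G => y i)) ->.
      by rewrite bigprod_morph IH; exact: esym (@mulrS (zsort_of (tG i)) (x0 i) j).
    apply: dep_funext => i; have [j <-] := fs i.
    rewrite [LHS]aux /N (bigD1 j)//= mulrnA; have [_ ->] := hk' (f j).
    by rewrite mul0rn.
  exists (exist _ x0 hx0 : torsion_type _).
  by apply: dep_funext => i; apply/val_inj.
- by apply: continuous_ultra => U uU x hx; apply: eventually_eq_cvg; apply: filterS (discrete_cvg hx) => t /= ->.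
Qed.

Section LocalLog.
Context {R : realType} {F : fieldType} (v : absvalue R F) (W : weierstrass F) (l : nat).
Hypothesis char0 : forall m, (0 < m)%N -> (m%:R : F) != 0.
Hypothesis dW : discriminant W != 0.
Hypothesis LC : loc_compact v.
Hypothesis um : nonarchimedean v.
Hypothesis l0 : (0 < l)%N.
Hypothesis vl : v l%:R < 1.

Lemma local_facts : [/\ tabgroup (ec_group v W), compact [set: ec_group v W] & hausdorff_space (ec_group v W)].
Proof.
apply: ec_group_facts => //; first exact: char0.
  exact: char0.
by exists l%:R => //; exact: char0.
Qed.

Lemma local_log (HG : tabgroup (ec_group v W)) : exists L : zsort_of HG -> F, [/\ {morph L : x y / x + y},
  (forall d : R, 0 < d -> nbhs (0 : zsort_of HG) [set P | v (L P) < d]),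
  (forall P, L P = 0 -> exists2 m, (0 < m)%N & P *+ m = 0),
  (exists2 d : R, 0 < d & forall t, v t < d -> exists P, L P = t) &
  nbhs (0 : zsort_of HG) [set P | L P = 0 -> P = 0]].
Proof.
have n2 : (2 : F) != 0 by exact: char0.
have n3 : (3 : F) != 0 by exact: char0.
have [a [b [sm _ ii]]] := short_reduction n2 n3 dW LC.
have nt : exists2 pi : F, pi != 0 & v pi < 1 by exists l%:R => //; exact: char0.
have HG' := short_tabgroup n2 sm LC nt.
have [z [N [C ch]]] := short_chart HG' n2 sm LC.
have cG' : compact [set: ec_group v (short_weierstrass a b)] by exact: ec_compact.
have vl0 : 0 < v l%:R by apply: absv_gt0; exact: char0.
have [L [LD Lc Lk Ls Li]] := chart_log ch cG' LC um vl0 vl char0.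
have [f [f0 fD [g [gf fg fc gc]]]] := ii.
pose f' (P : zsort_of HG) : zsort_of HG' := f P.
have fcv : f' @ (0 : zsort_of HG) --> (0 : zsort_of HG').
  have c : f @ nbhs (0 : ec_group v W) --> f 0 by exact: fc.
  by move: c; have -> : f 0 = 0 by exact: f0.
have fMn (P : zsort_of HG) m : f' (P *+ m) = f' P *+ m.
  elim: m => [|m IH]; first by exact: f0.
  by rewrite !mulrS -IH; exact: fD.
exists (fun P => L (f' P)); split.
- by move=> x y; rewrite -LD; congr L; exact: fD.
- by move=> d d0; exact: (fcv _ (Lc d d0)).
- move=> P /Lk[m m0 e]; exists m => //; apply: (can_inj gf).
  by have := fMn P m; rewrite e /f' => ->; rewrite f0.
- have [d d0 hd] := Ls; exists d => // t /hd[P hP]; exists (g P).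
  by rewrite /f' fg.
- have h0 : nbhs (0 : zsort_of HG) [set P | L (f' P) = 0 -> f' P = 0] by exact: (fcv _ Li).
  apply: filterS h0 => P /= h /h e; apply: (can_inj gf).
  by rewrite f0; exact: e.
Qed.

End LocalLog.

(** * The product of the E(K_p) over the primes above l *)

Section LadicPlace.
Context {R : realType} {K : fieldExtType rat}.
Let n := \dim {:K}.
Context (e : 'I_n -> K).
Hypothesis span : forall x, exists a : 'I_n -> rat, x = \sum_i a i *: e i.
Hypothesis free_e : forall a : 'I_n -> rat, \sum_i a i *: e i = 0 -> forall i, a i = 0.
Context {Om : numClosedFieldType} (w : absvalue R Om).
Context (s : 'I_n -> {rmorphism K -> Om}) (B : 'I_n -> 'I_n -> Om).
Hypothesis sB : forall (a : 'I_n -> rat) i, ratr (a i) = \sum_j B i j * s j (\sum_k a k *: e k).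
Context (Kc : forall p : prime_of R K, completion p).
Hypothesis nw : nontrivial_absv (ratw w).
Context (l : nat).
Hypothesis pl : prime l.
Hypothesis uw : nonarchimedean (ratw w).
Hypothesis wl : ratw w l%:R < 1.
Context (I : Type) (pr : I -> prime_of R K) (G : I -> topGroupLaw).
Hypothesis abv : forall i, above w Kc (pr i).
Hypothesis pri : injective pr.
Hypothesis prs : forall p, above w Kc p -> exists i, pr i = p.
Hypothesis tG : forall i, tabgroup (G i).
Hypothesis cG : forall i, compact [set: G i].
Hypothesis hG : forall i, hausdorff_space (G i).
Notation F i := (Kc (pr i)).
Notation v i := (compl_absv (Kc (pr i))).
Notation io i := (compl_emb (Kc (pr i))).
Context (L : forall i, zsort_of (tG i) -> F i).
Hypothesis LD : forall i, {morph @L i : x y / x + y}.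
Hypothesis Lc : forall i (d : R), 0 < d -> nbhs (0 : zsort_of (tG i)) [set P | v i (L P) < d].
Hypothesis Lk : forall i P, @L i P = 0 -> exists2 m, (0 < m)%N & P *+ m = 0.
Hypothesis Ls : forall i, exists2 d : R, 0 < d & forall t, v i t < d -> exists P, @L i P = t.
Hypothesis Li : forall i, nbhs (0 : zsort_of (tG i)) [set P | L P = 0 -> P = 0].

Lemma finite_index : exists (m : nat) (f : 'I_m -> I), forall i, exists j, f j = i.
Proof.
have [[i0 _]|emp] := pselect (exists i : I, True); last first.
  have f : 'I_0 -> I by case.
  by exists 0%N, f => i; exfalso; apply: emp; exists i.
exists n.
have h (j : 'I_n) : exists i, pr i = conj_prime s nw j by apply: prs; exact: above_conj.
have [f hf] := choice h; exists f => i.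
have [j hj] := above_is_conj span sB nw (abv i).
by exists j; apply: pri; rewrite hf hj.
Qed.

Lemma finite_min (P : I -> R -> Prop) : (forall i (c d : R), P i c -> 0 < d -> d <= c -> P i d) ->
  (forall i, exists2 c : R, 0 < c & P i c) -> exists2 c : R, 0 < c & forall i, P i c.
Proof.
move=> mono ex; have [m [f fs]] := finite_index.
have ex' j : exists c : R, 0 < c /\ P (f j) c by have [c c0 hc] := ex (f j); exists c.
have [c hc] := choice ex'.
have m0 : 0 < \big[Num.min/1]_j c j.
  by elim/big_ind: _ => // [x y x0 y0|j _]; [rewrite lt_min x0 | case: (hc j)].
exists (\big[Num.min/1]_j c j) => // i; have [j <-] := fs i.
by have [_ h] := hc j; apply: mono h m0 _; exact: bigmin_le.
Qed.

Lemma finite_nbhs (x : bigprod_group G) (A : forall i, set (G i)) : (forall i, nbhs (x i) (A i)) ->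
  nbhs x [set y : bigprod_group G | forall i, A i (y i)].
Proof.
move=> h; have [m [f fs]] := finite_index.
have h2 : nbhs x [set y : bigprod_group G | forall j, A (f j) (y (f j))].
  exact: (@filter_forall (bigprod_group G) 'I_m (fun j => [set y : bigprod_group G | A (f j) (y (f j))]) (nbhs x) (nbhs_filter x) (fun j => @proj_nbhs _ _ x (f j) _ (h (f j)))).
by apply: filterS h2 => y /= hy i; have [j <-] := fs i; exact: hy.
Qed.

Lemma L0 i : @L i 0 = 0.
Proof. by apply: (addrI (@L i 0)); rewrite -LD !addr0. Qed.
Lemma LN i (P : zsort_of (tG i)) : L (- P) = - L P.
Proof. by apply/eqP; rewrite -addr_eq0 -LD addNr L0. Qed.
Lemma LB i (P Q : zsort_of (tG i)) : L (P - Q) = L P - L Q.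
Proof. by rewrite LD LN. Qed.
Lemma LMn i (P : zsort_of (tG i)) m : L (P *+ m) = L P *+ m.
Proof. by elim: m => [|m IH]; rewrite ?L0// !mulrS LD IH. Qed.

Lemma F_char0 i m : (0 < m)%N -> (m%:R : F i) != 0.
Proof.
move=> m0; rewrite -(rmorph_nat (io i)) fmorph_eq0 -(rmorph_nat (in_alg K)) fmorph_eq0.
by rewrite pnatr_eq0 -lt0n.
Qed.

Lemma LMI i (P : zsort_of (tG i)) m : (0 < m)%N -> L P *+ m = 0 -> L P = 0.
Proof.
move=> m0 /eqP; rewrite -mulr_natr mulf_eq0 (negPf (F_char0 i m0)) orbF => /eqP; exact.
Qed.

Lemma L_bounded : exists2 M : R, 0 < M & forall i (P : zsort_of (tG i)), v i (L P) <= M.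
Proof.
have ex i : exists M : R, forall P : zsort_of (tG i), v i (L P) <= M.
  apply: contrapT => hn.
  have hP (k : nat) : exists P : zsort_of (tG i), k%:R < v i (L P).
    apply: contrapT => h; apply: hn; exists k%:R => P; rewrite leNgt; apply/negP => h2.
    by apply: h; exists P.
  have [P hP'] := choice hP.
  have [U [uU Un]] := ultra_nat.
  have [X hX] := compact_ultra_cvgT (@cG i) (ultra_map P uU).
  pose X' : zsort_of (tG i) := X.
  have U1 : U [set k | v i (L (P k - X')) < 1].
    exact: (proj1 (@zcvgP _ (tG i) _ U P X' uU) hX _ (@Lc i 1 ltr01)).
  have [k [/= h1 h2]] := filter_ex (filterI U1 (Un (Num.truncn (1 + v i (L X'))).+1)).
  have := hP' k; have := absv_le_dist (v i) (L (P k)) (L X'); rewrite -LB.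
  have h3 : 1 + v i (L X') < k%:R by apply: lt_le_trans (truncnS_gt _) _; rewrite ler_nat.
  lra.
have [m [f fs]] := finite_index; have [M hM] := choice ex.
exists (1 + \sum_j `|M (f j)|); first by rewrite ltr_pwDl// sumr_ge0.
move=> i P; have [j e0] := fs i; case: _ / e0 P => P.
apply: le_trans (hM (f j) P) _; apply: le_trans (ler_norm _) _.
by rewrite (bigD1 j)//= addrCA lerDl addr_ge0// sumr_ge0.
Qed.

Lemma L_range : exists2 d : R, 0 < d & forall i t, v i t < d -> exists P, @L i P = t.
Proof.
apply: (@finite_min (fun i d => forall t, v i t < d -> exists P, @L i P = t)) => //.
by move=> i c d h d0 dc t td; apply: h; exact: lt_le_trans td dc.
Qed.

Let q := ratw w l%:R.
Let q0 : 0 < q. Proof. by apply: natq_gt0; rewrite prime_gt0. Qed.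
Let vec (x : 'rV[rat]_n) := \sum_k x 0 k *: e k.

Lemma vecB x y : vec (x - y) = vec x - vec y.
Proof. by rewrite /vec -sumrB; apply: eq_bigr => k _; rewrite !mxE scalerBl. Qed.
Lemma vecZ c x : vec (c *: x) = c *: vec x.
Proof. by rewrite /vec scaler_sumr; apply: eq_bigr => k _; rewrite !mxE scalerA. Qed.
Lemma vec_sum (J : finType) (x : J -> 'rV[rat]_n) : vec (\sum_j x j) = \sum_j vec (x j).
Proof.
rewrite /vec exchange_big /=; apply: eq_bigr => k _; rewrite summxE scaler_suml.
by apply: eq_bigr.
Qed.

Lemma vec_surj y : exists x, vec x = y.
Proof.
have [a ->] := span y; exists (\row_k a k).
by apply: eq_bigr => k _; rewrite mxE.
Qed.

Definition R0 := [set c : rat | ratw w c <= 1].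
(* The x in K, in coordinates, that are logarithms at every prime above l. *)
Definition latt := [set x | forall i, exists P, @L i P = io i (vec x)].

Lemma R0_1 : R0 1. Proof. by rewrite /R0 /= rmorph1 absv1. Qed.
Lemma R0_B x y : R0 x -> R0 y -> R0 (x - y).
Proof. by move=> hx hy; apply: le_trans (uw _ _) _; rewrite absvN ge_max; apply/andP. Qed.
Lemma R0_M x y : R0 x -> R0 y -> R0 (x * y).
Proof. by move=> hx hy; rewrite /R0 /mkset absvM mulr_ile1 ?absv_ge0. Qed.

Lemma lattB x y : latt x -> latt y -> latt (x - y).
Proof.
move=> hx hy i; have [P hP] := hx i; have [Q hQ] := hy i.
by exists (P - Q); rewrite LB hP hQ vecB rmorphB.
Qed.

Lemma ioZ i c y : io i (c *: y) = io i (c%:A) * io i y.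
Proof. by rewrite -[c *: y]mulr_algl rmorphM. Qed.
Lemma io_nat i m : io i ((m%:R : rat)%:A) = m%:R.
Proof. by rewrite -[_%:A]/(in_alg K _) !rmorph_nat. Qed.

Lemma latt_Mn x m : latt x -> latt (m%:R *: x).
Proof.
move=> hx i; have [P hP] := hx i; exists (P *+ m).
by rewrite LMn hP vecZ ioZ io_nat mulr_natl.
Qed.

Lemma latt_near : exists2 c : R, 0 < c & forall x : 'rV[rat]_n, (forall k, ratw w (x 0 k) < c) -> latt x.
Proof.
have [d d0 hd] := L_range.
have [c c0 hc] := above_small span sB Kc nw d0.
by exists c => // x hx i; apply: hd; exact: (hc (fun k => x 0 k) hx _ (abv i)).
Qed.

Lemma qpow_small (c M : R) : 0 < c -> exists j, q ^+ j * M < c.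
Proof.
move=> c0; have [j hj] := @pow_small R q M c (ltW q0) wl c0.
by exists j; rewrite mulrC; exact: hj.
Qed.

(** Logarithms are evidently stable under integers only. c is approximated by an integer m so
    closely that (c - m) x is a logarithm by [latt_near]. *)
Lemma lattZ c x : R0 c -> latt x -> latt (c *: x).
Proof.
move=> hc hx; have [d d0 hd] := latt_near.
have [j hj] := qpow_small (1 + \sum_k ratw w (x 0 k)) d0.
have [m _ hm] := residue_approx pl j uw wl hc.
have -> : c *: x = (c - m%:R) *: x - (- m%:R) *: x by rewrite -scalerBl opprK subrK.
apply: lattB.
  apply: hd => k; rewrite mxE absvM; apply: le_lt_trans hj; apply: ler_pM => //; rewrite ?absv_ge0//.
  by rewrite (bigD1 k)//= addrCA lerDl addr_ge0// sumr_ge0// => *; exact: absv_ge0.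
have := lattB (lattB (latt_Mn m hx) (latt_Mn m hx)) (latt_Mn m hx).
by rewrite subrr sub0r scaleNr.
Qed.

Lemma lpow_lt1 k c : ratw w c < 1 -> ratw w (l%:R ^+ k * c) < 1.
Proof. by move=> h; rewrite absvM absvX; apply: le_lt_trans h; rewrite ler_piMl ?absv_ge0// exprn_ile1// ltW. Qed.

(** The logarithms fill a neighbourhood of 0 and are bounded, by compactness; [latt] therefore lies
    between l^k R0^n and l^-k R0^n. *)
Lemma latt_bounds : exists k, (forall i, latt (l%:R ^+ k *: delta_mx 0 i)) /\
  forall x, latt x -> forall i, R0 (l%:R ^+ k * x 0 i).
Proof.
have [d d0 hd] := latt_near.
have [j hj] := @pow_small R q 1 d (ltW q0) wl d0.
have [M M0 hM] := L_bounded.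
have [c c0 hc] := small_above sB Kc nw ltr01.
have [k hk] := natl_small span sB Kc nw wl M c0.
exists (maxn j k); split.
  move=> i; apply: hd => t; rewrite !mxE eqxx andTb; case: (t == i); rewrite ?mulr1 ?mulr0.
    by rewrite absvX -[X in X < _]mul1r; apply: hj; rewrite leq_max leqnn.
  by rewrite absv0.
move=> x hx i; apply: ltW; rewrite -(subnK (leq_maxr j k)) exprD -mulrA; apply: lpow_lt1.
apply: (hc (fun t => l%:R ^+ k * x 0 t)) => p /prs[i0 <-].
have -> : \sum_t (l%:R ^+ k * x 0 t) *: e t = (l%:R ^+ k) *: vec x.
  by rewrite /vec scaler_sumr; apply: eq_bigr => t _; rewrite scalerA.
have [P hP] := hx i0.
rewrite /= ioZ absvM -hP; apply: le_lt_trans (hk _ (abv i0)); apply: ler_pM; rewrite ?absv_ge0//.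
by rewrite -natrX io_nat /= rmorphXn rmorph_nat natrX.
Qed.

Lemma index_dense (y : forall i, F i) (d : R) : 0 < d -> exists x, forall i, v i (io i x - y i) < d.
Proof.
move=> d0; have d2 : 0 < d / 2 by rewrite divr_gt0.
have ex p : exists x : K, forall i, pr i = p -> v i (io i x - y i) < d / 2.
  have [[i ip]|h] := pselect (exists i, pr i = p).
    have [x hx] := compl_dense_emb (y i) d2.
    by exists x => j; rewrite -ip => /pri ->.
  by exists 0 => i ip; exfalso; apply: h; exists i.
have [a ha] := choice ex.
have [x hx] := above_dense span sB nw (fun p => compl_emb (Kc p) (a p)) d2.
exists x => i; have h1 := hx _ (abv i); have h2 := ha _ i erefl.
have := absvD3 (v i) (io i x) (io i (a (pr i))) (y i); lra.
Qed.

Lemma lattD x y : latt x -> latt y -> latt (x + y).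
Proof.
move=> hx hy; have -> : x + y = x - ((y - y) - y) by rewrite subrr sub0r opprK.
by apply: lattB => //; apply: lattB => //; exact: lattB.
Qed.

Lemma latt_sum (c : 'I_n -> rat) (b : 'I_n -> 'rV[rat]_n) : (forall j, R0 (c j)) -> (forall j, latt (b j)) ->
  latt (\sum_j c j *: b j).
Proof.
move=> hc hb; apply: (big_ind latt); last by move=> j _; exact: lattZ.
  by move=> i; exists 0; rewrite L0 /vec big1 ?rmorph0// => k _; rewrite mxE scale0r.
exact: lattD.
Qed.

Lemma ratw_dvd (m k : nat) : ratw w m%:R <= q ^+ k -> (l ^ k %| m)%N.
Proof.
have [->|m0] := posnP m; first by rewrite dvdn0.
have [m' cm e0] := pfactor_coprime pl m0.
rewrite {1}e0 natrM absvM (coprime_unit uw pl wl cm) mul1r natrX absvX => h.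
rewrite e0 dvdn_mull// dvdn_exp2l// leqNgt; apply/negP => lt.
have : q ^+ k < q ^+ logn l m.
  rewrite -(subnK (ltnW lt)) exprD gtr_pMl ?exprn_gt0//.
  by rewrite exprn_ilt1 ?(ltW q0)// subn_eq0 -ltnNge.
by rewrite ltNge h.
Qed.

Theorem ladic_place : isoG (bigprod_group G)
  (prod_group (power_group (ilim_group (fun k => (l ^ k).-1)) n) (bigprod_group (fun i => torsion_group (G i)))).
Proof.
have tB := bigprod_tab tG.
have cB := bigprod_compact cG.
have hB := bigprod_hausdorff hG.
have [k0 [lat1 lat2]] := latt_bounds.
have lk0 : (l%:R : rat) ^+ k0 != 0 by rewrite expf_neq0// pnatr_eq0 -lt0n prime_gt0.
have [b [bM bgen bfree]] := lattice_basis R0_1 R0_B R0_M lattB lattZ lk0 lat1 lat2.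
(* The g0 k are points whose logarithms are the vectors of the basis, at all primes above l
   simultaneously. *)
have [g0 hg0] : exists g0 : 'I_n -> zsort_of tB, forall k i, L ((g0 k : bigprod_group G) i : zsort_of (tG i)) = io i (vec (b k)).
  have h k : exists g : zsort_of tB, forall i, L ((g : bigprod_group G) i : zsort_of (tG i)) = io i (vec (b k)).
    have hi i : exists P : zsort_of (tG i), L P = io i (vec (b k)) by exact: bM.
    exists (fun i => sval (cid (hi i))) => i; exact: svalP (cid (hi i)).
  by have [g hg] := choice h; exists g.
pose LL (P : zsort_of tB) i : F i := L ((P : bigprod_group G) i : zsort_of (tG i)).
have LLD P Q i : LL (P + Q) i = LL P i + LL Q i by rewrite -LD /LL; congr L; exact: bigprod_morph.
have LL0 i : LL 0 i = 0 by exact: L0.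
have LLN P i : LL (- P) i = - LL P i by apply/eqP; rewrite -addr_eq0 -LLD addNr LL0.
have LLB P Q i : LL (P - Q) i = LL P i - LL Q i by rewrite LLD LLN.
have LLMn P m i : LL (P *+ m) i = LL P i *+ m.
  by elim: m => [|m IH]; rewrite ?LL0// !mulrS LLD IH.
have LLMz P m i : LL (P *~ m) i = LL P i *~ m.
  by case: (intP m) => [|k|k]; rewrite ?LL0 // ?mulrNz ?LLN -!pmulrn LLMn.
have LLsum (J : finType) (f : J -> zsort_of tB) i : LL (\sum_j f j) i = \sum_j LL (f j) i.
  by elim/big_rec2: _ => [|j x y _ <-]; rewrite ?LL0// LLD.
have [m [f fs]] := finite_index.
have torsP P : tors P <-> forall i, LL P i = 0.
  split=> [[k k0' hk] i|h].
    by apply: (LMI k0'); have := LLMn P k i; rewrite hk LL0 /LL => <-.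
  have hk i : exists k, (0 < k)%N /\ ((P : bigprod_group G) i : zsort_of (tG i)) *+ k = 0.
    by have [k kp ek] := Lk (h i); exists k.
  have [k hk'] := choice hk.
  exists (\prod_(j < m) k (f j))%N; first by apply: prodn_gt0 => j; case: (hk' (f j)).
  have aux j i : (P *+ j : bigprod_group G) i = ((P : bigprod_group G) i : zsort_of (tG i)) *+ j.
    by elim: j => [//|j IH]; rewrite !mulrS bigprod_morph IH.
  apply: dep_funext => i; have [j <-] := fs i.
  rewrite [LHS]aux (bigD1 j)//= mulrnA; have [_ ->] := hk' (f j).
  by rewrite mul0rn.
have ex_of (y : forall i, F i) : (forall i, exists P, @L i P = y i) -> exists P, forall i, LL P i = y i.
  move=> h; exists (fun i => sval (cid (h i))) => i; exact: svalP (cid (h i)).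
have lF i : (l%:R : F i) != 0 by apply: F_char0; rewrite prime_gt0.
have vl1 i : v i l%:R < 1.
  have := dominates_lt1 (abv i) wl; rewrite /= -[_%:A]/(in_alg K _) !rmorph_nat; exact.
have divLL k P Q : (forall i, LL P i = LL Q i *+ l ^ k) -> divtors l k P.
  move=> h; exists Q, (P - Q *+ l ^ k); split; last by rewrite addrC subrK.
  by apply/torsP => i; rewrite LLB LLMn h subrr.
have near k : exists2 d : R, 0 < d & forall P, (forall i, v i (LL P i) < d) -> divtors l k P.
  have [d d0 hd] := L_range.
  have [c c0 hc] : exists2 c : R, 0 < c & forall i, c <= d * v i l%:R ^+ k.
    apply: (@finite_min (fun i c => c <= d * v i l%:R ^+ k)).
      by move=> i c c' h _ h'; exact: le_trans h' h.
    by move=> i; exists (d * v i l%:R ^+ k); [rewrite mulr_gt0// exprn_gt0// absv_gt0// lF | exact: lexx].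
  exists c => // P hP.
  have [|Q hQ] := ex_of (fun i => LL P i / l%:R ^+ k).
    move=> i; apply: hd; rewrite absvM absvV absvX ltr_pdivrMr ?exprn_gt0 ?absv_gt0 ?lF//.
    exact: lt_le_trans (hP i) (hc i).
  by apply: (divLL k P Q) => i; rewrite hQ -[_ *+ (l ^ k)]mulr_natr natrX divfK// expf_neq0// lF.
have tsT : compact [set: torsion_group (bigprod_group G)] /\ isoG (bigprod_group G)
    (prod_group (power_group (ilim_group (fun k => (l ^ k).-1)) n) (torsion_group (bigprod_group G))); last first.
  have [h1 h2] := tsT; apply: isoG_trans h2 _; apply: isoG_prod; first exact: isoG_refl.
  by apply: torsion_bigprod => //; exists m, f.
suff ii : isoG (bigprod_group G)
    (prod_group (power_group (ilim_group (fun k => (l ^ k).-1)) n) (torsion_group (bigprod_group G))).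
  by split=> //; exact: isoG_compact_snd cB ii.
apply: (@ladic_structure _ tB cB hB l n g0 pl).
(* [gen]: some x in K is so close to the logarithm of P that the difference is l^k times a
   logarithm. Then x lies in [latt], and its coefficients on the basis are replaced by integers
   modulo l^k. *)
- move=> P k.
  have [d1 d10 hd1] := near k; have [d2 d20 hd2] := L_range.
  have m0 : 0 < Num.min d1 d2 by rewrite lt_min d10.
  have [x hx] := index_dense (LL P) m0.
  have [X hX] := vec_surj x.
  have hS0 i : exists S, @L i S = LL P i - io i x.
    by apply: hd2; rewrite absv_dist; have := hx i; rewrite lt_min => /andP[].
  have [S hS] := ex_of (fun i => LL P i - io i x) hS0.
  have MX : latt X.
    by move=> i; exists (((P - S : zsort_of tB) : bigprod_group G) i); rewrite -/(LL (P - S) i) LLB hS hX opprB addrCA subrr addr0.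
  have [c Rc eX] := bgen X MX.
  have hr j : exists r, ratw w (c j - r%:R) <= q ^+ k by have [r _ h] := residue_approx pl k uw wl (Rc j); exists r.
  have [r hr'] := choice hr; exists r.
  pose dd j := (c j - (r j)%:R) / l%:R ^+ k.
  have Rd j : R0 (dd j).
    by rewrite /R0 /mkset /dd absvM absvV absvX ler_pdivrMr ?exprn_gt0// mul1r.
  have lkr : (l%:R : rat) ^+ k != 0 by rewrite expf_neq0// pnatr_eq0 -lt0n prime_gt0.
  have [Q hQ] := ex_of (fun i => io i (vec (\sum_j dd j *: b j))) (latt_sum Rd bM).
  have divS : divtors l k S.
    by apply: hd1 => i; rewrite hS absv_dist; have := hx i; rewrite lt_min => /andP[].
  have -> : P - \sum_i g0 i *+ r i = S + ((P - S) - \sum_i g0 i *+ r i) by rewrite addrA [S + _]addrC subrK.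
  apply: divtorsD => //; apply: (divLL k _ Q) => i.
  rewrite !LLB hS hQ LLsum opprB addrCA subrr addr0 -hX eX.
  rewrite !vec_sum !rmorph_sum -sumrB -sumrMnl; apply: eq_bigr => j _.
  rewrite LLMn /LL hg0 !vecZ (ioZ i (c j) (vec (b j))) (ioZ i (dd j) (vec (b j))); set y := io i (vec (b j)).
  have -> : c j = (r j)%:R + (l ^ k)%:R * dd j by rewrite /dd natrX mulrC divfK// addrC subrK.
  rewrite scalerDl rmorphD -[((l ^ k)%:R * dd j)%:A]scalerA (ioZ i (l ^ k)%:R (dd j)%:A).
  by rewrite !io_nat mulrDl mulr_natl addrAC subrr add0r -mulrA mulr_natl.
(* [indep]: the combination with coefficients r_j / l^k has Q as a preimage under the logarithm, so
   it lies in [latt], and its coefficients are l-integral. *)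
- move=> r k [Q [t [ht eq]]] j.
  have e1 i : \sum_j LL (g0 j) i *~ r j = LL Q i *+ l ^ k.
    have := congr1 (fun P => LL P i) eq; rewrite LLsum LLD LLMn.
    have -> : LL t i = 0 by exact: (torsP t).1.
    by rewrite addr0 => <-; apply: eq_bigr => j' _; rewrite LLMz.
  pose a j : rat := (r j)%:~R / l%:R ^+ k.
  have My : latt (\sum_j a j *: b j).
    move=> i; exists ((Q : bigprod_group G) i); rewrite -/(LL Q i).
    have lki : (l%:R : F i) ^+ k != 0 by rewrite expf_neq0// lF.
    apply: (mulIf lki); rewrite -natrX [LHS]mulr_natr -e1 vec_sum rmorph_sum mulr_suml.
    apply: eq_bigr => j' _; rewrite vecZ (ioZ i (a j') (vec (b j'))) /LL hg0; set y := io i (vec (b j')).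
    have -> : io i ((a j')%:A) = (r j')%:~R / l%:R ^+ k.
      by rewrite -[_%:A]/(in_alg K _) /a !(rmorphM, fmorphV, rmorph_int, rmorphXn, rmorph_nat).
    by rewrite natrX mulrAC divfK// -mulrzl.
  have [c Rc ec] := bgen _ My.
  have ac : a j = c j.
    apply/eqP; rewrite -subr_eq0; apply/eqP; apply: (bfree (fun j => a j - c j)).
    rewrite (eq_bigr (fun j => a j *: b j - c j *: b j)); last by move=> j' _; rewrite scalerBl.
    by rewrite sumrB ec subrr.
  apply: ratw_dvd; rewrite -absv_int.
  have := Rc j; rewrite -ac /R0 /mkset /a absvM absvV absvX ler_pdivrMr ?exprn_gt0// mul1r; exact.
(* [sep]: if P lies in l^k G + torsion for all k, its logarithm is at most |l|^k M for all k, where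
   M bounds all logarithms. *)
- move=> P h; apply/torsP => i; apply/eqP/negP => /negP nz.
  have [M M0 hM] := L_bounded.
  have vz := absv_gt0 (v i) nz.
  have [k hk] := @pow_small R (v i l%:R) M _ (absv_ge0 _ _) (vl1 i) vz.
  have [Q [t [ht eq]]] := h k.
  have := hk k (leqnn k); rewrite {1}eq LLD LLMn.
  have -> : LL t i = 0 by exact: (torsP t).1.
  rewrite addr0 -[_ *+ (l ^ k)]mulr_natr natrX absvM absvX ltNge => /negP; apply.
  by rewrite ler_wpM2r ?exprn_ge0 ?absv_ge0//; exact: hM.
- move=> k; have [d d0 hd] := near k.
  have h0 : nbhs (0 : bigprod_group G) [set y : bigprod_group G | forall i, v i (L (y i : zsort_of (tG i))) < d].
    by apply: (@finite_nbhs 0 (fun i => [set P : G i | v i (L (P : zsort_of (tG i))) < d])) => i; exact: Lc.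
  by apply: filterS h0 => y; exact: hd.
- have h0 : nbhs (0 : bigprod_group G) [set y : bigprod_group G | forall i, L (y i : zsort_of (tG i)) = 0 -> y i = 0].
    by apply: (@finite_nbhs 0 (fun i => [set P : G i | L (P : zsort_of (tG i)) = 0 -> P = 0])) => i; exact: Li.
  apply: filterS h0 => y hy ty; apply: dep_funext => i; apply: hy.
  exact: ((torsP y).1 ty i).
Qed.

End LadicPlace.

(** * The infinite primes *)

Section ArchCurve.
Context {R : realType} {F : fieldType} (v : absvalue R F) (a b : F).
Hypothesis two_neq0 : (2 : F) != 0.
Hypothesis smooth : 4 * a ^+ 3 + 27 * b ^+ 2 != 0.
Notation W := (short_weierstrass a b).
Notation S := (ec_space v W).

Lemma affine_nbhs (P : S) (C : set S) : ~~ isO P -> nbhs P C ->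
  exists2 d : R, 0 < d & forall Q : S, ~~ isO Q -> v (Xc Q - Xc P) < d -> v (Yc Q - Yc P) < d -> C Q.
Proof.
move=> nP nC.
pose B (d : R) := [set Q : S | [/\ ~~ isO Q, v (Xc Q - Xc P) < d & v (Yc Q - Yc P) < d]].
pose U := filter_from [set d : R | 0 < d] B.
have FU : ProperFilter U.
  apply: filter_from_proper.
    apply: filter_from_filter; first by exists 1 => /=.
    move=> c d /= c0 d0; exists (Num.min c d); first by rewrite /= lt_min c0.
    by move=> Q [nQ]; rewrite !lt_min => /andP[? ?] /andP[? ?]; split; split.
  by move=> d /= d0; exists P; split => //; rewrite subrr absv0.
have c : (id : S -> S) @ U --> P.
  apply: econv_cvg; case: P nP @B @U FU {nC} => [//|x y h] _ B U FU; split.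
  - by exists 1 => //= Q [].
  - by move=> d d0; exists d => //= Q [].
  - by move=> d d0; exists d => //= Q [].
by have [d d0 hd] := c _ nC; exists d => // Q n1 n2 n3; apply: hd; split.
Qed.

(* Applied to the cosets of the image of exp other than this image: they are compact, open, and do
   not contain O. *)
Lemma max_coordinate (C : set S) c : loc_compact v -> closed C -> ~ C (EC_infinity W) -> (exists P, C P) ->
  exists P, C P /\ forall Q, C Q -> v (Xc Q - c) <= v (Xc P - c).
Proof.
move=> LC cC nO [P0 CP0].
pose B (Q : S) := [set P : S | C P /\ v (Xc Q - c) <= v (Xc P - c)].
pose V := filter_from C B.
have FV : ProperFilter V.
  apply: filter_from_proper; last by move=> Q CQ; exists Q.
  apply: filter_from_filter; first by exists P0.
  move=> P Q CP CQ; have [h|h] := lerP (v (Xc P - c)) (v (Xc Q - c)).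
    by exists Q => // T [CT hT]; split; split=> //; exact: le_trans hT.
  by exists P => // T [CT hT]; split; split=> //; apply: le_trans hT; exact: ltW.
have [U [uU VU]] := ultra_of_filter FV.
have cC' : compact C by apply: (subclosed_compact cC (ec_compact LC)).
have UC : U C by apply: VU; exists P0 => // T [].
have [P CP UP] := compact_ultra_cvg cC' uU UC.
exists P; split=> // Q CQ.
have nP : ~~ isO P by apply/negP => /isO_eq e; apply: nO; rewrite -e.
have e : econv v U (id : S -> S) P by exact: cvg_econv.
have l : vlim v U (fun T : S => Xc T - c) (Xc P - c).
  apply: vlimB; last exact: vlim_cst.
  by have [h _] := @econv_affine _ _ v _ _ _ U id P nP; case: (h e).
rewrite leNgt; apply/negP; rewrite -subr_gt0 => d0.
have h1 : U (B Q) by apply: VU; exists Q.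
have [T [[_ hT] hT']] := filter_ex (filterI h1 (l _ d0)).
have := le_trans hT (absv_le_dist v (Xc T - c) (Xc P - c)).
by rewrite leNgt -ltrBrDl hT'.
Qed.

(** When x is close to the abscissa of P, the product (y - y0)(y + y0) is small, so y or -y is close
    to y0. *)
Lemma nearby_points (P : S) (C : set S) : ~~ isO P -> open C -> C P ->
  exists2 d : R, 0 < d & forall (x y : F), y ^+ 2 = x ^+ 3 + a * x + b -> v (x - Xc P) < d ->
   exists Q, C Q /\ Xc Q = x.
Proof.
move=> nP oC CP.
have [d d0 hd] := affine_nbhs nP (open_nbhs_nbhs (conj oC CP)).
set x0 := Xc P in hd *; set y0 := Yc P in hd.
pose M := 1 + v (3 * x0) + v (3 * x0 ^+ 2 + a).
have M0 : 0 < M by rewrite /M -addrA ltr_pwDl// addr_ge0// absv_ge0.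
exists (Num.min (Num.min 1 d) (d ^+ 2 / M)).
  by rewrite !lt_min ltr01 d0 divr_gt0// exprn_gt0.
move=> x y exy; rewrite !lt_min => /andP[/andP[x1 xd] xM].
have e0 : y0 ^+ 2 = x0 ^+ 3 + a * x0 + b by exact: short_curve.
have key : v (y - y0) * v (y + y0) < d ^+ 2.
  rewrite -absvM; have -> : (y - y0) * (y + y0) = (x - x0) * ((x - x0) ^+ 2 + 3 * x0 * (x - x0) + (3 * x0 ^+ 2 + a)).
    by rewrite -subr_sqr exy e0; ring.
  rewrite absvM; apply: (@le_lt_trans _ _ (v (x - x0) * M)); last by rewrite -ltr_pdivlMr.
  apply: ler_wpM2l; first exact: absv_ge0.
  apply: le_trans (absvD _ _ _) _; apply: lerD => //; apply: le_trans (absvD _ _ _) _; apply: lerD.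
    by rewrite absvX; apply: exprn_ile1; [exact: absv_ge0 | exact: ltW].
  by rewrite absvM ler_piMr ?absv_ge0// ltW.
have [h|h] := ltrP (v (y - y0)) d.
  have hc : on_curve W x y by rewrite short_on_curveE exy.
  by exists (EC_affine hc); split => //; apply: hd.
have hc : on_curve W x (- y) by rewrite short_on_curveE sqrrN exy.
exists (EC_affine hc); split => //; apply: hd => //=; rewrite -opprD absvN ltNge; apply/negP => h'.
by move: key; rewrite ltNge expr2 => /negP; apply; apply: ler_pM => //; exact: ltW.
Qed.

Section Cosets.
Context (HG : tabgroup (ec_group v W)).
Notation Z := (zsort_of HG).
Context (X : F -> Z).
Hypothesis XD : {morph X : s t / s + t}.
Hypothesis Xop : nbhs (0 : Z) (range X).

Lemma XB s t : X (s - t) = X s - X t.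
Proof. by apply/eqP; rewrite eq_sym subr_eq -XD subrK. Qed.

Definition coset (P : Z) : set S := [set Q : S | exists t, X t = (Q : Z) - P].

Lemma coset_near (Q : S) : nbhs Q [set T : S | exists t, X t = (T : Z) - (Q : Z)].
Proof.
apply: nbhs_ultra => U uU UQ.
have h : (fun T : Z => T - (Q : Z)) @ U --> (0 : Z) by apply/(@zcvgP _ HG _ _ (fun T : Z => T)).
have h' : U [set T : S | range X ((T : Z) - (Q : Z))] by exact: (h _ Xop).
by apply: filterS h' => T [t _ e]; exists t.
Qed.

Lemma coset_open P : open (coset P).
Proof.
rewrite openE => Q [t et]; have nq := coset_near Q; apply: filterS nq => T [u eu]; exists (u + t).
by rewrite XD eu et addrA subrK.
Qed.

Lemma coset_closed P : closed (coset P).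
Proof.
rewrite -openC openE => Q nQ; have nq := coset_near Q; apply: filterS nq => T [u eu] [t et]; apply: nQ.
by exists (t - u); rewrite XB eu et opprB addrC addrA subrK.
Qed.

Lemma coset_self P : coset P P.
Proof. by exists 0; rewrite subrr; apply: (addIr (X 0)); rewrite -XD !add0r. Qed.

Lemma coset_max c P : loc_compact v -> ~ range X P -> exists Q, [/\ coset P Q, ~~ isO Q &
  forall T, coset P T -> v (Xc T - c) <= v (Xc Q - c)].
Proof.
move=> LC nP; have nO : ~ coset P (EC_infinity W).
  move=> [t et]; apply: nP; exists (0 - t) => //.
  rewrite XB et -[X in X = _]add0r; have [s es] := coset_self P.
  have -> : X 0 = 0 by apply: (addIr (X 0)); rewrite -XD !add0r.
  have -> : (EC_infinity W : Z) = 0 by [].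
  by rewrite !add0r opprK.
have [Q [CQ hQ]] := max_coordinate c LC (@coset_closed P) nO (ex_intro _ P (coset_self P)).
by exists Q; split => //; apply/negP => /isO_eq e; apply: nO; rewrite -e.
Qed.

End Cosets.
End ArchCurve.

Section ArchStruct.
Context {R : realType} {F : fieldType} (v : absvalue R F).

(* X is the exponential map, and the values of tau represent the cosets of its image. *)
Definition arch_struct (G T : topGroupLaw) : Prop :=
  exists (HG : tabgroup G) (X : F -> zsort_of HG) (tau : T -> zsort_of HG),
  [/\ {morph X : s t / s + t} /\ (forall (Y : Type) (U : set_system Y) f l, ultra U -> vlim v U f l ->
        (fun t => X (f t)) @ U --> X l),
      exists2 d : R, 0 < d & forall t, v t < d -> X t = 0 -> t = 0,
      forall d : R, 0 < d -> nbhs (0 : zsort_of HG) [set X t | t in [set t | v t < d]],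
      tau 0 = 0 /\ {morph tau : x y / x + y} &
      (forall P, exists z t, P = X z + tau t) /\
      (forall z z' t t', X z + tau t = X z' + tau t' -> t = t')].

(** H is a short Weierstrass model of G, on which exp is constructed. *)
Definition arch_iso (G T : topGroupLaw) : Prop :=
  exists H, [/\ isoG G H, compact [set: H], hausdorff_space H & arch_struct H T].

End ArchStruct.

Lemma complex_connected {R : realType} {F : fieldType} (v : absvalue R F) (a b : F) (HG : tabgroup (ec_group v (short_weierstrass a b)))
   (X : F -> zsort_of HG) : (2 : F) != 0 -> 4 * a ^+ 3 + 27 * b ^+ 2 != 0 -> loc_compact v ->
   {morph X : s t / s + t} -> nbhs (0 : zsort_of HG) (range X) ->
   (forall z : F, exists y, y ^+ 2 = z) ->
   (forall (x : F) (d : R), 0 < d -> exists x', v (x' - x) < d /\ v x < v x') ->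
   forall P, range X P.
Proof.
move=> n2 sm LC XD Xo sq gr P; apply: contrapT => nP.
have [Q [CQ nQ hQ]] := coset_max XD Xo 0 LC nP.
have [d d0 hd] := nearby_points nQ (@coset_open _ _ _ _ _ HG X XD Xo P) CQ.
have [x [xd vx]] := gr (Xc Q) d d0.
have [y ey] := sq (x ^+ 3 + a * x + b).
have [T [CT eT]] := hd x y ey xd.
by have := hQ T CT; rewrite !subr0 eT leNgt vx.
Qed.

Lemma oppnorm_le (R : realType) (x : R) : - `|x| <= x.
Proof. by rewrite lerNl -normrN ler_norm. Qed.

Section RealCubic.
Context {R : realType} (a b : R).
Hypothesis smooth : 4 * a ^+ 3 + 27 * b ^+ 2 != 0.

Lemma root_discriminant e : e ^+ 3 + a * e + b = 0 ->
  4 * a ^+ 3 + 27 * b ^+ 2 = (3 * e ^+ 2 + 4 * a) * (3 * e ^+ 2 + a) ^+ 2.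
Proof. by move=> h; have -> : b = - (e ^+ 3 + a * e) by [lra]; ring. Qed.

(** Once X - e is divided out, X^2 + e X + e^2 + a remains, of discriminant r^2. The root -(r + e) /
    2 is the case of -r. *)
Lemma other_roots e r : e ^+ 3 + a * e + b = 0 -> r ^+ 2 = - (3 * e ^+ 2 + 4 * a) ->
  let e' := (r - e) / 2 in e' ^+ 3 + a * e' + b = 0 /\ 3 * e' ^+ 2 + a = r * (r - 3 * e) / 2.
Proof.
move=> h hr e'; have ea : a = - (r ^+ 2 + 3 * e ^+ 2) / 4 by rewrite hr; field.
have eb : b = - (e ^+ 3 + a * e) by lra.
by rewrite eb ea /e'; split; field.
Qed.

Lemma real_root : exists e, e ^+ 3 + a * e + b = 0.
Proof.
pose p : {poly R} := 'X ^+ 3 + a *: 'X + b%:P.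
pose M := 1 + `|a| + `|b|.
have pe x : p.[x] = x ^+ 3 + a * x + b by rewrite /p !hornerE.
have M1 : 1 <= M by rewrite /M -addrA lerDl addr_ge0.
have ha : - `|a| <= a <= `|a| by rewrite -ler_norml.
have hb : - `|b| <= b <= `|b| by rewrite -ler_norml.
have a0 := normr_ge0 a; have b0 := normr_ge0 b.
have aM : `|a| <= M - 1 - `|b| by rewrite /M; lra.
have h1 : - M <= M by lra.
have M2 : M <= M ^+ 2 by rewrite expr2 ler_peMl//; lra.
have M3 : M ^+ 2 * M = M ^+ 3 by ring.
case/andP: ha => ha1 ha2; case/andP: hb => hb1 hb2.
have k1 : `|a| * M + `|b| <= M ^+ 3.
  rewrite -M3; have : (`|a| + `|b|) * M <= M ^+ 2 * M by apply: ler_wpM2r; lra.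
  have : `|b| <= `|b| * M by rewrite ler_peMr.
  by rewrite mulrDl; lra.
have am : - (`|a| * M) <= a * M by rewrite -mulNr; apply: ler_wpM2r; lra.
have am' : a * M <= `|a| * M by apply: ler_wpM2r; lra.
have [|e _ /rootP] := @poly_ivt _ p (- M) M h1.
  rewrite !pe; apply/andP; split.
    have -> : (- M) ^+ 3 + a * - M + b = - M ^+ 3 - a * M + b by ring.
    by lra.
  by lra.
by rewrite pe => h; exists e.
Qed.

(** The middle one of three real roots is the one where the cubic decreases. At a root e, 4 a^3 + 27
    b^2 is (3 e^2 + 4 a)(3 e^2 + a)^2, and 3 e^2 + a < 0 forces 3 e^2 + 4 a < 0. *)
Lemma middle_root_discriminant : (exists e, e ^+ 3 + a * e + b = 0 /\ 3 * e ^+ 2 + a < 0) <->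
  0 < - (16 * (4 * a ^+ 3 + 27 * b ^+ 2)).
Proof.
split=> [[e [h f']]|pos].
  rewrite (root_discriminant h) -mulrN pmulr_rgt0// -mulNr pmulr_lgt0; first by have := sqr_ge0 e; lra.
  by rewrite exprn_even_gt0//=; lra.
have [e h] := real_root.
have e0 : 3 * e ^+ 2 + a != 0 by apply: contra_neq smooth; rewrite (root_discriminant h) => ->; rewrite expr0n mulr0.
have [lt|ge] := ltrP (3 * e ^+ 2 + a) 0; first by exists e.
have D0 : 0 < - (3 * e ^+ 2 + 4 * a).
  have : (3 * e ^+ 2 + 4 * a) * (3 * e ^+ 2 + a) ^+ 2 < 0 by rewrite -(root_discriminant h); lra.
  by rewrite pmulr_llt0 ?exprn_even_gt0//=; lra.
pose r := Num.sqrt (- (3 * e ^+ 2 + 4 * a)).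
have r0 : 0 < r by rewrite sqrtr_gt0.
have hr : r ^+ 2 = - (3 * e ^+ 2 + 4 * a) by rewrite sqr_sqrtr// ltW.
have hr' : (- r) ^+ 2 = - (3 * e ^+ 2 + 4 * a) by rewrite sqrrN.
have fe : (3 * e - r) * (3 * e + r) = 4 * (3 * e ^+ 2 + a) by rewrite -subr_sqr hr; ring.
(* If r < 3 e, then e is the largest root; otherwise it is the least one, and the middle root is on
   its other side. *)
have [gt|le] := ltrP r (3 * e).
  have [h1 h2] := other_roots h hr; exists ((r - e) / 2); split => //.
  by rewrite h2 pmulr_llt0// pmulr_rlt0// subr_lt0.
have [h1 h2] := other_roots h hr'; exists ((- r - e) / 2); split => //.
rewrite h2 pmulr_llt0// nmulr_rlt0 ?oppr_lt0//.
have : (3 * e - r) * (3 * e + r) > 0 by rewrite fe pmulr_rgt0// lt0r e0.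
have [->|ne] := eqVneq (3 * e) r; first by rewrite subrr mul0r ltxx.
by rewrite nmulr_rgt0; [lra|rewrite subr_lt0 lt_neqAle ne].
Qed.

Lemma middle_root_unique e e' : e ^+ 3 + a * e + b = 0 -> e' ^+ 3 + a * e' + b = 0 ->
  3 * e ^+ 2 + a < 0 -> 3 * e' ^+ 2 + a < 0 -> e = e'.
Proof.
move=> h h' f f'; apply/eqP; rewrite -subr_eq0; apply/negPn/negP => ne.
have q : e ^+ 2 + e * e' + e' ^+ 2 + a = 0.
  by apply: (mulfI ne); rewrite mulr0 -(subrr 0) -{1}h -h'; ring.
have : (3 * e ^+ 2 + a) + (3 * e' ^+ 2 + a) = (e - e') ^+ 2 by rewrite -(subr0 (_ + _)) -(mulr0 2) -q; ring.
by have := sqr_ge0 (e - e'); lra.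
Qed.

End RealCubic.

(** When y^2 = x^3 + a x + b, the left-hand side is 4 y^2 (x(2P) - e), as the slope of the tangent
    is (3 x^2 + a) / (2 y). *)
Lemma duplication_square {F : fieldType} (a b e x : F) : e ^+ 3 + a * e + b = 0 ->
  (x ^+ 2 + x * x + x ^+ 2 + a) ^+ 2 - 4 * (x ^+ 3 + a * x + b) * (2 * x + e) = (x ^+ 2 - 2 * x * e - 2 * e ^+ 2 - a) ^+ 2.
Proof. by move=> h; have -> : b = - (e ^+ 3 + a * e) by [rewrite -(addr0 (- _)) -h; ring]; ring. Qed.

(* x(2P) - e' is a square for every root e' of the cubic. *)
Lemma halving_obstruction {F : realType} (a b : F) (P : ec_point (short_weierstrass a b)) (e : F) :
  4 * a ^+ 3 + 27 * b ^+ 2 != 0 -> e ^+ 3 + a * e + b = 0 -> 3 * e ^+ 2 + a < 0 ->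
  ~~ isO (ec_add P P) -> Xc (ec_add P P) <> e.
Proof.
move=> sm h f' nPP eX.
have n2 : (2 : F) != 0 by rewrite pnatr_eq0.
have nP : ~~ isO P by case: P nPP {eX}.
have nop : ~~ ec_opposite P P.
  by apply/negP => o; move: nPP; rewrite ec_add_opposite.
have [l [[_ hl] _ hX _]] := ec_add_slope n2 nP nP nop.
have D0 : 0 < - (3 * e ^+ 2 + 4 * a) by have := sqr_ge0 e; lra.
pose r := Num.sqrt (- (3 * e ^+ 2 + 4 * a)).
have hr : r ^+ 2 = - (3 * e ^+ 2 + 4 * a) by rewrite sqr_sqrtr// ltW.
have r3 : `|3 * e| < r by rewrite -(@ltr_pXn2r _ 2)// ?nnegrE// ?sqrtr_ge0// hr real_normK ?num_real//; lra.
(* e' is the largest root. If x(2P) = e, then e - e' < 0 would be a square. *)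
pose e' := (r - e) / 2.
have le : e < e' by move: r3; rewrite ltr_norml /e' => /andP[_]; lra.
have y0 : Yc P != 0.
  by apply: contraNneq nop => y0; rewrite /ec_opposite eqxx y0 addr0 eqxx.
have hy := short_curve nP.
have [he' _] := other_roots h hr.
have key : 4 * Yc P ^+ 2 * (e - e') = (Xc P ^+ 2 - 2 * Xc P * e' - 2 * e' ^+ 2 - a) ^+ 2.
  have -> : 4 * Yc P ^+ 2 * (e - e') = ((Yc P + Yc P) * l) ^+ 2 - 4 * Yc P ^+ 2 * (2 * Xc P + e').
    by rewrite -eX hX; ring.
  by rewrite hl hy; exact: duplication_square.
have : 4 * Yc P ^+ 2 * (e - e') < 0.
  by rewrite pmulr_rlt0 ?subr_lt0// mulr_gt0// exprn_even_gt0.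
by rewrite key ltNge sqr_ge0.
Qed.

Section RealCosets.
Context {R : realType} (a b : R).
Hypothesis smooth : 4 * a ^+ 3 + 27 * b ^+ 2 != 0.
Notation v := (real_absvalue R).
Notation W := (short_weierstrass a b).
Context (HG : tabgroup (ec_group v W)).
Notation Z := (zsort_of HG).
Context (X : R -> Z).
Hypothesis XD : {morph X : s t / s + t}.
Hypothesis Xop : nbhs (0 : Z) (range X).

Lemma real_coset (P : Z) : ~ range X P -> exists Q : ec_point W, [/\ coset X P Q, ~~ isO Q, Yc Q = 0 & 3 * Xc Q ^+ 2 + a < 0].
Proof.
move=> nP.
(* c lies below all abscissas of the curve, so a point farthest from c is a point with the largest
   abscissa. *)
pose c := - (1 + `|a| + `|b|).
have a0 := normr_ge0 a; have b0 := normr_ge0 b.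
have xc (Q : ec_point W) : ~~ isO Q -> c <= Xc Q.
  move=> nQ; rewrite leNgt; apply/negP => lt.
  have h := short_curve nQ; set x := Xc Q in lt h; have y0 := sqr_ge0 (Yc Q).
  have x1 : 1 <= - x by rewrite /c in lt; lra.
  have x2 : - x <= (- x) ^+ 2 by rewrite expr2 ler_peMl//; lra.
  have ha : - `|a| <= a by have := oppnorm_le a; lra.
  have hb := ler_norm b.
  have am : a * x <= `|a| * (- x) by rewrite -[a * x]opprK -mulrN -mulNr; apply: ler_wpM2r; lra.
  have k : (- x) ^+ 3 = (- x) * (- x) ^+ 2 by rewrite exprS.
  have k2 : (1 + `|a| + `|b|) * (- x) < (- x) ^+ 3.
    rewrite k [(- x) * (_ ^+ 2)]mulrC; apply: (@lt_le_trans _ _ ((- x) * (- x))).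
      by rewrite ltr_pM2r; rewrite /c in lt; lra.
    by apply: ler_wpM2r; lra.
  have k3 : `|b| <= `|b| * (- x) by rewrite ler_peMr.
  have k4 : (- x) ^+ 3 = - x ^+ 3 by ring.
  by move: k2; rewrite !mulrDl k4; lra.
have [Q [CQ nQ hQ]] := coset_max XD Xop c (@real_loc_compact R) nP.
have [d d0 hd] := nearby_points nQ (@coset_open _ _ _ _ _ HG X XD Xop P) CQ.
set x0 := Xc Q in hQ hd *.
(* Just to the right of the maximal abscissa x0 the coset has no point; by [nearby_points] the
   cubic, expanded here at x0, is negative there. *)
have neg h : 0 < h -> h < d -> Yc Q ^+ 2 + h * (h ^+ 2 + 3 * x0 * h + (3 * x0 ^+ 2 + a)) < 0.
  move=> h0 hd'; rewrite ltNge; apply/negP => ge.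
  have e : (x0 + h) ^+ 3 + a * (x0 + h) + b = Yc Q ^+ 2 + h * (h ^+ 2 + 3 * x0 * h + (3 * x0 ^+ 2 + a)).
    by rewrite (short_curve nQ) -/x0; ring.
  have vh : v (x0 + h - x0) < d by have -> : x0 + h - x0 = h by [ring]; rewrite /= gtr0_norm.
  have sq : Num.sqrt ((x0 + h) ^+ 3 + a * (x0 + h) + b) ^+ 2 = (x0 + h) ^+ 3 + a * (x0 + h) + b by rewrite sqr_sqrtr ?e.
  have [T [CT eT]] := hd _ _ sq vh.
  have := hQ T CT; rewrite eT /= !ger0_norm; [lra| |].
    by have := xc Q nQ; rewrite -/x0; lra.
  by have := xc Q nQ; rewrite -/x0; lra.
have y0 : Yc Q = 0.
  apply/eqP; rewrite -[_ == 0](@expf_eq0 _ _ 2); apply/negPn/negP => ne.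
  have yp : 0 < Yc Q ^+ 2 by rewrite lt0r ne sqr_ge0.
  pose K := 1 + `|3 * x0| + `|3 * x0 ^+ 2 + a|.
  have K1 : 1 <= K by rewrite /K -addrA lerDl addr_ge0.
  (* If y0 <> 0, the cubic would stay nonnegative for so small an h: the other terms of the
     expansion are at least -h K, and h K <= y0^2. *)
  pose h := Num.min (d / 2) (Num.min 1 (Yc Q ^+ 2 / K)).
  have h0 : 0 < h by rewrite !lt_min ltr01 !divr_gt0//; lra.
  have h1 : h <= d / 2 by rewrite ge_min lexx.
  have h2 : h <= 1 by rewrite !ge_min lexx orbT.
  have h3 : h * K <= Yc Q ^+ 2 by rewrite -ler_pdivlMr ?ge_min ?lexx ?orbT//; lra.
  have hd' : h < d by lra.
  have := neg h h0 hd'.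
  have k1 : - K <= h ^+ 2 + 3 * x0 * h + (3 * x0 ^+ 2 + a).
    have := sqr_ge0 h; have := oppnorm_le (3 * x0 ^+ 2 + a).
    have : - `|3 * x0| <= 3 * x0 * h.
      have : `|3 * x0 * h| <= `|3 * x0| by rewrite normrM ler_piMr// gtr0_norm.
      by have := oppnorm_le (3 * x0 * h); lra.
    by rewrite /K; lra.
  have k2 : h * - K <= h * (h ^+ 2 + 3 * x0 * h + (3 * x0 ^+ 2 + a)) by apply: ler_wpM2l => //; exact: ltW.
  by rewrite mulrN in k2; lra.
exists Q; split => //; rewrite -/x0 lt_neqAle.
have -> /= : 3 * x0 ^+ 2 + a != 0.
  by apply: (short_smooth smooth); rewrite -(short_curve nQ) y0 expr0n.
rewrite leNgt; apply/negP => f'.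
set q := 3 * x0 ^+ 2 + a in neg f'.
pose h := Num.min (d / 2) (q / (1 + `|3 * x0|)).
have x3 := normr_ge0 (3 * x0).
have h0 : 0 < h by rewrite lt_min !divr_gt0//; lra.
have h1 : h <= d / 2 by rewrite ge_min lexx.
have h2 : h * (1 + `|3 * x0|) <= q by rewrite -ler_pdivlMr ?ge_min ?lexx ?orbT//; lra.
have := neg h h0; rewrite y0 expr0n add0r pmulr_rlt0// => H; have {H} : h ^+ 2 + 3 * x0 * h + q < 0 by apply: H; lra.
have := sqr_ge0 h; have := oppnorm_le (3 * x0 * h); rewrite normrM (gtr0_norm h0).
by rewrite mulrDr mulr1 [h * _]mulrC in h2; lra.
Qed.

(** Every element of the image of X is a double, whereas [halving_obstruction] excludes this point
    from the doubles. *)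
Lemma middle_root_coset (e : R) (h : on_curve W e 0) : 3 * e ^+ 2 + a < 0 -> ~ range X (EC_affine h).
Proof.
move=> f' [z _ ez].
have e0 : e ^+ 3 + a * e + b = 0 by have := short_on_curveE a b e 0; rewrite (h : _ = true) expr0n eq_sym => /esym/eqP.
have := @halving_obstruction R a b (X (z / 2)) e smooth e0 f'.
have -> : ec_add (X (z / 2)) (X (z / 2)) = EC_affine h.
  by rewrite -ez [z in RHS]splitr XD.
by move=> /(_ isT); apply.
Qed.

End RealCosets.

Section LocalStructure.
Context {R : realType} {F : fieldType} (v : absvalue R F).
Hypothesis LC : loc_compact v.
Hypothesis v2 : v 2 = 2.

Lemma arch_exp (W : weierstrass F) : (3 : F) != 0 -> discriminant W != 0 ->
  exists a b (HG : tabgroup (ec_group v (short_weierstrass a b))) (X : F -> zsort_of HG),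
  [/\ 4 * a ^+ 3 + 27 * b ^+ 2 != 0 /\ discriminant W = - (16 * (4 * a ^+ 3 + 27 * b ^+ 2)),
     forall T, arch_struct v (ec_group v (short_weierstrass a b)) T -> arch_iso v (ec_group v W) T,
     {morph X : s t / s + t} /\ (forall (Y : Type) (U : set_system Y) f l, ultra U -> vlim v U f l ->
        (fun t => X (f t)) @ U --> X l),
     exists2 d : R, 0 < d & forall t, v t < d -> X t = 0 -> t = 0 &
     forall d : R, 0 < d -> nbhs (0 : zsort_of HG) [set X t | t in [set t | v t < d]] ].
Proof.
move=> n3 dW.
have n2 : (2 : F) != 0 by apply/eqP => e; have := v2; rewrite e absv0 => /esym/eqP; rewrite pnatr_eq0.
have nt : exists2 pi : F, pi != 0 & v pi < 1.
  by exists 2^-1; rewrite ?invr_eq0// absvV v2 invf_lt1 ?ltr1n.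
have [a [b [sm eD ii]]] := short_reduction n2 n3 dW LC.
have HG := short_tabgroup n2 sm LC nt.
have [z [N [C ch]]] := short_chart HG n2 sm LC.
have [X [XD Xc Xk Xo]] := chart_exp ch (@ec_compact _ _ v _ LC) (@ec_hausdorff _ _ v _) LC v2.
exists a, b, HG, X; split => //.
move=> T st; exists (ec_group v (short_weierstrass a b)).
by split=> //; [exact: ec_compact | exact: ec_hausdorff].
Qed.

End LocalStructure.

Lemma I1_eq (x y : 'I_1) : x = y. Proof. by rewrite [x]ord1 [y]ord1. Qed.

Lemma I2_case (x : 'I_2) : x = ord0 \/ x = ord_max.
Proof. by case: x => [[|[|m]] h] //; [left | right]; apply/val_inj. Qed.

Theorem real_local {R : realType} (W : weierstrass R) : discriminant W != 0 ->
  arch_iso (real_absvalue R) (ec_group (real_absvalue R) W)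
    (if 0 < discriminant W then discrete_group 'I_2 else discrete_group 'I_1).
Proof.
move=> dW; have v2 : real_absvalue R 2 = 2 by rewrite /= normr_nat.
have n3 : (3 : R) != 0 by rewrite pnatr_eq0.
have [a [b [HG [X [[sm eD] tr [XD Xl] Xk Xo]]]]] := arch_exp (@real_loc_compact R) v2 n3 dW.
apply: tr; have X0 : X 0 = 0 by apply: (addIr (X 0)); rewrite -XD !add0r.
have Xop : nbhs (0 : zsort_of HG) (range X) by apply: filterS (Xo 1 ltr01) => P [t _ <-]; exists t.
case: ifPn => [pos|neg]; last first.
  exists HG, X, (fun=> 0); split=> //.
  split=> [P|z z' t t' _]; last exact: I1_eq.
  have [[z _ <-]|nP] := pselect (range X P); first by exists z, ord0; rewrite addr0.
  have [Q [_ nQ Q0 f']] := real_coset sm XD Xop nP.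
  exfalso; move/negP: neg; apply; rewrite eD; apply/(middle_root_discriminant sm).
  by exists (Xc Q); split => //; rewrite -(short_curve nQ) Q0 expr0n.
have [e [e0 f']] := (middle_root_discriminant sm).2 (etrans (congr1 _ (esym eD)) pos).
have h : on_curve (short_weierstrass a b) e 0 by rewrite short_on_curveE e0 expr0n.
pose t : zsort_of HG := EC_affine h.
have tt : t + t = 0.
  by apply: (@ec_add_opposite _ a b (EC_affine h) (EC_affine h)) => //; rewrite /ec_opposite eqxx /= addr0 eqxx.
have nt : ~ range X t by exact: middle_root_coset.
(* Each coset other than the image of X contains the 2-torsion point t, by [real_coset] and the
   uniqueness of the middle root; so there are exactly two cosets. *)
have cover P : range X P \/ range X (P - t).
  have [|nP] := pselect (range X P); [by left|right].
  have [Q [[z ez] nQ Q0 fQ]] := real_coset sm XD Xop nP.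
  have eQ : Q = t.
    apply/ec_eqP; split; rewrite ?Q0//; first by move: nQ; case: (Q).
    apply: (middle_root_unique _ e0 fQ f').
    by rewrite -(short_curve nQ) Q0 expr0n.
  exists (0 - z) => //; rewrite (XB XD) ez X0 sub0r eQ.
  by rewrite opprB.
pose tau (i : discrete_group 'I_2) : zsort_of HG := if i == ord0 then 0 else t.
exists HG, X, tau; split=> //.
  split=> // i j; have [-> | ->] := I2_case i; have [-> | ->] := I2_case j; rewrite /tau /= ?addr0 ?add0r//.
split=> [P|z z' i j].
  have [[z _ ez]|[z _ ez]] := cover P; first by exists z, ord0; rewrite ez /tau /= addr0.
  by exists z, ord_max; rewrite ez /tau /= subrK.
have [-> | ->] := I2_case i; have [-> | ->] := I2_case j; rewrite /tau //= ?addr0 => E; exfalso; apply: nt.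
  by exists (z - z') => //; rewrite (XB XD) E addrC addKr.
by exists (z' - z) => //; rewrite (XB XD) -E addrC addKr.
Qed.

Lemma complex_absv_real {R : realType} (x : R) : complex_absvalue R (real_complex R x) = `|x|.
Proof. exact: normc_real. Qed.

Theorem complex_local {R : realType} (W : weierstrass R[i]) : discriminant W != 0 ->
  arch_iso (complex_absvalue R) (ec_group (complex_absvalue R) W) (discrete_group 'I_1).
Proof.
move=> dW; have n3 : (3 : R[i]) != 0 by rewrite pnatr_eq0.
have v2 : complex_absvalue R 2 = 2.
  have -> : (2 : R[i]) = real_complex R 2 by rewrite rmorph_nat.
  by rewrite complex_absv_real normr_nat.
have [a [b [HG [X [[sm eD] tr [XD Xl] Xk Xo]]]]] := arch_exp (@complex_loc_compact R) v2 n3 dW.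
apply: tr; have n2 : (2 : R[i]) != 0 by rewrite pnatr_eq0.
have Xop : nbhs (0 : zsort_of HG) (range X) by apply: filterS (Xo 1 ltr01) => P [t _ <-]; exists t.
exists HG, X, (fun=> 0); split=> //.
split=> [P|z z' t t' _]; last exact: I1_eq.
have [] := complex_connected n2 sm (@complex_loc_compact R) XD Xop _ _ P; last by move=> z _ <-; exists z, ord0; rewrite addr0.
  by move=> z; exists (sqrtC z); rewrite sqrtCK.
move=> x d d0; have [->|x0] := eqVneq x 0.
  exists (real_complex R (d / 2)); rewrite subr0 absv0 complex_absv_real gtr0_norm ?divr_gt0//.
  by split; lra.
have vx : 0 < complex_absvalue R x by exact: absv_gt0.
pose h := d / (2 * complex_absvalue R x).
have h0 : 0 < h by rewrite divr_gt0// mulr_gt0.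
exists (x * (1 + real_complex R h)); split.
  have -> : x * (1 + real_complex R h) - x = real_complex R h * x by ring.
  rewrite absvM complex_absv_real gtr0_norm// /h.
  have -> : d / (2 * complex_absvalue R x) * complex_absvalue R x = d / 2 by field; exact: lt0r_neq0.
  by lra.
rewrite absvM ltr_pMr//.
have -> : 1 + real_complex R h = real_complex R (1 + h) by rewrite rmorphD rmorph1.
by rewrite complex_absv_real gtr0_norm; lra.
Qed.

Lemma unitmx_inj (F : fieldType) n (A : 'M[F]_n) : (forall x : 'rV_n, x *m A = 0 -> x = 0) -> A \in unitmx.
Proof.
move=> h; rewrite -row_free_unit -kermx_eq0; apply/eqP/row_matrixP => i.
by rewrite row0; apply: h; rewrite -row_mul mulmx_ker row0.
Qed.

(** * Lattices of R^n *)

Section RealLattice.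
Context {R : realType} {n : nat}.

Lemma frac_le1 (x : R) : `|x - (Num.floor x)%:~R| <= 1.
Proof.
have h1 := Num.Theory.floor_le x; have h2 := Num.Theory.floorD1_gt x; rewrite rmorphD rmorph1 in h2.
by rewrite ger0_norm; lra.
Qed.

Lemma bounded_pigeonhole (d B : R) : 0 < d -> exists q, forall u : nat -> 'rV[R]_n,
  (forall m k, `|u m 0 k| <= B) -> exists m m', (m < m' <= q)%N /\ forall k, `|u m 0 k - u m' 0 k| < d.
Proof.
move=> d0; pose Q := Num.truncn (2 * B / d).
exists #|{ffun 'I_n -> 'I_Q.+1}| => u ub; set q := #|_|.
pose cell (x : R) : nat := Num.truncn ((x + B) / d).
have cellP x : `|x| <= B -> (cell x <= Q)%N /\ (cell x)%:R * d <= x + B < (cell x).+1%:R * d.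
  rewrite ler_norml => /andP[x1 x2].
  have y0 : 0 <= (x + B) / d by apply: divr_ge0; lra.
  have := Num.Theory.truncn_itv y0; rewrite ler_pdivlMr// ltr_pdivrMr// => ->; split=> //.
  by apply: Num.Theory.le_truncn; rewrite ler_pM2r ?invr_gt0//; lra.
pose phi (m : 'I_q.+1) := [ffun k : 'I_n => inord (cell (u m 0 k)) : 'I_Q.+1].
have /injectivePn[m [m' ne e]] : ~~ injectiveb phi.
  by apply/negP => /injectiveP /leq_card; rewrite card_ord ltnn.
have close (a b : 'I_q.+1) : phi a = phi b -> forall k, `|u a 0 k - u b 0 k| < d.
  move=> eab k; have := congr1 (fun f : {ffun 'I_n -> 'I_Q.+1} => (f k : nat)) eab.
  rewrite !ffunE; have [c1 /andP[a1 a2]] := cellP _ (ub a k); have [c2 /andP[b1 b2]] := cellP _ (ub b k).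
  rewrite !inordK// => ec; move: a1 a2 b1 b2; rewrite -ec -natr1 mulrDl mul1r => a1 a2 b1 b2.
  by rewrite ltr_norml; apply/andP; split; lra.
have [lt|ge] := ltnP m m'.
  by exists m, m'; rewrite lt -ltnS ltn_ord; split=> //; exact: close.
exists m', m; split; last exact: close.
have nv : (m' != m :> nat)%N by apply: contraNneq ne => h; apply/eqP/val_inj.
by rewrite ltn_neqAle nv ge -ltnS ltn_ord.
Qed.

Context (Lam : set 'rV[R]_n).
Hypothesis LamB : forall x y, Lam x -> Lam y -> Lam (x - y).
Hypothesis Lam_discrete : exists2 d : R, 0 < d & forall x, Lam x -> (forall k, `|x 0 k| < d) -> x = 0.
Hypothesis Lam_cocompact : exists M : R, forall r : 'rV[R]_n, exists2 x, Lam x & forall k, `|r 0 k - x 0 k| <= M.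

Lemma Lam0 : Lam 0.
Proof. by have [M h] := Lam_cocompact; have [x Lx _] := h 0; rewrite -(subrr x); exact: LamB. Qed.

Lemma LamN x : Lam x -> Lam (- x).
Proof. by move=> h; rewrite -sub0r; apply: LamB => //; exact: Lam0. Qed.

Lemma LamD x y : Lam x -> Lam y -> Lam (x + y).
Proof. by move=> hx hy; rewrite -[y]opprK; apply: LamB => //; exact: LamN. Qed.

Lemma LamMz x (m : int) : Lam x -> Lam (m%:~R *: x).
Proof.
move=> hx; have hn k : Lam (k%:R *: x).
  elim: k => [|k IH]; first by rewrite scale0r; exact: Lam0.
  by rewrite -natr1 scalerDl scale1r; exact: LamD.
case: m => k; first exact: hn.
by rewrite NegzE rmorphN scaleNr; apply: LamN; exact: hn.
Qed.

Lemma Lam_sum (I : finType) (f : I -> 'rV[R]_n) : (forall i, Lam (f i)) -> Lam (\sum_i f i).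
Proof. by move=> h; elim/big_ind: _ => //; [exact: Lam0 | exact: LamD]. Qed.

(** The rows are elements of the lattice within |M| of the vectors N e_i. As N > n |M|, no nonzero
    combination of them can vanish. *)
Lemma near_basis : exists2 A : 'M[R]_n, A \in unitmx & forall i, Lam (row i A).
Proof.
have [M hM] := Lam_cocompact.
pose N := n%:R * `|M| + 1.
have h (i : 'I_n) : exists x : 'rV[R]_n, Lam x /\ forall k, `|(N *: delta_mx 0 i : 'rV[R]_n) 0 k - x 0 k| <= `|M|.
  have [x Lx hx] := hM (N *: delta_mx 0 i : 'rV[R]_n); exists x; split=> // k.
  exact: (le_trans (hx k) (ler_norm M)).
have [f hf] := choice h.
pose A := \matrix_i f i.
exists A; last by move=> i; rewrite rowK; case: (hf i).
apply: unitmx_inj => x xA.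
have N0 : 0 < N by rewrite ltr_wpDl// mulr_ge0.
have col k : N * `|x 0 k| <= \sum_i `|x 0 i| * `|M|.
  have e : N * x 0 k = \sum_i x 0 i * ((N *: delta_mx 0 i : 'rV[R]_n) 0 k - A i k).
    under eq_bigr do rewrite mulrBr.
    rewrite sumrB; have -> : \sum_i x 0 i * A i k = (x *m A) 0 k by rewrite mxE.
    rewrite xA mxE subr0 (bigD1 k)//= big1 ?addr0 => [|i ik].
      by rewrite !mxE !eqxx /= mulr1 mulrC.
    by rewrite !mxE /= eq_sym (negbTE ik) !mulr0.
  rewrite -(gtr0_norm N0) -normrM e; apply: le_trans (ler_norm_sum _ _ _) _.
  apply: ler_sum => i _; rewrite normrM; apply: ler_wpM2l => //.
  by rewrite [A i k]mxE; case: (hf i).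
have S : \sum_k N * `|x 0 k| <= n%:R * `|M| * \sum_i `|x 0 i|.
  apply: le_trans (ler_sum _ (fun k _ => col k)) _.
  by rewrite sumr_const card_ord -mulr_suml -[_ *+ n]mulr_natl le_eqVlt; apply/orP; left; apply/eqP; ring.
rewrite -mulr_sumr {1}/N mulrDl mul1r gerDl in S.
have S0 : \sum_i `|x 0 i| = 0 by apply: le_anti; rewrite S sumr_ge0.
apply/rowP => k; rewrite mxE; apply/eqP; rewrite -normr_eq0.
by have /psumr_eq0P/(_ S0) -> : forall i : 'I_n, true -> 0 <= `|x 0 i|.
Qed.

(* In a basis of periods, the coordinates of all periods have a common denominator, by the pigeonhole
   principle; the lattice then comes from a lattice of Q^n. *)
Theorem real_lattice : exists2 A : 'M[R]_n, A \in unitmx &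
  forall x : 'rV[R]_n, Lam (x *m A) <-> forall k, x 0 k \is a Num.int.
Proof.
have [A uA LA] := near_basis; have [d d0 hd] := Lam_discrete.
have Lrow (c : 'I_n -> int) : Lam ((\row_i (c i)%:~R) *m A).
  have -> : (\row_i (c i)%:~R) *m A = \sum_i (c i)%:~R *: row i A.
    by rewrite mulmx_sum_row; apply: eq_bigr => i _; rewrite mxE.
  by apply: Lam_sum => i; apply: LamMz.
pose B := \sum_i \sum_k `|A i k|.
have [q hq] := bounded_pigeonhole B d0.
pose N0 := q`!.
(* Reducing the coordinates of m c modulo Z gives bounded elements of the lattice. Two of the first
   q + 1 are closer than d, hence equal, so (m' - m) c is integral; and m' - m divides q!. *)
have den (c : 'rV[R]_n) : Lam (c *m A) -> forall k, N0%:R * c 0 k \is a Num.int.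
  move=> Lc.
  pose fl m : 'rV[R]_n := \row_i (Num.floor (m%:R * c 0 i))%:~R.
  pose u m := (m%:R *: c - fl m) *m A.
  have Lu m : Lam (u m).
    by rewrite /u mulmxBl; apply: LamB; [rewrite -scalemxAl; exact: (LamMz m%:Z Lc) | exact: Lrow].
  have ub m k : `|u m 0 k| <= B.
    rewrite mxE; apply: le_trans (ler_norm_sum _ _ _) _; apply: ler_sum => i _.
    rewrite normrM; apply: (@le_trans _ _ (1 * `|A i k|)).
      by apply: ler_wpM2r => //; rewrite !mxE; exact: frac_le1.
    by rewrite mul1r (bigD1 k)//= lerDl sumr_ge0.
  have [m [m' [/andP[mm' mq] hk]]] := hq u ub.
  have e : u m = u m'.
    by apply/eqP; rewrite -subr_eq0; apply/eqP; apply: hd; [exact: LamB | move=> k; have := hk k; rewrite !mxE].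
  have e2 : m%:R *: c - fl m = m'%:R *: c - fl m' by rewrite -(mulmxK uA (_ - fl m)) [_ *m A]e mulmxK.
  have key k : (m' - m)%:R * c 0 k \is a Num.int.
    have := congr1 (fun x : 'rV[R]_n => x 0 k) e2; rewrite !mxE => e3.
    have -> : (m' - m)%:R * c 0 k = (Num.floor (m'%:R * c 0 k) - Num.floor (m%:R * c 0 k))%:~R.
      by rewrite natrB 1?ltnW// rmorphB mulrBl /=; lra.
    exact: rpred_int.
  have dv : (m' - m %| N0)%N by apply: dvdn_fact; rewrite subn_gt0 mm' (leq_trans (leq_subr _ _)).
  move=> k; rewrite -(divnK dv) natrM -mulrA.
  by apply: rpredM; rewrite ?rpred_nat//; exact: key.
pose ra (x : 'rV[rat]_n) : 'rV[R]_n := map_mx ratr x.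
have raB x y : ra (x - y) = ra x - ra y by apply/rowP => k; rewrite !mxE rmorphB.
have raZ c x : ra (c *: x) = ratr c *: ra x by apply/rowP => k; rewrite !mxE rmorphM.
have rat_int (x : rat) : ((ratr x : R) \is a Num.int) = (x \is a Num.int).
  apply/idP/idP => /intrP[m e].
    have -> : x = m%:~R by apply: (fmorph_inj (ratr : {rmorphism rat -> R})); exact: (etrans e (esym (ratr_int _ _))).
    exact: rpred_int.
  by rewrite e ratr_int; exact: rpred_int.
have N00 : (N0%:R : rat) != 0 by rewrite pnatr_eq0 -lt0n fact_gt0.
pose M := [set x : 'rV[rat]_n | Lam (ra x *m A)].
pose R0 := [set c : rat | c \is a Num.int].
have [b [Mb gb ib]] : exists b : 'I_n -> 'rV[rat]_n, [/\ forall i, M (b i),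
  forall x, M x -> exists2 c : 'I_n -> rat, (forall i, R0 (c i)) & x = \sum_i c i *: b i &
  forall c : 'I_n -> rat, \sum_i c i *: b i = 0 -> forall i, c i = 0].
  apply: (@lattice_basis R0 n M N0%:R).
  - exact: rpred1.
  - by move=> x y; exact: rpredB.
  - by move=> x y; exact: rpredM.
  - by move=> x y hx hy; rewrite /M /= raB mulmxBl; exact: LamB.
  - move=> r x /intrP[m ->] hx; rewrite /M /= raZ ratr_int -scalemxAl; exact: LamMz.
  - exact: N00.
  - move=> i; rewrite /M /= raZ -scalemxAl ratr_nat.
    have -> : ra (delta_mx 0 i) = delta_mx 0 i by apply/rowP => k; rewrite !mxE ratr_nat.
    by rewrite -rowE; exact: (LamMz N0%:Z (LA i)).
  - move=> x /den h i; rewrite /R0 /= -rat_int; have := h i.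
    by rewrite mxE rmorphM rmorph_nat.
pose C : 'M[rat]_n := \matrix_i b i.
have CE (c : 'rV[rat]_n) : c *m C = \sum_i c 0 i *: b i.
  by rewrite mulmx_sum_row; apply: eq_bigr => i _; rewrite rowK.
have uC : C \in unitmx.
  by apply: unitmx_inj => x; rewrite CE => /ib h; apply/rowP => k; rewrite h mxE.
pose C' : 'M[R]_n := map_mx ratr C.
have uC' : C' \in unitmx by rewrite map_unitmx.
exists (C' *m A); first by rewrite unitmx_mul uC' uA.
move=> x; split=> [|h].
  rewrite mulmxA => Lx.
  have [y ey] : exists y : 'rV[rat]_n, ra y = x *m C'.
    have ex k : exists m : int, N0%:R * (x *m C') 0 k = m%:~R by apply/intrP; exact: den.
    have [m hm] := choice ex.
    exists (\row_k ((m k)%:~R / N0%:R)); apply/rowP => k; rewrite !mxE.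
    rewrite rmorphM fmorphV /= ratr_int ratr_nat -hm mulrC mulKf ?mxE//.
    by rewrite pnatr_eq0 -lt0n fact_gt0.
  have My : M y by rewrite /M /= ey.
  have [c cR yc] := gb y My.
  have ex : x = ra (\row_i c i).
    apply: (can_inj (mulmxK uC')); rewrite -ey.
    rewrite -map_mxM /= CE yc; congr map_mx; apply: eq_bigr => i _; by rewrite mxE.
  by move=> k; rewrite ex !mxE rat_int; exact: cR.
have ex k : exists m : int, x 0 k = m%:~R by apply/intrP; exact: h.
have [m hm] := choice ex.
rewrite mulmxA.
have -> : x *m C' *m A = \sum_i (m i)%:~R *: (ra (b i) *m A).
  rewrite [x *m C']mulmx_sum_row mulmx_suml; apply: eq_bigr => i _.
  by rewrite -hm -scalemxAl; congr (_ *: (_ *m _)); apply/rowP => k; rewrite !mxE.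
by apply: Lam_sum => i; apply: LamMz; exact: Mb.
Qed.

End RealLattice.

(** * The circle R/Z *)

Section CircleFacts.
Context {R : realType}.
Local Open Scope quotient_scope.
Notation circ := (circle_group R).

Definition circle_pi (x : R) : circ := (\pi_(Quotient.quot (@integers R)) x).
Definition circle_repr (c : circ) : R := repr (c : Quotient.quot (@integers R)).

Lemma circle_reprK c : circle_pi (circle_repr c) = c.
Proof. exact: reprK. Qed.

Lemma circle_piD x y : circle_pi (x + y) = circle_pi x + circle_pi y.
Proof. exact: (Quotient.pi_add (@integers R) x y). Qed.

Lemma circle_pi0 : circle_pi 0 = 0.
Proof. exact: raddf0 (\pi_(Quotient.quot (@integers R)) : {additive R -> _}). Qed.

Lemma circle_pi_eq x y : circle_pi x = circle_pi y <-> x - y \is a Num.int.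
Proof.
split=> [h|h].
  by have /eqmodP := h.
by apply/eqmodP.
Qed.

Lemma circle_pi_continuous : continuous (circle_pi : R -> circ).
Proof. exact: pi_continuous. Qed.

Lemma circle_continuous (T : topologicalType) (f : circ -> T) : continuous (fun x : R => f (circle_pi x)) -> continuous f.
Proof. by move=> h; apply/quotient_continuous. Qed.

Lemma circle_pi_repr (c : circ) : exists x : R, 0 <= x <= 1 /\ circle_pi x = c.
Proof.
pose x := circle_repr c; exists (x - (Num.floor x)%:~R); split.
  have := Num.Theory.floor_le x; have := Num.Theory.floorD1_gt x; rewrite rmorphD rmorph1 => h1 h2.
  by apply/andP; split; lra.
rewrite -(circle_reprK c); apply/circle_pi_eq; rewrite -/x addrAC subrr sub0r.
by rewrite rpredN rpred_int.
Qed.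

Lemma circle_compact : compact [set: circ].
Proof.
have -> : [set: circ] = circle_pi @` [set` `[0 : R, 1]].
  apply/seteqP; split=> // c _; have [x [hx e]] := circle_pi_repr c.
  by exists x => //=; rewrite in_itv.
apply: continuous_compact; last exact: segment_compact.
by apply: continuous_subspaceT; exact: circle_pi_continuous.
Qed.
End CircleFacts.

Lemma choice_dep (I : Type) (F : I -> Type) (P : forall i, F i -> Prop) : (forall i, exists x, P i x) ->
  exists f : forall i, F i, forall i, P i (f i).
Proof. by move=> h; exists (fun i => sval (cid (h i))) => i; exact: (svalP (cid (h i))). Qed.

(** * The product of the E(K_p) over the infinite primes *)

Section ArchPlace.
Context {R : realType} {K : fieldExtType rat}.
Let n := \dim {:K}.
Context (e : 'I_n -> K).
Hypothesis span : forall x, exists a : 'I_n -> rat, x = \sum_i a i *: e i.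
Context {Om : numClosedFieldType} (w : absvalue R Om).
Context (s : 'I_n -> {rmorphism K -> Om}) (B : 'I_n -> 'I_n -> Om).
Hypothesis sB : forall (a : 'I_n -> rat) i, ratr (a i) = \sum_j B i j * s j (\sum_k a k *: e k).
Context (Kc : forall p : prime_of R K, completion p).
Hypothesis nw : nontrivial_absv (ratw w).
Hypothesis wq : forall q, ratw w q = `|ratr q : R|.
Context (I : Type) (pr : I -> prime_of R K) (G T : I -> topGroupLaw).
Hypothesis abv : forall i, above w Kc (pr i).
Hypothesis pri : injective pr.
Hypothesis prs : forall p, above w Kc p -> exists i, pr i = p.
Hypothesis tG : forall i, tabgroup (G i).
Hypothesis cG : forall i, compact [set: G i].
Hypothesis hG : forall i, hausdorff_space (G i).
Hypothesis cT : forall i, compact [set: T i].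
Notation F i := (Kc (pr i)).
Notation v i := (compl_absv (Kc (pr i))).
Notation io i := (compl_emb (Kc (pr i))).
Context (j : forall i, {rmorphism R -> F i}).
Hypothesis jv : forall i x, v i (j i x) = `|x|.
Hypothesis jq : forall i q, io i (q%:A) = j i (ratr q).
Context (X : forall i, F i -> zsort_of (tG i)) (tau : forall i, T i -> zsort_of (tG i)).
Hypothesis XD : forall i, {morph @X i : x y / x + y}.
Hypothesis Xc : forall i (Y : Type) (U : set_system Y) f l, ultra U -> vlim (v i) U f l -> (fun t => X (f t)) @ U --> X l.
Hypothesis Xk : forall i, exists2 d : R, 0 < d & forall t, v i t < d -> X t = 0 -> t = 0.
Hypothesis Xo : forall i (d : R), 0 < d -> nbhs (0 : zsort_of (tG i)) [set X t | t in [set t | v i t < d]].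
Hypothesis tau0 : forall i, @tau i 0 = 0.
Hypothesis tauD : forall i, {morph @tau i : x y / x + y}.
Hypothesis tauc : forall i (Y : Type) (U : set_system Y) (f : Y -> T i) (l : T i), ultra U -> f @ U --> l ->
  (fun t => tau (f t)) @ U --> tau l.
Hypothesis Xtau : forall i P, exists z t, P = @X i z + tau t.
Hypothesis tau_inj : forall i z z' t t', @X i z + tau t = X z' + tau t' -> t = t'.

(** The component at i of the identification of R^n with K (x) R, that is, with the product of the
    K_p. *)
Definition psi i (r : 'rV[R]_n) : F i := \sum_k j i (r 0 k) * io i (e k).

Lemma psiB i x y : psi i (x - y) = psi i x - psi i y.
Proof. by rewrite -sumrB; apply: eq_bigr => k _; rewrite !mxE rmorphB mulrBl. Qed.

Lemma psiD i x y : psi i (x + y) = psi i x + psi i y.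
Proof. by rewrite -big_split; apply: eq_bigr => k _; rewrite !mxE rmorphD mulrDl. Qed.

Lemma psiZ i c x : psi i (c *: x) = j i c * psi i x.
Proof. by rewrite mulr_sumr; apply: eq_bigr => k _; rewrite !mxE rmorphM mulrA. Qed.

Lemma psi_rat i (a : 'I_n -> rat) : psi i (\row_k ratr (a k)) = io i (\sum_k a k *: e k).
Proof.
rewrite rmorph_sum; apply: eq_bigr => k _.
by rewrite mxE -jq -rmorphM -scalerAl mul1r.
Qed.

Lemma psi_bound : exists2 M : R, 0 < M & forall i (r : 'rV[R]_n) (d : R), 0 <= d -> (forall k, `|r 0 k| <= d) -> v i (psi i r) <= M * d.
Proof.
have [m [f fs]] := finite_index span sB nw abv pri prs.
pose Mi i := \sum_k v i (io i (e k)).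
have Mi0 i : 0 <= Mi i by apply: sumr_ge0 => k _; exact: absv_ge0.
exists (1 + \sum_(a < m) Mi (f a)); first by rewrite ltr_pwDl// sumr_ge0.
move=> i r d d0 h; apply: (@le_trans _ _ (Mi i * d)); last first.
  apply: ler_wpM2r => //; have [a <-] := fs i.
  by rewrite (bigD1 a)//= addrCA lerDl addr_ge0// sumr_ge0.
apply: le_trans (absv_sum _ _ _ _) _; rewrite mulr_suml; apply: ler_sum => k _.
by rewrite absvM jv mulrC; apply: ler_wpM2l => //; exact: absv_ge0.
Qed.

Lemma rat_approx (r : 'rV[R]_n) (d : R) : 0 < d -> exists a : 'I_n -> rat, forall k, `|(\row_k ratr (a k) - r) 0 k| <= d.
Proof.
move=> d0; have ex k : exists q : rat, `|ratr q - r 0 k| <= d.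
  have lt : r 0 k - d < r 0 k + d by lra.
  have [q] := rat_in_itvoo lt; rewrite in_itv /= => /andP[q1 q2]; exists q.
  by rewrite ler_norml; apply/andP; split; lra.
by have [a ha] := choice ex; exists a => k; rewrite !mxE; exact: ha.
Qed.

(** For rational r this is [small_above], with bound 1; a real r is approximated by rational vectors
    within 1. *)
Lemma psi_small : exists2 c : R, 0 < c & forall r, (forall i, v i (psi i r) < c) -> forall k, `|r 0 k| < 2.
Proof.
have [c c0 hc] := small_above sB Kc nw ltr01; have [M M0 hM] := psi_bound.
exists (c / 2); first by rewrite divr_gt0.
move=> r hr k; pose d := Num.min 1 (c / 2 / M).
have d0 : 0 < d by rewrite lt_min ltr01 !divr_gt0.
have d1 : d <= 1 by rewrite ge_min lexx.
have dM : M * d <= c / 2 by rewrite mulrC -ler_pdivlMr// ge_min lexx orbT.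
have [a ha] := rat_approx r d0.
have : ratw w (a k) < 1.
  apply: hc => p /prs[i <-]; rewrite /prime_absv /= -psi_rat.
  have := hM i _ d (ltW d0) ha; rewrite psiB => h1.
  have h2 := hr i; apply: le_lt_trans (absv_le_dist (v i) _ (psi i r)) _; lra.
have := ha k; rewrite wq !mxE => h1 h2.
have := ler_normB (ratr (a k)) (ratr (a k) - r 0 k); rewrite subKr; lra.
Qed.

Lemma psi_small_scaled : exists2 c : R, 0 < c & forall r (d : R), 0 < d -> (forall i, v i (psi i r) < c * d) -> forall k, `|r 0 k| < 2 * d.
Proof.
have [c c0 hc] := psi_small; exists c => // r d d0 h k.
have h1 i : v i (psi i (d^-1 *: r)) < c.
  by rewrite psiZ absvM jv gtr0_norm ?invr_gt0// mulrC ltr_pdivrMr.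
have := hc _ h1 k; rewrite mxE normrM gtr0_norm ?invr_gt0//.
by rewrite mulrC ltr_pdivrMr.
Qed.

Lemma psi_inj r : (forall i, psi i r = 0) -> r = 0.
Proof.
move=> h; have [c c0 hc] := psi_small.
apply/rowP => k; rewrite mxE; apply/eqP/negPn/negP => ne.
have := hc ((2 / r 0 k) *: r) _ k; rewrite !mxE divfK// normr_nat ltxx => H.
suff : false by []. apply: H => i; by rewrite psiZ h mulr0 absv0.
Qed.

Lemma psi_vlim i (U : set_system nat) (x : nat -> 'rV[R]_n) (r : 'rV[R]_n) : ProperFilter U ->
  (forall k, vlim (real_absvalue R) U (fun m => x m 0 k) (r 0 k)) -> vlim (v i) U (fun m => psi i (x m)) (psi i r).
Proof.
move=> PU h d d0; have [M M0 hM] := psi_bound.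
have dM : 0 < d / M / 2 by rewrite !divr_gt0.
have hall : U [set m | forall k, `|x m 0 k - r 0 k| < d / M / 2].
  by apply: filter_forall => k; exact: h.
apply: filterS hall => m hm; rewrite /= -psiB.
apply: (@le_lt_trans _ _ (M * (d / M / 2))).
  by apply: hM; [exact: ltW | move=> k; rewrite !mxE; apply: ltW; exact: hm].
have -> : M * (d / M / 2) = d / 2 by field; exact: lt0r_neq0.
by lra.
Qed.

(** Weak approximation gives elements of K that tend to y at all infinite primes. [psi_small_scaled]
    bounds their coordinates, which therefore have limits. *)
Lemma psi_surj (y : forall i, F i) : exists r, forall i, psi i r = y i.
Proof.
have dm (m : nat) : 0 < m.+1%:R^-1 :> R by rewrite invr_gt0.
have ex m : exists r, forall i, v i (psi i r - y i) < m.+1%:R^-1.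
  have [x hx] := index_dense span sB nw abv pri y (dm m).
  by have [a ea] := span x; exists (\row_k ratr (a k)) => i; rewrite psi_rat -ea.
have [x hx] := choice ex; have [U [uU Ubig]] := ultra_nat; have [PU _] := uU.
have [c c0 hc] := psi_small_scaled.
have bd m k : `|x m 0 k - x 0%N 0 k| < 2 * (2 / c).
  have := hc (x m - x 0%N) (2 / c) _ _ k; rewrite !mxE; apply; first by rewrite divr_gt0.
  move=> i; rewrite mulrC divfK ?lt0r_neq0// psiB.
  have h1 := absvD3 (v i) (psi i (x m)) (y i) (psi i (x 0%N)).
  have h2 := hx m i; have h3 := hx 0%N i; rewrite absv_dist invr1 in h3.
  have h4 : m.+1%:R^-1 <= 1 :> R by rewrite invf_le1 ?ltr0n// ler1n.
  apply: le_lt_trans h1 _; rewrite -[2]/(1 + 1); apply: ltrD => //; exact: lt_le_trans h4.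
have lim k : exists l, vlim (real_absvalue R) U (fun m => x m 0 k) l.
  apply: (lc_vlim (@real_loc_compact R)) => //; exists (`|x 0%N 0 k| + 2 * (2 / c)).
  apply: filterE => m /=; have := bd m k.
  have := ler_normD (x 0%N 0 k) (x m 0 k - x 0%N 0 k); rewrite subrKC; lra.
have [l hl] := choice lim.
exists (\row_k l k) => i.
have l1 : vlim (v i) U (fun m => psi i (x m)) (psi i (\row_k l k)).
  by apply: psi_vlim => k; rewrite mxE; exact: hl.
apply: (@vlim_unique _ _ (v i) _ U PU _ _ _ l1) => d d0.
have iN : 0 <= d^-1 by rewrite invr_ge0 ltW.
have [_ hN] := andP (Num.Theory.truncn_itv iN).
apply: filterS (Ubig (Num.truncn d^-1)) => m /= hm.
apply: lt_trans (hx m i) _; rewrite invf_plt ?posrE//.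
by apply: lt_le_trans hN _; rewrite ler_nat.
Qed.

Let tGb : tabgroup (bigprod_group G) := bigprod_tab tG.
Notation Zb := (zsort_of tGb).

Lemma zb_ext (P Q : Zb) : (forall i, P i = Q i) -> P = Q.
Proof. exact: dep_funext. Qed.

Definition Exp (r : 'rV[R]_n) : Zb := fun i => X (psi i r).

Lemma ExpD x y : Exp (x + y) = Exp x + Exp y.
Proof. by apply: zb_ext => i; rewrite /Exp psiD XD. Qed.

Lemma Exp0 : Exp 0 = 0.
Proof. by apply: (addIr (Exp 0)); rewrite -ExpD !add0r. Qed.

Lemma ExpB x y : Exp (x - y) = Exp x - Exp y.
Proof. by apply/eqP; rewrite eq_sym subr_eq -ExpD subrK. Qed.

Lemma Exp_sum (J : finType) (f : J -> 'rV[R]_n) : Exp (\sum_a f a) = \sum_a Exp (f a).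
Proof. exact: (big_morph Exp ExpD Exp0). Qed.

Definition periods : set 'rV[R]_n := [set r | Exp r = 0].

Lemma periodsB x y : periods x -> periods y -> periods (x - y).
Proof. by rewrite /periods /= ExpB => -> ->; rewrite subrr. Qed.

Lemma periods_discrete : exists2 d : R, 0 < d & forall x, periods x -> (forall k, `|x 0 k| < d) -> x = 0.
Proof.
have [d d0 hd] : exists2 d : R, 0 < d & forall i, forall t, v i t < d -> X t = 0 -> t = 0.
  apply: (@finite_min _ _ _ span _ _ _ _ sB _ nw _ _ abv pri prs (fun i d => forall t, v i t < d -> X t = 0 -> t = 0)) => //.
  by move=> i c d h d0 dc t td; apply: h; exact: lt_le_trans td dc.
have [M M0 hM] := psi_bound.
have d2 : 0 < d / M / 2 by rewrite !divr_gt0.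
exists (d / M / 2) => // x Lx hx; apply: psi_inj => i; apply: (hd i); last first.
  by move: Lx => /(congr1 (fun f : Zb => f i)).
apply: (@le_lt_trans _ _ (M * (d / M / 2))).
  by apply: hM; [exact: ltW | move=> k; exact: ltW].
have -> : M * (d / M / 2) = d / 2 by field; exact: lt0r_neq0.
by lra.
Qed.

Lemma Exp_open : nbhs (0 : Zb) [set Exp r | r in [set r : 'rV[R]_n | forall k, `|r 0 k| < 2]].
Proof.
have [c c0 hc] := psi_small.
have h : nbhs (0 : bigprod_group G) [set P : bigprod_group G | forall i, [set X t | t in [set t | v i t < c]] (P i)].
  by apply: (@finite_nbhs _ _ _ span _ _ _ _ sB _ nw _ _ _ abv pri prs 0 (fun i => [set X t | t in [set t | v i t < c]])) => i; exact: Xo.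
apply: filterS h => P hP.
have ex i : exists t, v i t < c /\ X t = P i by have [t] := hP i; exists t.
have [t ht] := choice_dep ex.
have [r hr] := psi_surj t; exists r; last first.
  by apply: zb_ext => i; rewrite /Exp hr; case: (ht i).
by apply: hc => i; rewrite hr; case: (ht i).
Qed.

(** Otherwise there are vectors r_m farther than m from all periods. By compactness Exp (r_m) has a
    limit, so Exp (r_m - r_m0) is close to 0 and equals Exp u with u bounded; then r_m - r_m0 - u is
    a period at a bounded distance from r_m. *)
Lemma periods_cocompact : exists M : R, forall r : 'rV[R]_n, exists2 x, periods x & forall k, `|r 0 k - x 0 k| <= M.
Proof.
apply: contrapT => no.
have ex (m : nat) : exists r : 'rV[R]_n, ~ exists2 x, periods x & forall k, `|r 0 k - x 0 k| <= m%:R.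
  by apply: contrapT => h; apply: no; exists m%:R => r; apply: contrapT => h'; apply: h; exists r.
have [r hr] := choice ex; have [U [uU Ubig]] := ultra_nat.
have [P hP] := compact_ultra_cvgT (bigprod_compact cG) (ultra_map (fun m => Exp (r m)) uU).
have h0 : (fun m => Exp (r m) - (P : Zb)) @ U --> (0 : Zb) by apply/(@zcvgP _ tGb _ _ (fun m => Exp (r m))).
have [B0 nB hB] := znbhs_split Exp_open.
have UB : U [set m | B0 (Exp (r m) - (P : Zb))] by exact: (h0 _ nB).
have [m0 hm0] := filter_ex UB.
pose b := \sum_k `|r m0 0 k| + 2.
have b0 : 0 <= b by rewrite addr_ge0// sumr_ge0.
have [_ hb] := andP (Num.Theory.truncn_itv b0).
have [m [hm /= mb]] := filter_ex (filterI UB (Ubig (Num.truncn b).+1)).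
have [_] := hB _ _ hm hm0.
have -> : Exp (r m) - (P : Zb) - (Exp (r m0) - (P : Zb)) = Exp (r m - r m0) by rewrite ExpB opprB addrA subrK.
move=> [u hu eu]; apply: (hr m); exists (r m - r m0 - u).
  by rewrite /periods /= ExpB eu subrr.
move=> k; rewrite !mxE.
have -> : r m 0 k - (r m 0 k - r m0 0 k - u 0 k) = r m0 0 k + u 0 k by ring.
apply: le_trans (ler_normD _ _) _; apply: (@le_trans _ _ b).
  apply: lerD; last exact: ltW (hu k).
  by rewrite (bigD1 k)//= lerDl sumr_ge0.
by apply: le_trans (ltW hb) _; rewrite ler_nat.
Qed.

Lemma zcvg_sum {Y : Type} (U : set_system Y) (J : finType) (f : J -> Y -> Zb) (x : J -> Zb) : ultra U ->
  (forall a, f a @ U --> x a) -> (fun t => \sum_a f a t) @ U --> \sum_a x a.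
Proof.
move=> uU h; elim: (index_enum J) => [|a l IH].
  apply: (@cvg_eqfun _ _ _ (fun=> \sum_(a <- [::]) x a)); first by move=> t; rewrite !big_nil.
  exact: cvg_cst.
rewrite big_cons; apply: (@cvg_eqfun _ _ _ (fun t => f a t + \sum_(b <- l) f b t)); first by move=> t; rewrite big_cons.
exact: zcvgD.
Qed.

Notation circles_T := (prod_group (power_group (circle_group R) n) (bigprod_group T)).

Theorem arch_place : isoG (bigprod_group G) (prod_group (power_group (circle_group R) n) (bigprod_group T)).
Proof.
have [A uA hA] := real_lattice periodsB periods_discrete periods_cocompact.
apply: isoG_sym.
(* The k-th row of A is a period, so the value depends on the factor only modulo Z. *)
pose eta (k : 'I_n) (c : circle_group R) : Zb := Exp (circle_repr c *: row k A).
have eta_pi k x : eta k (circle_pi x) = Exp (x *: row k A).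
  apply/eqP; rewrite -subr_eq0 -ExpB -scalerBl; apply/eqP.
  have /circle_pi_eq h : circle_pi (circle_repr (circle_pi x)) = circle_pi x by exact: circle_reprK.
  rewrite rowE scalemxAl; apply/hA => b; rewrite !mxE /=.
  by case: (_ == _); rewrite ?mulr1// mulr0.
have etaD k c c' : eta k (c + c') = eta k c + eta k c'.
  by rewrite -(circle_reprK c) -(circle_reprK c') -circle_piD !eta_pi scalerDl ExpD.
have eta0 k : eta k 0 = 0 by rewrite -circle_pi0 eta_pi scale0r Exp0.
have eta_cont k : continuous (eta k : circle_group R -> bigprod_group G).
  apply: circle_continuous; apply: continuous_ultra => U uU x Ux.
  apply: bprod_cvg => i.
  apply: (@cvg_eqfun _ _ _ (fun y => X (j i y * psi i (row k A)))).
    by move=> y; rewrite eta_pi /Exp psiZ.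
  rewrite eta_pi /Exp psiZ; apply: Xc => // d d0.
  have va := absv_ge0 (v i) (psi i (row k A)).
  have d1 : 0 < d / (1 + v i (psi i (row k A))) by rewrite divr_gt0// ltr_pwDl.
  have h : U (ball x (d / (1 + v i (psi i (row k A))))) by apply: Ux; exact: nbhsx_ballx.
  apply: filterS h => y; rewrite /ball /= distrC => hy.
  rewrite -mulrBl -rmorphB absvM jv; apply: le_lt_trans (_ : _ <= `|y - x| * (1 + v i (psi i (row k A)))) _.
    by apply: ler_wpM2l => //; rewrite lerDr.
  by rewrite -ltr_pdivlMr// ltr_pwDl.
pose tt (t : bigprod_group T) : Zb := fun i => tau (t i).
have ttD t t' : tt (t + t') = tt t + tt t' by apply: zb_ext => i; exact: tauD.
pose f (z : circles_T) : bigprod_group G :=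
  (\sum_k eta k (z.1 k) + tt z.2 : Zb).
have sumE (c : 'I_n -> R) : \sum_k eta k (circle_pi (c k)) = Exp ((\row_k c k) *m A).
  rewrite mulmx_sum_row Exp_sum; apply: eq_bigr => k _.
  by rewrite eta_pi mxE.
have fE c t i : f ((fun k => circle_pi (c k)), t) i = X (psi i ((\row_k c k) *m A)) + tau (t i).
  by rewrite /f /= sumE.
have repr_eq (z : circles_T) :
    z = ((fun k => circle_pi (circle_repr (z.1 k))), z.2).
  case: z => c t; congr pair; apply: dep_funext => k /=.
  by rewrite circle_reprK.
exists f; apply: compact_isoG.
- apply: prod_compact; apply: bigprod_compact => //; move=> k; exact: circle_compact.
- exact: bigprod_hausdorff.
- have -> : f 0 = (0 + tt 0 : Zb) by rewrite /f big1// => k _; exact: eta0.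
  by rewrite add0r; apply: zb_ext => i; exact: tau0.
- move=> [c t] [c' t']; rewrite /f /=.
  have -> : \sum_k eta k ((c + c' : power_group (circle_group R) n) k) = \sum_k eta k (c k) + \sum_k eta k (c' k).
    by rewrite -big_split; apply: eq_bigr => k _; exact: etaD.
  by rewrite ttD; exact: (addrACA (\sum_k eta k (c k))).
- move=> z z'; rewrite (repr_eq z) (repr_eq z') => E.
  have E' i := congr1 (fun P : bigprod_group G => P i) E; rewrite /= in E'.
  have et i : z.2 i = z'.2 i by have := E' i; rewrite !fE; exact: tau_inj.
  congr pair; last exact: dep_funext.
  apply: dep_funext => k; apply/circle_pi_eq.
  have L : periods ((\row_k (circle_repr (z.1 k)) - \row_k (circle_repr (z'.1 k))) *m A).
    rewrite /periods /= mulmxBl ExpB.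
    rewrite (_ : Exp ((\row_k circle_repr (z.1 k)) *m A) = Exp ((\row_k circle_repr (z'.1 k)) *m A)) ?subrr//.
    apply: zb_ext => i.
    have := E' i; rewrite !fE et; exact: (@addIr (zsort_of (tG i))).
  by have := (hA _).1 L k; rewrite !mxE.
- move=> P; have ex i : exists zt : F i * T i, P i = X zt.1 + tau zt.2.
    by have [z [t ezt]] := Xtau (P i : zsort_of (tG i)); exists (z, t).
  have [zt hzt] := choice_dep ex.
  have [r hr] := psi_surj (fun i => (zt i).1).
  exists ((fun k => circle_pi ((r *m invmx A) 0 k)), (fun i => (zt i).2)).
  apply: dep_funext => i; rewrite fE.
  have -> : (\row_k (r *m invmx A) 0 k) *m A = r.
    by rewrite -[RHS](mulmxKV uA); congr (_ *m _); apply/rowP => k; rewrite mxE.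
  by rewrite hr hzt.
- apply: continuous_ultra => U uU x Ux.
  apply: (@zcvgD _ tGb _ U (fun z : circles_T => \sum_k eta k (z.1 k)) (fun z => tt z.2)) => //.
    apply: (@zcvg_sum _ U _ (fun k z => eta k (z.1 k))) => // k.
    have cx : (fun z : circles_T => z.1 k) @ U --> x.1 k.
      exact: (@bproj_cvg _ _ (fun=> circle_group R) U (fun z : circles_T => z.1) x.1 k (fst_cvg Ux)).
    have cc := @cvg_comp_at _ _ _ U _ (eta k : circle_group R -> bigprod_group G) (x.1 k) (eta_cont k (x.1 k)) cx.
    exact: cc.
  apply: bprod_cvg => i; apply: tauc => //.
  exact: (@bproj_cvg _ _ T U (fun z : circles_T => z.2) x.2 i (snd_cvg Ux)).
Qed.

End ArchPlace.

(** * The adelic point group *)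

Lemma finite_discrete_compact m : compact [set: discrete_group 'I_m.+1].
Proof. by apply: finite_compact; exact: (@finite_finset 'I_m.+1). Qed.

Lemma ilim_compact q : compact [set: ilim_group q].
Proof.
apply: ultra_cvg_compact => U uU _.
have cA : compact [set: ilim_ambient q].
  by apply: bigprod_compact => k; exact: finite_discrete_compact.
have [x hx] := compact_ultra_cvgT cA (ultra_map (fun a : ilim_group q => \val a : ilim_ambient q) uU).
have hk k : U [set a : ilim_group q | (\val a : ilim_ambient q) k = x k].
  apply: discrete_cvg; exact: (@bproj_cvg _ _ _ U (fun a : ilim_group q => \val a : ilim_ambient q) x k hx).
have cx : ilim_compatible x.
  move=> i k ik; have [a [/= e1 e2]] := filter_ex (filterI (hk i) (hk k)).
  by rewrite -e1 -e2; exact: (set_mem (valP a) i k ik).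
by exists (exist _ x (mem_set cx)) => //; exact: ilim_cvg.
Qed.

(** * Zhat as the product of the Z_l *)

Lemma eqn_mod_prime_powers N a b : (0 < N)%N -> (forall p, prime p -> a = b %[mod p ^ logn p N])%N -> (a = b %[mod N])%N.
Proof.
move=> N0; wlog ab : a b / (a <= b)%N.
  by move=> H h; have [/H|/ltnW/H] := leqP a b; [exact | move=> H'; symmetry; apply: H' => p pp; rewrite h].
move=> h; apply/eqP; rewrite eq_sym eqn_mod_dvd//; apply/dvdn_partP => // p pN.
rewrite p_part -eqn_mod_dvd// eq_sym; apply/eqP; apply: h.
by move: pN; rewrite mem_primes => /and3P[].
Qed.

Lemma chinese_primes (k y : nat -> nat) (s : seq nat) : uniq s -> all prime s ->
  exists x, forall p, p \in s -> (x = y p %[mod p ^ k p])%N.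
Proof.
elim: s => [|p s IH] /=; first by exists 0%N.
move=> /andP[ps us] /andP[pp als]; have [x hx] := IH us als.
pose M := (\prod_(q <- s) q ^ k q)%N.
have co : coprime (p ^ k p) M.
  rewrite /M; elim: s ps als {IH us x hx M} => [|q s IH]; first by rewrite big_nil coprimen1.
  rewrite in_cons negb_or big_cons /= => /andP[pq ps] /andP[pq' als].
  by rewrite coprimeMr IH// andbT coprimeXl// coprimeXr// prime_coprime// dvdn_prime2.
exists (chinese (p ^ k p) M (y p) x) => q; rewrite in_cons => /orP[/eqP->|qs].
  exact: chinese_modl.
rewrite -(hx q qs).
have dv : (q ^ k q %| M)%N by rewrite /M (big_rem q)//= dvdn_mulr.
by rewrite -(modn_dvdm _ dv) chinese_modr// modn_dvdm.
Qed.

Notation prime_index := {l : nat | prime l}.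

Lemma prime_pow_pred (l : prime_index) k : ((sval l ^ k).-1.+1 = sval l ^ k)%N.
Proof. by rewrite prednK// expn_gt0 prime_gt0//; case: l. Qed.

Lemma mod_cast (a b d d' : nat) : d = d' -> (a = b %[mod d])%N -> (a = b %[mod d'])%N.
Proof. by move=> ->. Qed.

Lemma Zhat_ilim : isoG Zhat_group (ilim_group id).
Proof.
exists (fun a => a : ilim_group id); split.
- exact: val_inj.
- by move=> a b; exact: val_inj.
- by exists (fun a => a : Zhat_group); split=> // a A hA.
Qed.

(** The Chinese remainder theorem: the component at l retains the moduli l^k, and every modulus is
    recovered from its prime-power factors. *)
Theorem Zhat_primes : isoG Zhat_group (bigprod_group (fun l : prime_index => ilim_group (fun k => (sval l ^ k).-1))).
Proof.
apply: (isoG_trans Zhat_ilim).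
have co (a : ilim_group id) (l : prime_index) :
  (fun k => (\val a : ilim_ambient id) (sval l ^ k).-1) \in @ilim_compatible (fun k => (sval l ^ k).-1).
  by apply/mem_set => i k ik; exact: (set_mem (valP a) _ _ ik).
pose f (a : ilim_group id) : bigprod_group (fun l : prime_index => ilim_group (fun k => (sval l ^ k).-1)) :=
  fun l => (exist (fun z : ilim_ambient _ => z \in @ilim_compatible (fun k => (sval l ^ k).-1)) _ (co a l) : ilim (fun k => (sval l ^ k).-1)).
(* The index m stands for the modulus m + 1, whence the predecessor of a prime power as index. *)
have cmp (a : ilim_group id) m (p : nat) (pp : prime p) :
  ((\val a : ilim_ambient id) m = (\val a : ilim_ambient id) (p ^ logn p m.+1).-1 %[mod p ^ logn p m.+1])%N.
  have pe : ((p ^ logn p m.+1).-1.+1 = p ^ logn p m.+1)%N by rewrite prednK// expn_gt0 prime_gt0.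
  have dv : ((p ^ logn p m.+1).-1.+1 %| m.+1)%N by rewrite pe; exact: pfactor_dvdnn.
  have h := set_mem (valP a) _ m dv.
  exact: mod_cast pe h.
exists f; apply: compact_isoG.
- exact: ilim_compact.
- by apply: bigprod_hausdorff => l; exact: ilim_hausdorff.
- by apply: dep_funext => l; apply: val_inj.
- by move=> a b; apply: dep_funext => l; apply: val_inj.
- move=> a b E; apply: val_inj; apply: dep_funext => m; apply: val_inj => /=.
  have key : ((\val a : ilim_ambient id) m = (\val b : ilim_ambient id) m %[mod m.+1])%N.
    apply: eqn_mod_prime_powers => // p pp; rewrite cmp// [in RHS]cmp//.
    have := congr1 (fun g : bigprod_group (fun l : prime_index => ilim_group (fun k => (sval l ^ k).-1)) =>
      (\val (g (exist _ p pp)) : ilim_ambient _) (logn p m.+1)) E.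
    by rewrite /f /= => ->.
  by move: key; rewrite !modn_small.
- move=> y.
  pose yy p k : nat := if pselect (prime p) is left pp then (\val (y (exist _ p pp)) : ilim_ambient _) k else 0%N.
  have yc p i k : prime p -> (i <= k)%N -> (yy p k = yy p i %[mod p ^ i])%N.
    rewrite /yy; case: pselect => // pp _ ik.
    apply: (mod_cast (prime_pow_pred (exist _ p pp) i)).
    apply: (set_mem (valP (y (exist _ p pp))) i k).
    by rewrite !prime_pow_pred; exact: dvdn_exp2l.
  have ex m : exists x : 'I_m.+1, forall p, prime p -> (x = yy p (logn p m.+1) %[mod p ^ logn p m.+1])%N.
    have [x hx] := chinese_primes (fun p => logn p m.+1) (fun p => yy p (logn p m.+1)) (primes_uniq m.+1) (all_prime_primes m.+1).
    exists (inord (x %% m.+1)) => p pp; rewrite inordK ?ltn_mod//.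
    rewrite modn_dvdm ?pfactor_dvdnn//.
    have [pm|] := boolP (p \in primes m.+1); first exact: hx.
    by move=> np; rewrite (_ : logn p m.+1 = 0)%N ?modn1//; apply/eqP; rewrite -leqn0 leqNgt logn_gt0.
  have [x hx] := choice_dep ex.
  have cx : x \in (@ilim_compatible id).
    apply/mem_set => i k ik; apply: eqn_mod_prime_powers => // p pp.
    rewrite (hx i p pp) -(yc p _ (logn p k.+1) pp) ?dvdn_leq_log//.
    have dv : (p ^ logn p i.+1 %| p ^ logn p k.+1)%N by apply: dvdn_exp2l; exact: dvdn_leq_log.
    by rewrite -(modn_dvdm (x k) dv) hx// modn_dvdm.
  exists (exist (fun z : ilim_ambient id => z \in @ilim_compatible id) x cx : ilim id); apply: dep_funext => -[p pp].
  apply: val_inj; apply: dep_funext => k; apply: val_inj => /=.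
  have e : ((p ^ k).-1.+1 = p ^ k)%N := prime_pow_pred (exist _ p pp) k.
  have hk : logn p (p ^ k).-1.+1 = k by rewrite e pfactorK.
  have h := hx (p ^ k).-1 p pp; rewrite hk in h.
  have b1 : (x (p ^ k).-1 < p ^ k)%N by apply: (leq_trans (ltn_ord _)); rewrite e.
  have b2 : ((\val (y (exist _ p pp)) : ilim_ambient _) k < p ^ k)%N by apply: (leq_trans (ltn_ord _)); rewrite prime_pow_pred.
  rewrite -[LHS](modn_small b1) h /yy; case: pselect => // pp'.
  by rewrite (Prop_irrelevance pp' pp) modn_small.
- apply: continuous_ultra => U uU a Ua.
  apply: bprod_cvg => l; apply: ilim_cvg => k.
  exact: (@ilim_proj _ id U _ (fun t => t) a (sval l ^ k).-1 Ua).
Qed.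

Lemma discriminant_map (F L : fieldType) (f : {rmorphism F -> L}) (W : weierstrass F) :
  discriminant (map_weierstrass f W) = f (discriminant W).
Proof.
case: W => a1 a2 a3 a4 a6 /=.
by rewrite !(rmorph_nat, rmorphB, rmorphN, rmorphD, rmorphM, rmorphXn).
Qed.

Lemma prodA_iso (A B C : topGroupLaw) :
  topgroup_iso (fun x : prod_group A (prod_group B C) => ((x.1, x.2.1), x.2.2) : prod_group (prod_group A B) C).
Proof.
split=> //.
exists (fun x => (x.1.1, (x.1.2, x.2))); split; [by case=> [? [? ?]] | by case=> [[? ?] ?] | |];
  apply: continuous_ultra => U uU x Ux.
- have h := snd_cvg Ux; apply: pair_cvg; last exact: (snd_cvg h).
  by apply: pair_cvg; [exact: (fst_cvg Ux) | exact: (fst_cvg h)].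
- have h := fst_cvg Ux; apply: pair_cvg; first exact: (fst_cvg h).
  by apply: pair_cvg; [exact: (snd_cvg h) | exact: (snd_cvg Ux)].
Qed.

Lemma isoG_prodCA (A B C : topGroupLaw) :
  isoG (prod_group A (prod_group B C)) (prod_group B (prod_group A C)).
Proof.
have c (A' B' C' : topGroupLaw) : continuous (fun x : prod_group A' (prod_group B' C') => (x.2.1, (x.1, x.2.2)) : prod_group B' (prod_group A' C')).
  apply: continuous_ultra => U uU x Ux; have h := snd_cvg Ux.
  apply: pair_cvg; first exact: (fst_cvg h).
  by apply: pair_cvg; [exact: (fst_cvg Ux) | exact: (snd_cvg h)].
exists (fun x => (x.2.1, (x.1, x.2.2))); split=> //.
by exists (fun x => (x.2.1, (x.1, x.2.2))); split; [case=> [? [? ?]] | case=> [? [? ?]] | exact: c | exact: c].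
Qed.

(** * The product over all primes of K *)

Section NumberField.
Context {R : realType} {K : fieldExtType rat}.
Let n := \dim {:K}.
Context (E : elliptic_curve K) (Kc : forall p : prime_of R K, completion p).
Context (e : 'I_n -> K).
Hypothesis span : forall x, exists a : 'I_n -> rat, x = \sum_i a i *: e i.
Hypothesis free_e : forall a : 'I_n -> rat, \sum_i a i *: e i = 0 -> forall i, a i = 0.
Hypothesis emb : forall Om : numClosedFieldType, exists (s : 'I_n -> {rmorphism K -> Om}) (B : 'I_n -> 'I_n -> Om),
    forall (a : 'I_n -> rat) i, ratr (a i) = \sum_j B i j * s j (\sum_k a k *: e k).

Notation prime_index := {l : nat | prime l}.

Lemma compl_char0 (p : prime_of R K) (Kp : completion p) m : (0 < m)%N -> (m%:R : Kp) != 0.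
Proof.
move=> m0; rewrite -(rmorph_nat (compl_emb Kp)) fmorph_eq0 -(rmorph_nat (in_alg K)) fmorph_eq0.
by rewrite pnatr_eq0 -lt0n.
Qed.

Lemma compl_disc (p : prime_of R K) (Kp : completion p) : discriminant (map_weierstrass (compl_emb Kp) E) != 0.
Proof. by rewrite discriminant_map fmorph_eq0; exact: ec_smooth. Qed.

Lemma nonarch_compl (p : prime_of R K) : ~ archv (prime_absv Kc p) -> nonarchimedean (compl_absv (Kc p)).
Proof.
move=> h; apply: nonarch_of_nat => m; rewrite leNgt; apply/negP => lt; apply: h; exists m.
by rewrite /prime_absv /= rmorph_nat.
Qed.

Lemma prime_place (p : prime_of R K) : exists o : option prime_index,
  match o with None => archv (prime_absv Kc p)
  | Some l => ~ archv (prime_absv Kc p) /\ prime_absv Kc p (sval l)%:R < 1 end.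
Proof.
have [a|na] := pselect (archv (prime_absv Kc p)); first by exists None.
have nt : nontrivial_absv (prime_absv Kc p) := prime_nontrivial (prime_absvP Kc p).
have [l pl hl] := nonarch_residue nt na.
by exists (Some (exist _ l pl)).
Qed.

Definition place p := sval (cid (prime_place p)).

Notation at_place o := {p | place p = o}.

Lemma placeP p : match place p with None => archv (prime_absv Kc p)
  | Some l => ~ archv (prime_absv Kc p) /\ prime_absv Kc p (sval l)%:R < 1 end.
Proof. exact: svalP (cid (prime_place p)). Qed.

Lemma place_archP p : archv (prime_absv Kc p) <-> place p = None.
Proof. by split; have := placeP p; case: (place p) => // l []. Qed.

Lemma place_SomeP p (l : prime_index) : (~ archv (prime_absv Kc p) /\ prime_absv Kc p (sval l)%:R < 1) <-> place p = Some l.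
Proof.
split=> [[na vl]|e0]; last by have := placeP p; rewrite e0.
have := placeP p; case: (place p) => [l'|//] [_ vl'].
have um : nonarchimedean (prime_absv Kc p).
  apply: nonarch_of_nat => m; rewrite leNgt; apply/negP => lt; apply: na; by exists m.
congr Some; apply: val_inj; exact: residue_unique um (svalP l') (svalP l) vl' vl.
Qed.

Lemma finite_places (l : prime_index) :
  (forall i : at_place (Some l), tabgroup (local_points E Kc (sval i)) /\ compact [set: local_points E Kc (sval i)]) /\
  isoG (bigprod_group (fun i : at_place (Some l) => local_points E Kc (sval i)))
    (prod_group (power_group (ilim_group (fun k => (sval l ^ k).-1)) n)
       (bigprod_group (fun i : at_place (Some l) => local_T E Kc (sval i)))).
Proof.
have [w uw wl] := ladic_absvalue R (svalP l).
have [s [B sB]] := emb algC.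
have l0 : (0 < sval l)%N := prime_gt0 (svalP l).
have rl : ratw w (sval l)%:R = w (sval l)%:R by exact: ratw_natE.
have nw : nontrivial_absv (ratw w).
  exists (sval l)%:R; first by rewrite pnatr_eq0 -lt0n.
  by rewrite rl lt_eqF.
have ru : nonarchimedean (ratw w).
  by move=> x y; have := uw (ratr x) (ratr y); rewrite -rmorphD.
have abv (i : at_place (Some l)) : above w Kc (sval i).
  apply/(nonarch_over _ (svalP l) uw wl); apply/place_SomeP; exact: svalP i.
have pri : injective (fun i : at_place (Some l) => sval i).
  by move=> [p hp] [q hq] /= pq; subst q; rewrite (Prop_irrelevance hp hq).
have prs p : above w Kc p -> exists i : at_place (Some l), sval i = p.
  by move=> /(nonarch_over _ (svalP l) uw wl)/place_SomeP h; exists (exist _ p h).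
have vl (i : at_place (Some l)) : compl_absv (Kc (sval i)) (sval l)%:R < 1.
  have [_] := (place_SomeP (sval i) l).2 (svalP i).
  by rewrite /prime_absv /= rmorph_nat.
have rl1 : ratw w (sval l)%:R < 1 by rewrite rl.
have LC (i : at_place (Some l)) : loc_compact (compl_absv (Kc (sval i))).
  exact: (finite_loc_compact span sB nw (svalP l) ru rl1 (abv i)).
have facts (i : at_place (Some l)) := local_facts (@compl_char0 _ (Kc (sval i))) (@compl_disc _ (Kc (sval i))) (LC i) l0 (vl i).
have tG (i : at_place (Some l)) : tabgroup (local_points E Kc (sval i)) by have [] := facts i.
have um (i : at_place (Some l)) : nonarchimedean (compl_absv (Kc (sval i))).
  by apply: nonarch_compl; have [] := (place_SomeP (sval i) l).2 (svalP i).
have [L hL] := choice_dep (fun i : at_place (Some l) => local_log (@compl_char0 _ (Kc (sval i))) (@compl_disc _ (Kc (sval i))) (LC i) (um i) l0 (vl i) (tG i)).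
split; first by move=> i; split=> //; have [] := facts i.
apply: isoG_trans (@ladic_place R K e span algC w s B sB Kc nw (sval l) (svalP l) ru rl1 _ _ _ abv pri prs tG _ _ L _ _ _ _ _) _.
- by move=> i; have [] := facts i.
- by move=> i; have [] := facts i.
- by move=> i; have [] := hL i.
- by move=> i; have [] := hL i.
- by move=> i; have [] := hL i.
- by move=> i; have [] := hL i.
- by move=> i; have [] := hL i.
apply: isoG_prod; first exact: isoG_refl.
apply: isoG_bigprod => i; rewrite /local_T.
have -> : `[< finite_prime (sval i) >]; last exact: isoG_refl.
apply/asboolP/(finite_primeP (prime_absvP Kc (sval i))).
by have [] := (place_SomeP (sval i) l).2 (svalP i).
Qed.

(** A completion to which the results on R and C apply. It contains R isometrically, which fixes the
    normalization of its absolute value. *)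
Definition standard (p : prime_of R K) (Kp : completion p) : Prop :=
  [/\ loc_compact (compl_absv Kp),
      exists j : {rmorphism R -> Kp}, (forall x, compl_absv Kp (j x) = `|x|) /\ (forall q : rat, compl_emb Kp (q%:A) = j (ratr q)) &
      arch_iso (compl_absv Kp) (ec_group (compl_absv Kp) (map_weierstrass (compl_emb Kp) E)) (local_T E Kc p) ].

Lemma complex2 : 1 < complex_absvalue R 2.
Proof.
have -> : (2 : R[i]) = real_complex R 2 by rewrite rmorph_nat.
by rewrite complex_absv_real normr_nat ltr1n.
Qed.

Lemma complex_ratw (q : rat) : ratw (complex_absvalue R) q = `|ratr q : R|.
Proof. by rewrite -complex_absv_real; congr (complex_absvalue R _); rewrite fmorph_rat. Qed.

Lemma complex_nontrivial : nontrivial_absv (ratw (complex_absvalue R)).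
Proof. by exists 2%:R; rewrite ?pnatr_eq0// ratw_natE gt_eqF// complex2. Qed.

Lemma standard_completion p : archv (prime_absv Kc p) -> exists Kp : completion p, standard Kp.
Proof.
move=> ap; have nf : ~ finite_prime p by move=> /(finite_primeP (prime_absvP Kc p)).
have eT : local_T E Kc p = if `[< exists s : {rmorphism K -> R}, real_prime_of p s /\ 0 < s (discriminant E) >]
    then discrete_group 'I_2 else discrete_group 'I_1.
  by rewrite /local_T; case: asboolP.
have [[r pr]|nr] := pselect (exists s : {rmorphism K -> R}, real_prime_of p s).
  (* s is the embedding provided by [local_T] in the positive case and r otherwise, so that the sign
     of the discriminant under s decides between the two values of [local_T]. *)
  have [s ps eT'] : exists2 s : {rmorphism K -> R}, real_prime_of p s &
      local_T E Kc p = if 0 < s (discriminant E) then discrete_group 'I_2 else discrete_group 'I_1.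
    rewrite eT; case: asboolP => [[s [ps pos]]|h]; first by exists s; rewrite ?pos.
    by exists r => //; case: ifPn => // pos; exfalso; apply: h; exists r.
  exists (real_completion ps); split; first exact: real_loc_compact.
    by exists (idfun : {rmorphism R -> R}); split=> // q; exact: (rmorph_ratA s q).
  have dW := compl_disc (real_completion ps).
  by rewrite eT' -(discriminant_map s E); exact: real_local.
have ab : above (complex_absvalue R) Kc p by apply/(arch_over (prime_absv Kc p)) => //; exists 2%N; exact: complex2.
have [s [B sB]] := emb R[i].
have [k ek] := above_is_conj span sB complex_nontrivial ab.
have ps : sval p (absv_pullback (complex_absvalue R) (s k)).
  by rewrite ek; exact: class_primeP.
have [ns|//] := real_or_complex ps.
exists (complex_completion ps ns); split; first exact: complex_loc_compact.
  exists (real_complex R : {rmorphism R -> R[i]}); split; first exact: complex_absv_real.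
  by move=> q; rewrite fmorph_rat; exact: (rmorph_ratA (s k) q).
have dW := compl_disc (complex_completion ps ns).
rewrite eT; case: asboolP => [[r [pr _]]|_]; first by exfalso; apply: nr; exists r.
exact: complex_local.
Qed.

Lemma local_T_arch p : archv (prime_absv Kc p) -> compact [set: local_T E Kc p] /\
  forall (Y : Type) (U : set_system Y) (f : Y -> local_T E Kc p) (l : local_T E Kc p), f @ U --> l -> U [set t | f t = l].
Proof.
move=> ap; have nf : ~ finite_prime p by move=> /(finite_primeP (prime_absvP Kc p)).
rewrite /local_T; case: asboolP => // _.
by case: asboolP => _; split; try exact: finite_discrete_compact; move=> Y U f l; exact: discrete_cvg.
Qed.

(** The given completions at infinity are replaced by standard ones, which leaves the set of
    infinite primes unchanged and alters the groups of points by the isomorphisms of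
    [completion_isoG]. *)
Lemma arch_places :
  (forall i : at_place None, tabgroup (local_points E Kc (sval i)) /\ compact [set: local_points E Kc (sval i)]) /\
  isoG (bigprod_group (fun i : at_place None => local_points E Kc (sval i)))
  (prod_group (power_group (circle_group R) n) (bigprod_group (fun i : at_place None => local_T E Kc (sval i)))).
Proof.
have ex p : exists Kp : completion p, archv (prime_absv Kc p) -> standard Kp.
  by have [/standard_completion[Kp h]|h] := pselect (archv (prime_absv Kc p)); [exists Kp | exists (Kc p)].
have [Kc' hK] := choice_dep ex.
have ar (i : at_place None) : archv (prime_absv Kc (sval i)) := (place_archP _).2 (svalP i).
have st i := hK _ (ar i).
have [s [B sB]] := emb R[i]; have nw := complex_nontrivial.
have two : exists m, 1 < complex_absvalue R m%:R by exists 2%N; exact: complex2.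
have arE p : archv (prime_absv Kc p) <-> archv (prime_absv Kc' p).
  by split; apply: equiv_arch; apply: prime_equiv (prime_absvP _ p) (prime_absvP _ p).
have abv (i : at_place None) : above (complex_absvalue R) Kc' (sval i).
  by apply/(arch_over (prime_absv Kc' (sval i)) two)/arE.
have pri : injective (fun i : at_place None => sval i).
  by move=> [p hp] [q hq] /= pq; subst q; rewrite (Prop_irrelevance hp hq).
have prs p : above (complex_absvalue R) Kc' p -> exists i : at_place None, sval i = p.
  by move=> /(arch_over (prime_absv Kc' p) two)/arE/place_archP h; exists (exist _ p h).
have [j hj] := choice_dep (fun i : at_place None => let: And3 _ h _ := st i in h).
have [H hH] := choice_dep (fun i : at_place None => let: And3 _ _ h := st i in h).
have [tG h1] := choice_dep (fun i : at_place None => let: And4 _ _ _ h := hH i in h).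
have [X h2] := choice_dep h1; have [tau h3] := choice_dep h2.
have ii (i : at_place None) : isoG (local_points E Kc (sval i)) (H i).
  apply: isoG_trans (_ : isoG _ (local_points E Kc' (sval i))) _; last by have [] := hH i.
  by apply: isoG_sym; apply: completion_isoG; have [] := st i.
split.
  move=> i; split; first exact: isoG_tab (ii i) (tG i).
  by apply: isoG_compact (ii i) _; have [] := hH i.
apply: (isoG_trans (isoG_bigprod ii)).
apply: (@arch_place R K e span _ (complex_absvalue R) s B sB Kc' nw complex_ratw _ _ _ _ abv pri prs tG _ _ _ j _ _ X tau).
- by move=> i; have [] := hH i.
- by move=> i; have [] := hH i.
- by move=> i; have [] := local_T_arch (ar i).
- by move=> i; have [] := hj i.
- by move=> i; have [] := hj i.
- by move=> i; have [[]] := h3 i.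
- by move=> i; have [[]] := h3 i.
- by move=> i; have [_] := h3 i.
- by move=> i; have [_ _] := h3 i.
- by move=> i; have [_ _ _ []] := h3 i.
- by move=> i; have [_ _ _ []] := h3 i.
- move=> i Y U f l uU fl; have [_ dT] := local_T_arch (ar i).
  by apply: eventually_eq_cvg; apply: filterS (dT _ _ _ _ fl) => t /= ->.
- by move=> i; have [_ _ _ _ []] := h3 i.
- by move=> i; have [_ _ _ _ []] := h3 i.
Qed.

Lemma local_points_facts p : tabgroup (local_points E Kc p) /\ compact [set: local_points E Kc p].
Proof.
case e0: (place p) => [l|]; first exact: ((finite_places l).1 (exist _ p e0)).
exact: (arch_places.1 (exist _ p e0)).
Qed.

Lemma adelic_iso : isoG (adelic_points E Kc)
  (prod_group (power_group (circle_group R) n) (prod_group (power_group Zhat_group n) (T_group E Kc))).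
Proof.
apply: (isoG_trans (isoG_regroup place (local_points E Kc))).
apply: (isoG_trans (isoG_option _)).
apply: isoG_trans (isoG_prod arch_places.2 (isoG_trans (isoG_bigprod (fun l => (finite_places l).2)) (isoG_bigprod_prod _ _))) _.
apply: (isoG_trans (isoG_sym (ex_intro _ _ (prodA_iso _ _ _)))); apply: isoG_prod; first exact: isoG_refl.
apply: (isoG_trans (isoG_prodCA _ _ _)); apply: isoG_prod.
  apply: isoG_sym; apply: isoG_trans (isoG_bigprod (fun=> Zhat_primes)) _.
  exact: isoG_swap.
apply: isoG_sym; apply: (isoG_trans (isoG_regroup place (local_T E Kc))).
exact: isoG_option.
Qed.

Lemma local_T_cases p : local_T E Kc p = torsion_group (local_points E Kc p) \/ exists m, local_T E Kc p = discrete_group 'I_m.+1.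
Proof.
rewrite /local_T; case: asboolP => _; first by left.
by right; case: asboolP => _; [exists 1%N | exists 0%N].
Qed.

End NumberField.

(** * Zero-dimensional spaces and the component of zero *)

Lemma continuous_within {X Y : topologicalType} (f : X -> Y) (A : set X) : continuous f -> {within A, continuous f}.
Proof. exact: continuous_subspaceT. Qed.

Lemma clopen_preimage {X Y : topologicalType} (f : X -> Y) (A : set Y) : continuous f -> clopen A -> clopen (f @^-1` A).
Proof. by move=> fc [oA cA]; split; [apply: open_comp => // x _ | apply: preimage_closed => // x _]; exact: fc. Qed.

Lemma zero_dimensional_separated {X : topologicalType} : (forall x y : X, x <> y ->
  exists (Y : topologicalType) (f : X -> Y), [/\ continuous f, zero_dimensional Y & f x <> f y]) -> zero_dimensional X.
Proof.
move=> h x y /eqP/h[Y [f [fc zY /eqP/zY[U [cU Ux Uy]]]]].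
by exists (f @^-1` U); split => //; exact: clopen_preimage.
Qed.

Lemma zero_dimensional_bigprod {I : Type} (G : I -> topGroupLaw) : (forall i, zero_dimensional (G i)) ->
  zero_dimensional (bigprod_group G).
Proof.
move=> zG; apply: zero_dimensional_separated => x y ne.
have [i hi] : exists i, x i <> y i.
  apply: contrapT => h; apply: ne; apply: dep_funext => i.
  by apply: contrapT => h'; apply: h; exists i.
exists (G i), (fun z : bigprod_group G => z i); split => //.
by apply: continuous_ultra => U uU z Uz; exact: (@bproj_cvg _ _ G U (fun t => t) z i Uz).
Qed.

Lemma zero_dimensional_prod (G H : topGroupLaw) : zero_dimensional G -> zero_dimensional H ->
  zero_dimensional (prod_group G H).
Proof.
move=> zG zH; apply: zero_dimensional_separated => x y ne.
have [h|h] := pselect (x.1 = y.1).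
  exists H, (fun z : prod_group G H => z.2); split=> //.
    by apply: continuous_ultra => U uU z Uz; exact: (snd_cvg Uz).
  by move=> h'; apply: ne; move: h h'; case: x y => [? ?] [? ?] /= -> ->.
exists G, (fun z : prod_group G H => z.1); split=> //.
by apply: continuous_ultra => U uU z Uz; exact: (fst_cvg Uz).
Qed.

Lemma zero_dimensional_discrete (V : Algebra.ChoiceBaseAddUMagma.type) : zero_dimensional (discrete_group V).
Proof. exact: discrete_zero_dimension. Qed.

Lemma zero_dimensional_Zhat : zero_dimensional Zhat_group.
Proof.
apply: zero_dimensional_separated => x y ne.
exists Zhat_ambient, (fun z : Zhat_group => \val z); split.
- by apply: continuous_ultra => U uU z Uz; exact: (set_type_val_cvg Uz).
- by apply: zero_dimensional_bigprod => m; exact: zero_dimensional_discrete.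
- by move=> /val_inj.
Qed.

Lemma zero_dimensional_hausdorff {X : topologicalType} : zero_dimensional X -> hausdorff_space X.
Proof.
move=> zX; apply: hausdorff_cvg => U p q PU Up Uq; apply: contrapT => /eqP/zX[A [[oA cA] Ap nAq]].
have h1 : U A by apply: Up; exact: open_nbhs_nbhs.
have h2 : U (~` A) by apply: Uq; apply: open_nbhs_nbhs; split => //; exact: closed_openC.
by have [x [? []]] := filter_ex (filterI h1 h2).
Qed.

Lemma homeomorphism_zero_dimensional {X Y : topologicalType} (f : X -> Y) : homeomorphism f ->
  zero_dimensional Y -> zero_dimensional X.
Proof.
move=> [g [fK gK fc gc]] zY; apply: zero_dimensional_separated => x y ne.
by exists Y, f; split=> // /(can_inj fK).
Qed.

(** A factor of a product is a retract of it: this is how [tabgroup] descends from E(A_K) to Zhat^n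
    x T and to T. *)
Lemma retract_tab (G H : topGroupLaw) (i : G -> H) (r : H -> G) : tabgroup H -> continuous i -> continuous r ->
  i 0 = 0 -> {morph i : x y / x + y} -> {morph r : x y / x + y} -> cancel i r -> tabgroup G.
Proof.
move=> [AA AC A0 [op oc oK] Ac] ic rc i0 iD rD ir.
have r0 : r 0 = 0 by rewrite -i0 ir.
split.
- by move=> x y z; rewrite -[LHS]ir -[RHS]ir !iD AA.
- by move=> x y; rewrite -[LHS]ir -[RHS]ir !iD AC.
- by move=> x; rewrite -[LHS]ir iD i0 A0 ir.
- exists (fun x => r (op (i x))).
    by move=> x; apply: (@continuous_comp _ _ _ (fun x => op (i x)) r); [apply: (@continuous_comp _ _ _ i op); [exact: ic | exact: oc] | exact: rc].
  by move=> x; rewrite -[x in _ + x]ir -rD oK r0.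
- move=> T U f g x y uU fx gy; rewrite -[x + y]ir iD.
  apply: (@cvg_eqfun _ _ _ (fun t => r (i (f t) + i (g t)))).
    by move=> t; rewrite -iD ir.
  apply: (@cvg_comp_at _ _ _ U (fun t => i (f t) + i (g t)) r); first exact: rc.
  by apply: Ac => //; [exact: (@cvg_comp_at _ _ _ U f i x (ic x) fx) | exact: (@cvg_comp_at _ _ _ U g i y (ic y) gy)].
Qed.
Lemma snd_tab (G H : topGroupLaw) : (0 : G) + 0 = 0 -> tabgroup (prod_group G H) -> tabgroup H.
Proof.
move=> h0 t; apply: (@retract_tab H (prod_group G H) (fun x => (0, x)) (fun z => z.2)) => //.
- by apply: continuous_ultra => U uU x Ux; apply: pair_cvg => //; exact: cvg_cst.
- by apply: continuous_ultra => U uU x Ux; exact: (snd_cvg Ux).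
- by move=> x y; congr pair; rewrite /= h0.
Qed.

Section ComponentQuotientIso.
Context (G C D : topGroupLaw) (f : G -> prod_group C D).
Hypothesis tG : tabgroup G.
Hypothesis cG : compact [set: G].
Hypothesis fI : topgroup_iso f.
Hypothesis zD : zero_dimensional D.
Hypothesis hC : forall c : C, exists A : set C, [/\ connected A, A 0 & A c].
Hypothesis C0 : (0 : C) + 0 = 0.

Let tD : tabgroup D.
Proof. by apply: (@snd_tab C D) => //; apply: isoG_tab tG; apply: isoG_sym; exists f. Qed.

Let q (x : G) : D := (f x).2.
Let qD x y : q (x + y) = q x + q y.
Proof. by case: fI => _ fD _; rewrite /q fD. Qed.
Let q_cont : continuous q.
Proof.
case: fI => _ _ [g [_ _ fc _]]; apply: continuous_ultra => U uU x Ux.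
exact: (@snd_cvg _ _ _ U f (f x) (@cvg_comp_at _ _ _ U (fun t => t) f x (fc x) Ux)).
Qed.

(** A connected set containing 0 maps to 0 in the zero-dimensional factor D; conversely each point
    of C lies in a connected set containing 0. *)
Lemma componentE x : connected_component0 G x <-> q x = 0.
Proof.
have [f0 fD [g [fK gK fc gc]]] := fI; split=> [[A [A0 _ cA] Ax]|qx].
  have := zero_dimension_totally_disconnected zD (I : setT (0 : D)).
  have : connected_component [set: D] 0 (q x).
    suff sub : q @` A `<=` connected_component [set: D] 0 by apply: sub; exists x.
    apply: connected_component_max => //; first by exists 0 => //; rewrite /q f0.
    by apply: connected_continuous_connected => //; exact: continuous_within.
  by move=> + e; rewrite e.
have [A [cA A0 Ax]] := hC (f x).1.
have e : x = g ((f x).1, 0) by rewrite -[LHS]fK; congr g; rewrite [LHS]surjective_pairing -qx.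
suff sub : (fun a => g (a, 0)) @` A `<=` connected_component [set: G] 0 by rewrite e; apply: sub; exists (f x).1.
apply: connected_component_max => //; first by exists 0 => //; rewrite -[RHS]fK f0.
apply: connected_continuous_connected => //; apply: continuous_within.
apply: continuous_ultra => U uU a Ua.
apply: (@cvg_comp_at _ _ _ U (fun t : C => (t, 0) : prod_group C D) g); first exact: gc.
by apply: pair_cvg => //; exact: cvg_cst.
Qed.

Lemma component_image : f @` connected_component0 G = [set z | z.2 = 0].
Proof.
have [f0 fD [g [fK gK fc gc]]] := fI; apply/seteqP; split=> [_ [x /componentE qx <-]//|z z0].
by exists (g z); rewrite ?gK//; apply/componentE; rewrite /q gK.
Qed.

Notation Z := (zsort_of tG).
Notation ZD := (zsort_of tD).

Lemma coset0E (x u : G) : coset0 x u <-> q u = q x.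
Proof.
split=> [[y /componentE qy <-]|e].
  by rewrite qD qy; exact: (@addr0 ZD).
exists ((u : Z) - (x : Z) : G); last by exact: (@subrKC Z).
apply/componentE; have := qD x ((u : Z) - (x : Z) : G).
have -> : x + ((u : Z) - (x : Z) : G) = u by exact: (@subrKC Z).
rewrite e => h; apply: (@addrI ZD (q x)); rewrite -[LHS]h.
by symmetry; exact: (@addr0 ZD).
Qed.

Lemma component_piE x y : component_pi x = component_pi y <-> q x = q y.
Proof.
split=> [h|h].
  have /eqmodP/asboolP e : component_pi x = component_pi y by exact: h.
  have : coset0 x x by apply/coset0E.
  by rewrite e => /coset0E.
apply/eqmodP/asboolP/seteqP; split=> u /coset0E e; apply/coset0E; by rewrite e.
Qed.

Lemma component_reprK (x : component_quotient G) : component_pi (component_repr x) = x.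
Proof. exact: reprK. Qed.

Lemma component_quotient_iso : exists2 g : component_quotient_group G -> D, topgroup_iso g &
  forall x, g (component_pi x) = q x.
Proof.
have [f0 fD [h [fK hK fc hc]]] := fI.
have gE x : q (component_repr (component_pi x)) = q x by apply/component_piE; exact: component_reprK.
exists (fun x : component_quotient_group G => q (component_repr x)) => //; split.
- by rewrite gE /q f0.
- by move=> x y; rewrite -qD; exact: gE.
- exists (fun d : D => component_pi (h (0, d)) : component_quotient_group G); split.
  + by move=> x; rewrite -[RHS]component_reprK; apply/component_piE; rewrite /q hK.
  + by move=> d; rewrite gE /q hK.
  + apply/quotient_continuous; rewrite (_ : _ \o _ = q) //.
    by apply: dep_funext => x; exact: gE.
  + apply: continuous_ultra => U uU d Ud.
    apply: (@cvg_comp_at _ _ _ U (fun t => h (0, t)) (@component_pi G)); first exact: pi_continuous.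
    apply: (@cvg_comp_at _ _ _ U (fun t : D => (0, t) : prod_group C D) h); first exact: hc.
    by apply: pair_cvg => //; exact: cvg_cst.
Qed.

Lemma component_quotient_profinite : profinite_space (component_quotient_group G).
Proof.
have [g gI _] := component_quotient_iso; have [_ _ gh] := gI.
have zQ := homeomorphism_zero_dimensional gh zD.
split; [|exact: zero_dimensional_hausdorff | exact: zero_dimension_totally_disconnected].
have cD : compact [set: D] by apply: (@isoG_compact_snd G C D) => //; exists f.
by apply: isoG_compact cD; exists g.
Qed.

End ComponentQuotientIso.

Lemma iso_torsion_closure (G H : topGroupLaw) (f : G -> H) : topgroup_iso f ->
  f @` closure (torsion G) = closure (torsion H).
Proof.
move=> [f0 fD [g [fK gK fc gc]]].
have gD : {morph g : x y / x + y} by move=> x y; apply: (can_inj fK); rewrite fD !gK.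
have g0 : g 0 = 0 by rewrite -f0 fK.
have tr (A B : topGroupLaw) (h : A -> B) : h 0 = 0 -> {morph h : x y / x + y} -> continuous h ->
    forall x, closure (torsion A) x -> closure (torsion B) (h x).
  move=> h0 hD hc x cx V nV.
  have [y [[m m0 ym] Vy]] := cx (h @^-1` V) (hc x V nV).
  exists (h y); split => //; exists m => //.
  have hMn k : h (y *+ k) = h y *+ k.
    case: k => [|k]; first exact: h0.
    by elim: k => [|k IH] //; rewrite !Algebra.mulrSS hD IH.
  by rewrite -hMn ym h0.
apply/seteqP; split=> [_ [x cx <-]|y cy]; first exact: (tr _ _ f).
by exists (g y); rewrite ?gK//; exact: (tr _ _ g).
Qed.

Lemma morph_natmul (G H : topGroupLaw) (h : G -> H) : h 0 = 0 -> {morph h : x y / x + y} ->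
  forall x k, h (x *+ k) = h x *+ k.
Proof.
move=> h0 hD x [|k]; first exact: h0.
by elim: k => [|k IH] //; rewrite !Algebra.mulrSS hD IH.
Qed.

Lemma ordinal_torsion m (x : discrete_group 'I_m.+1) : exists2 k, (0 < k)%N & x *+ k = 0.
Proof.
exists m.+1 => //; have -> : x *+ m.+1 = (x : 'I_m.+1) *+ m.+1 by [].
by apply/val_inj; rewrite Zp_mulrn /= modnMl.
Qed.

Lemma torsion_group_torsion (G : topGroupLaw) (tG : tabgroup G) (x : torsion_group G) :
  exists2 k, (0 < k)%N & x *+ k = 0.
Proof.
have [k k0 hk] := set_mem (valP (x : torsion_type G)).
exists k => //; apply: val_inj.
have := @morph_natmul (torsion_group G) G (fun y => val (y : torsion_type G)) erefl (torsion_addE tG) x k.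
by rewrite hk.
Qed.

(** At the modulus (i + 1) m, the relation m z = 0 means that i + 1 divides the component of z, so
    the component at the modulus i + 1 vanishes. *)
Lemma Zhat_torsion_free (z : Zhat_group) m : (0 < m)%N -> z *+ m = 0 -> z = 0.
Proof.
move=> m0 zm; apply: val_inj; apply: dep_funext => i.
pose k := (i.+1 * m).-1.
have kE : k.+1 = (i.+1 * m)%N by rewrite /k prednK// muln_gt0.
have hk : (val z : Zhat_ambient) k *+ m = 0.
  have := @morph_natmul Zhat_group (discrete_group 'I_k.+1) (fun y => (val y : Zhat_ambient) k) erefl (fun _ _ => erefl) z m.
  by rewrite zm => <-.
have dv : (i.+1 %| k.+1)%N by rewrite kE dvdn_mulr.
have zi : (i.+1 %| (val z : Zhat_ambient) k)%N.
  have e : ((val z : Zhat_ambient) k : 'I_k.+1) *+ m = 0 by exact: hk.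
  have := congr1 (fun x : 'I_k.+1 => x : nat) e; rewrite Zp_mulrn /= => /eqP h.
  have : (k.+1 %| (val z : Zhat_ambient) k * m)%N by exact: h.
  by rewrite [X in (X %| _)%N]kE dvdn_pmul2r.
have c := set_mem (valP z) i k dv.
apply: val_inj => /=; move: c; rewrite (eqP zi : (_ %% _ = 0)%N) modn_small//.
Qed.

(** * The closure of the torsion subgroup *)

Section TorsionClosure.
Context {I : choiceType} (T : I -> topGroupLaw) (n : nat).
Notation D := (prod_group (power_group Zhat_group n) (bigprod_group T)).
Hypothesis tT : tabgroup (bigprod_group T).
Hypothesis Ttors : forall i (x : T i), exists2 k, (0 < k)%N & x *+ k = 0.

Lemma bigprod_natmul (t : bigprod_group T) i m : (t *+ m) i = t i *+ m.
Proof. exact: (@morph_natmul (bigprod_group T) (T i) (fun t => t i)). Qed.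

Lemma component_mul0n i m : (0 : T i) *+ m = 0.
Proof. by rewrite -[LHS](bigprod_natmul 0 i m) (_ : 0 *+ m = 0)//; exact: (@mul0rn (zsort_of tT)). Qed.

Lemma finite_torsion (t : bigprod_group T) (s : seq I) : exists2 m, (0 < m)%N & forall i, i \in s -> t i *+ m = 0.
Proof.
elim: s => [|i s [m m0 hm]]; first by exists 1%N.
have [k k0 hk] := Ttors (t i).
have mA a b j : t j *+ (a * b) = t j *+ a *+ b.
  by rewrite -!bigprod_natmul; congr (_ j); exact: (@mulrnA (zsort_of tT)).
exists (k * m)%N; first by rewrite muln_gt0 k0.
move=> j; rewrite in_cons => /orP[/eqP->|js]; first by rewrite mA hk component_mul0n.
by rewrite mulnC mA hm// component_mul0n.
Qed.

Lemma Zhat_power00 : (0 : power_group Zhat_group n) + 0 = 0.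
Proof.
apply: dep_funext => i; apply: val_inj.
by apply: dep_funext => k; apply: val_inj.
Qed.

(** A torsion element has zero component in Zhat^n, which is torsion-free, and this condition is
    closed. Conversely, families of T with finite support are torsion, and they are dense in T. *)
Lemma torsion_closure : closure (torsion D) = [set z | z.1 = 0].
Proof.
have zZ : zero_dimensional (power_group Zhat_group n).
  by apply: zero_dimensional_bigprod => i; exact: zero_dimensional_Zhat.
have fM (z : D) m : (z *+ m).1 = z.1 *+ m by exact: (@morph_natmul D (power_group Zhat_group n) fst).
have sM (z : D) m : (z *+ m).2 = z.2 *+ m by exact: (@morph_natmul D (bigprod_group T) snd).
apply/seteqP; split=> z.
  move=> cz; apply: contrapT => /eqP/zZ[U [[oU _] Uz nU]].
  have nb : nbhs z [set y : D | U y.1].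
    have c : (fun y : D => y.1) @ nbhs z --> z.1 by apply: fst_cvg.
    by apply: c; exact: open_nbhs_nbhs.
  have [y [[m m0 ym] Uy]] := cz _ nb; apply: nU.
  suff <- : y.1 = 0 by [].
  apply: dep_funext => i; apply: (@Zhat_torsion_free _ m) => //.
  have := @morph_natmul (power_group Zhat_group n) Zhat_group (fun t => t i) erefl (fun _ _ => erefl) y.1 m.
  by rewrite -fM ym => <-.
case: z => z t /= -> B nB.
(* The directed set of finite families of indices; the truncations [ts] of t converge to t along
   it. *)
pose F : set_system (seq I) := filter_from [set: seq I] (fun s0 : seq I => [set s : seq I | {subset s0 <= s}]).
have FF : ProperFilter F.
  apply: filter_from_proper; last by move=> s _; exists s.
  apply: filter_from_filter; first by exists [::].
  move=> s s' _ _; exists (s ++ s') => // u h; split=> x xs; apply: h; rewrite mem_cat xs ?orbT//.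
pose ts (s : seq I) : bigprod_group T := fun i => if i \in s then t i else 0.
have tc : ts @ F --> t.
  apply: bprod_cvg => i; apply: eventually_eq_cvg; exists [:: i] => // s /= h.
  by rewrite /ts h// inE.
have zc : (fun s => (0, ts s) : D) @ F --> ((0, t) : D) by apply: pair_cvg => //; exact: cvg_cst.
have FB : F [set s : seq I | B ((0, ts s) : D)] by exact: (zc _ nB).
have [s Bs] := filter_ex FB.
exists (0, ts s); split => //; have [m m0 hm] := finite_torsion t s.
have z0 (G : topGroupLaw) (h : (0 : G) + 0 = 0) k : (0 : G) *+ k = 0.
  by case: k => // k; elim: k => // k IH; rewrite Algebra.mulrSS IH.
exists m => //; rewrite [LHS]surjective_pairing fM sM; congr pair.
  exact: z0 Zhat_power00 m.
apply: dep_funext => i; rewrite bigprod_natmul /ts /=.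
by case: (boolP (i \in s)) => [/hm//|_]; exact: component_mul0n.
Qed.

End TorsionClosure.

Lemma circle_power_path (R : realType) n (c : power_group (circle_group R) n) :
  exists A : set (power_group (circle_group R) n), [/\ connected A, A 0 & A c].
Proof.
pose p (s : R) : power_group (circle_group R) n := fun k => circle_pi (s * circle_repr (c k)).
exists (p @` [set: R]); split.
- apply: connected_continuous_connected; first by apply/connected_intervalP.
  apply: continuous_within; apply: continuous_ultra => U uU x Ux.
  apply: bprod_cvg => k.
  apply: (@cvg_comp_at _ _ _ U (fun s : R => s * circle_repr (c k)) (@circle_pi R)); first exact: circle_pi_continuous.
  by apply: cvgM => //; exact: cvg_cst.
- exists 0 => //; apply: dep_funext => k.
  by rewrite /p mul0r circle_pi0.
- exists 1 => //; apply: dep_funext => k.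
  by rewrite /p mul1r circle_reprK.
Qed.

Theorem mainTheorem3 (R : realType) (K : fieldExtType rat) (n : nat)
    (hn : n = \dim {:K}) (E : elliptic_curve K)
    (Kc : forall p : prime_of R K, completion p) :
  let EA := adelic_points E Kc in
  let EAcc := component_quotient_group EA in
  let T := T_group E Kc in
  exists f : EA -> prod_group (prod_group (power_group (circle_group R) n)
                                          (power_group Zhat_group n)) T,
    [/\ topgroup_iso f,
        f @` connected_component0 EA = [set z | z.1.2 = 0 /\ z.2 = 0],
        profinite_space EAcc
      & exists g : EAcc -> prod_group (power_group Zhat_group n) T,
          [/\ topgroup_iso g,
              forall x : EA, g (component_pi x) = ((f x).1.2, (f x).2)
            & g @` closure (torsion EAcc) = [set z | z.1 = 0] ] ].
Proof.
move=> EA EAcc T; subst n; set n := \dim _.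
have [e [free_e span emb]] := embeddings K.
have facts := local_points_facts E Kc span emb.
have [f fI] := adelic_iso E Kc span emb.
have tEA : tabgroup EA by apply: bigprod_tab => p; have [] := facts p.
have cEA : compact [set: EA] by apply: bigprod_compact => p; have [] := facts p.
have zD : zero_dimensional (prod_group (power_group Zhat_group n) T).
  apply: zero_dimensional_prod; first by apply: zero_dimensional_bigprod => i; exact: zero_dimensional_Zhat.
  apply: zero_dimensional_bigprod => p; have [->|[m ->]] := local_T_cases E Kc p; exact: zero_dimensional_discrete.
have C0 : (0 : power_group (circle_group R) n) + 0 = 0.
  by apply: dep_funext => k; exact: (@addr0 (Quotient.quot (@integers R))).
have hC := @circle_power_path R n.
have [g gI gE] := component_quotient_iso tEA fI zD hC C0.
(* f has values in C x (Zhat^n x T), which exhibits the quotient by the component; the factors are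
   only bracketed anew here. *)
exists (fun x => (((f x).1, (f x).2.1), (f x).2.2)); split.
- exact: (topgroup_iso_comp fI (prodA_iso _ _ _)).
- have ci := component_image fI zD hC; apply/seteqP; split=> [_ [x cx <-]|[[c z] t] /= [-> ->]].
    have : [set z | z.2 = 0] (f x) by rewrite -ci; exists x.
    by move=> /= ->.
  have : [set z : prod_group (power_group (circle_group R) n) (prod_group (power_group Zhat_group n) T) | z.2 = 0] (c, 0) by [].
  by rewrite -ci => -[x cx ex]; exists x => //; rewrite ex.
- exact: component_quotient_profinite tEA cEA fI zD hC C0.
- exists g; split => //; first by move=> x; rewrite gE -surjective_pairing.
  rewrite (iso_torsion_closure gI); apply: torsion_closure => [|p].
    apply: (snd_tab (@Zhat_power00 n)); apply: (snd_tab C0).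
    by apply: isoG_tab tEA; apply: isoG_sym; exists f.
  have [->|[m ->]] := local_T_cases E Kc p; last exact: ordinal_torsion.
  by apply: torsion_group_torsion; have [] := facts p.
Qed.
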